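(* Let $h(w)=w^m e^{H(w)}$, $w\in\mathbb{C}$, where $m\in\mathbb{N}\cup\{0\}$ and $H$ is a non-constant entire function, and assume that: (a) $h$ has an (unbounded) forward-invariant Fatou component $G$ on which $h$ has infinite degree; (b) there exists a point $b\in G$ such that $h^{-1}(\{b\})\cap G$ contains exactly $p\ge 0$ points, counting multiplicity; and (c) an inner function $g_h$ dynamically associated to $h|_G$ has a finite number $q\ge 1$ of singularities on $\partial\mathbb{D}$. Let $a\in\mathbb{C}\setminus\{0\}$, $\pi_a(z)=e^{az}$, and let $f\in\mathcal{L}_{a,h}$, i.e. $f$ is a transcendental entire function with $h\circ\pi_a=\pi_a\circ f$ in $\mathbb{C}$. Then exactly one of the following holds. (i) $0\in G$ and $U:=\pi_a^{-1}(G)$ is connected. In this case, $b=0$, $p=m$, and $f|_U$ has a dynamically associated inner function (of the upper half-plane) of the form $$g_f:\mathbb{H}\to\mathbb{H};\qquad g_f(z)=\sigma+mz+\frac{i}{2}\sum_{j=1}^{q}\Big(c_j\cdot\frac{e^{i\theta_j}+e^{2iz}}{e^{i\theta_j}-e^{2iz}}\Big),$$ where $\sigma,\theta_1,\dots,\theta_q$ are real numbers and $c_1,\dots,c_q$ are positive real numbers. (ii) $0\notin G$ and $\{U_k\}_{k\in\mathbb{Z}}$ are the connected components of $\pi_a^{-1}(G)$. Then $g_h$ is associated to $f|_{U_k}$ for each $k\in\mathbb{Z}$, and it can be taken to be of the form $$g_h:\mathbb{D}\to\mathbb{D};\qquad g_h(z)=B(z)\cdot\exp\Big(-\sum_{j=1}^{q}\Big(c_j\cdot\frac{e^{i\theta_j}+z}{e^{i\theta_j}-z}\Big)\Big),$$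 where $B$ is a finite Blaschke product of degree $p$, $\theta_j\in\mathbb{R}$ and $c_j>0$ for all $j\in\{1,\dots,q\}$.
   Context: $\mathbb{D}$ is the open unit disc, $\mathbb{H}$ the open upper half-plane, and $\mathbb{N}=\{1,2,\dots\}$. For a transcendental entire function $f$, the Fatou set $F(f)$ is the set of points having a neighbourhood on which the iterates $\{f^n\}_n$ form a normal family; a Fatou component is a connected component of $F(f)$. A Fatou component $U$ is forward-invariant if $f(U)\subset U$. Degree: if $U,V$ are Fatou components of $f$ with $f(U)\subset V$, then $f|_U:U\to V$ has finite degree $d$ if it is proper of degree $d$ (every point of $V$ has exactly $d$ preimages in $U$, counting multiplicity); otherwise it has infinite degree (every point of $V$, with at most one exception, has infinitely many preimages in $U$). Lifts: for $a\in\mathbb{C}\setminus\{0\}$ and $\pi_a(z)=e^{az}$, $\mathcal{L}_{a,h}$ is the set of all transcendental entire functions $f$ with $h\circ\pi_a=\pi_a\circ f$ in $\mathbb{C}$. Each connected component of $\pi_a^{-1}(G)$ is a Fatou component of $f$, and all Fatou components considered here ($G$ and the components of $\pi_a^{-1}(G)$) are simply connected, so Riemann maps exist. When $0\notin G$, the components are indexed by $\mathbb{Z}$ so that $U_{k+1}=U_k+\frac{2\pi i}{a}$. Inner functions: an inner function is a holomorphic self-map of $\mathbb{D}$ whose radial limits exist and lie on $\partial\mathbb{D}$ almost everywhere. A map $g:\mathbb{H}\to\mathbb{H}$ is an inner function of the upper half-plane if $M^{-1}\circ g\circ M$ is an inner function for a conformal homeomorphism $M:\mathbb{D}\to\mathbb{H}$.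 A Riemann map is a conformal bijection. If $U,V$ are simply connected Fatou components of $f$ with $f(U)\subset V$, an inner function associated to $f|_U$ is any function $\psi^{-1}\circ f\circ\varphi:\mathbb{D}\to\mathbb{D}$, where $\varphi:\mathbb{D}\to U$ and $\psi:\mathbb{D}\to V$ are Riemann maps. If $U=V$ and $\psi=\varphi$, it is called dynamically associated to $f|_U$ (it is unique up to conformal conjugacy); for the upper half-plane one uses a Riemann map $\varphi:\mathbb{H}\to U$ instead. A point $\zeta\in\partial\mathbb{D}$ is a singularity of an inner function $g$ if $g$ cannot be extended holomorphically to any neighbourhood of $\zeta$ in $\mathbb{C}$. A finite Blaschke product of degree $d$ is a function $B(z)=e^{i\theta}\prod_{n=1}^d\frac{|a_n|}{a_n}\frac{a_n-z}{1-\overline{a_n}z}$ with $\theta\in\mathbb{R}$, $a_n\in\mathbb{D}$ (the factor is interpreted as $z$ when $a_n=0$); for $d=0$ it is a unimodular constant. *)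

(* Defs.v *)
From HB Require Import structures.
From mathcomp Require Import all_boot all_order all_algebra.
From mathcomp Require Import all_classical all_reals all_analysis.
From mathcomp Require Import complex.

Set Implicit Arguments.
Unset Strict Implicit.
Unset Printing Implicit Defensive.

Import Order.TTheory GRing.Theory Num.Theory numFieldNormedType.Exports.

Local Open Scope classical_set_scope.
Local Open Scope ring_scope.

(* [R[i]] itself already carries the structure of a module over [R]; the alias
   [C R] is there to carry that of a normed module over itself, so that
   [derivable f z 1] is complex differentiability at [z]. *)
Definition C (R : realType) : Type := R[i].
HB.instance Definition _ (R : realType) := Num.ClosedField.on (C R).
HB.instance Definition _ (R : realType) := GRing.ComAlgebra.copy (C R) (C R)^o.
HB.instance Definition _ (R : realType) := Vector.copy (C R) (C R)^o.
HB.instance Definition _ (R : realType) := NormedModule.copy (C R) (C R)^o.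

Section Elementary.
Variable R : realType.
Implicit Types (z w a : C R) (t : R).

Definition rC t : C R := t%:C%C.

Definition iC : C R := 'i%C.

Definition cexp z : C R :=
  rC (expR (complex.Re z)) *
    (rC (cos (complex.Im z)) + iC * rC (sin (complex.Im z))).

Definition expi t : C R := cexp (iC * rC t).

Definition modulus z : R := complex.Re `|z|.

Definition disc : set (C R) := [set z | `|z| < 1].

Definition upper_half_plane : set (C R) := [set z | 0 < complex.Im z].

Definition exp_map a z : C R := cexp (a * z).

End Elementary.

Arguments iC {R}.
Arguments disc {R}.
Arguments upper_half_plane {R}.

Section Holomorphy.
Variable R : realType.
Implicit Types (f g F : C R -> C R) (U V K : set (C R)) (z w zeta : C R).

(* Only used for open [U]. *)
Definition holomorphic U f := forall z, U z -> derivable f z 1.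

Definition entire f := holomorphic setT f.

Definition transcendental_entire f :=
  entire f /\ ~ exists P : {poly C R}, forall z, f z = P.[z].

Definition riemann_map U V f := holomorphic U f /\ set_bij U V f.

(* [F] is holomorphic near [z] with a zero of order exactly [k] at [z]
   (for k = 0: F z != 0). *)
Definition zero_order F z (k : nat) := exists V g,
  [/\ open V, V z, holomorphic V g, g z != 0 &
      forall w, V w -> F w = (w - z) ^+ k * g w].

(* [w] has exactly [d] preimages in [U], counting multiplicity: [s] lists each
   preimage as many times as its multiplicity. *)
Definition npreimages f U w (d : nat) := exists s : seq (C R),
  [/\ size s = d, forall z, z \in s -> U z &
      forall z, U z -> zero_order (fun u => f u - w) z (count_mem z s)].

Definition proper_map U V f :=
  forall K, compact K -> K `<=` V -> compact (U `&` f @^-1` K).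

Definition has_degree f U V (d : nat) :=
  proper_map U V f /\ forall w, V w -> npreimages f U w d.

Definition infinite_degree f U V := ~ exists d, has_degree f U V d.

End Holomorphy.

Section Fatou.
Variable R : realType.
Implicit Types (f : C R -> C R) (U V K : set (C R)).

(* Chordal metric on the Riemann sphere; [None] is the point at infinity. *)
Definition chordal (z w : option (C R)) : R :=
  match z, w with
  | Some z, Some w => 2 * modulus (z - w) /
      (Num.sqrt (1 + modulus z ^+ 2) * Num.sqrt (1 + modulus w ^+ 2))
  | Some z, None | None, Some z => 2 / Num.sqrt (1 + modulus z ^+ 2)
  | None, None => 0
  end.

(* Normality is with respect to the chordal metric, so locally uniform
   convergence to infinity is allowed. *)
Definition normal_family (F : nat -> C R -> C R) V :=
  forall k : nat -> nat, exists s : nat -> nat,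
    {homo s : i j / (i < j)%N} /\
    exists g : C R -> option (C R),
      forall K, compact K -> K `<=` V -> forall e : R, 0 < e ->
        \forall n \near \oo, forall z, K z ->
          chordal (Some (F (k (s n)) z)) (g z) < e.

Definition fatou f : set (C R) :=
  [set z | exists V, [/\ open V, V z & normal_family (fun n => iter n f) V]].

Definition component (A U : set (C R)) :=
  exists2 x, A x & U = connected_component A x.

Definition fatou_component f U := component (fatou f) U.

End Fatou.

Section Inner.
Variable R : realType.
Implicit Types (f g M phi psi : C R -> C R) (U V : set (C R)).

(* Almost every point of the circle is rendered as almost every angle in R. *)
Definition inner g :=
  [/\ holomorphic disc g,
      forall z, disc z -> disc (g z) &
      {ae @lebesgue_measure R, forall t : R, exists l : C R,
        `|l| = 1 /\ g (rC r * expi t) @[r --> (1 : R)^'-] --> l}].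

Definition inner_half_plane g := exists M g',
  [/\ riemann_map disc upper_half_plane M, inner g' &
      forall z, disc z -> M (g' z) = g (M z)].

Definition associated_inner f U g := inner g /\ exists V phi psi,
  [/\ fatou_component f U, fatou_component f V & f @` U `<=` V] /\
  [/\ riemann_map disc U phi, riemann_map disc V psi &
      forall z, disc z -> psi (g z) = f (phi z)].

Definition dyn_associated_inner f U g := inner g /\ exists phi,
  [/\ fatou_component f U, f @` U `<=` U, riemann_map disc U phi &
      forall z, disc z -> phi (g z) = f (phi z)].

Definition dyn_associated_inner_half_plane f U g :=
  inner_half_plane g /\ exists phi,
  [/\ fatou_component f U, f @` U `<=` U,
      riemann_map upper_half_plane U phi &
      forall z, upper_half_plane z -> phi (g z) = f (phi z)].

Definition singularity g (zeta : C R) :=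
  `|zeta| = 1 /\
  ~ exists V E, [/\ open V, V zeta, holomorphic V E &
                    forall z, V z -> disc z -> E z = g z].

Definition blaschke_factor (a z : C R) : C R :=
  if a == 0 then z else `|a| / a * ((a - z) / (1 - a^* * z)).

Definition finite_blaschke (d : nat) (B : C R -> C R) :=
  exists (theta : R) (a : 'I_d -> C R), (forall n, disc (a n)) /\
    forall z, B z = expi theta * \prod_(n < d) blaschke_factor (a n) z.

End Inner.

Definition lifts (R : realType) (a : C R) (h : C R -> C R) : set (C R -> C R) :=
  [set f | transcendental_entire f /\
           forall z, h (exp_map a z) = exp_map a (f z)].

(* Main.v *)
Require Import Defs.
From mathcomp Require Import all_boot all_order all_algebra.
From mathcomp Require Import all_classical all_reals all_analysis.
From mathcomp Require Import complex.
From mathcomp Require Import ring lra.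
Set Implicit Arguments.
Unset Strict Implicit.
Unset Printing Implicit Defensive.
Import Order.TTheory GRing.Theory Num.Theory numFieldNormedType.Exports.
Local Open Scope classical_set_scope.
Local Open Scope ring_scope.

(** Write [P] for the preimage of [G] under [exp (a z)] and [T = 2 pi i / a].  The
    exponential semiconjugates [f] to [h], and [f (z + T) = f z + m T].

    Two facts identify the components of [P] with Fatou components of [f].  First,
    iterates of [f] that start in [P] omit all logarithms of a nonzero value outside
    [G], so [P] lies in the Fatou set by Montel's theorem ([preimage_fatou]).  Second,
    the exponential sends Fatou points of [f] to Fatou points of [h]
    ([fatou_exp_map]).  Suppose iterates of [h] were not normal near [exp (a z0)]
    while those of [f] are normal near [z0].  Then the iterates of [f], read through a
    branch of the logarithm, tend to infinity along a bad sequence, and Harnack's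
    inequality makes their moduli at nearby points comparable up to a fixed power.
    But the bad iterates of [h] cover, by Montel's theorem, both a point over one that
    [f] fixes modulo [T] (Picard), whose [f]-orbit grows at most exponentially, and a
    circle on which, by Bohr's theorem, the iterates of [h] grow doubly
    exponentially.

    The inner function is understood through its boundary values.  Where it extends,
    it is unimodular ([inner_unimodular]).  Composing with automorphisms of the disc
    moves the point over [b] to the origin; then there are finitely many zeros, a
    Blaschke product can be divided out by Schwarz' lemma, and the quotient is
    [exp (- F)] with [Re F >= 0] tending to [0] at all but [q] boundary points.  By
    Schwarz' integral formula the measure representing [F] is concentrated on these
    points ([herglotz_finite]).  So [gh] is, in suitable coordinates, a finite Blaschke
    product times a singular factor with [q] atoms ([normal_form]), all of positive
    weight, since otherwise [gh] would extend across a singularity.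

    If [0] is not in [G], a Riemann map of [G] has a logarithm, whose translates by
    multiples of [T] parametrise the components of [P]; the conjugacy between [h] and
    [gh] lifts to them ([outside_origin]).  If [0] is in [G], then both [0] and [b] have
    finitely many preimages, which forces [gh] to tend to the points over both along
    one curve, so that [b = 0] ([base_point_eq0]) and [p = m].  A Riemann map fixing
    the origin is [z exp (k z)], and [(2 i z + k (exp (2 i z))) / a] maps the half-plane
    conformally onto [P]; in this coordinate [f] is a logarithm of the normal form
    ([inside_origin]). *)

(** * Complex numbers, moduli and continuity *)

Section Modulus.
Context {R : realType}.
Implicit Types (z w : C R) (t : R).

Lemma rC_inj : injective (@rC R). Proof. by move=> x y []. Qed.
Lemma rCD s t : rC (s + t) = rC s + rC t. Proof. exact: rmorphD. Qed.
Lemma rCB s t : rC (s - t) = rC s - rC t. Proof. exact: rmorphB. Qed.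
Lemma rCM s t : rC (s * t) = rC s * rC t. Proof. exact: rmorphM. Qed.
Lemma rCN t : rC (- t) = - rC t. Proof. exact: rmorphN. Qed.
Lemma rC0 : rC (0 : R) = 0. Proof. by []. Qed.
Lemma rC1 : rC (1 : R) = 1. Proof. by []. Qed.
Lemma rCV t : rC (t^-1) = (rC t)^-1. Proof. exact: fmorphV. Qed.
Lemma rCn n : rC (n%:R : R) = n%:R. Proof. exact: rmorph_nat. Qed.
Lemma rCX t n : rC (t ^+ n) = rC t ^+ n. Proof. exact: rmorphXn. Qed.
Lemma rC_eq0 t : (rC t == 0) = (t == 0).
Proof. by rewrite -rC0 (inj_eq rC_inj). Qed.
Lemma ReD z w : complex.Re (z + w) = complex.Re z + complex.Re w.
Proof. by case: z w => [x y] [u v]. Qed.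
Lemma ImD z w : complex.Im (z + w) = complex.Im z + complex.Im w.
Proof. by case: z w => [x y] [u v]. Qed.
Lemma ReN z : complex.Re (- z) = - complex.Re z.
Proof. by case: z. Qed.
Lemma ImN z : complex.Im (- z) = - complex.Im z.
Proof. by case: z. Qed.
Lemma ReM z w : complex.Re (z * w) =
  complex.Re z * complex.Re w - complex.Im z * complex.Im w.
Proof. by case: z w => [x y] [u v]. Qed.
Lemma ImM z w : complex.Im (z * w) =
  complex.Re z * complex.Im w + complex.Im z * complex.Re w.
Proof. by case: z w => [x y] [u v]. Qed.
Lemma Re0 : complex.Re (0 : C R) = 0. Proof. by []. Qed.
Lemma ReMr t z : complex.Re (rC t * z) = t * complex.Re z.
Proof. by rewrite ReM /= mul0r subr0. Qed.
Lemma ImMr t z : complex.Im (rC t * z) = t * complex.Im z.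
Proof. by rewrite ImM /= mul0r addr0. Qed.
Lemma Re_sum (I : Type) (r : seq I) (P : pred I) (F : I -> C R) :
  complex.Re (\sum_(i <- r | P i) F i) = \sum_(i <- r | P i) complex.Re (F i).
Proof. exact: (big_morph _ ReD Re0). Qed.
Lemma CE z : z = rC (complex.Re z) + iC * rC (complex.Im z).
Proof. exact: complexE. Qed.

Lemma C_eq z w : complex.Re z = complex.Re w -> complex.Im z = complex.Im w ->
  z = w.
Proof. by case: z w => [x y] [u v] /= -> ->. Qed.

Lemma iC2 : iC * iC = -1 :> C R.
Proof. by apply: C_eq; rewrite ?ReM ?ImM /=; ring. Qed.

Lemma iC_neq0 : iC != 0 :> C R.
Proof.
apply/eqP => /(congr1 (@complex.Im R)) /= /eqP; by rewrite oner_eq0.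
Qed.

Lemma normE z : `|z| = rC (modulus z).
Proof.
by rewrite /modulus /rC -[RHS]/((complex.Re `|z|)%:C%C) RRe_real ?normr_real.
Qed.

Lemma modE z : modulus z = Num.sqrt (complex.Re z ^+ 2 + complex.Im z ^+ 2).
Proof. by rewrite /modulus normc_def. Qed.

Lemma mod_sqr z : modulus z ^+ 2 = complex.Re z ^+ 2 + complex.Im z ^+ 2.
Proof. by rewrite modE sqr_sqrtr // addr_ge0 ?sqr_ge0. Qed.

Lemma mod_ge0 z : 0 <= modulus z.
Proof. by rewrite modE sqrtr_ge0. Qed.

Lemma mod_eq0 z : (modulus z == 0) = (z == 0).
Proof. by rewrite -rC_eq0 -normE normr_eq0. Qed.

Lemma mod0 : modulus (0 : C R) = 0.
Proof. by apply/eqP; rewrite mod_eq0. Qed.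

Lemma mod_gt0 z : (0 < modulus z) = (z != 0).
Proof. by rewrite lt_def mod_ge0 andbT mod_eq0. Qed.

Lemma modM z w : modulus (z * w) = modulus z * modulus w.
Proof. by apply: rC_inj; rewrite rCM -!normE normrM. Qed.

Lemma mod1 : modulus (1 : C R) = 1.
Proof. by apply: rC_inj; rewrite -normE normr1. Qed.

Lemma modX z n : modulus (z ^+ n) = modulus z ^+ n.
Proof. by apply: rC_inj; rewrite rCX -!normE normrX. Qed.

Lemma modV z : modulus z^-1 = (modulus z)^-1.
Proof. by apply: rC_inj; rewrite rCV -!normE normfV. Qed.

Lemma mod_div z w : modulus (z / w) = modulus z / modulus w.
Proof. by rewrite modM modV. Qed.

Lemma modN z : modulus (- z) = modulus z.
Proof. by apply: rC_inj; rewrite -!normE normrN. Qed.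

Lemma mod_distC z w : modulus (z - w) = modulus (w - z).
Proof. by rewrite -modN opprB. Qed.

Lemma lecR_rC s t : (rC s <= rC t) = (s <= t). Proof. exact: lecR. Qed.
Lemma ltcR_rC s t : (rC s < rC t) = (s < t). Proof. exact: ltcR. Qed.

Lemma modD z w : modulus (z + w) <= modulus z + modulus w.
Proof. by rewrite -lecR_rC rCD -!normE ler_normD. Qed.

Lemma modB z w : modulus (z - w) <= modulus z + modulus w.
Proof. by rewrite -(modN w) modD. Qed.

Lemma modDB z w : modulus z - modulus w <= modulus (z + w).
Proof. by have := modB (z + w) w; rewrite addrK; lra. Qed.

Lemma modBB z w : modulus z - modulus w <= modulus (z - w).
Proof. by have := modDB z (- w); rewrite modN. Qed.

Lemma mod_dist_triangle z w v :
  modulus (z - w) <= modulus (z - v) + modulus (v - w).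
Proof. by have := modD (z - v) (v - w); rewrite addrA subrK. Qed.

Lemma mod_sum (I : Type) (r : seq I) (P : pred I) (F : I -> C R) :
  modulus (\sum_(i <- r | P i) F i) <= \sum_(i <- r | P i) modulus (F i).
Proof.
elim/big_rec2: _ => [|i y x _ h]; first by rewrite mod0.
by apply: le_trans (modD _ _) _; rewrite lerD2l.
Qed.

Lemma mod_prod (I : Type) (r : seq I) (P : pred I) (F : I -> C R) :
  modulus (\prod_(i <- r | P i) F i) = \prod_(i <- r | P i) modulus (F i).
Proof. exact: (big_morph _ modM mod1). Qed.

Lemma mod_rC t : modulus (rC t) = `|t|.
Proof. by rewrite modE /= expr0n addr0 sqrtr_sqr. Qed.

Lemma mod_iC : modulus (iC : C R) = 1.
Proof. by rewrite modE /= expr0n add0r expr1n sqrtr1. Qed.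

Lemma mod_nat n : modulus (n%:R : C R) = n%:R.
Proof. by rewrite -rCn mod_rC ger0_norm. Qed.

Lemma Re_le_mod z : `|complex.Re z| <= modulus z.
Proof. by rewrite modE -sqrtr_sqr ler_wsqrtr // lerDl sqr_ge0. Qed.

Lemma Im_le_mod z : `|complex.Im z| <= modulus z.
Proof. by rewrite modE -sqrtr_sqr ler_wsqrtr // lerDr sqr_ge0. Qed.

Lemma mod_le_ReIm z : modulus z <= `|complex.Re z| + `|complex.Im z|.
Proof.
by rewrite {1}(CE z) (le_trans (modD _ _)) // modM mod_iC mul1r !mod_rC.
Qed.

Lemma mod_conj z : modulus z^* = modulus z.
Proof. by apply: rC_inj; rewrite -!normE norm_conjC. Qed.

Lemma conj_mod2 z : z * z^* = rC (modulus z ^+ 2).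
Proof. by rewrite rCX -normE normCK. Qed.

Lemma disc_mod z : disc z = (modulus z < 1) :> Prop.
Proof. by rewrite /disc /mkset normE -rC1 ltcR_rC. Qed.

Lemma norm1_mod z : `|z| = 1 <-> modulus z = 1.
Proof. by rewrite normE -rC1; split=> [/rC_inj|->]. Qed.

Lemma rotate_mod z : exists2 u : C R, modulus u = 1 & u * z = rC (modulus z).
Proof.
have [->|z0] := eqVneq z 0; first by exists 1; rewrite ?mod1 // mod0 mulr0.
have m0 : modulus z != 0 by rewrite mod_eq0.
exists (rC (modulus z) / z); last by rewrite divfK.
by rewrite mod_div mod_rC ger0_norm ?mod_ge0 // divff.
Qed.

End Modulus.

Section Topology.
Context {R : realType}.
Implicit Types (f g : C R -> C R) (z w : C R) (U V : set (C R)).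

Definition Ball z (r : R) : set (C R) := [set w | modulus (w - z) < r].

Lemma Ball_center z (r : R) : 0 < r -> Ball z r z.
Proof. by rewrite /Ball /= subrr mod0. Qed.

Lemma le_Ball z (r s : R) : r <= s -> Ball z r `<=` Ball z s.
Proof. by move=> rs w /= /lt_le_trans; apply. Qed.

Lemma Ball_sub z w (r s : R) : modulus (w - z) + r <= s -> Ball w r `<=` Ball z s.
Proof.
move=> h v vw; apply: lt_le_trans h; rewrite /Ball /= in vw *.
by apply: le_lt_trans (mod_dist_triangle _ _ w) _; rewrite addrC ltrD2l.
Qed.

Lemma disc_Ball : disc = Ball (0 : C R) 1.
Proof. by apply/funext => z; rewrite disc_mod /Ball /= subr0. Qed.

Lemma nbhs_Ball z (P : set (C R)) :
  nbhs z P <-> exists2 r : R, 0 < r & Ball z r `<=` P.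
Proof.
split.
  move=> /nbhs_ballP[e /= e0 H].
  have ee : e = rC (complex.Re e).
    by rewrite [LHS]CE; move: e0; rewrite ltcE /= => /andP[/eqP -> _]; rewrite rC0 mulr0 addr0.
  exists (complex.Re e); first by rewrite -ltcR_rC -ee.
  by move=> w zw; apply: H; rewrite -ball_normE /= ee normE ltcR_rC mod_distC.
move=> [r r0 H]; apply/nbhs_ballP; exists (rC r); first by rewrite /= -rC0 ltcR_rC.
by move=> w; rewrite -ball_normE /= normE ltcR_rC mod_distC => /H.
Qed.

Lemma openP U : open U <-> forall z, U z -> exists2 r : R, 0 < r & Ball z r `<=` U.
Proof.
rewrite openE; split=> H z Uz; first exact/nbhs_Ball/H.
exact/nbhs_Ball/H.
Qed.

Lemma open_Ball z (r : R) : open (Ball z r).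
Proof.
apply/openP => w zw; exists (r - modulus (w - z)); first by rewrite subr_gt0.
by apply: Ball_sub; rewrite addrC subrK.
Qed.

Lemma nbhs_BallT z (r : R) : 0 < r -> nbhs z (Ball z r).
Proof. by move=> r0; apply/nbhs_Ball; exists r. Qed.

(** Continuity at a point, wrapped so that unification does not unfold the filters
    behind it. *)
Variant cont {T T' : topologicalType} (f : T -> T') (x : T) : Prop :=
  Cont of f @ nbhs x --> f x.

Lemma contE {T T' : topologicalType} (f : T -> T') (x : T) :
  cont f x <-> f @ nbhs x --> f x.
Proof. by split=> [[]|]. Qed.

Lemma contP {T : topologicalType} (f : T -> C R) x :
  cont f x <->
  forall e : R, 0 < e -> \forall y \near x, modulus (f y - f x) < e.
Proof.
split=> [[H] e e0|H].
  by apply: (H (Ball (f x) e)); exact: nbhs_BallT.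
by split=> P /= /nbhs_Ball[r r0 rP]; apply: filterS (H _ r0) => y /= /rP.
Qed.

Lemma contCP f z : cont f z <->
  forall e : R, 0 < e -> exists2 d : R, 0 < d &
    forall w, modulus (w - z) < d -> modulus (f w - f z) < e.
Proof.
rewrite contP; split=> H e e0; first by have /nbhs_Ball := H _ e0.
by apply/nbhs_Ball/H.
Qed.

Lemma contRP (f : R -> C R) t : cont f t <->
  forall e : R, 0 < e -> exists2 d : R, 0 < d &
    forall s, `|s - t| < d -> modulus (f s - f t) < e.
Proof.
rewrite contP; split=> H e e0.
  have /nbhs_ballP[d /= d0 dH] := H _ e0; exists d => // s st.
  by apply: dH; rewrite -ball_normE /= distrC.
have [d d0 dH] := H _ e0; apply/nbhs_ballP; exists d => //= s.
by rewrite -ball_normE /= distrC => /dH.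
Qed.

Lemma cont_cst {T T' : topologicalType} (c : T') (x : T) :
  cont (fun=> c) x.
Proof. by split; exact: cvg_cst. Qed.

Lemma cont_id {T : topologicalType} (x : T) : cont (fun y => y) x.
Proof. by split; exact: cvg_id. Qed.

Lemma cont_comp {T T' T'' : topologicalType} (f : T -> T') (g : T' -> T'') x :
  cont f x -> cont g (f x) ->
  cont (fun y => g (f y)) x.
Proof. by move=> [fc] [gc]; split; exact: (@continuous_comp _ _ _ f g x). Qed.

Lemma contD {T : topologicalType} (f g : T -> C R) x :
  cont f x -> cont g x ->
  cont (fun y => f y + g y) x.
Proof.
move=> [fc] [gc]; split.
have h : (f \+ g) @ nbhs x --> f x + g x by apply: (cvgD fc gc).
exact: h.
Qed.

Lemma contN {T : topologicalType} (f : T -> C R) x :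
  cont f x -> cont (fun y => - f y) x.
Proof.
move=> [fc]; split; have h : (\- f) @ nbhs x --> - f x by apply: (cvgN fc).
exact: h.
Qed.

Lemma contB {T : topologicalType} (f g : T -> C R) x :
  cont f x -> cont g x ->
  cont (fun y => f y - g y) x.
Proof. by move=> fc gc; exact: contD fc (contN gc). Qed.

Lemma contM {T : topologicalType} (f g : T -> C R) x :
  cont f x -> cont g x ->
  cont (fun y => f y * g y) x.
Proof.
move=> [fc] [gc]; split.
have h : (f \* g) @ nbhs x --> f x * g x by apply: (cvgM fc gc).
exact: h.
Qed.

Lemma contV {T : topologicalType} (f : T -> C R) x : f x != 0 ->
  cont f x -> cont (fun y => (f y)^-1) x.
Proof.
move=> f0 [fc]; split; have h : (fun y => (f y)^-1) @ nbhs x --> (f x)^-1 by apply: (cvgV f0 fc).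
exact: h.
Qed.

Lemma contX {T : topologicalType} (f : T -> C R) n x :
  cont f x -> cont (fun y => f y ^+ n) x.
Proof.
move=> fc; elim: n => [|n IH]; first exact: cont_cst.
rewrite (_ : (fun _ => _) = fun y => f y * f y ^+ n); first exact: contM fc IH.
by apply/funext => y; rewrite exprS.
Qed.

Lemma cont_sum {T : topologicalType} (I : Type) (r : seq I) (P : pred I)
    (F : I -> T -> C R) x : (forall i, P i -> cont (F i) x) ->
  cont (fun y => \sum_(i <- r | P i) F i y) x.
Proof.
move=> Fc; elim: r => [|i r IH].
  by rewrite (_ : (fun _ => _) = fun=> 0) ?funeqE => [|y]; [exact: cont_cst|rewrite big_nil].
case Pi : (P i).
  rewrite (_ : (fun _ => _) = fun y => F i y + \sum_(i <- r | P i) F i y).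
    exact: contD (Fc _ Pi) IH.
  by apply/funext => y; rewrite big_cons Pi.
rewrite (_ : (fun _ => _) = fun y => \sum_(i <- r | P i) F i y); first exact: IH.
by apply/funext => y; rewrite big_cons Pi.
Qed.

Lemma cont_prod {T : topologicalType} (I : Type) (r : seq I) (P : pred I)
    (F : I -> T -> C R) x : (forall i, P i -> cont (F i) x) ->
  cont (fun y => \prod_(i <- r | P i) F i y) x.
Proof.
move=> Fc; elim: r => [|i r IH].
  by rewrite (_ : (fun _ => _) = fun=> 1) ?funeqE => [|y]; [exact: cont_cst|rewrite big_nil].
case Pi : (P i).
  rewrite (_ : (fun _ => _) = fun y => F i y * \prod_(i <- r | P i) F i y).
    exact: contM (Fc _ Pi) IH.
  by apply/funext => y; rewrite big_cons Pi.
rewrite (_ : (fun _ => _) = fun y => \prod_(i <- r | P i) F i y); first exact: IH.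
by apply/funext => y; rewrite big_cons Pi.
Qed.

Lemma near_cont_eq {T T' : topologicalType} (f g : T -> T') x :
  (\forall y \near x, f y = g y) ->
  cont f x -> cont g x.
Proof.
move=> fg [fc]; split; rewrite -(nbhs_singleton fg).
by apply: cvg_trans fc; exact: near_eq_cvg.
Qed.

Lemma cont_rC t : cont (@rC R) t.
Proof.
by apply/contRP => e e0; exists e => // s st; rewrite -rCB mod_rC.
Qed.

Lemma cont_Re z : cont (@complex.Re R : C R -> R) z.
Proof.
split=> P /= /nbhs_ballP[e /= e0 eP]; apply/nbhs_Ball; exists e => // w wz.
apply: eP; rewrite -ball_normE /=.
have := Re_le_mod (w - z); rewrite ReD ReN distrC => /le_lt_trans; apply.
exact: wz.
Qed.

Lemma cont_Im z : cont (@complex.Im R : C R -> R) z.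
Proof.
split=> P /= /nbhs_ballP[e /= e0 eP]; apply/nbhs_Ball; exists e => // w wz.
apply: eP; rewrite -ball_normE /=.
have := Im_le_mod (w - z); rewrite ImD ImN distrC => /le_lt_trans; apply.
exact: wz.
Qed.

Lemma cont_mod z : cont (@modulus R) z.
Proof.
split=> P /= /nbhs_ballP[e /= e0 eP]; apply/nbhs_Ball; exists e => // w wz.
apply: eP; rewrite -ball_normE /=; apply: le_lt_trans wz.
rewrite ler_distlC; have := modBB z w; have := modBB w z; rewrite (mod_distC z); lra.
Qed.

End Topology.

(** * Complex and real derivatives *)

Section Caratheodory.
Context {K : numFieldType}.
Implicit Types (f q : K -> K) (z : K).

Lemma caratheodory_is_derive f q z : {for z, continuous q} ->
  (forall w, f w - f z = q w * (w - z)) -> is_derive z 1 f (q z).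
Proof.
move=> qc fq.
have H : (fun h => h^-1 *: ((f \o shift z) (h *: (1 : K)) - f z)) @ 0^' --> q z.
  move=> P /= /nbhs_ballP[e /= e0 eP].
  have /nbhs_ballP[d /= d0 dH] := qc _ (nbhsx_ballx (q z) e e0).
  apply/nbhs_ballP; exists d => //= h zh h0; apply: eP.
  rewrite /= fq /shift /= [h *: 1]mulr1 addrK [_ *: _]mulrC mulfK //.
  apply: dH; rewrite -ball_normE /= opprD addrCA subrr addr0.
  by move: zh; rewrite -ball_normE /= sub0r.
by split; [apply/cvg_ex; exists (q z)|exact: cvg_lim H].
Qed.

Lemma derivable_caratheodory f z : derivable f z 1 -> exists q,
  {for z, continuous q} /\ forall w, f w - f z = q w * (w - z).
Proof.
move=> /cvg_ex[l Hl].
exists (fun w => if w == z then l else (f w - f z) / (w - z)); split; last first.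
  move=> w; case: eqVneq => [->|wz]; first by rewrite !subrr mulr0.
  by rewrite divfK // subr_eq0.
rewrite /prop_for /continuous_at eqxx.
move=> P /= /nbhs_ballP[e /= e0 eP].
have /nbhs_ballP[d /= d0 dH] := Hl _ (nbhsx_ballx l e e0).
apply/nbhs_ballP; exists d => //= w zw; apply: eP.
case: eqVneq => [_|wz]; first exact: ballxx.
have := dH (w - z); rewrite /= -ball_normE /= sub0r normrN distrC subr_eq0.
move: zw; rewrite -ball_normE /= => zw /(_ zw wz).
by rewrite [(w - z) *: 1]mulr1 subrK [_ *: _]mulrC.
Qed.

End Caratheodory.

Section Derivatives.
Context {R : realType}.
Implicit Types (f g : C R -> C R) (z w d : C R) (p : R -> C R) (t : R)
  (U : set (C R)).

(** Complex derivatives are handled in the form of Caratheodory: the difference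
    quotient extends continuously to [z]. This makes the chain rules, for paths
    as well as for functions, a matter of composing continuous maps. *)
Variant cder f z d : Prop :=
  Cder q of cont q z & q z = d & forall w, f w - f z = q w * (w - z).

Variant rder p t d : Prop :=
  Rder (q : R -> C R) of cont q t & q t = d &
    forall s, p s - p t = q s * rC (s - t).

Lemma cder_derivable f z d : cder f z d -> derivable f z 1.
Proof.
by move=> [q [qc] _ fq]; case: (@caratheodory_is_derive (C R) f q z qc fq).
Qed.

Lemma derivable_cder f z : derivable f z 1 -> exists d, cder f z d.
Proof.
move=> /(@derivable_caratheodory (C R))[q [qc fq]]; exists (q z).
by apply: (@Cder _ _ _ q).
Qed.

Lemma cder_cont f z d : cder f z d -> cont f z.
Proof.
move=> [q qc _ fq].
have -> : f = (fun w => f z + q w * (w - z)).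
  by apply/funext => w; rewrite -fq addrC subrK.
apply: contD; first exact: cont_cst.
by apply: contM qc _; apply: contB; [exact: cont_id|exact: cont_cst].
Qed.

Lemma rder_cont p t d : rder p t d -> cont p t.
Proof.
move=> [q qc _ fq].
have -> : p = (fun s => p t + q s * (rC s - rC t)).
  by apply/funext => s; rewrite -rCB -fq addrC subrK.
apply: contD; first exact: cont_cst.
by apply: contM qc _; apply: contB; [exact: cont_rC|exact: cont_cst].
Qed.

Lemma cder_cst c z : cder (fun=> c) z 0.
Proof.
by apply: (@Cder _ _ _ (fun=> 0)) => [|//|w]; [exact: cont_cst|ring].
Qed.

Lemma cder_id z : cder (fun w => w) z 1.
Proof.
by apply: (@Cder _ _ _ (fun=> 1)) => [|//|w]; [exact: cont_cst|ring].
Qed.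

Lemma cderD f g z d e : cder f z d -> cder g z e ->
  cder (fun w => f w + g w) z (d + e).
Proof.
move=> [q qc <- fq] [r rc <- gr].
apply: (@Cder _ _ _ (fun w => q w + r w)) => [|//|w]; first exact: contD.
by rewrite mulrDl -fq -gr; ring.
Qed.

Lemma cderN f z d : cder f z d -> cder (fun w => - f w) z (- d).
Proof.
move=> [q qc <- fq].
apply: (@Cder _ _ _ (fun w => - q w)) => [|//|w]; first exact: contN.
by rewrite mulNr -fq; ring.
Qed.

Lemma cderB f g z d e : cder f z d -> cder g z e ->
  cder (fun w => f w - g w) z (d - e).
Proof. by move=> h1 h2; exact: cderD h1 (cderN h2). Qed.

Lemma cderM f g z d e : cder f z d -> cder g z e ->
  cder (fun w => f w * g w) z (d * g z + f z * e).
Proof.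
move=> fd [r rc <- gr]; have fc := cder_cont fd; case: fd => q qc <- fq.
apply: (@Cder _ _ _ (fun w => q w * g z + f w * r w)) => [|//|w].
  by apply: contD; [exact: contM qc (cont_cst _ _)|exact: contM fc rc].
by rewrite mulrDl -[q w * _ * _]mulrAC -fq -[f w * _ * _]mulrA -gr; ring.
Qed.

Lemma cderZ c f z d : cder f z d -> cder (fun w => c * f w) z (c * d).
Proof.
by move=> h; have := cderM (cder_cst c z) h; rewrite mul0r add0r.
Qed.

Lemma cder_comp f g z d e : cder f z d -> cder g (f z) e ->
  cder (fun w => g (f w)) z (e * d).
Proof.
move=> fd [r rc <- gr]; have fc := cder_cont fd; case: fd => q qc <- fq.
apply: (@Cder _ _ _ (fun w => r (f w) * q w)) => [|//|w].
  exact: contM (cont_comp fc rc) qc.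
by rewrite gr fq; ring.
Qed.

Lemma cderV z : z != 0 -> cder (fun w => w^-1) z (- z ^- 2).
Proof.
move=> z0.
apply: (@Cder _ _ _ (fun w => if w == 0 then z ^- 2 else - (z * w)^-1)).
- apply: (@near_cont_eq _ _ (fun w => - (z * w)^-1)); last first.
    apply: contN; apply: contV; first by rewrite mulf_neq0.
    by apply: contM; [exact: cont_cst|exact: cont_id].
  apply/nbhs_Ball; exists (modulus z); first by rewrite mod_gt0.
  by move=> w; case: eqVneq => // ->; rewrite /Ball /= sub0r modN ltxx.
- by rewrite (negPf z0) expr2.
- move=> w; case: eqVneq => [->|w0]; last by field; rewrite z0 w0.
  by rewrite invr0; field.
Qed.

Lemma rderD p r t d e : rder p t d -> rder r t e ->
  rder (fun s => p s + r s) t (d + e).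
Proof.
move=> [q qc <- fq] [u uc <- gu].
apply: (@Rder _ _ _ (fun s => q s + u s)) => [|//|w]; first exact: contD.
by rewrite mulrDl -fq -gu; ring.
Qed.

Lemma rder_cst c t : rder (fun=> c) t 0.
Proof.
by apply: (@Rder _ _ _ (fun=> 0)) => [|//|w]; [exact: cont_cst|ring].
Qed.

Lemma rder_rC t : rder (@rC R) t 1.
Proof.
apply: (@Rder _ _ _ (fun=> 1)) => [|//|w]; first exact: cont_cst.
by rewrite rCB mul1r.
Qed.

Lemma rderM p r t d e : rder p t d -> rder r t e ->
  rder (fun s => p s * r s) t (d * r t + p t * e).
Proof.
move=> fd [u uc <- gu]; have fc := rder_cont fd; case: fd => q qc <- fq.
apply: (@Rder _ _ _ (fun s => q s * r t + p s * u s)) => [|//|w].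
  by apply: contD; [exact: contM qc (cont_cst _ _)|exact: contM fc uc].
by rewrite mulrDl -[q w * _ * _]mulrAC -fq -[p w * _ * _]mulrA -gu; ring.
Qed.

Lemma rderZ c p t d : rder p t d -> rder (fun s => c * p s) t (c * d).
Proof.
by move=> h; have := rderM (rder_cst c t) h; rewrite mul0r add0r.
Qed.

Lemma rderN p t d : rder p t d -> rder (fun s => - p s) t (- d).
Proof.
move=> [q qc <- fq].
apply: (@Rder _ _ _ (fun s => - q s)) => [|//|w]; first exact: contN.
by rewrite mulNr -fq; ring.
Qed.

Lemma rderB p r t d e : rder p t d -> rder r t e ->
  rder (fun s => p s - r s) t (d - e).
Proof. by move=> h1 h2; exact: rderD h1 (rderN h2). Qed.

Lemma cder_rder f p t d e : rder p t d -> cder f (p t) e ->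
  rder (fun s => f (p s)) t (e * d).
Proof.
move=> fd [r rc <- gr]; have fc := rder_cont fd; case: fd => q qc <- fq.
apply: (@Rder _ _ _ (fun s => r (p s) * q s)) => [|//|w].
  exact: contM (cont_comp fc rc) qc.
by rewrite gr fq; ring.
Qed.

Lemma rder_affine p t (a b : R) d : rder p (a * t + b) d ->
  rder (fun s => p (a * s + b)) t (rC a * d).
Proof.
move=> [q qc <- pq].
apply: (@Rder _ _ _ (fun s => rC a * q (a * s + b))) => [|//|s].
  apply: contM; first exact: cont_cst.
  apply: (@cont_comp _ _ _ (fun s => a * s + b) q) qc; apply/contE.
  apply: cvgD; last exact: cvg_cst.
  by apply: cvgM; [exact: cvg_cst|exact: cvg_id].
rewrite pq.
have -> : a * s + b - (a * t + b) = a * (s - t) by ring.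
by rewrite rCM; ring.
Qed.

Lemma rder_Re p t d : rder p t d ->
  is_derive t 1 (fun s => complex.Re (p s)) (complex.Re d).
Proof.
move=> [q qc <- pq].
refine (@caratheodory_is_derive R (fun s => complex.Re (p s))
  (fun s => complex.Re (q s)) t _ _).
  by have /contE := cont_comp qc (cont_Re (q t)).
by move=> s; rewrite -ReN -ReD pq ReM /=; ring.
Qed.

Lemma rder_ReIm p t (d1 d2 : R) :
  is_derive t 1 (fun s => complex.Re (p s)) d1 ->
  is_derive t 1 (fun s => complex.Im (p s)) d2 ->
  rder p t (rC d1 + iC * rC d2).
Proof.
move=> [D1 e1] [D2 e2].
have [q1 [q1c q1E]] := @derivable_caratheodory R _ _ D1.
have [q2 [q2c q2E]] := @derivable_caratheodory R _ _ D2.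
have [_ e1'] := @caratheodory_is_derive R _ _ _ q1c q1E.
have [_ e2'] := @caratheodory_is_derive R _ _ _ q2c q2E.
move/contE: q1c => q1c; move/contE: q2c => q2c.
apply: (@Rder _ _ _ (fun s => rC (q1 s) + iC * rC (q2 s))).
- apply: contD; first exact: cont_comp q1c (cont_rC _).
  by apply: contM; [exact: cont_cst|exact: cont_comp q2c (cont_rC _)].
- by rewrite -e1' -e2' e1 e2.
- move=> s; rewrite [p s in LHS]CE [p t in LHS]CE mulrDl -mulrA -!rCM -q1E -q2E.
  by rewrite !rCB; ring.
Qed.

(** Rotate the displacement to the positive axis and apply the mean value theorem
    to its real part. *)
Lemma rder_le p (P : R -> R) (d : R -> C R) (e : R -> R) (a b : R) : a <= b ->
  (forall t, a <= t <= b -> rder p t (d t)) ->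
  (forall t, a <= t <= b -> is_derive t 1 P (e t)) ->
  (forall t, a <= t <= b -> modulus (d t) <= e t) ->
  modulus (p b - p a) <= P b - P a.
Proof.
move=> ab pd Pe de.
have [u u1 uE] := rotate_mod (p b - p a).
pose G t := P t - complex.Re (u * p t).
have GD t : a <= t <= b -> is_derive t 1 G (e t - complex.Re (u * d t)).
  by move=> h; apply: is_deriveB; [exact: Pe|apply: rder_Re; apply: rderZ; exact: pd].
have : G a <= G b.
  have [||c] := @MVT_segment R G (fun t => e t - complex.Re (u * d t)) a b ab.
  - by move=> t; rewrite in_itv /= => /andP[/ltW h1 /ltW h2]; apply: GD; rewrite h1 h2.
  - apply: derivable_within_continuous => t; rewrite in_itv /= => h.
    by case: (GD _ h).
  - rewrite in_itv /= => h GE; rewrite -subr_ge0 GE.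
    apply: mulr_ge0; last by rewrite subr_ge0.
    rewrite subr_ge0; apply: le_trans (de _ h).
    apply: le_trans (le_trans (ler_norm _) (Re_le_mod _)) _.
    by rewrite modM u1 mul1r.
rewrite /G; have : complex.Re (u * (p b - p a)) = modulus (p b - p a) by rewrite uE.
by rewrite mulrBr ReD ReN; lra.
Qed.

Lemma rder_bound p (d : R -> C R) (m a b : R) : a <= b ->
  (forall t, a <= t <= b -> rder p t (d t)) ->
  (forall t, a <= t <= b -> modulus (d t) <= m) ->
  modulus (p b - p a) <= m * (b - a).
Proof.
move=> ab pd dm; have := @rder_le p (fun t => m * t) d (fun=> m) a b ab pd.
rewrite mulrBr; apply => // t _.
apply: (@caratheodory_is_derive R (fun t => m * t) (fun=> m)).
  exact: cvg_cst.
by move=> s; rewrite mulrBr.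
Qed.

Lemma rder_eq p r (d : R -> C R) (a b : R) : a <= b ->
  (forall t, a <= t <= b -> rder p t (d t)) ->
  (forall t, a <= t <= b -> rder r t (d t)) ->
  p b - p a = r b - r a.
Proof.
move=> ab pd rd; apply/eqP; rewrite -subr_eq0 -mod_eq0 eq_le mod_ge0 andbT.
have := @rder_bound (fun s => p s - r s) (fun=> 0) 0 a b ab.
rewrite mul0r; have -> : p b - r b - (p a - r a) = p b - p a - (r b - r a) by ring.
apply => t h; last by rewrite mod0.
by rewrite -(subrr (d t)); apply: rderB; [exact: pd|exact: rd].
Qed.

Lemma rder_line z w t : rder (fun s => z + rC s * w) t w.
Proof.
have := rderD (rder_cst z t) (rderM (rder_rC t) (rder_cst w t)).
by rewrite mulr0 addr0 mul1r add0r.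
Qed.

Lemma Ball_line z w (r : R) v t : Ball z r w -> Ball z r v -> 0 <= t <= 1 ->
  Ball z r (w + rC t * (v - w)).
Proof.
rewrite /Ball /= => wr vr /andP[t0 t1].
have -> : w + rC t * (v - w) - z = rC (1 - t) * (w - z) + rC t * (v - z).
  by rewrite rCB rC1; ring.
apply: le_lt_trans (modD _ _) _; rewrite !modM !mod_rC !ger0_norm ?subr_ge0 //.
have [->|t0'] := eqVneq t 0; first by rewrite subr0 mul1r mul0r addr0.
have : t * modulus (v - z) < t * r by rewrite ltr_pM2l // lt_def t0' t0.
have : (1 - t) * modulus (w - z) <= (1 - t) * r by rewrite ler_wpM2l ?subr_ge0 // ltW.
lra.
Qed.

Lemma cder_ball_bound f (d : C R -> C R) z (r m : R) w v :
  (forall u, Ball z r u -> cder f u (d u)) ->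
  (forall u, Ball z r u -> modulus (d u) <= m) ->
  Ball z r w -> Ball z r v -> modulus (f v - f w) <= m * modulus (v - w).
Proof.
move=> fd dm wz vz.
have := @rder_bound (fun t => f (w + rC t * (v - w)))
  (fun t => d (w + rC t * (v - w)) * (v - w)) (m * modulus (v - w)) 0 1 ler01.
rewrite rC1 mul1r rC0 mul0r addr0 subr0 mulr1.
have -> : w + (v - w) = v by ring.
apply => t h; last by rewrite modM ler_wpM2r ?mod_ge0 // dm //; exact: Ball_line.
apply: cder_rder; first exact: rder_line.
by apply: fd; exact: Ball_line.
Qed.

Lemma cder_ball_eq f g (d : C R -> C R) z (r : R) :
  (forall u, Ball z r u -> cder f u (d u)) ->
  (forall u, Ball z r u -> cder g u (d u)) ->
  f z = g z -> forall u, Ball z r u -> f u = g u.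
Proof.
move=> fd gd fgz u uz.
have r0 : 0 < r by apply: le_lt_trans uz; exact: mod_ge0.
have := @cder_ball_bound (fun w => f w - g w) (fun=> 0) z r 0 z u.
rewrite mul0r fgz subrr subr0 => h; apply/eqP; rewrite -subr_eq0 -mod_eq0.
rewrite eq_le mod_ge0 andbT; apply: h => //.
- by move=> v vz; rewrite -(subrr (d v)); apply: cderB; [exact: fd|exact: gd].
- by move=> v _; rewrite mod0.
- exact: Ball_center.
Qed.

End Derivatives.

(** * The exponential and integrals along paths *)

Section Exponential.
Context {R : realType}.
Implicit Types (z w : C R) (t : R).

Lemma Re_cexp z : complex.Re (cexp z) = expR (complex.Re z) * cos (complex.Im z).
Proof. by rewrite /cexp ReMr ReD ReM /=; ring. Qed.

Lemma Im_cexp z : complex.Im (cexp z) = expR (complex.Re z) * sin (complex.Im z).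
Proof. by rewrite /cexp ImMr ImD ImM /=; ring. Qed.

Lemma cexpD z w : cexp (z + w) = cexp z * cexp w.
Proof.
apply: C_eq; [rewrite Re_cexp ReM|rewrite Im_cexp ImM];
  rewrite !(Re_cexp, Im_cexp) ReD ImD expRD ?cosD ?sinD; ring.
Qed.

Lemma cexp0 : cexp (0 : C R) = 1.
Proof. by apply: C_eq; rewrite !(Re_cexp, Im_cexp) /= expR0 ?cos0 ?sin0 mul1r. Qed.

Lemma mod_cexp z : modulus (cexp z) = expR (complex.Re z).
Proof.
rewrite modE !(Re_cexp, Im_cexp) !exprMn -mulrDr cos2Dsin2 mulr1 sqrtr_sqr.
by rewrite ger0_norm ?expR_ge0.
Qed.

Lemma cexp_neq0 z : cexp z != 0.
Proof. by rewrite -mod_gt0 mod_cexp expR_gt0. Qed.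

Lemma cexpN z : cexp (- z) = (cexp z)^-1.
Proof.
apply: (mulIf (cexp_neq0 z)); rewrite -cexpD addNr cexp0 mulVf //.
exact: cexp_neq0.
Qed.

Lemma cexpB z w : cexp (z - w) = cexp z / cexp w.
Proof. by rewrite cexpD cexpN. Qed.

Lemma cexpMn n z : cexp (n%:R * z) = cexp z ^+ n.
Proof.
elim: n => [|n IH]; first by rewrite mul0r cexp0 expr0.
by rewrite -natr1 mulrDl mul1r cexpD IH exprSr.
Qed.

Lemma cexp_rC t : cexp (rC t) = rC (expR t).
Proof. by rewrite /cexp /= cos0 sin0 rC0 mulr0 addr0 rC1 mulr1. Qed.

Lemma expiE t : expi t = rC (cos t) + iC * rC (sin t).
Proof.
have [x0 y0] : complex.Re (iC * rC t) = 0 /\ complex.Im (iC * rC t) = t.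
  by rewrite ReM ImM /=; split; ring.
by rewrite /expi /cexp x0 y0 expR0 rC1 mul1r.
Qed.

Lemma expiD s t : expi (s + t) = expi s * expi t.
Proof. by rewrite /expi rCD mulrDr cexpD. Qed.

Lemma expi0 : expi (0 : R) = 1.
Proof. by rewrite /expi rC0 mulr0 cexp0. Qed.

Lemma expiN t : expi (- t) = (expi t)^-1.
Proof. by rewrite /expi rCN mulrN cexpN. Qed.

Lemma Re_expi t : complex.Re (expi t) = cos t.
Proof. by rewrite expiE ReD ReM /=; ring. Qed.

Lemma mod_expi t : modulus (expi t) = 1.
Proof.
have x0 : complex.Re (iC * rC t) = 0 by rewrite ReM /=; ring.
by rewrite /expi mod_cexp x0 expR0.
Qed.

Lemma expi_neq0 t : expi t != 0 :> C R.
Proof. exact: cexp_neq0. Qed.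

Lemma expi_conj t : (expi t)^* = (expi t)^-1.
Proof.
apply: (mulfI (expi_neq0 t)); rewrite divff ?expi_neq0 //.
by rewrite conj_mod2 mod_expi expr1n.
Qed.

Lemma expi_2pi : expi (2 * pi) = 1 :> C R.
Proof. by rewrite expiE mulr_natl cos2pi sin2pi rC0 mulr0 addr0. Qed.

Lemma expi_2pin (k : int) : expi (2 * pi * k%:~R) = 1 :> C R.
Proof.
have h n : expi (2 * pi * n%:R) = 1 :> C R.
  elim: n => [|n IH]; first by rewrite mulr0 expi0.
  by rewrite -[n.+1%:R]natr1 [_ * (_ + 1)]mulrDr [_ * 1]mulr1 expiD IH expi_2pi mulr1.
by case: k => n; [exact: h|rewrite NegzE intrN mulrN expiN h invr1].
Qed.

Definition period : C R := 2 * rC pi * iC.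

Lemma period_neq0 : period != 0.
Proof. by rewrite !mulf_neq0 ?iC_neq0 ?rC_eq0 ?pnatr_eq0 // gt_eqF ?pi_gt0. Qed.

Lemma cexp_period (k : int) : cexp (k%:~R * period) = 1.
Proof.
apply: etrans (expi_2pin k); rewrite /expi /period !rCM rCn; congr cexp.
by have -> : rC (k%:~R) = k%:~R :> C R; [exact: rmorph_int|ring].
Qed.

Lemma cos_eq1 t : cos t = 1 -> exists k : int, t = 2 * pi * k%:~R.
Proof.
have tp : 0 < 2 * pi :> R by rewrite mulr_gt0 ?pi_gt0.
pose k := Num.floor (t / (2 * pi)); pose r := t - 2 * pi * k%:~R.
have rE : t = r + 2 * pi * k%:~R by rewrite /r subrK.
have r0 : 0 <= r.
  have := Num.Theory.floor_le (t / (2 * pi)); rewrite -/k ler_pdivlMr // mulrC.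
  by rewrite /r subr_ge0.
have r1 : r < 2 * pi.
  have := Num.Theory.floorD1_gt (t / (2 * pi)); rewrite -/k ltr_pdivrMr // intrD.
  by rewrite /r mulrDl mul1r [_ * (2 * pi)]mulrC; lra.
have cr : cos t = cos r.
  by rewrite -[in LHS]Re_expi rE expiD expi_2pin mulr1 Re_expi.
move=> c1; exists k; rewrite rE; suff -> : r = 0 by rewrite add0r.
rewrite cr in c1; apply: (@cos_inj R); rewrite ?cos0 ?in_itv /= ?lexx ?pi_ge0 //.
rewrite r0 /= leNgt; apply/negP => pr.
have := @cos_inj R (2 * pi - r) 0; rewrite !in_itv /= lexx pi_ge0 => H.
suff : 2 * pi - r = 0 by lra.
have := pi_gt0 R => p0; apply: H => //; first by apply/andP; split; lra.
by rewrite mulr_natl cos0 cosB cos2pi sin2pi c1; ring.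
Qed.

Lemma cexp_eq1 z : cexp z = 1 -> exists k : int, z = k%:~R * period.
Proof.
move=> z1; have x0 : complex.Re z = 0.
  by apply: expR_inj; rewrite expR0 -mod_cexp z1 mod1.
have : cos (complex.Im z) = 1.
  by have := congr1 (@complex.Re R) z1; rewrite Re_cexp x0 expR0 mul1r.
move=> /cos_eq1[k kE]; exists k.
rewrite [z]CE x0 rC0 add0r kE !rCM rCn /period.
by have -> : rC (k%:~R) = k%:~R :> C R; [exact: rmorph_int|ring].
Qed.

Lemma cexp_eq z w : cexp z = cexp w -> exists k : int, z = w + k%:~R * period.
Proof.
move=> zw; have : cexp (z - w) = 1 by rewrite cexpB zw divff ?cexp_neq0.
by move=> /cexp_eq1[k kE]; exists k; rewrite -kE addrC subrK.
Qed.

Lemma unit_expi z : modulus z = 1 -> exists t, `|t| <= pi /\ expi t = z.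
Proof.
move=> z1; have c1 : -1 <= complex.Re z <= 1.
  by have := Re_le_mod z; rewrite z1 ler_norml.
have s2 : complex.Im z ^+ 2 = 1 - complex.Re z ^+ 2.
  by have := mod_sqr z; rewrite z1 expr1n; lra.
have [a0 ap] : 0 <= acos (complex.Re z) /\ acos (complex.Re z) <= pi.
  by have [/andP[]] := acos_def c1.
have cE : cos (acos (complex.Re z)) = complex.Re z by apply: acosK; rewrite in_itv.
have sE : sin (acos (complex.Re z)) = `|complex.Im z|.
  by rewrite sin_acos // -s2 sqrtr_sqr.
have [y0|y0] := leP 0 (complex.Im z).
  exists (acos (complex.Re z)); split; first by rewrite ger0_norm.
  by rewrite [RHS]CE expiE cE sE ger0_norm.
exists (- acos (complex.Re z)); split; first by rewrite normrN ger0_norm.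
by rewrite [RHS]CE expiE cosN sinN cE sE ltr0_norm // opprK.
Qed.

Lemma cexp_surj z : z != 0 -> exists w,
  [/\ cexp w = z, complex.Re w = ln (modulus z) & `|complex.Im w| <= pi].
Proof.
move=> z0; have m0 : 0 < modulus z by rewrite mod_gt0.
have [|t [tp tE]] := @unit_expi (z / rC (modulus z)).
  by rewrite mod_div mod_rC ger0_norm ?mod_ge0 // divff // gt_eqF.
exists (rC (ln (modulus z)) + iC * rC t); split.
- rewrite cexpD cexp_rC lnK ?posrE // -[cexp _]/(expi t) tE mulrC divfK //.
  by rewrite rC_eq0 gt_eqF.
- by rewrite ReD ReM /=; ring.
- suff -> : complex.Im (rC (ln (modulus z)) + iC * rC t) = t by [].
  by rewrite ImD ImM /=; ring.
Qed.

Lemma cont_cexp z : cont (@cexp R) z.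
Proof.
apply: contM; first exact: cont_comp (cont_comp (cont_Re z) (@Cont _ _ _ _ (@continuous_expR R _))) (cont_rC _).
apply: contD; first exact: cont_comp (cont_comp (cont_Im z) (@Cont _ _ _ _ (@continuous_cos R _))) (cont_rC _).
apply: contM; first exact: cont_cst.
exact: cont_comp (cont_comp (cont_Im z) (@Cont _ _ _ _ (@continuous_sin R _))) (cont_rC _).
Qed.

Lemma rder_cexp_line w t : rder (fun s => cexp (rC s * w)) t (w * cexp (rC t * w)).
Proof.
pose x := complex.Re w; pose y := complex.Im w.
have dl (c : R) : is_derive t 1 (fun s => s * c) c.
  apply: (@caratheodory_is_derive R (fun s => s * c) (fun=> c)).
    exact: cvg_cst.
  by move=> s; ring.
have dE : is_derive t 1 (fun s => expR (s * x)) (x * expR (t * x)).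
  by have := @is_derive1_comp R (@expR R) _ _ _ _ (is_derive_expR _) (dl x); rewrite mulrC.
have dC : is_derive t 1 (fun s => cos (s * y)) (- (y * sin (t * y))).
  have := @is_derive1_comp R (@cos R) _ _ _ _ (is_derive_cos _) (dl y).
  by rewrite mulNr mulrC.
have dS : is_derive t 1 (fun s => sin (s * y)) (y * cos (t * y)).
  by have := @is_derive1_comp R (@sin R) _ _ _ _ (is_derive_sin _) (dl y); rewrite mulrC.
have mE (f g : R -> R) (a b : R) : is_derive t 1 f a -> is_derive t 1 g b ->
    is_derive t 1 (fun s => f s * g s) (f t * b + g t * a).
  by move=> h1 h2; exact: (@is_deriveM R R f g t 1 a b h1 h2).
have -> : w * cexp (rC t * w) =
    rC (complex.Re (w * cexp (rC t * w))) + iC * rC (complex.Im (w * cexp (rC t * w))).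
  by rewrite -CE.
apply: rder_ReIm.
- have := mE _ _ _ _ dE dC; rewrite (_ : _ + _ = complex.Re (w * cexp (rC t * w))).
    by under [X in _ -> is_derive _ _ X _]eq_fun do rewrite Re_cexp ReMr ImMr.
  by rewrite ReM Re_cexp Im_cexp ReMr ImMr -/x -/y; ring.
- have := mE _ _ _ _ dE dS; rewrite (_ : _ + _ = complex.Im (w * cexp (rC t * w))).
    by under [X in _ -> is_derive _ _ X _]eq_fun do rewrite Im_cexp ReMr ImMr.
  by rewrite ImM Re_cexp Im_cexp ReMr ImMr -/x -/y; ring.
Qed.

(** Only the derivative at the origin needs an estimate: along the segment from [0]
    to [w], [cexp] has derivative [w * cexp], and [cexp] is close to [1]. *)
Lemma cexp_near0 (e : R) : 0 < e -> exists2 d : R, 0 < d &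
  forall w, modulus w < d -> modulus (cexp w - 1 - w) <= e * modulus w.
Proof.
move=> e0; have /contCP/(_ _ e0)[d d0 dH] := cont_cexp 0; exists d => // w wd.
have := @rder_bound _ (fun s => cexp (rC s * w) - rC s * w)
  (fun s => w * cexp (rC s * w) - w) (e * modulus w) 0 1 ler01.
rewrite !(rC1, rC0, mul1r, mul0r, cexp0, subr0, mulr1) addrAC; apply => t /andP[t0 t1].
  apply: rderB; first exact: rder_cexp_line.
  by have := rderM (rder_rC t) (rder_cst w t); rewrite mulr0 addr0 mul1r.
have -> : w * cexp (rC t * w) - w = (cexp (rC t * w) - 1) * w by ring.
rewrite modM ler_wpM2r ?mod_ge0 // -cexp0 ltW // dH // subr0 modM mod_rC ger0_norm //.
by apply: le_lt_trans wd; rewrite ler_piMl ?mod_ge0.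
Qed.

Lemma cder_cexp z : cder (@cexp R) z (cexp z).
Proof.
apply: (@Cder _ _ _ _ (fun w => cexp z *
  (if w - z == 0 then 1 else (cexp (w - z) - 1) / (w - z)))).
- apply: contM; first exact: cont_cst.
  apply/contCP => e e0; have [|d d0 dH] := @cexp_near0 (e / 2); first exact: divr_gt0.
  exists d => // w wz; rewrite [z - z]subrr eqxx; case: eqVneq => [_|h0].
    by rewrite subrr mod0.
  have -> : (cexp (w - z) - 1) / (w - z) - 1 = (cexp (w - z) - 1 - (w - z)) / (w - z).
    by rewrite [RHS]mulrBl divff.
  rewrite mod_div ltr_pdivrMr ?mod_gt0 //.
  apply: le_lt_trans (dH _ wz) _; rewrite ltr_pM2r ?mod_gt0 //; lra.
- by rewrite subrr eqxx mulr1.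
- move=> w; have {1}-> : w = z + (w - z) by ring.
  rewrite cexpD -{2}[cexp z]mulr1 -mulrBr -mulrA; congr (_ * _).
  by case: eqVneq => [->|h0]; rewrite ?cexp0 ?subrr ?mulr0 // divfK.
Qed.

Lemma rder_expi t : rder (@expi R) t (iC * expi t).
Proof.
have := rder_cexp_line iC t; rewrite /expi.
rewrite (_ : (fun s => _) = (fun s => cexp (iC * rC s))); first by rewrite [rC t * _]mulrC.
by apply/funext => s; rewrite mulrC.
Qed.

Lemma cont_expi t : cont (@expi R) t.
Proof. exact: rder_cont (rder_expi t). Qed.

End Exponential.

Arguments period {R}.

Section Integral.
Context {R : realType}.
Implicit Types (p q : R -> C R) (a b t : R) (u v : R -> R).

Lemma real_primitive u : continuous u ->
  exists v, forall t, -1 < t -> is_derive t 1 v (u t).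
Proof.
move=> uc; exists (fun x => \int[lebesgue_measure]_(t in `[-1, x]) u t)%R => t t1.
have [||h1 h2] := @continuous_FTC1_closed R u (-1) t (t + 1) _ _ t1 (uc t).
- by rewrite ltrDl.
- apply: continuous_compact_integrable; first exact: segment_compact.
  by apply: continuous_subspaceT => x; exact: uc.
- by split; [exact: h1|rewrite -h2 derive1E].
Qed.

Definition has_prim p q := forall t, -1 < t -> rder q t (p t).

(** Any primitive gives the same increment, so it does not matter which one is
    chosen; the integral is meant for continuous [p] and [0 <= b]. *)
Definition cint p b : C R :=
  let q := xget (fun=> 0) [set q | has_prim p q] in q b - q 0.

Definition contT p := forall t, cont p t.

Lemma prim_exists p : contT p -> exists q, has_prim p q.
Proof.
move=> pc.
have [u uH] := @real_primitive (fun t => complex.Re (p t)) (fun t => (contE _ _).1 (cont_comp (pc t) (cont_Re _))).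
have [v vH] := @real_primitive (fun t => complex.Im (p t)) (fun t => (contE _ _).1 (cont_comp (pc t) (cont_Im _))).
exists (fun t => rC (u t) + iC * rC (v t)) => t t1.
rewrite [p t]CE; apply: rder_ReIm.
  have -> : (fun s => complex.Re (rC (u s) + iC * rC (v s))) = u.
    by apply/funext => s; rewrite ReD ReM /=; ring.
  exact: uH.
have -> : (fun s => complex.Im (rC (u s) + iC * rC (v s))) = v.
  by apply/funext => s; rewrite ImD ImM /=; ring.
exact: vH.
Qed.

Lemma cint_prim p b q : contT p -> 0 <= b ->
  (forall t, 0 <= t <= b -> rder q t (p t)) -> cint p b = q b - q 0.
Proof.
move=> pc b0 qH; rewrite /cint.
have := xgetPex (fun=> 0) (prim_exists pc); rewrite /= => H.
apply: (@rder_eq _ _ _ p) => // t /andP[t0 tb]; apply: H.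
by apply: lt_le_trans t0; rewrite oppr_lt0.
Qed.

Lemma cintP p b : contT p -> 0 <= b -> exists2 q,
  (forall t, 0 <= t -> rder q t (p t)) & cint p b = q b - q 0.
Proof.
move=> pc b0; have [q qH] := prim_exists pc; exists q.
  by move=> t t0; apply: qH; apply: lt_le_trans t0; rewrite oppr_lt0.
apply: cint_prim => // t /andP[t0 _]; apply: qH.
by apply: lt_le_trans t0; rewrite oppr_lt0.
Qed.

Lemma contT_D p q : contT p -> contT q -> contT (fun t => p t + q t).
Proof. by move=> h1 h2 t; exact: contD (h1 t) (h2 t). Qed.

Lemma contT_B p q : contT p -> contT q -> contT (fun t => p t - q t).
Proof. by move=> h1 h2 t; exact: contB (h1 t) (h2 t). Qed.

Lemma contT_M p q : contT p -> contT q -> contT (fun t => p t * q t).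
Proof. by move=> h1 h2 t; exact: contM (h1 t) (h2 t). Qed.

Lemma contT_cst (c : C R) : contT (fun=> c).
Proof. by move=> t; exact: cont_cst. Qed.

Lemma contT_V p : (forall t, p t != 0) -> contT p -> contT (fun t => (p t)^-1).
Proof. by move=> h0 h1 t; exact: contV (h0 t) (h1 t). Qed.

Lemma contT_expi : contT (@expi R).
Proof. by move=> t; exact: cont_expi. Qed.

Lemma cintD p q b : contT p -> contT q -> 0 <= b ->
  cint (fun t => p t + q t) b = cint p b + cint q b.
Proof.
move=> pc qc b0; have [p' pH ->] := cintP pc b0; have [q' qH ->] := cintP qc b0.
rewrite (@cint_prim _ _ (fun t => p' t + q' t)) //; first by ring.
- exact: contT_D.
- by move=> t /andP[t0 _]; apply: rderD; [exact: pH|exact: qH].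
Qed.

Lemma cintZ c p b : contT p -> 0 <= b ->
  cint (fun t => c * p t) b = c * cint p b.
Proof.
move=> pc b0; have [p' pH ->] := cintP pc b0.
rewrite (@cint_prim _ _ (fun t => c * p' t)) //; first by ring.
- by apply: contT_M => //; exact: contT_cst.
- by move=> t /andP[t0 _]; apply: rderZ; exact: pH.
Qed.

Lemma cintB p q b : contT p -> contT q -> 0 <= b ->
  cint (fun t => p t - q t) b = cint p b - cint q b.
Proof.
move=> pc qc b0; have [p' pH ->] := cintP pc b0; have [q' qH ->] := cintP qc b0.
rewrite (@cint_prim _ _ (fun t => p' t - q' t)) //; first by ring.
- exact: contT_B.
- by move=> t /andP[t0 _]; apply: rderB; [exact: pH|exact: qH].
Qed.

Lemma cint_cst (c : C R) b : 0 <= b -> cint (fun=> c) b = c * rC b.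
Proof.
move=> b0; rewrite (@cint_prim _ _ (fun t => c * rC t)) //.
- by rewrite rC0 mulr0 subr0.
- exact: contT_cst.
- by move=> t _; have := rderZ c (rder_rC t); rewrite mulr1.
Qed.

Lemma cint_sum (I : Type) (r : seq I) (F : I -> R -> C R) b :
  (forall i, contT (F i)) -> 0 <= b ->
  cint (fun t => \sum_(i <- r) F i t) b = \sum_(i <- r) cint (F i) b.
Proof.
move=> Fc b0; elim: r => [|i r IH].
  rewrite big_nil -[RHS](mul0r (rC b)) -(cint_cst 0) //.
  by congr cint; apply/funext => t; rewrite big_nil.
rewrite big_cons -IH -cintD //; last by move=> t; apply: cont_sum => j _; exact: Fc.
by congr cint; apply/funext => t; rewrite big_cons.
Qed.

Lemma cint_le p q b : contT p -> contT q -> 0 <= b ->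
  (forall t, 0 <= t <= b -> modulus (p t) <= complex.Re (q t)) ->
  modulus (cint p b) <= complex.Re (cint q b).
Proof.
move=> pc qc b0 pq; have [p' pH ->] := cintP pc b0; have [q' qH ->] := cintP qc b0.
rewrite ReD ReN.
apply: (@rder_le _ p' (fun t => complex.Re (q' t)) p (fun t => complex.Re (q t))) => //.
- by move=> t /andP[t0 _]; exact: pH.
- by move=> t /andP[t0 _]; apply: rder_Re; exact: qH.
Qed.

Lemma cint_bound p (m : R) b : contT p -> 0 <= b ->
  (forall t, 0 <= t <= b -> modulus (p t) <= m) -> modulus (cint p b) <= m * b.
Proof.
move=> pc b0 pm; have := @cint_le p (fun=> rC m) b pc (contT_cst _) b0 pm.
by rewrite cint_cst // -rCM.
Qed.

Lemma eq_cint p q b : contT p -> contT q -> 0 <= b ->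
  (forall t, 0 <= t <= b -> p t = q t) -> cint p b = cint q b.
Proof.
move=> pc qc b0 pq; have [q' qH ->] := cintP qc b0.
by apply: cint_prim => // t /andP[t0 tb]; rewrite pq ?t0 //; exact: qH.
Qed.

Lemma rder_conj p t d : rder p t d -> rder (fun s => (p s)^*) t d^*.
Proof.
move=> [q qc <- pq].
apply: (@Rder _ _ _ _ (fun s => (q s)^*)) => [|//|s].
  apply/contP => e e0; move/contP: qc => /(_ e e0); apply: filterS => s.
  by rewrite -rmorphB mod_conj.
rewrite -rmorphB pq rmorphM; congr (_ * _).
exact: conjc_real.
Qed.

Lemma cint_conj p b : contT p -> 0 <= b ->
  cint (fun t => (p t)^*) b = (cint p b)^*.
Proof.
move=> pc b0; have [p' pH ->] := cintP pc b0.
rewrite (@cint_prim _ _ (fun t => (p' t)^*)) ?rmorphB //.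
- move=> t; apply/contP => e e0; have /contP/(_ e e0) := pc t; apply: filterS => s.
  by rewrite -rmorphB mod_conj.
- by move=> t /andP[t0 _]; apply: rder_conj; exact: pH.
Qed.

End Integral.

(** * First-order approximation and integrals along segments *)

Section Approximation.
Context {R : realType}.
Implicit Types (f g F : C R -> C R) (z w a b c d u v : C R) (r e : R).

Lemma cder_approx f z d : cder f z d -> forall e, 0 < e -> exists2 r, 0 < r &
  forall w, modulus (w - z) < r ->
    modulus (f w - f z - d * (w - z)) <= e * modulus (w - z).
Proof.
move=> [q /contCP qc <- fq] e e0; have [r r0 rH] := qc _ e0; exists r => // w /rH.
by move=> h; rewrite fq -mulrBl modM ler_wpM2r ?mod_ge0 // ltW.
Qed.

Lemma cder_intro f z d : (forall e, 0 < e -> exists2 r, 0 < r &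
  forall w, modulus (w - z) < r ->
    modulus (f w - f z - d * (w - z)) <= e * modulus (w - z)) -> cder f z d.
Proof.
move=> H; apply: (@Cder _ _ _ _ (fun w => if w == z then d else (f w - f z) / (w - z))).
- apply/contCP => e e0; have [|r r0 rH] := H (e / 2); first exact: divr_gt0.
  exists r => // w /rH h; rewrite eqxx; case: eqVneq => [_|wz].
    by rewrite subrr mod0.
  have wz' : w - z != 0 by rewrite subr_eq0.
  have -> : (f w - f z) / (w - z) - d = (f w - f z - d * (w - z)) / (w - z) by field.
  rewrite mod_div ltr_pdivrMr ?mod_gt0 //.
  by apply: le_lt_trans h _; rewrite ltr_pM2r ?mod_gt0 //; lra.
- by rewrite eqxx.
- move=> w; case: eqVneq => [->|wz]; first by rewrite !subrr mulr0.
  by rewrite divfK // subr_eq0.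
Qed.

Lemma cder_unique f z d d' : cder f z d -> cder f z d' -> d = d'.
Proof.
move=> [q [qc] <- fq] [q' [qc'] <- fq'].
by rewrite -(@derive_val _ _ _ _ _ _ _ (@caratheodory_is_derive (C R) f q z qc fq))
  -(@derive_val _ _ _ _ _ _ _ (@caratheodory_is_derive (C R) f q' z qc' fq')).
Qed.

Definition cD f z : C R := xget 0 [set d | cder f z d].

Lemma cDE f z d : cder f z d -> cD f z = d.
Proof.
move=> fd; apply: (@cder_unique f z) (fd); rewrite /cD.
by apply: (@xgetPex _ 0 [set d | cder f z d]); exists d.
Qed.

Lemma cD_derivable f z : derivable f z 1 -> cder f z (cD f z).
Proof. by move=> /derivable_cder[d fd]; rewrite (cDE fd). Qed.

Lemma cder_near f g z d r : 0 < r -> (forall w, Ball z r w -> f w = g w) ->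
  cder f z d -> cder g z d.
Proof.
move=> r0 fg /cder_approx H; apply: cder_intro => e e0; have [r' r'0 rH] := H e e0.
exists (Num.min r r'); first by rewrite lt_min r0.
move=> w; rewrite lt_min => /andP[h1 h2]; rewrite -!fg //; first exact: rH.
exact: Ball_center.
Qed.

Lemma cderX f z d n : cder f z d ->
  cder (fun w => f w ^+ n) z (n%:R * f z ^+ n.-1 * d).
Proof.
move=> fd; elim: n => [|n IH].
  by rewrite !mul0r; apply: cder_near ltr01 _ (cder_cst 1 z) => w _; rewrite expr0.
have := cderM fd IH; rewrite (_ : _ + _ = n.+1%:R * f z ^+ n * d).
  by apply: cder_near ltr01 _ => w _; rewrite exprS.
by case: n {IH} => [|n] /=; rewrite -?[n.+2%:R]natr1 ?exprS; ring.
Qed.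

Lemma cderVf f z d : f z != 0 -> cder f z d ->
  cder (fun w => (f w)^-1) z (- (d / f z ^+ 2)).
Proof.
move=> f0 fd; have := cder_comp fd (cderV f0).
by rewrite mulNr mulrC.
Qed.

Lemma cder_div f g z d (e : C R) : g z != 0 -> cder f z d -> cder g z e ->
  cder (fun w => f w / g w) z ((d * g z - f z * e) / g z ^+ 2).
Proof.
move=> g0 fd gd; have := cderM fd (cderVf g0 gd).
by congr cder; field.
Qed.

Lemma half_pow_small (c e : R) : 0 < e -> exists n, c * 2^-1 ^+ n < e.
Proof.
move=> e0; have [n nH] : exists n : nat, `|c| / e < n%:R.
  by exists (Num.Def.archi_bound (`|c| / e)); apply: archi_boundP; rewrite divr_ge0 // ltW.
exists n; apply: le_lt_trans (_ : `|c| * 2^-1 ^+ n < e).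
  by rewrite ler_wpM2r ?ler_norm // exprn_ge0 // invr_ge0.
rewrite exprVn ltr_pdivrMr ?exprn_gt0 // mulrC -ltr_pdivrMr //.
apply: lt_trans nH _; rewrite -natrX ltr_nat; exact: ltn_expl.
Qed.

(** Corners of the bisected triangles converge geometrically. *)
Lemma geometric_cauchy (x : nat -> R) (c : R) :
  (forall n, `|x n.+1 - x n| <= c * 2^-1 ^+ n) ->
  exists l, forall n, `|x n - l| <= 2 * c * 2^-1 ^+ n.
Proof.
move=> H; have c0 : 0 <= c by have := H 0%N; rewrite expr0 mulr1; apply: le_trans.
pose y n := x n - 2 * c * 2^-1 ^+ n; pose z n := x n + 2 * c * 2^-1 ^+ n.
have hp n : 0 <= c * 2^-1 ^+ n by rewrite mulr_ge0 // exprn_ge0 // invr_ge0.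
have hS n : 2 * c * 2^-1 ^+ n.+1 = c * 2^-1 ^+ n by rewrite exprS; field.
have y1 n : y n <= y n.+1.
  by have := H n; rewrite /y ler_norml hS => /andP[h1 h2]; lra.
have z1 n : z n.+1 <= z n.
  by have := H n; rewrite /z ler_norml hS => /andP[h1 h2]; lra.
have ym n m : (n <= m)%N -> y n <= y m.
  by move=> /subnK <-; elim: (m - n)%N => [//|k IH]; apply: le_trans IH (y1 _).
have zm n m : (n <= m)%N -> z m <= z n.
  by move=> /subnK <-; elim: (m - n)%N => [//|k IH]; apply: le_trans (z1 _) IH.
have yz n m : y n <= z m.
  apply: le_trans (ym _ _ (leq_addr m n)) (le_trans _ (zm _ _ (leq_addl n m))).
  by rewrite /y /z; have := hp (n + m)%N; lra.
have sy : has_sup (range y).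
  by split; [exists (y 0%N), 0%N|exists (z 0%N) => _ [n _ <-]].
exists (sup (range y)) => n.
have h1 : y n <= sup (range y) by apply: sup_upper_bound => //; exists n.
have h2 : sup (range y) <= z n.
  by apply: ge_sup; [exists (y 0%N), 0%N|move=> _ [m _ <-]].
by rewrite ler_norml; apply/andP; rewrite /y /z in h1 h2; split; lra.
Qed.

Lemma geometric_cauchyC (x : nat -> C R) (c : R) :
  (forall n, modulus (x n.+1 - x n) <= c * 2^-1 ^+ n) ->
  exists l, forall n, modulus (x n - l) <= 4 * c * 2^-1 ^+ n.
Proof.
move=> H.
have [n|l1 l1H] := @geometric_cauchy (fun n => complex.Re (x n)) c.
  by apply: le_trans (H n); rewrite -ReN -ReD Re_le_mod.
have [n|l2 l2H] := @geometric_cauchy (fun n => complex.Im (x n)) c.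
  by apply: le_trans (H n); rewrite -ImN -ImD Im_le_mod.
exists (rC l1 + iC * rC l2) => n; apply: le_trans (mod_le_ReIm _) _.
have e1 : complex.Re (rC l1 + iC * rC l2) = l1 by rewrite ReD ReM /=; ring.
have e2 : complex.Im (rC l1 + iC * rC l2) = l2 by rewrite ImD ImM /=; ring.
by have := l1H n; have := l2H n; rewrite ReD ReN ImD ImN e1 e2; lra.
Qed.

End Approximation.

Section Segments.
Context {R : realType}.
Implicit Types (f g F : C R -> C R) (z w a b c d u v : C R) (r e : R).

Definition clamp (t : R) := Num.max 0 (Num.min t 1).

Lemma clamp_itv t : 0 <= clamp t <= 1.
Proof. by rewrite /clamp le_max lexx /= ge_max ler01 ge_min lexx orbT. Qed.

Lemma clamp_id t : 0 <= t <= 1 -> clamp t = t.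
Proof. by move=> /andP[t0 t1]; rewrite /clamp min_l // max_r. Qed.

Lemma cont_clamp t : cont clamp t.
Proof.
apply/contE/cvgrPdist_lt => e e0; apply/nbhs_ballP; exists e => //= s.
rewrite -ball_normE /=; apply: le_lt_trans.
have := ler_norm (t - s); have := ler_norm (s - t); rewrite (distrC s) => h1 h2.
rewrite /clamp ler_norml; case: (leP t 1) => ?; case: (leP s 1) => ?;
  case: (leP 0 t) => ?; case: (leP 0 s) => ?; case: (leP (0 : R) 1) => ?;
  apply/andP; split; lra.
Qed.

(** Clamping the parameter makes the integrand continuous on the whole line, also
    when [f] is only continuous on a convex set containing the segment. *)
Definition line f a b (t : R) := f (a + rC (clamp t) * (b - a)).
Definition seg f a b := (b - a) * cint (line f a b) 1.

Definition convexC (D : set (C R)) := forall a b (t : R), D a -> D b ->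
  0 <= t <= 1 -> D (a + rC t * (b - a)).

Lemma convex_Ball z r : convexC (Ball z r).
Proof. by move=> a b t za zb; exact: Ball_line. Qed.

Section Convex.
Variables (D : set (C R)) (f : C R -> C R).
Hypothesis Dconvex : convexC D.
Hypothesis fc : forall u, D u -> cont f u.

Lemma contT_line a b : D a -> D b -> contT (line f a b).
Proof.
move=> Da Db t.
apply: (@cont_comp _ _ _ (fun t => a + rC (clamp t) * (b - a)) f); last first.
  by apply/fc/Dconvex => //; exact: clamp_itv.
apply: contD; first exact: cont_cst.
by apply: contM; [exact: cont_comp (cont_clamp _) (cont_rC _)|exact: cont_cst].
Qed.

Lemma seg_bound a b (m : R) : D a -> D b ->
  (forall t : R, 0 <= t <= 1 -> modulus (f (a + rC t * (b - a))) <= m) ->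
  modulus (seg f a b) <= m * modulus (b - a).
Proof.
move=> Da Db fm; rewrite modM mulrC ler_wpM2r ?mod_ge0 //.
have := @cint_bound _ (line f a b) m 1 (contT_line Da Db) ler01; rewrite mulr1; apply.
by move=> t t01; rewrite /line clamp_id //; exact: fm.
Qed.

Lemma seg_prim F a b : D a -> D b -> (forall u, D u -> cder F u (f u)) ->
  seg f a b = F b - F a.
Proof.
move=> Da Db FH; rewrite /seg -cintZ //; last exact: contT_line.
rewrite (@cint_prim _ _ _ (fun t => F (a + rC t * (b - a)))) //.
- by rewrite rC1 rC0 mul1r mul0r addr0; congr (F _ - _); ring.
- by apply: contT_M; [exact: contT_cst|exact: contT_line].
- move=> t t01; rewrite /line clamp_id // mulrC; apply: cder_rder.
    exact: rder_line.
  by apply: FH; exact: Dconvex.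
Qed.

Lemma seg_rev a b : D a -> D b -> seg f b a = - seg f a b.
Proof.
move=> Da Db; rewrite /seg.
have [P PH ->] := cintP (contT_line Da Db) ler01.
rewrite (@cint_prim _ _ _ (fun t => - P (-1 * t + 1))) //.
- by rewrite mulr0 add0r mulr1 addNr; ring.
- exact: contT_line.
- move=> t /andP[t0 t1].
  have e1 : line f b a t = - (rC (-1) * line f a b (-1 * t + 1)).
    rewrite rCN rC1 [-1 * line _ _ _ _]mulN1r opprK /line !clamp_id ?t0 ?t1 //; last first.
      by apply/andP; split; lra.
    by congr f; rewrite rCD rCM rCN rC1; ring.
  rewrite e1; apply: rderN; apply: rder_affine; apply: PH; lra.
Qed.

Lemma seg_mid a b : D a -> D b ->
  seg f a b = seg f a (a + rC 2^-1 * (b - a)) + seg f (a + rC 2^-1 * (b - a)) b.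
Proof.
move=> Da Db; set m := a + _.
have h01 : 0 <= (2^-1 : R) <= 1 by rewrite invr_ge0 ler0n invf_le1 ?ltr0n // ler1n.
have Dm : D m by exact: Dconvex.
have [P PH e0] := cintP (contT_line Da Db) ler01.
have r2 : rC 2^-1 != 0 :> C R by rewrite rC_eq0 invr_eq0 pnatr_eq0.
have -> : seg f a m = (b - a) * (P 2^-1 - P 0).
  rewrite /seg (@cint_prim _ _ _ (fun t => (rC 2^-1)^-1 * P (2^-1 * t + 0))) //.
  - rewrite mulr1 mulr0 !addr0 /m; by field.
  - exact: contT_line.
  - move=> t /andP[t0 t1].
    have -> : line f a m t = (rC 2^-1)^-1 * (rC 2^-1 * line f a b (2^-1 * t + 0)).
      rewrite mulKf // /line !clamp_id ?t0 ?t1 //; last by apply/andP; split; lra.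
      by congr f; rewrite /m addr0 rCM; ring.
    by apply: rderZ; apply: rder_affine; apply: PH; lra.
have -> : seg f m b = (b - a) * (P 1 - P 2^-1).
  rewrite /seg (@cint_prim _ _ _ (fun t => (rC 2^-1)^-1 * P (2^-1 * t + 2^-1))) //.
  - have -> : 2^-1 * 1 + 2^-1 = 1 :> R by field.
    have e1 : b - m = rC 2^-1 * (b - a).
      have e2 : 1 = rC 2^-1 + rC 2^-1 :> C R by rewrite -rCD -rC1; congr rC; field.
      by rewrite /m opprD addrA -[b - a in LHS]mul1r {1}e2; ring.
    by rewrite mulr0 add0r e1; field.
  - exact: contT_line.
  - move=> t /andP[t0 t1].
    have -> : line f m b t = (rC 2^-1)^-1 * (rC 2^-1 * line f a b (2^-1 * t + 2^-1)).
      rewrite mulKf // /line !clamp_id ?t0 ?t1 //; last by apply/andP; split; lra.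
      congr f; rewrite /m rCD rCM.
      have : 1 = rC 2^-1 + rC 2^-1 :> C R by rewrite -rCD -rC1; congr rC; field.
      move=> e2; have -> : b - (a + rC 2^-1 * (b - a)) = rC 2^-1 * (b - a).
        by rewrite opprD addrA -[b - a in LHS]mul1r {1}e2; ring.
      by ring.
    by apply: rderZ; apply: rder_affine; apply: PH; lra.
by rewrite /seg e0; ring.
Qed.

End Convex.

Lemma segB (D : set (C R)) f g a b : convexC D ->
  (forall u, D u -> cont f u) -> (forall u, D u -> cont g u) -> D a -> D b ->
  seg (fun u => f u - g u) a b = seg f a b - seg g a b.
Proof.
move=> Dc fc gc Da Db; rewrite /seg -mulrBr.
by rewrite -(cintB (contT_line Dc fc Da Db) (contT_line Dc gc Da Db) ler01).
Qed.

End Segments.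

(** * Primitives of holomorphic functions *)

Section Goursat.
Context {R : realType}.
Implicit Types (f g F : C R -> C R) (z w a b c u v : C R) (r : R).

Variables (z0 : C R) (r0 : R) (f : C R -> C R).
Hypothesis fd : forall u, Ball z0 r0 u -> derivable f u 1.

Let D := Ball z0 r0.
Let Dc : convexC D. Proof. exact: convex_Ball. Qed.
Let fc u : D u -> cont f u.
Proof. by move=> /fd /derivable_cder[d /cder_cont]. Qed.

Let tri a b c := seg f a b + seg f b c + seg f c a.
Let per a b c := modulus (b - a) + modulus (c - b) + modulus (a - c).
Let mid a b := a + rC 2^-1 * (b - a).

Let half2 : rC 2^-1 + rC 2^-1 = 1 :> C R.
Proof. by rewrite -rCD -rC1; congr rC; field. Qed.

Let mod_half u : modulus (rC 2^-1 * u) = 2^-1 * modulus u.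
Proof. by rewrite modM mod_rC ger0_norm // invr_ge0. Qed.

Let midC a b : mid a b = mid b a.
Proof.
apply/eqP; rewrite -subr_eq0; apply/eqP; rewrite /mid.
have -> : a + rC 2^-1 * (b - a) - (b + rC 2^-1 * (a - b)) =
  (a - b) * (1 - (rC 2^-1 + rC 2^-1)) by ring.
by rewrite half2 subrr mulr0.
Qed.

Let mid_sub a b c : mid a b - mid a c = rC 2^-1 * (b - c).
Proof. by rewrite /mid; ring. Qed.

Let mid_subl a b : mid a b - a = rC 2^-1 * (b - a).
Proof. by rewrite /mid addrAC subrr add0r. Qed.

Let step_spec (K : set (C R)) a b c a' b' c' :=
  [/\ K a', K b' & K c'] /\
  [/\ modulus (tri a b c) <= 4 * modulus (tri a' b' c'),
      per a' b' c' <= 2^-1 * per a b c & modulus (a' - a) <= per a b c].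

(** One bisection: the midpoints of the sides cut the triangle in four, and one
    of the four pieces carries a quarter of the integral. *)
Let bisect (K : set (C R)) a b c : convexC K -> K `<=` D -> K a -> K b -> K c ->
  exists a' b' c', step_spec K a b c a' b' c'.
Proof.
move=> Kc KD Ka Kb Kc'; have [Da Db Dc'] : [/\ D a, D b & D c] by split; exact: KD.
have hh : 0 <= (2^-1 : R) <= 1 by rewrite invr_ge0 ler0n invf_le1 ?ltr0n // ler1n.
have Km u v : K u -> K v -> K (mid u v) by move=> Ku Kv; exact: Kc.
set x := mid a b; set y := mid b c; set t := mid c a.
have [Kx Ky Kt] : [/\ K x, K y & K t] by split; exact: Km.
have [Dx Dy Dt] : [/\ D x, D y & D t] by split; exact: KD.
have S4 : tri a b c = tri a x t + tri x b y + tri t y c + tri x y t.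
  rewrite /tri (seg_mid Dc fc Da Db) (seg_mid Dc fc Db Dc') (seg_mid Dc fc Dc' Da).
  rewrite -/(mid a b) -/(mid b c) -/(mid c a) -/x -/y -/t.
  rewrite (seg_rev Dc fc Dx Dt) (seg_rev Dc fc Dx Dy) (seg_rev Dc fc Dy Dt); ring.
have exy : y - x = rC 2^-1 * (c - a) by rewrite /y /x [mid a b]midC mid_sub.
have eyt : t - y = rC 2^-1 * (a - b) by rewrite /y /t [mid b c]midC mid_sub.
have etx : x - t = rC 2^-1 * (b - c) by rewrite /x /t [mid c a]midC mid_sub.
have eax : x - a = rC 2^-1 * (b - a) by rewrite /x mid_subl.
have exb : b - x = rC 2^-1 * (b - a).
  by rewrite -opprB /x midC mid_subl -mulrN opprB.
have eby : y - b = rC 2^-1 * (c - b) by rewrite /y mid_subl.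
have eyc : c - y = rC 2^-1 * (c - b).
  by rewrite -opprB /y midC mid_subl -mulrN opprB.
have ect : t - c = rC 2^-1 * (a - c) by rewrite /t mid_subl.
have eta : a - t = rC 2^-1 * (a - c).
  by rewrite -opprB /t midC mid_subl -mulrN opprB.
have n1 := mod_ge0 (b - a); have n2 := mod_ge0 (c - b); have n3 := mod_ge0 (a - c).
have d1 := mod_distC b a; have d2 := mod_distC c b; have d3 := mod_distC a c.
have [h|h1] := leP (modulus (tri a b c)) (4 * modulus (tri a x t)).
  exists a, x, t; split; split=> //; last by rewrite subrr mod0 /per; lra.
  by rewrite /per eax -[t - x]opprB modN etx eta !mod_half; lra.
have [h|h2] := leP (modulus (tri a b c)) (4 * modulus (tri x b y)).
  exists x, b, y; split; split=> //; last by rewrite eax mod_half /per; lra.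
  by rewrite /per exb eby -[x - y]opprB modN exy !mod_half; lra.
have [h|h3] := leP (modulus (tri a b c)) (4 * modulus (tri t y c)).
  exists t, y, c; split; split=> //; last first.
    by rewrite -[t - a]opprB modN eta mod_half /per; lra.
  by rewrite /per -[y - t]opprB modN eyt eyc ect !mod_half; lra.
exists x, y, t; split; split=> //; last by rewrite eax mod_half /per; lra.
  have := modD (tri a x t + tri x b y + tri t y c) (tri x y t).
  have := modD (tri a x t + tri x b y) (tri t y c).
  by have := modD (tri a x t) (tri x b y); rewrite -S4; lra.
by rewrite /per exy eyt etx !mod_half; lra.
Qed.

(** A nonzero integral around a triangle would survive bisection: the nested
    triangles shrink to a point, where the first-order approximation makes the
    integral smaller than any multiple of the square of the perimeter. *)
Lemma goursat a b c : D a -> D b -> D c -> tri a b c = 0.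
Proof.
move=> Da Db Dcc.
pose rho := Num.max (modulus (a - z0)) (Num.max (modulus (b - z0)) (modulus (c - z0))).
have rho0 : rho < r0 by rewrite !gt_max Da Db Dcc.
pose K : set (C R) := [set u | modulus (u - z0) <= rho].
have KD : K `<=` D by move=> u /= h; exact: le_lt_trans h rho0.
have Kc : convexC K.
  move=> u v t Ku Kv /andP[t0 t1]; rewrite /K /=.
  have -> : u + rC t * (v - u) - z0 = rC (1 - t) * (u - z0) + rC t * (v - z0).
    by rewrite rCB rC1; ring.
  apply: le_trans (modD _ _) _; rewrite !modM !mod_rC !ger0_norm ?subr_ge0 //.
  have h1 : (1 - t) * modulus (u - z0) <= (1 - t) * rho by rewrite ler_wpM2l ?subr_ge0.
  have h2 : t * modulus (v - z0) <= t * rho by rewrite ler_wpM2l.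
  lra.
have Ka : K a by rewrite /K /= /rho le_max lexx.
have Kb : K b by rewrite /K /= /rho !le_max lexx orbT.
have Kcc : K c by rewrite /K /= /rho !le_max lexx !orbT.
pose good (T : C R * C R * C R) := [/\ K T.1.1, K T.1.2 & K T.2].
have /choice[nxt nxtH] : forall T, exists T' : C R * C R * C R,
    good T -> step_spec K T.1.1 T.1.2 T.2 T'.1.1 T'.1.2 T'.2.
  move=> T; have [gT|nT] := pselect (good T); last by exists T.
  case: (gT) => h1 h2 h3; have [a' [b' [c' H]]] := bisect Kc KD h1 h2 h3.
  by exists (a', b', c').
pose T n := iter n nxt (a, b, c).
have gT n : good (T n).
  by elim: n => [|n IH]; [split|have [] := nxtH _ IH].
pose x n := (T n).1.1; pose y n := (T n).1.2; pose t n := (T n).2.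
pose P := per a b c.
have H n : [/\ modulus (tri (x n) (y n) (t n)) <= 4 * modulus (tri (x n.+1) (y n.+1) (t n.+1)),
      per (x n.+1) (y n.+1) (t n.+1) <= 2^-1 * per (x n) (y n) (t n) &
      modulus (x n.+1 - x n) <= per (x n) (y n) (t n)].
  by have [] := nxtH _ (gT n).
have perH n : per (x n) (y n) (t n) <= P * 2^-1 ^+ n.
  elim: n => [|n IH]; first by rewrite expr0 mulr1.
  by have [_ h _] := H n; rewrite exprS; lra.
have triH n : modulus (tri a b c) <= 4 ^+ n * modulus (tri (x n) (y n) (t n)).
  elim: n => [|n IH]; first by rewrite expr0 mul1r.
  have [h _ _] := H n; apply: le_trans IH _; rewrite exprSr -mulrA.
  by apply: ler_wpM2l; [exact: exprn_ge0|exact: h].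
have [|p pH] := @geometric_cauchyC _ x P.
  by move=> n; have [_ _ h] := H n; exact: le_trans h (perH n).
have P0 : 0 <= P by rewrite /P /per !addr_ge0 ?mod_ge0.
have Kp : K p.
  rewrite /K /= leNgt; apply/negP => h.
  have [n nH] := @half_pow_small _ (4 * P) (modulus (p - z0) - rho) (ltac:(by rewrite subr_gt0)).
  have [Kx _ _] := gT n; rewrite /K /= in Kx.
  have := mod_dist_triangle p z0 (x n); have := pH n; rewrite mod_distC -/(x n) in Kx *.
  by rewrite /x in Kx nH *; lra.
have [d dH] : exists d, cder f p d by apply/derivable_cder/fd/KD.
apply/eqP; rewrite -mod_eq0 eq_le mod_ge0 andbT leNgt; apply/negP => tau0.
pose e := modulus (tri a b c) / (30 * (P ^+ 2 + 1)).
have PP : 0 < 30 * (P ^+ 2 + 1) by rewrite mulr_gt0 // ltr_wpDl // sqr_ge0.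
have e0 : 0 < e by rewrite divr_gt0.
have [s s0 sH] := cder_approx dH e0.
have [n nH] := @half_pow_small _ (5 * P) s s0.
have pown : 0 <= 2^-1 ^+ n :> R by rewrite exprn_ge0 // invr_ge0.
pose A u := f p + d * (u - p).
pose AF u := f p * u + d * (u - p) ^+ 2 / 2.
have AFd u : cder AF u (A u).
  have h1 := cderZ (f p) (cder_id u).
  have h2 := cderX 2 (cderB (cder_id u) (cder_cst p u)).
  have := cderD h1 (cderZ (d / 2) h2).
  rewrite (_ : _ + _ = A u); last by rewrite /A /=; field.
  by apply: cder_near ltr01 _ => v _; rewrite /AF; field.
have Ac u : cont A u.
  by apply: contD; [exact: cont_cst|apply: contM; [exact: cont_cst|apply: contB; [exact: cont_id|exact: cont_cst]]].
have [Kx Ky Kt] := gT n; rewrite -/(x n) -/(y n) -/(t n) in Kx Ky Kt.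
have [Dx Dy Dt] : [/\ D (x n), D (y n) & D (t n)] by split; exact: KD.
have triB : tri (x n) (y n) (t n) = seg (fun u => f u - A u) (x n) (y n)
   + seg (fun u => f u - A u) (y n) (t n) + seg (fun u => f u - A u) (t n) (x n).
  rewrite !(segB Dc fc (fun u _ => Ac u)) // !(seg_prim Dc (fun u _ => Ac u) _ _ (fun u _ => AFd u)) //.
  by rewrite /tri; ring.
have pn := perH n; have xp := pH n.
have m1 := mod_ge0 (y n - x n); have m2 := mod_ge0 (t n - y n); have m3 := mod_ge0 (x n - t n).
rewrite /per in pn.
have segE u v : D u -> D v -> modulus (u - p) <= 5 * P * 2^-1 ^+ n ->
    modulus (v - p) <= 5 * P * 2^-1 ^+ n ->
    modulus (seg (fun u => f u - A u) u v) <= e * (5 * P * 2^-1 ^+ n) * modulus (v - u).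
  move=> Du Dv up vp.
  apply: (@seg_bound _ D _ Dc _ u v) => // [w Dw|k k01].
    by apply: contB; [exact: fc|exact: Ac].
  set w := u + _.
  have wp : modulus (w - p) <= 5 * P * 2^-1 ^+ n.
    rewrite /w; case/andP: k01 => k0 k1.
    have -> : u + rC k * (v - u) - p = rC (1 - k) * (u - p) + rC k * (v - p).
      by rewrite rCB rC1; ring.
    apply: le_trans (modD _ _) _; rewrite !modM !mod_rC !ger0_norm ?subr_ge0 //.
    have h1 : (1 - k) * modulus (u - p) <= (1 - k) * (5 * P * 2^-1 ^+ n).
      by rewrite ler_wpM2l ?subr_ge0.
    have h2 : k * modulus (v - p) <= k * (5 * P * 2^-1 ^+ n) by rewrite ler_wpM2l.
    lra.
  have := sH w (le_lt_trans wp nH); rewrite /A opprD addrA => /le_trans; apply.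
  by rewrite ler_wpM2l // ltW.
have xE : modulus (x n - p) <= 5 * P * 2^-1 ^+ n by have := mulr_ge0 P0 pown; lra.
have yE : modulus (y n - p) <= 5 * P * 2^-1 ^+ n.
  by have := mod_dist_triangle (y n) p (x n); lra.
have tE : modulus (t n - p) <= 5 * P * 2^-1 ^+ n.
  by have := mod_dist_triangle (t n) p (x n); have := mod_distC (t n) (x n); lra.
have := segE _ _ Dx Dy xE yE; have := segE _ _ Dy Dt yE tE; have := segE _ _ Dt Dx tE xE.
move=> s3 s2 s1.
have bound : modulus (tri (x n) (y n) (t n)) <= e * (5 * P * 2^-1 ^+ n) * (P * 2^-1 ^+ n).
  rewrite triB; apply: le_trans (modD _ _) _.
  have := modD (seg (fun u => f u - A u) (x n) (y n)) (seg (fun u => f u - A u) (y n) (t n)).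
  have k0 : 0 <= e * (5 * P * 2^-1 ^+ n) by rewrite mulr_ge0 ?(ltW e0) // mulr_ge0 // mulr_ge0.
  have : e * (5 * P * 2^-1 ^+ n) * (modulus (y n - x n) + modulus (t n - y n) + modulus (x n - t n))
     <= e * (5 * P * 2^-1 ^+ n) * (P * 2^-1 ^+ n) by rewrite ler_wpM2l.
  by lra.
have := triH n; rewrite leNgt => /negP; apply.
apply: le_lt_trans (_ : 4 ^+ n * (e * (5 * P * 2^-1 ^+ n) * (P * 2^-1 ^+ n)) < _).
  by rewrite ler_wpM2l // exprn_ge0.
have -> : 4 ^+ n * (e * (5 * P * 2^-1 ^+ n) * (P * 2^-1 ^+ n)) =
   5 * e * P ^+ 2 * (4 * 2^-1 * 2^-1) ^+ n by rewrite !exprMn; ring.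
have -> : 4 * 2^-1 * 2^-1 = 1 :> R by field.
rewrite expr1n mulr1.
have eE : e * (30 * (P ^+ 2 + 1)) = modulus (tri a b c) by rewrite /e divfK // gt_eqF.
have := sqr_ge0 P; rewrite -eE => P2.
have : 0 <= e * P ^+ 2 by rewrite mulr_ge0 // ltW.
lra.
Qed.

(** Integrate along the segments issued from the centre: by Goursat's lemma the
    increment between two points is the integral along the segment joining them. *)
Lemma holo_primitive : exists F, forall u, D u -> cder F u (f u).
Proof.
exists (seg f z0) => u Du.
have r0gt : 0 < r0 by apply: le_lt_trans Du; exact: mod_ge0.
have Dz : D z0 by exact: Ball_center.
have diff v : D v -> seg f z0 v - seg f z0 u = seg f u v.
  move=> Dv; have := goursat Dz Du Dv; rewrite /tri (seg_rev Dc fc Dz Dv) => h.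
  by apply/eqP; rewrite -subr_eq0 -oppr_eq0 -h; apply/eqP; ring.
apply: cder_intro => e e0; have /contCP/(_ e e0)[d d0 dH] := fc Du.
exists (Num.min d (r0 - modulus (u - z0))).
  by rewrite lt_min d0 subr_gt0.
move=> v; rewrite lt_min => /andP[vd vr].
have Dv : D v.
  apply: (@Ball_sub _ z0 u (r0 - modulus (u - z0)) r0); last exact: vr.
  by rewrite addrC subrK.
have cc (w : C R) : D w -> cont (fun=> f u) w by move=> _; exact: cont_cst.
have -> : f u * (v - u) = seg (fun=> f u) u v.
  rewrite (@seg_prim _ D _ Dc cc (fun w => f u * w)) //; first by ring.
  by move=> w _; have := cderZ (f u) (cder_id w); rewrite mulr1.
rewrite diff // -(segB Dc fc cc) //.
apply: (@seg_bound _ D _ Dc) => // [w Dw|t /andP[t0 t1]].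
  by apply: contB; [exact: fc|exact: cont_cst].
apply/ltW/dH; rewrite addrAC subrr add0r modM mod_rC ger0_norm //.
by apply: le_lt_trans vd; rewrite ler_piMl // mod_ge0.
Qed.

End Goursat.

(** * Cauchy's formula *)

Section Leibniz.
Context {R : realType}.
Implicit Types (f g F : C R -> C R) (z w c d t : C R) (r rho : R) (u : R -> C R).

Lemma cont_fst {T T' : topologicalType} (x : T * T') : cont (fun p : T * T' => p.1) x.
Proof. by apply/contE; exact: cvg_fst. Qed.

Lemma cont_snd {T T' : topologicalType} (x : T * T') : cont (fun p : T * T' => p.2) x.
Proof. by apply/contE; exact: cvg_snd. Qed.

(** Compactness of the segment turns joint continuity into continuity that is
    uniform in the second variable. *)
Lemma unif_segment (g : C R -> R -> C R) t0 (b : R) :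
  (forall s, cont (fun p : C R * R => g p.1 p.2) (t0, s)) ->
  forall e : R, 0 < e -> exists2 d : R, 0 < d &
    forall t s, modulus (t - t0) < d -> 0 <= s <= b -> modulus (g t s - g t0 s) <= e.
Proof.
move=> gc e e0.
have /compact_near_coveringP H := @segment_compact R 0 b.
have {}H := H _ (nbhs t0) (fun t s => modulus (g t s - g t0 s) <= e) _.
have /nbhs_Ball[d d0 dH] : \forall t \near t0,
    `[0, b] `<=` (fun s => modulus (g t s - g t0 s) <= e).
  apply: H => s _; have /contP/(_ (e / 2)) := gc s.
  rewrite divr_gt0 // => /(_ isT)[[A B] /= [A0 Bs] AB].
  exists (B, A) => //= -[s' t] /= [Bs' At].
  have h1 := AB (t, s') (conj At Bs'); have h2 := AB (t0, s') (conj (nbhs_singleton A0) Bs').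
  rewrite /= in h1 h2; have := mod_dist_triangle (g t s') (g t0 s') (g t0 s).
  by rewrite (mod_distC (g t0 s)); lra.
by exists d => // t s /dH h s01; apply: h; rewrite /= in_itv.
Qed.

(** Joint continuity of the derivative makes the difference quotients converge
    uniformly on the segment. *)
Lemma leibniz (k dk : C R -> R -> C R) t0 r (b : R) : 0 < r -> 0 <= b ->
  (forall t, Ball t0 r t -> contT (k t)) -> contT (dk t0) ->
  (forall t s, Ball t0 r t -> cder (k^~ s) t (dk t s)) ->
  (forall s, cont (fun p : C R * R => dk p.1 p.2) (t0, s)) ->
  cder (fun t => cint (k t) b) t0 (cint (dk t0) b).
Proof.
move=> r0 b0 kc dkc kd dkj; apply: cder_intro => e e0.
have b1 : 0 < b + 1 by lra.
have [|d d0 dH] := unif_segment b dkj (e := e / (b + 1)); first exact: divr_gt0.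
exists (Num.min d r); first by rewrite lt_min d0.
move=> t; rewrite lt_min => /andP[td tr].
have t0r : Ball t0 r t0 by exact: Ball_center.
rewrite [_ * (t - t0)]mulrC -cintZ // -cintB //; [|exact: kc..].
rewrite -cintB //; [|by apply: contT_B; exact: kc|by apply: contT_M => //; exact: contT_cst].
apply: le_trans (_ : e / (b + 1) * modulus (t - t0) * b <= _).
  apply: cint_bound => // [|s s01].
    apply: contT_B; last by apply: contT_M => //; exact: contT_cst.
    by apply: contT_B; exact: kc.
  have := @cder_ball_bound _ (fun t => k t s - t * dk t0 s)
    (fun t => dk t s - dk t0 s) t0 (Num.min d r) (e / (b + 1)) t0 t.
  have -> : k t s - t * dk t0 s - (k t0 s - t0 * dk t0 s) =
    k t s - k t0 s - (t - t0) * dk t0 s by ring.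
  apply.
  - move=> v; rewrite /Ball /= lt_min => /andP[vd vr]; apply: cderB; first exact: kd.
    by have := cderM (cder_id v) (cder_cst (dk t0 s) v); rewrite mul1r mulr0 addr0.
  - by move=> v; rewrite /Ball /= lt_min => /andP[vd vr]; exact: dH.
  - by apply: Ball_center; rewrite lt_min d0.
  - by rewrite /Ball /= lt_min td.
rewrite mulrAC; apply: ler_wpM2r; first exact: mod_ge0.
by rewrite mulrAC ler_pdivrMr // ler_wpM2l ?(ltW e0) //; lra.
Qed.

Definition circ z rho (s : R) := z + rC rho * expi s.

Lemma contT_circ z rho : contT (circ z rho).
Proof.
by apply: contT_D; [exact: contT_cst|apply: contT_M; [exact: contT_cst|exact: contT_expi]].
Qed.

Lemma mod_circ z rho s : 0 <= rho -> modulus (circ z rho s - z) = rho.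
Proof.
by move=> r0; rewrite /circ addrAC subrr add0r modM mod_rC mod_expi mulr1 ger0_norm.
Qed.

Lemma circ_neq z rho s w : modulus (w - z) < rho -> circ z rho s - w != 0.
Proof.
move=> wr; have rho0 : 0 <= rho by apply: le_trans (ltW wr); exact: mod_ge0.
by rewrite subr_eq0; apply: contraTneq wr => <-; rewrite mod_circ // ltxx.
Qed.

Lemma circ_dist z rho s w : modulus (w - z) < rho ->
  rho - modulus (w - z) <= modulus (circ z rho s - w).
Proof.
move=> wr; have rho0 : 0 <= rho by apply: le_trans (ltW wr); exact: mod_ge0.
by have := mod_dist_triangle (circ z rho s) z w; rewrite mod_circ //; lra.
Qed.

Lemma twopi_ge0 : 0 <= 2 * pi :> R.
Proof. by rewrite mulr_ge0 // pi_ge0. Qed.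

Lemma twopi_gt0 : 0 < 2 * pi :> R.
Proof. by rewrite mulr_gt0 // pi_gt0. Qed.

(** Cauchy-type integral over a circle: differentiating in [w] raises the exponent
    of the kernel by one. *)
Definition kern z rho u n w :=
  cint (fun s => u s / (circ z rho s - w) ^+ n.+1) (2 * pi).

Lemma contT_kern z rho u n w : contT u -> modulus (w - z) < rho ->
  contT (fun s => u s / (circ z rho s - w) ^+ n.+1).
Proof.
move=> uc wr; apply: contT_M => //; apply: contT_V => [s|s].
  by rewrite expf_neq0 // circ_neq.
by apply: contX; apply: contB; [exact: contT_circ|exact: cont_cst].
Qed.

Lemma cder_kern z rho u n w : contT u -> modulus (w - z) < rho ->
  cder (kern z rho u n) w (n.+1%:R * kern z rho u n.+1 w).
Proof.
move=> uc wr; rewrite /kern -cintZ ?twopi_ge0 //; last exact: contT_kern.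
have r0 : 0 < rho - modulus (w - z) by rewrite subr_gt0.
have sub t : Ball w (rho - modulus (w - z)) t -> modulus (t - z) < rho.
  by move=> h; apply: (@Ball_sub _ z w (rho - modulus (w - z)) rho _ _ h); rewrite addrC subrK.
apply: (@leibniz (fun w s => u s / (circ z rho s - w) ^+ n.+1)
  (fun w s => n.+1%:R * (u s / (circ z rho s - w) ^+ n.+2)) w _ (2 * pi) r0 twopi_ge0).
- by move=> t /sub tr; exact: contT_kern.
- by apply: contT_M; [exact: contT_cst|exact: contT_kern].
- move=> t s /sub tr; have c0 := circ_neq s tr.
  have h := cderX n.+1 (cderB (cder_cst (circ z rho s) t) (cder_id t)).
  have := cderZ (u s) (cderVf _ h); rewrite expf_neq0 // => /(_ isT).
  congr cder; rewrite sub0r /= mulrN1.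
  by rewrite [_ ^+ n.+2]exprS [_ ^+ n.+1]exprS; field; rewrite c0 expf_neq0.
- move=> s; apply: contM; first exact: cont_cst.
  apply: contM.
    exact: (@cont_comp _ _ _ (fun p : C R * R => p.2) u (w, s) (cont_snd _) (uc s)).
  apply: contV; first by rewrite expf_neq0 // circ_neq.
  apply: contX; apply: contB; last exact: cont_fst.
  exact: (@cont_comp _ _ _ (fun p : C R * R => p.2) (circ z rho) (w, s) (cont_snd _) (contT_circ z rho s)).
Qed.

Lemma rder_circ z rho s : rder (circ z rho) s (rC rho * (iC * expi s)).
Proof.
have := rderD (rder_cst z s) (rderZ (rC rho) (rder_expi s)); rewrite add0r; exact.
Qed.

Lemma circ_2pi z rho : circ z rho (2 * pi) = circ z rho 0.
Proof. by rewrite /circ expi_2pi expi0. Qed.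

Lemma cint_closed (p : R -> C R) (q : R -> C R) : contT p ->
  (forall s, rder q s (p s)) -> q (2 * pi) = q 0 -> cint p (2 * pi) = 0.
Proof.
move=> pc qH qE.
by rewrite (cint_prim pc twopi_ge0 (fun s _ => qH s)) qE subrr.
Qed.

(** The winding number of the circle around an inner point is one: deform the
    point to the centre. *)
Lemma winding z rho w : modulus (w - z) < rho ->
  kern z rho (fun s => rC rho * expi s) 0 w = rC (2 * pi).
Proof.
move=> wr; have rho0 : 0 < rho by apply: le_lt_trans wr; exact: mod_ge0.
pose u s : C R := rC rho * expi s.
have uc : contT u by apply: contT_M; [exact: contT_cst|exact: contT_expi].
have kd v : Ball z rho v -> cder (kern z rho u 0) v 0.
  move=> vr; have := @cder_kern z rho u 0 v uc vr; rewrite mul1r; congr cder.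
  apply: (@cint_closed _ (fun s => iC * (circ z rho s - v)^-1)).
  - exact: contT_kern.
  - move=> s; have c0 := circ_neq s vr.
    have h := rderB (rder_circ z rho s) (rder_cst v s).
    have := rderZ iC (cder_rder h (cderV c0)).
    have -> : iC * (- (circ z rho s - v) ^- 2 * (rC rho * (iC * expi s) - 0)) =
      - (iC * iC) * (u s / (circ z rho s - v) ^+ 2) by rewrite /u; ring.
    by rewrite iC2 opprK mul1r.
  - by rewrite circ_2pi.
have := @cder_ball_eq _ (kern z rho u 0) (fun=> kern z rho u 0 z) (fun=> 0) z rho.
move=> -> //; last by move=> v _; exact: cder_cst.
rewrite /kern (_ : (fun s => _) = fun=> 1); first by rewrite cint_cst ?twopi_ge0 // mul1r.
apply/funext => s; rewrite expr1 /circ addrAC subrr add0r divff //.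
by rewrite mulf_neq0 ?expi_neq0 // rC_eq0 gt_eqF.
Qed.

Lemma line_Ball z rho w s (t : R) : modulus (w - z) < rho -> 0 <= t <= 1 ->
  modulus (w + rC t * (circ z rho s - w) - z) <= rho.
Proof.
move=> wr /andP[t0 t1]; have rho0 : 0 <= rho by apply: le_trans (ltW wr); exact: mod_ge0.
have -> : w + rC t * (circ z rho s - w) - z = rC (1 - t) * (w - z) + rC t * (circ z rho s - z).
  by rewrite rCB rC1; ring.
apply: le_trans (modD _ _) _; rewrite !modM !mod_rC mod_circ // !ger0_norm ?subr_ge0 //.
have : (1 - t) * modulus (w - z) <= (1 - t) * rho by rewrite ler_wpM2l ?subr_ge0 // ltW.
lra.
Qed.

(** Cauchy's formula for a function with continuous derivative: contract the
    circle to the point [w]; the derivative in the contraction parameter is the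
    integral of a derivative along the circle. *)
Lemma cauchy_C1 F f z rho r w : rho < r -> modulus (w - z) < rho ->
  (forall v, Ball z r v -> cder F v (f v)) -> (forall v, Ball z r v -> cont f v) ->
  F w * rC (2 * pi) =
    kern z rho (fun s => F (circ z rho s) * (rC rho * expi s)) 0 w.
Proof.
move=> rr wr Fd fc; have rho0 : 0 < rho by apply: le_lt_trans wr; exact: mod_ge0.
pose e s : C R := rC rho * expi s.
have ec : contT e by apply: contT_M; [exact: contT_cst|exact: contT_expi].
have eE s : circ z rho s = z + e s by [].
pose k (t : C R) s := F (w + t * (circ z rho s - w)) * (e s / (circ z rho s - w)).
pose dk (t : C R) s := f (w + t * (circ z rho s - w)) * e s.
pose del := (r - rho) / (2 * rho).
have rho2 : 0 < 2 * rho by rewrite mulr_gt0.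
have del0 : 0 < del by rewrite divr_gt0 // subr_gt0.
have inB (t : C R) (t0 : R) s : 0 <= t0 <= 1 -> Ball (rC t0) del t ->
    Ball z r (w + t * (circ z rho s - w)).
  move=> t01 td; rewrite /Ball /=.
  have -> : w + t * (circ z rho s - w) - z = (w + rC t0 * (circ z rho s - w) - z) +
     (t - rC t0) * (circ z rho s - w) by ring.
  apply: le_lt_trans (modD _ _) _; rewrite modM.
  have h1 := line_Ball s wr t01.
  have h2 : modulus (circ z rho s - w) <= 2 * rho.
    by have := mod_dist_triangle (circ z rho s) w z; rewrite mod_circ ?(ltW rho0) // (mod_distC z); lra.
  have h3 : modulus (t - rC t0) * modulus (circ z rho s - w) <= modulus (t - rC t0) * (2 * rho).
    by rewrite ler_wpM2l ?mod_ge0.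
  have h4 : modulus (t - rC t0) * (2 * rho) < del * (2 * rho) by rewrite ltr_pM2r.
  have : del * (2 * rho) = r - rho by rewrite /del divfK // gt_eqF.
  lra.
have argc (t : C R) : contT (fun s => w + t * (circ z rho s - w)).
  apply: contT_D; first exact: contT_cst.
  apply: contT_M; first exact: contT_cst.
  by apply: contT_B; [exact: contT_circ|exact: contT_cst].
have fB v : Ball z r v -> cont F v by move=> /Fd /cder_cont.
have kc (t : C R) (t0 : R) : 0 <= t0 <= 1 -> Ball (rC t0) del t -> contT (k t).
  move=> t01 td; apply: contT_M => [s|].
    by apply: (@cont_comp _ _ _ _ F) (argc t s) _; apply/fB/(inB _ t0).
  apply: contT_M => //; apply: contT_V => [s|]; first exact: circ_neq.
  by apply: contT_B; [exact: contT_circ|exact: contT_cst].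
have dkc (t0 : R) : 0 <= t0 <= 1 -> contT (dk (rC t0)).
  move=> t01; apply: contT_M => // s.
  by apply: (@cont_comp _ _ _ _ f) (argc _ s) _; apply/fc/(inB _ t0) => //; exact: Ball_center.
have Kd (t0 : R) : 0 <= t0 <= 1 ->
    cder (fun t => cint (k t) (2 * pi)) (rC t0) (cint (dk (rC t0)) (2 * pi)).
  move=> t01; apply: (@leibniz k dk (rC t0) del) => //; first exact: twopi_ge0.
  - by move=> t td; exact: kc td.
  - exact: dkc.
  - move=> t s td; have c0 := circ_neq s wr.
    have h : cder (fun t => w + t * (circ z rho s - w)) t (circ z rho s - w).
      have := cderD (cder_cst w t) (cderM (cder_id t) (cder_cst (circ z rho s - w) t)).
      by rewrite mulr0 addr0 add0r mul1r.
    have := cderM (cder_comp h (Fd _ (inB _ _ s t01 td))) (cder_cst (e s / (circ z rho s - w)) t).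
    by congr cder; rewrite /dk; field.
  - move=> s; apply: contM; last first.
      exact: (@cont_comp _ _ _ (fun p : C R * R => p.2) e (rC t0, s) (cont_snd _) (ec s)).
    apply: (@cont_comp _ _ _ (fun p : C R * R => w + p.1 * (circ z rho p.2 - w)) f).
      apply: contD; first exact: cont_cst.
      apply: contM; first exact: cont_fst.
      apply: contB; last exact: cont_cst.
      exact: (@cont_comp _ _ _ (fun p : C R * R => p.2) (circ z rho) (rC t0, s) (cont_snd _) (contT_circ z rho s)).
    by apply/fc/(inB _ t0) => //; exact: Ball_center.
have dk0 (t0 : R) : 0 <= t0 <= 1 -> cint (dk (rC t0)) (2 * pi) = 0.
  move=> t01; have [->|t0n] := eqVneq t0 0.
    apply: (@cint_closed _ (fun s => f w * (- iC * e s))).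
    - by apply: dkc; rewrite lexx ler01.
    - move=> s; have := rderZ (f w * - iC) (rderZ (rC rho) (rder_expi s)).
      have -> : f w * - iC * (rC rho * (iC * expi s)) = - (iC * iC) * (f w * e s).
        by rewrite /e; ring.
      rewrite iC2 opprK mul1r /dk rC0 mul0r addr0.
      by rewrite (_ : (fun s => _) = (fun s => f w * (- iC * e s))) // funeqE => s'; rewrite /e; ring.
    - by rewrite /e expi_2pi expi0.
  apply: (@cint_closed _ (fun s => - iC / rC t0 * F (w + rC t0 * (circ z rho s - w)))).
  - exact: dkc.
  - move=> s.
    have h : rder (fun s => w + rC t0 * (circ z rho s - w)) s (rC t0 * (rC rho * (iC * expi s))).
      have := rderD (rder_cst w s) (rderZ (rC t0) (rderB (rder_circ z rho s) (rder_cst w s))).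
      by rewrite subr0 add0r.
    have Bs : Ball z r (w + rC t0 * (circ z rho s - w)).
      by apply: (inB _ t0) => //; exact: Ball_center.
    have := rderZ (- iC / rC t0) (cder_rder h (Fd _ Bs)).
    have -> : - iC / rC t0 * (f (w + rC t0 * (circ z rho s - w)) *
       (rC t0 * (rC rho * (iC * expi s)))) = - (iC * iC) * dk (rC t0) s.
      by rewrite /dk /e; field; rewrite rC_eq0.
    by rewrite iC2 opprK mul1r.
  - by rewrite circ_2pi.
have := @rder_eq _ (fun t : R => cint (k (rC t)) (2 * pi)) (fun=> 0) (fun=> 0) 0 1 ler01.
rewrite subrr => /(_ _ _)/eqP; rewrite subr_eq0 => H.
have /eqP : cint (k (rC 1)) (2 * pi) == cint (k (rC 0)) (2 * pi).
  apply: H => t t01; last exact: rder_cst.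
  by have := cder_rder (rder_rC t) (Kd t t01); rewrite dk0 // mul0r.
have -> : k (rC 1) = fun s => F (circ z rho s) * (rC rho * expi s) / (circ z rho s - w) ^+ 1.
  by apply/funext => s; rewrite /k rC1 mul1r expr1 mulrA; congr (F _ * _ / _); ring.
rewrite -/(kern z rho _ 0 w) => ->.
have -> : k (rC 0) = fun s => F w * (e s / (circ z rho s - w) ^+ 1).
  by apply/funext => s; rewrite /k rC0 mul0r addr0 expr1.
rewrite cintZ ?twopi_ge0 //; last exact: contT_kern.
by rewrite -[cint _ _]/(kern z rho e 0 w) winding.
Qed.

(** A primitive of [f] has a continuous derivative, so it is a Cauchy-type
    integral, and such integrals may be differentiated any number of times. The
    continuity assumption of the previous lemma thus comes for free. *)
Lemma holo_cD_Ball f z r : holomorphic (Ball z r) f -> holomorphic (Ball z r) (cD f).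
Proof.
move=> fd w wz; have [F FH] := holo_primitive fd.
have fc v : Ball z r v -> cont f v by move=> /fd /derivable_cder[d /cder_cont].
pose rho := (modulus (w - z) + r) / 2.
have rho1 : modulus (w - z) < rho by rewrite /rho; move: wz; rewrite /Ball /=; lra.
have rho2 : rho < r by rewrite /rho; move: wz; rewrite /Ball /=; lra.
have rho0 : 0 <= rho by apply: le_trans (ltW rho1); exact: mod_ge0.
pose u s := F (circ z rho s) * (rC rho * expi s).
have uc : contT u.
  apply: contT_M; last by apply: contT_M; [exact: contT_cst|exact: contT_expi].
  move=> s; apply: (@cont_comp _ _ _ (circ z rho) F) (contT_circ _ _ _) _.
  by apply: cder_cont (FH _ _); rewrite /Ball /= mod_circ.
have p0 : rC (2 * pi) != 0 :> C R by rewrite rC_eq0 gt_eqF ?twopi_gt0.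
have FE v : Ball z rho v -> F v = (rC (2 * pi))^-1 * kern z rho u 0 v.
  by move=> vr; rewrite -(cauchy_C1 rho2 vr FH fc) mulrCA mulVf // mulr1.
have near (g h : C R -> C R) v d : (forall v, Ball z rho v -> g v = h v) -> Ball z rho v ->
    cder g v d -> cder h v d.
  move=> gh vr; apply: (@cder_near _ _ _ _ _ (rho - modulus (v - z))); first by rewrite subr_gt0.
  by move=> x xv; apply: gh; apply: Ball_sub xv; rewrite addrC subrK.
have fE v : Ball z rho v -> f v = (rC (2 * pi))^-1 * kern z rho u 1 v.
  move=> vr; have := cderZ (rC (2 * pi))^-1 (cder_kern 0 uc vr); rewrite mul1r.
  move=> /(near _ F) h; apply: cder_unique (FH _ _) (h _ vr).
    by apply: le_Ball vr; exact: ltW.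
  by move=> x xr; rewrite FE.
have f1E v : Ball z rho v -> cD f v = (rC (2 * pi))^-1 * (2%:R * kern z rho u 2 v).
  move=> vr; apply: cDE; apply: near (cderZ (rC (2 * pi))^-1 (cder_kern 1 uc vr)) => //.
  by move=> x xr; rewrite fE.
have := cderZ (rC (2 * pi))^-1 (cderZ 2%:R (cder_kern 2 uc rho1)).
move=> /(near _ (cD f)) h; apply: cder_derivable; apply: h => //.
by move=> x xr; rewrite f1E.
Qed.

Lemma holo_cD (U : set (C R)) f : open U -> holomorphic U f -> holomorphic U (cD f).
Proof.
move=> /openP Uo fU z /[dup] Uz /Uo[r r0 rU]; apply: (@holo_cD_Ball _ z r).
  by move=> w /rU /fU.
exact: Ball_center.
Qed.

Theorem cauchy_formula f z rho r w : rho < r -> modulus (w - z) < rho ->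
  holomorphic (Ball z r) f ->
  f w * rC (2 * pi) = kern z rho (fun s => f (circ z rho s) * (rC rho * expi s)) 0 w.
Proof.
move=> rr wr fd; apply: (@cauchy_C1 f (cD f) z rho r w) => // v vr.
  exact/cD_derivable/fd.
by have /derivable_cder[d /cder_cont] := holo_cD_Ball fd vr.
Qed.

End Leibniz.

(** * Local theory of holomorphic functions *)

Section HolomorphicAlgebra.
Context {R : realType}.
Implicit Types (f g F : C R -> C R) (z w c d : C R) (r rho : R) (U V : set (C R)).

Lemma hol_cont U f z : holomorphic U f -> U z -> cont f z.
Proof. by move=> h /h /derivable_cder[d /cder_cont]. Qed.

Lemma hol_cD U f z : holomorphic U f -> U z -> cder f z (cD f z).
Proof. by move=> h /h; exact: cD_derivable. Qed.

Lemma sub_hol U V f : V `<=` U -> holomorphic U f -> holomorphic V f.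
Proof. by move=> VU h z /VU /h. Qed.

Lemma hol_cst U c : holomorphic U (fun=> c).
Proof. by move=> z _; exact: cder_derivable (cder_cst c z). Qed.

Lemma hol_id U : holomorphic U (fun z => z).
Proof. by move=> z _; exact: cder_derivable (cder_id z). Qed.

Lemma holD U f g : holomorphic U f -> holomorphic U g ->
  holomorphic U (fun z => f z + g z).
Proof. by move=> h k z Uz; exact: cder_derivable (cderD (hol_cD h Uz) (hol_cD k Uz)). Qed.

Lemma holN U f : holomorphic U f -> holomorphic U (fun z => - f z).
Proof. by move=> h z Uz; exact: cder_derivable (cderN (hol_cD h Uz)). Qed.

Lemma holB U f g : holomorphic U f -> holomorphic U g ->
  holomorphic U (fun z => f z - g z).
Proof. by move=> h k z Uz; exact: cder_derivable (cderB (hol_cD h Uz) (hol_cD k Uz)). Qed.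

Lemma holM U f g : holomorphic U f -> holomorphic U g ->
  holomorphic U (fun z => f z * g z).
Proof. by move=> h k z Uz; exact: cder_derivable (cderM (hol_cD h Uz) (hol_cD k Uz)). Qed.

Lemma holX U f n : holomorphic U f -> holomorphic U (fun z => f z ^+ n).
Proof. by move=> h z Uz; exact: cder_derivable (cderX n (hol_cD h Uz)). Qed.

Lemma holV U f : (forall z, U z -> f z != 0) -> holomorphic U f ->
  holomorphic U (fun z => (f z)^-1).
Proof.
by move=> f0 h z Uz; exact: cder_derivable (cderVf (f0 z Uz) (hol_cD h Uz)).
Qed.

Lemma hol_div U f g : (forall z, U z -> g z != 0) -> holomorphic U f ->
  holomorphic U g -> holomorphic U (fun z => f z / g z).
Proof. by move=> g0 h k; exact: holM h (holV g0 k). Qed.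

Lemma hol_comp U V f g : (forall z, U z -> V (f z)) -> holomorphic U f ->
  holomorphic V g -> holomorphic U (fun z => g (f z)).
Proof.
move=> UV h k z Uz.
exact: cder_derivable (cder_comp (hol_cD h Uz) (hol_cD k (UV z Uz))).
Qed.

Lemma hol_cexp U : holomorphic U (@cexp R).
Proof. by move=> z _; exact: cder_derivable (cder_cexp z). Qed.

Lemma hol_cexpf U f : holomorphic U f -> holomorphic U (fun z => cexp (f z)).
Proof. by move=> h; apply: (@hol_comp U setT _ _ _ h) => //; exact: hol_cexp. Qed.

Lemma hol_sum U (I : Type) (s : seq I) (F : I -> C R -> C R) :
  (forall i, holomorphic U (F i)) -> holomorphic U (fun z => \sum_(i <- s) F i z).
Proof.
move=> h; elim: s => [|i s IH].
  by rewrite (_ : (fun _ => _) = fun=> 0) ?funeqE => [|z]; [exact: hol_cst|rewrite big_nil].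
rewrite (_ : (fun _ => _) = fun z => F i z + \sum_(i <- s) F i z).
  exact: holD (h i) IH.
by apply/funext => z; rewrite big_cons.
Qed.

Lemma hol_prod U (I : Type) (s : seq I) (F : I -> C R -> C R) :
  (forall i, holomorphic U (F i)) -> holomorphic U (fun z => \prod_(i <- s) F i z).
Proof.
move=> h; elim: s => [|i s IH].
  by rewrite (_ : (fun _ => _) = fun=> 1) ?funeqE => [|z]; [exact: hol_cst|rewrite big_nil].
rewrite (_ : (fun _ => _) = fun z => F i z * \prod_(i <- s) F i z).
  exact: holM (h i) IH.
by apply/funext => z; rewrite big_cons.
Qed.

End HolomorphicAlgebra.

Section LocalTheory.
Context {R : realType}.
Implicit Types (f g F : C R -> C R) (z w c d : C R) (r rho m M : R) (U V : set (C R)).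

Lemma contT_comp_circ f z rho r : 0 <= rho -> rho < r -> holomorphic (Ball z r) f ->
  contT (fun s => f (circ z rho s)).
Proof.
move=> r0 rr h s; apply: (@cont_comp _ _ _ (circ z rho) f) (contT_circ _ _ _) _.
by apply: hol_cont h _; rewrite /Ball /= mod_circ.
Qed.

Lemma circle_max (u : R -> C R) : contT u -> exists M, 0 <= M /\
  forall s, 0 <= s <= 2 * pi -> modulus (u s) <= M.
Proof.
move=> uc; have [|c _ H] := @EVT_max R (fun s => modulus (u s)) 0 (2 * pi) (twopi_ge0).
  apply: continuous_subspaceT => s.
  exact: (contE _ _).1 (cont_comp (uc s) (cont_mod _)).
exists (modulus (u c)); split; first exact: mod_ge0.
by move=> s s01; apply: H; rewrite in_itv.
Qed.

Lemma circle_min (u : R -> C R) : contT u -> (forall s, u s != 0) -> exists m,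
  0 < m /\ forall s, 0 <= s <= 2 * pi -> m <= modulus (u s).
Proof.
move=> uc u0; have [|c _ H] := @EVT_min R (fun s => modulus (u s)) 0 (2 * pi) (twopi_ge0).
  apply: continuous_subspaceT => s.
  exact: (contE _ _).1 (cont_comp (uc s) (cont_mod _)).
exists (modulus (u c)); split; first by rewrite mod_gt0.
by move=> s s01; apply: H; rewrite in_itv.
Qed.

Lemma pow_bounded (x c : R) : (forall n, x ^+ n <= c) -> x <= 1.
Proof.
move=> H; rewrite leNgt; apply/negP => x1.
have B n : 1 + n%:R * (x - 1) <= x ^+ n.
  elim: n => [|n IH]; first by rewrite mul0r addr0 expr0.
  have h : (1 + n%:R * (x - 1)) * x <= x ^+ n.+1.
    by rewrite exprSr ler_wpM2r //; lra.
  apply: le_trans h; rewrite -[n.+1%:R]natr1.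
  have : 0 <= n%:R * (x - 1) * (x - 1) :> R by rewrite !mulr_ge0 //; lra.
  lra.
have x10 : 0 < x - 1 by lra.
pose n := Num.Def.archi_bound (`|c| / (x - 1)).
have : `|c| / (x - 1) < n%:R by apply: archi_boundP; rewrite divr_ge0 // ltW.
rewrite ltr_pdivrMr // => h; have := B n; have := H n; have := ler_norm c; lra.
Qed.

Lemma cauchy_bound f z rho r w M : rho < r -> modulus (w - z) < rho ->
  holomorphic (Ball z r) f ->
  (forall s, 0 <= s <= 2 * pi -> modulus (f (circ z rho s)) <= M) ->
  modulus (f w) <= M * (rho / (rho - modulus (w - z))).
Proof.
move=> rr wr h fM; have rho0 : 0 < rho by apply: le_lt_trans wr; exact: mod_ge0.
have p0 := @twopi_gt0 R.
have M0 : 0 <= M by apply: le_trans (fM 0 _); rewrite ?mod_ge0 // lexx ltW.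
rewrite -(ler_pM2r p0) -{1}[2 * pi]ger0_norm ?twopi_ge0 // -mod_rC -modM.
rewrite (cauchy_formula rr wr h).
have fc := contT_comp_circ (ltW rho0) rr h.
have ec : contT (fun s => rC rho * expi s).
  by apply: contT_M; [exact: contT_cst|exact: contT_expi].
apply: cint_bound; rewrite ?twopi_ge0 //.
  by apply: contT_kern => //; exact: contT_M.
move=> s s01; rewrite expr1 mod_div modM [modulus (rC rho * _)]modM mod_rC mod_expi mulr1 ger0_norm ?(ltW rho0) //.
have d := circ_dist s wr.
have dp : 0 < rho - modulus (w - z) by rewrite subr_gt0.
rewrite -mulrA; apply: ler_pM; rewrite ?mod_ge0 ?fM //.
  by rewrite divr_ge0 ?mod_ge0 // ltW.
by rewrite ler_pM2l // lef_pV2 // posrE //; apply: lt_le_trans dp d.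
Qed.

(** The constant lost in Cauchy's estimate disappears when the estimate is applied
    to the powers of the function. *)
Theorem max_modulus f z rho r w M : rho < r -> modulus (w - z) < rho ->
  holomorphic (Ball z r) f ->
  (forall s, 0 <= s <= 2 * pi -> modulus (f (circ z rho s)) <= M) ->
  modulus (f w) <= M.
Proof.
move=> rr wr h fM.
have M0 : 0 <= M by apply: le_trans (fM 0 _); rewrite ?mod_ge0 // lexx ltW ?twopi_gt0.
have [M1|M1] := eqVneq M 0.
  by have := cauchy_bound rr wr h fM; rewrite M1 mul0r.
have Mp : 0 < M by rewrite lt_def M1.
rewrite -[M]mul1r -ler_pdivrMr //.
apply: (@pow_bounded _ (rho / (rho - modulus (w - z)))) => n.
rewrite expr_div_n ler_pdivrMr ?exprn_gt0 // mulrC -modX.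
apply: (cauchy_bound rr wr (holX (n := n) h)) => s s01.
by rewrite modX lerXn2r ?nnegrE ?mod_ge0 // fM.
Qed.

Definition dq f z w := if w == z then cD f z else (f w - f z) / (w - z).

Lemma dqE f z w : f w = f z + (w - z) * dq f z w.
Proof.
rewrite /dq; case: eqVneq => [->|wz]; first by rewrite subrr mul0r addr0.
by rewrite mulrC divfK ?subr_eq0 // addrC subrK.
Qed.

Lemma hol_dq U f z : open U -> U z -> holomorphic U f -> holomorphic U (dq f z).
Proof.
move=> /openP Uo Uz h w Uw; have [wz|wz] := eqVneq w z; last first.
  have wz0 : w - z != 0 by rewrite subr_eq0.
  have := cder_div (g := fun v => v - z) wz0 (cderB (hol_cD h Uw) (cder_cst (f z) w))
     (cderB (cder_id w) (cder_cst z w)).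
  move=> /(@cder_near _ _ (dq f z) w _ (modulus (w - z))); rewrite mod_gt0 => /(_ wz0) H.
  apply: cder_derivable; apply: H => v vw; rewrite /dq ifN //.
  by apply: contraTneq vw => ->; rewrite /Ball /= mod_distC ltxx.
rewrite wz => {w wz Uw}; have [r r0 rU] := Uo z Uz; have {U Uo Uz rU}h := sub_hol rU h.
pose rho := r / 2; have rho0 : 0 < rho by rewrite divr_gt0.
have rr : rho < r by rewrite /rho; lra.
pose u s := f (circ z rho s) * (rC rho * expi s).
have uc : contT u.
  apply: contT_M; first exact: contT_comp_circ (ltW rho0) rr h.
  by apply: contT_M; [exact: contT_cst|exact: contT_expi].
have zr : modulus (z - z) < rho by rewrite subrr mod0.
pose u1 s := u s / (circ z rho s - z).
have u1c : contT u1.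
  apply: contT_M => //; apply: contT_V => s; first exact: circ_neq.
  by apply: contB; [exact: contT_circ|exact: cont_cst].
have p0 : rC (2 * pi) != 0 :> C R by rewrite rC_eq0 gt_eqF ?twopi_gt0.
have fE v : Ball z rho v -> f v = (rC (2 * pi))^-1 * kern z rho u 0 v.
  by move=> vr; rewrite -(cauchy_formula rr vr h) mulrCA mulVf // mulr1.
have E v : Ball z rho v -> (rC (2 * pi))^-1 * kern z rho u1 0 v = dq f z v.
  move=> vr; rewrite /dq; case: eqVneq => [->|vz].
    have := cderZ (rC (2 * pi))^-1 (cder_kern 0 uc zr); rewrite mul1r.
    move=> /(@cder_near _ _ f z _ rho rho0) H; rewrite (cDE (H _)); last first.
      by move=> x /fE.
    congr (_ * _); apply: eq_cint; rewrite ?twopi_ge0 //; try exact: contT_kern.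
    by move=> s _; rewrite /u1 expr1 expr2 invfM mulrA.
  rewrite !fE // -mulrBr -mulrA; congr (_ * _).
  rewrite /kern -cintB ?twopi_ge0 //; try exact: contT_kern.
  rewrite [RHS]mulrC -cintZ ?twopi_ge0 //; last first.
    by apply: contT_B; exact: contT_kern.
  apply: eq_cint; rewrite ?twopi_ge0 //; first exact: contT_kern.
    by apply: contT_M; [exact: contT_cst|apply: contT_B; exact: contT_kern].
  have vz0 : v - z != 0 by rewrite subr_eq0.
  by move=> s _; rewrite /u1 !expr1; field; rewrite vz0 !circ_neq.
apply: cder_derivable; apply: (@cder_near _ _ _ z _ rho rho0) E _.
exact: cderZ (cder_kern 0 u1c zr).
Qed.

(** The divided difference at the centre is bounded by [M / rho] on the circle of
    radius [rho], hence inside it; let [rho] tend to [r]. *)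
Lemma schwarz f z r w M : holomorphic (Ball z r) f ->
  (forall v, Ball z r v -> modulus (f v) <= M) -> f z = 0 -> Ball z r w ->
  modulus (f w) <= M * (modulus (w - z) / r).
Proof.
move=> h fM fz wr; have r0 : 0 < r by apply: le_lt_trans wr; exact: mod_ge0.
have zr : Ball z r z by exact: Ball_center.
have M0 : 0 <= M by apply: le_trans (fM z zr); exact: mod_ge0.
have key rho : modulus (w - z) < rho -> rho < r -> modulus (dq f z w) <= M / rho.
  move=> wrho rr; have rho0 : 0 < rho by apply: le_lt_trans wrho; exact: mod_ge0.
  refine (@max_modulus (dq f z) z rho r w (M / rho) rr wrho (hol_dq (@open_Ball _ z r) zr h) _) => s _.
  have cz : circ z rho s != z by rewrite -subr_eq0 -mod_eq0 mod_circ ?(ltW rho0) // gt_eqF.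
  rewrite /dq (negPf cz) fz subr0 mod_div mod_circ ?(ltW rho0) //.
  by rewrite ler_pM2r ?invr_gt0 // fM // /Ball /= mod_circ // ltW.
have H : modulus (dq f z w) * r <= M.
  rewrite leNgt; apply/negP => lt.
  have q0 : 0 < modulus (dq f z w).
    by rewrite -(pmulr_lgt0 _ r0); apply: le_lt_trans M0 lt.
  have Mr : M / modulus (dq f z w) < r by rewrite ltr_pdivrMr // mulrC.
  pose rho := (Num.max (modulus (w - z)) (M / modulus (dq f z w)) + r) / 2.
  have mx : Num.max (modulus (w - z)) (M / modulus (dq f z w)) < r by rewrite gt_max wr.
  have := le_max (M / modulus (dq f z w)) (modulus (w - z)) (M / modulus (dq f z w)).
  have := le_max (modulus (w - z)) (modulus (w - z)) (M / modulus (dq f z w)).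
  rewrite !lexx orbT /= => h1 h2.
  have r1 : modulus (w - z) < rho by rewrite /rho; lra.
  have r2 : rho < r by rewrite /rho; lra.
  have rho0 : 0 < rho by apply: le_lt_trans r1; exact: mod_ge0.
  have := key _ r1 r2; rewrite ler_pdivlMr // mulrC -ler_pdivlMr //.
  by apply/negP; rewrite -ltNge /rho; lra.
rewrite [f w](dqE f z w) fz add0r modM mulrA [M * _]mulrC -mulrA.
by rewrite ler_wpM2l ?mod_ge0 // ler_pdivlMr.
Qed.

(** Let the radius tend to infinity in Schwarz' lemma for [f - f 0]. *)
Lemma liouville f M : holomorphic setT f -> (forall z, modulus (f z) <= M) ->
  forall z, f z = f 0.
Proof.
move=> h fM z; apply/eqP; rewrite -subr_eq0 -mod_eq0 eq_le mod_ge0 andbT leNgt.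
apply/negP => p0; pose r := Num.max (modulus z + 1) (4 * M * modulus z / modulus (f z - f 0) + 1).
have r1 : modulus z < r by rewrite /r lt_max ltrDl ltr01.
have r2 : 4 * M * modulus z / modulus (f z - f 0) < r by rewrite /r lt_max ltrDl ltr01 orbT.
have r0 : 0 < r by apply: le_lt_trans r1; exact: mod_ge0.
have M0 : 0 <= M by apply: le_trans (fM 0); exact: mod_ge0.
have hB : holomorphic (Ball 0 r) (fun v => f v - f 0).
  by apply: holB; [exact: sub_hol h|exact: hol_cst].
have := schwarz (w := z) (M := 2 * M) hB _ (subrr _).
rewrite /Ball /= subr0 => /(_ _ r1) H.
have : modulus (f z - f 0) <= 2 * M * (modulus z / r).
  by apply: H => v _; have := modB (f v) (f 0); have := fM v; have := fM 0; lra.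
move: r2; rewrite ltr_pdivrMr // mulrA ler_pdivlMr //.
have : 0 <= 2 * M * modulus z by rewrite mulr_ge0 ?mod_ge0 // mulr_ge0.
lra.
Qed.

(** If the factor [w - z] could be split off infinitely often, the maximum principle
    would force the function to vanish. *)
Lemma zero_factor f z r : 0 < r -> holomorphic (Ball z r) f ->
  (forall w, Ball z r w -> f w = 0) \/
  exists k g, [/\ holomorphic (Ball z r) g, g z != 0 &
    forall w, Ball z r w -> f w = (w - z) ^+ k * g w].
Proof.
move=> r0 h; have zr : Ball z r z by exact: Ball_center.
have [H|nH] := pselect (exists k g, [/\ holomorphic (Ball z r) g, g z != 0 &
    forall w, Ball z r w -> f w = (w - z) ^+ k * g w]); [by right|left => w wr].
have all n : exists2 g, holomorphic (Ball z r) g &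
    forall w, Ball z r w -> f w = (w - z) ^+ n * g w.
  elim: n => [|n [g gh gE]]; first by exists f => // v _; rewrite expr0 mul1r.
  have gz : g z = 0.
    by apply/eqP; apply: contra_notT nH => gz; exists n, g.
  exists (dq g z); first refine (hol_dq (@open_Ball _ z r) zr gh).
  by move=> v vr; rewrite gE // (dqE g z v) gz add0r exprSr mulrA.
pose rho := (modulus (w - z) + r) / 2.
have r1 : modulus (w - z) < rho by rewrite /rho; move: wr; rewrite /Ball /=; lra.
have r2 : rho < r by rewrite /rho; move: wr; rewrite /Ball /=; lra.
have rho0 : 0 < rho by apply: le_lt_trans r1; exact: mod_ge0.
have [M [M0 fM]] := circle_max (contT_comp_circ (ltW rho0) r2 h).
have [//|fw] := eqVneq (f w) 0.
have wz : modulus (w - z) != 0.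
  rewrite mod_eq0 subr_eq0; apply: contraNneq fw => ->.
  by have [g _ gE] := all 1%N; rewrite gE // subrr expr1 mul0r.
have wz0 : 0 < modulus (w - z) by rewrite lt_def wz mod_ge0.
have fw0 : 0 < modulus (f w) by rewrite mod_gt0.
suff : rho / modulus (w - z) <= 1 by rewrite ler_pdivrMr // mul1r leNgt r1.
apply: (@pow_bounded _ (M / modulus (f w))) => n.
have [g gh gE] := all n.
have : modulus (g w) <= M / rho ^+ n.
  apply: (max_modulus r2 r1 gh) => s s01.
  have cB : Ball z r (circ z rho s) by rewrite /Ball /= mod_circ // ltW.
  rewrite ler_pdivlMr ?exprn_gt0 // mulrC -{1}(@mod_circ _ z rho s (ltW rho0)) -modX -modM.
  by rewrite -gE // fM.
rewrite ler_pdivlMr ?exprn_gt0 // => h1.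
rewrite expr_div_n ler_pdivlMr // mulrAC ler_pdivrMr ?exprn_gt0 //.
rewrite gE // modM modX mulrCA mulrC ler_wpM2r ?exprn_ge0 ?mod_ge0 //.
by rewrite mulrC.
Qed.

Lemma cont_neq0 f z : cont f z -> f z != 0 ->
  exists2 d, 0 < d & forall w, Ball z d w -> f w != 0.
Proof.
move=> /contCP fc f0; have [|d d0 dH] := fc (modulus (f z)); first by rewrite mod_gt0.
exists d => // w /dH; apply: contraTneq => ->; by rewrite sub0r modN ltxx.
Qed.

(** If [c] were omitted, [1 / (f - c)] would be holomorphic and, by the bound on the
    circle, violate the maximum principle at the centre. *)
Lemma cover_disc f z rho r m c : 0 < rho -> rho < r -> holomorphic (Ball z r) f ->
  (forall s, 0 <= s <= 2 * pi -> m <= modulus (f (circ z rho s) - f z)) ->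
  modulus (c - f z) < m / 2 -> exists2 w, Ball z r w & f w = c.
Proof.
move=> rho0 rr h fm cm.
have [[w wr <-]|N] := pselect (exists2 w, Ball z r w & f w = c); first by exists w.
have nz w : Ball z r w -> f w - c != 0.
  by move=> wr; rewrite subr_eq0; apply: contra_notN N => /eqP fw; exists w.
have gh : holomorphic (Ball z r) (fun w => (f w - c)^-1).
  exact: holV nz (holB h (hol_cst (c := c))).
have m0 : 0 < m by have := mod_ge0 (c - f z); lra.
have zr : modulus (z - z) < rho by rewrite subrr mod0.
have : modulus (f z - c)^-1 <= (m / 2)^-1.
  apply: (max_modulus rr zr gh) => s s01; rewrite modV.
  have h1 := fm s s01; have h2 := mod_dist_triangle (f (circ z rho s)) (f z) c.
  by rewrite lef_pV2 ?posrE //; lra.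
have fzc : f z - c != 0 by apply: nz; apply: Ball_center; exact: lt_trans rr.
rewrite modV lef_pV2 ?posrE ?mod_gt0 //; last by lra.
by rewrite (mod_distC (f z)) leNgt cm.
Qed.

(** Some circle around [z] carries no further point of the fibre, by the finite order
    of the zero of [f - f z]. *)
Lemma open_mapping f z r e : 0 < r -> 0 < e -> holomorphic (Ball z r) f ->
  ~ (forall w, Ball z r w -> f w = f z) ->
  exists2 d, 0 < d & forall c, Ball (f z) d c ->
    exists w, [/\ Ball z r w, Ball z e w & f w = c].
Proof.
move=> r0 e0 h nc.
have gh : holomorphic (Ball z r) (fun w => f w - f z).
  exact: holB h (hol_cst (c := f z)).
have [H|[k [g [gg gz gE]]]] := zero_factor r0 gh.
  by exfalso; apply: nc => w /H /eqP; rewrite subr_eq0 => /eqP.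
have [d d0 dH] := cont_neq0 (hol_cont gg (Ball_center z r0)) gz.
pose t := Num.min r (Num.min e d); have t0 : 0 < t by rewrite !lt_min r0 e0 d0.
have [tr te td] : [/\ t <= r, t <= e & t <= d] by rewrite /t !ge_min !lexx !orbT.
pose rho := t / 2; have rho0 : 0 < rho by rewrite divr_gt0.
have rt : rho < t by rewrite /rho; lra.
have ht : holomorphic (Ball z t) f by apply: sub_hol h; exact: le_Ball.
have u0 s : f (circ z rho s) - f z != 0.
  have cd x : t <= x -> Ball z x (circ z rho s).
    by move=> tx; rewrite /Ball /= mod_circ ?(ltW rho0) //; exact: lt_le_trans tx.
  rewrite gE; last exact: cd.
  rewrite mulf_neq0 ?expf_neq0 ?dH //; last exact: cd.
  by rewrite -mod_eq0 mod_circ ?(ltW rho0) // gt_eqF.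
have uc : contT (fun s => f (circ z rho s) - f z).
  by apply: contT_B; [exact: contT_comp_circ (ltW rho0) rt ht|exact: contT_cst].
have [m [m0 mH]] := circle_min uc u0.
exists (m / 2); first exact: divr_gt0.
move=> c cm; have [w wt fw] := cover_disc rho0 rt ht mH cm.
by exists w; split => //; apply: le_Ball wt.
Qed.

(** A primitive of [f' / f], normalised at the centre. *)
Lemma hol_log f z r : 0 < r -> holomorphic (Ball z r) f ->
  (forall w, Ball z r w -> f w != 0) ->
  forall c, cexp c = f z -> exists L, [/\ holomorphic (Ball z r) L, L z = c &
    forall w, Ball z r w -> cexp (L w) = f w].
Proof.
move=> r0 h f0 c cE; have zr := Ball_center z r0.
have ch : holomorphic (Ball z r) (fun w => cD f w / f w).
  exact: hol_div f0 (holo_cD (@open_Ball _ z r) h) h.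
have [P PH] := holo_primitive ch.
pose L w := P w - P z + c.
have LH w : Ball z r w -> cder L w (cD f w / f w).
  move=> wr; have := cderD (cderB (PH w wr) (cder_cst (P z) w)) (cder_cst c w).
  by rewrite subr0 addr0.
exists L; split.
- by move=> w /LH; exact: cder_derivable.
- by rewrite /L subrr add0r.
- move=> w wr.
  have gd v : Ball z r v -> cder (fun w => f w * cexp (- L w)) v 0.
    move=> vr.
    have := cderM (hol_cD h vr) (cder_comp (cderN (LH v vr)) (cder_cexp _)).
    by congr cder; field; exact: f0.
  have := cder_ball_eq gd (fun v _ => cder_cst (1 : C R) v) _ wr.
  rewrite /L subrr add0r cexpN cE divff ?f0 // => /(_ erefl) /(congr1 (fun x => x * cexp (L w))).
  by rewrite -mulrA cexpN mulVf ?cexp_neq0 // mul1r mulr1.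
Qed.

Lemma nat_expi_root n : (1 < n)%N -> exists o : C R, o ^+ n = 1 /\ o != 1.
Proof.
move=> n1; have n0 : (n%:R : R) != 0 by rewrite pnatr_eq0 -lt0n ltnW.
pose t := 2 * pi / n%:R : R.
have np : (1 : R) < n%:R by rewrite ltr1n.
have t1 : 0 < t by rewrite divr_gt0 ?twopi_gt0 // (lt_trans ltr01).
have t2 : t < 2 * pi by rewrite ltr_pdivrMr ?(lt_trans ltr01) // ltr_pMr ?twopi_gt0.
exists (expi t); split.
  rewrite /expi -cexpMn; apply: etrans (expi_2pi); rewrite /expi; congr cexp.
  by rewrite -(rCn n) mulrCA -rCM /t mulrCA divff // mulr1.
apply/eqP => /(congr1 (@complex.Re R)); rewrite Re_expi /= => /cos_eq1[k kE].
have p0 := @twopi_gt0 R.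
rewrite kE in t1 t2; move: t1; rewrite pmulr_rgt0 // ltr0z gtz0_ge1 => t1.
move: t2; rewrite -[X in _ < X]mulr1 ltr_pM2l // -[1]/(1%:~R) ltr_int.
by rewrite ltNge t1.
Qed.

(** Near a critical point the map is a [k]-th power, [k > 1], of an open map, and two
    points whose images differ by a [k]-th root of unity are identified. *)
Lemma inj_cD_neq0 f z r : 0 < r -> holomorphic (Ball z r) f ->
  (forall v w, Ball z r v -> Ball z r w -> f v = f w -> v = w) -> cD f z != 0.
Proof.
move=> r0 h fi; have zr := Ball_center z r0.
have gh : holomorphic (Ball z r) (fun w => f w - f z).
  exact: holB h (hol_cst (c := f z)).
have wne : exists2 w, Ball z r w & w != z.
  exists (z + rC (r / 2)).
    by rewrite /Ball /= addrAC subrr add0r mod_rC ger0_norm; lra.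
  by rewrite -subr_eq0 addrAC subrr add0r rC_eq0 mulf_neq0 ?invr_eq0 ?gt_eqF.
have [w0 w0r w0z] := wne.
have [H|[k [g [gg gz gE]]]] := zero_factor r0 gh.
  have /eqP := H _ w0r; rewrite subr_eq0 => /eqP /(fi _ _ w0r zr) /eqP.
  by rewrite (negPf w0z).
have [d d0 dH] := cont_neq0 (hol_cont gg zr) gz.
pose t := Num.min r d; have t0 : 0 < t by rewrite lt_min r0 d0.
have [tr td] : t <= r /\ t <= d by rewrite /t !ge_min !lexx orbT.
case: k gE => [|[|k]] gE.
- by have := gE z zr; rewrite subrr expr0 mul1r => /esym/eqP; rewrite (negPf gz).
- suff -> : cD f z = g z by [].
  apply: cDE; have := cderM (cderB (cder_id z) (cder_cst z z)) (hol_cD gg zr).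
  rewrite subr0 subrr mul0r addr0 mul1r => H.
  have := cderD (cder_near r0 (g := fun w => f w - f z) _ H) (cder_cst (f z) z).
  rewrite addr0 => /(_ _)/(cder_near r0 (g := f)); apply.
    by move=> w _; rewrite subrK.
  by move=> w wr; rewrite gE // expr1.
- exfalso; have [c [cE _ _]] := cexp_surj gz.
  have gt : holomorphic (Ball z t) g by apply: sub_hol gg; exact: le_Ball.
  have g0 w : Ball z t w -> g w != 0 by move=> wt; apply: dH; exact: le_Ball wt.
  have [L [Lh Lz LE]] := hol_log t0 gt g0 cE.
  pose K : C R := k.+2%:R; have K0 : K != 0 by rewrite pnatr_eq0.
  pose psi w := (w - z) * cexp (L w / K).
  have psih : holomorphic (Ball z t) psi.
    apply: holM; first by apply: holB; [exact: hol_id|exact: hol_cst].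
    exact: hol_cexpf (holM Lh (hol_cst (c := K^-1))).
  have psiz : psi z = 0 by rewrite /psi subrr mul0r.
  have psiE w : Ball z t w -> f w = f z + psi w ^+ k.+2.
    move=> wt; have wr : Ball z r w by exact: le_Ball wt.
    have e1 : k.+2%:R * (L w / K) = L w by rewrite -/K mulrCA divff // mulr1.
    by rewrite /psi exprMn -cexpMn e1 LE // -gE //; ring.
  have nc : ~ (forall w, Ball z t w -> psi w = psi z).
    move=> H; pose w := z + rC (t / 2).
    have wt : Ball z t w by rewrite /Ball /= /w addrAC subrr add0r mod_rC ger0_norm; lra.
    have := H w wt; rewrite psiz => /eqP; rewrite mulf_eq0 (negPf (cexp_neq0 _)) orbF.
    by rewrite /w addrAC subrr add0r rC_eq0 mulf_eq0 invr_eq0 !gt_eqF.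
  have [e e0 eH] := open_mapping t0 ltr01 psih nc.
  have [om [omE om1]] := @nat_expi_root k.+2 isT.
  have mo : modulus om = 1.
    have : modulus om ^+ k.+2 = 1 by rewrite -modX omE mod1.
    by move=> /eqP; rewrite pexpr_eq1 ?mod_ge0 // => /eqP.
  have e2 : modulus (rC (e / 2)) = e / 2 by rewrite mod_rC ger0_norm //; lra.
  have [|w1 [w1t _ w1E]] := eH (rC (e / 2)).
    by rewrite /Ball /= psiz subr0 e2; lra.
  have [|w2 [w2t _ w2E]] := eH (om * rC (e / 2)).
    by rewrite /Ball /= psiz subr0 modM mo mul1r e2; lra.
  have : w1 = w2.
    apply: fi; [exact: le_Ball w1t|exact: le_Ball w2t|].
    by rewrite (psiE w1 w1t) (psiE w2 w2t) w1E w2E exprMn omE mul1r.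
  move=> ww; move: w2E; rewrite -ww w1E => /eqP; rewrite -subr_eq0.
  rewrite -[X in X - _]mul1r -mulrBl mulf_eq0 subr_eq0 eq_sym (negPf om1) /= rC_eq0.
  by rewrite mulf_eq0 invr_eq0 !gt_eqF.
Qed.

Section Inverse.
Variables (U V : set (C R)) (phi psi : C R -> C R).
Hypotheses (Uo : open U) (phih : holomorphic U phi).
Hypothesis phi_inj : forall v w, U v -> U w -> phi v = phi w -> v = w.
Hypothesis psiP : forall v, V v -> U (psi v) /\ phi (psi v) = v.
Hypothesis phiV : forall u, U u -> V (phi u).

(** Open mapping, for an injective map on an open set. *)
Lemma inj_cover u e : U u -> 0 < e ->
  exists2 d, 0 < d & forall c, Ball (phi u) d c -> exists w, [/\ U w, Ball u e w & phi w = c].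
Proof.
move=> Uu e0; have [r r0 rU] := (openP U).1 Uo u Uu.
have h := sub_hol rU phih.
have [|d d0 dH] := open_mapping r0 e0 h.
  move=> H; pose w := u + rC (r / 2).
  have wr : Ball u r w by rewrite /Ball /= /w addrAC subrr add0r mod_rC ger0_norm; lra.
  have /eqP := phi_inj (rU _ wr) Uu (H w wr); rewrite -subr_eq0 /w addrAC subrr add0r.
  by rewrite rC_eq0 mulf_eq0 invr_eq0 !gt_eqF.
by exists d => // c /dH[w [/rU h1 h2 h3]]; exists w.
Qed.

Lemma inj_image_open : open V.
Proof.
apply/openP => v Vv; have [Uu uE] := psiP Vv.
have [d d0 dH] := inj_cover Uu ltr01; rewrite uE in dH; exists d => // c /dH[w [Uw _ <-]].
exact: phiV.
Qed.

(** The inverse is continuous since the map is open, and its difference quotients are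
    the inverses of those of the map. *)
Lemma inv_hol : holomorphic V psi.
Proof.
move=> v Vv; have [Uu uE] := psiP Vv.
have [r r0 rU] := (openP U).1 Uo _ Uu.
have d0 : cD phi (psi v) != 0.
  by apply: (inj_cD_neq0 r0 (sub_hol rU phih)) => x y /rU xU /rU yU; exact: phi_inj.
have psic : cont psi v.
  apply/contCP => e e0; have [d dp dH] := inj_cover Uu e0.
  rewrite uE in dH; exists d => // c /dH[w [Uw wB wE]].
  have Vc : V c by rewrite -wE; exact: phiV.
  have [Uc cE] := psiP Vc.
  by rewrite (phi_inj Uc Uw) // cE.
have [q qc qd qE] := hol_cD phih Uu.
have qpc : cont (fun w => q (psi w)) v by exact: cont_comp psic qc.
have qn : q (psi v) != 0 by rewrite qd.
have [t t0 tH] := cont_neq0 qpc qn.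
have [s s0 sV] := (openP V).1 inj_image_open v Vv.
apply: (@cder_derivable _ _ _ (q (psi v))^-1); apply: cder_intro => e e0.
have /contCP/(_ e e0)[x x0 xH] := contV qn qpc.
exists (Num.min x (Num.min t s)); first by rewrite !lt_min x0 t0.
move=> w; rewrite !lt_min => /and3P[wx wt ws].
have [_ wE] := psiP (sV _ ws); have := qE (psi w); rewrite wE uE => E.
have -> : psi w - psi v = (q (psi w))^-1 * (w - v) by rewrite E mulKf // tH.
by rewrite -mulrBl modM ler_wpM2r ?mod_ge0 // ltW // xH.
Qed.

End Inverse.

End LocalTheory.

(** * Normal families of bounded functions and Harnack inequalities *)

Section Subsequences.
Context {R : realType}.

Definition infinitely (P : nat -> Prop) := forall m, exists n, (m < n)%N /\ P n.

Lemma infinitely_subseq (P : nat -> Prop) : infinitely P ->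
  exists s : nat -> nat, {homo s : i j / (i < j)%N} /\ forall n, P (s n).
Proof.
move=> /choice[phi H]; pose s := fix s j := if j is j.+1 then phi (s j) else phi 0%N.
exists s; split; last by case=> [|n]; [exact: (H 0%N).2|exact: (H (s n)).2].
refine (@homo_ltn _ s (fun i j => is_true (i < j)%N) _ _) => [y x z|i].
  exact: ltn_trans.
exact: (H (s i)).1.
Qed.

Lemma subseq_ge (s : nat -> nat) : {homo s : i j / (i < j)%N} -> forall n, (n <= s n)%N.
Proof.
move=> sh; elim=> [//|n IH]; apply: leq_ltn_trans IH (sh _ _ _); exact: ltnSn.
Qed.

Lemma not_infinitely (P : nat -> Prop) : ~ infinitely P ->
  exists m, forall n, (m < n)%N -> ~ P n.
Proof.
move=> nP; apply: contrapT => H; apply: nP => m.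
apply: contrapT => H'; apply: H; exists m => n mn Pn; apply: H'; exists n; split => //.
Qed.

(** Take a cluster point in the product of the intervals, which is compact. *)
Lemma diag_real (x : nat -> nat -> R) (B : nat -> R) :
  (forall n k, `|x n k| <= B k) ->
  exists s : nat -> nat, {homo s : i j / (i < j)%N} /\ exists b : nat -> R,
    forall k (e : R), 0 < e -> exists N, forall n, (N <= n)%N ->
      `|x (s n) k - b k| < e.
Proof.
move=> xB.
pose A k : set R := `[- B k, B k]%classic.
have Ac k : compact (A k) by exact: segment_compact.
have := @tychonoff nat (fun=> R) A Ac; set K := (X in compact X) => Kc.
pose y n : prod_topology (fun _ : nat => R) := x n.
have [] := Kc (y @ \oo) _.
  by exists 0%N => // n _ k; rewrite /A /= in_itv /= -ler_norml; exact: xB.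
move=> b [_ bc].
have H m j : exists n, (m < n)%N /\ forall k, (k <= j)%N -> `|x n k - b k| < j.+1%:R^-1.
  have nb : nbhs b [set f : prod_topology (fun _ : nat => R) |
      forall k, (k <= j)%N -> `|f k - b k| < j.+1%:R^-1].
    have nbk k : nbhs b [set f : prod_topology (fun _ : nat => R) | `|f k - b k| < j.+1%:R^-1].
      have pc := @proj_continuous nat (fun=> R) k b.
      have : nbhs (b k) [set t : R | `|t - b k| < j.+1%:R^-1].
        apply/nbhs_ballP; exists j.+1%:R^-1; first by rewrite /= invr_gt0.
        by move=> t; rewrite -ball_normE /= distrC.
      by move=> /pc.
    suff : forall i, nbhs b [set f : prod_topology (fun _ : nat => R) |
      forall k, (k <= i)%N -> `|f k - b k| < j.+1%:R^-1] by apply.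
    elim=> [|i IH].
      by apply: filterS (nbk 0%N) => f h k; rewrite leqn0 => /eqP ->.
    apply: filterS2 IH (nbk i.+1) => f h1 h2 k.
    by rewrite leq_eqVlt => /predU1P[-> //|]; rewrite ltnS => /h1.
  have [f [[n mn <-] h]] : (y @` [set n | (m < n)%N]) `&` [set f : prod_topology (fun _ : nat => R) |
      forall k, (k <= j)%N -> `|f k - b k| < j.+1%:R^-1] !=set0.
    apply: bc nb; exists m.+1 => // n /= mn; exists n => //.
  by exists n.
have /choice[phi phiH] : forall p : nat * nat, exists n, (p.1 < n)%N /\
    forall k, (k <= p.2)%N -> `|x n k - b k| < p.2.+1%:R^-1.
  by move=> p; exact: H.
pose s := fix s j := if j is i.+1 then phi (s i, j) else phi (0%N, 0%N).
exists s; split.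
  refine (@homo_ltn _ s (fun i j => is_true (i < j)%N) _ _) => [y' x' z'|i].
    exact: ltn_trans.
  exact: (phiH (s i, i.+1)).1.
exists b => k e e0.
have sH n j : (j <= n)%N -> `|x (s n) j - b j| < n.+1%:R^-1.
  by case: n => [|n] jn; [exact: (phiH (0%N, 0%N)).2|exact: (phiH (s n, n.+1)).2].
pose N := Num.Def.archi_bound e^-1.
have NH : e^-1 < N%:R by apply: archi_boundP; rewrite invr_ge0 ltW.
exists (maxn N k) => n; rewrite geq_max => /andP[Nn kn].
apply: lt_trans (sH n k kn) _; rewrite invf_plt ?posrE //.
by apply: lt_le_trans NH _; rewrite ler_nat leqW.
Qed.

Lemma diag_complex (a : nat -> nat -> C R) (B : nat -> R) :
  (forall n k, modulus (a n k) <= B k) ->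
  exists s : nat -> nat, {homo s : i j / (i < j)%N} /\ exists b : nat -> C R,
    forall k (e : R), 0 < e -> exists N, forall n, (N <= n)%N ->
      modulus (a (s n) k - b k) < e.
Proof.
move=> aB.
pose x n k := if odd k then complex.Im (a n k./2) else complex.Re (a n k./2).
have [|s [sh [b bH]]] := @diag_real x (fun k => B k./2).
  move=> n k; apply: le_trans (aB n k./2); rewrite /x.
  by case: ifP => _; [exact: Im_le_mod|exact: Re_le_mod].
exists s; split => //; exists (fun k => rC (b k.*2) + iC * rC (b k.*2.+1)) => k e e0.
have [|N1 H1] := bH k.*2 (e / 2); first exact: divr_gt0.
have [|N2 H2] := bH k.*2.+1 (e / 2); first exact: divr_gt0.
exists (maxn N1 N2) => n; rewrite geq_max => /andP[/H1 h1 /H2 h2].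
apply: le_lt_trans (mod_le_ReIm _) _.
have e1 : complex.Re (rC (b k.*2) + iC * rC (b k.*2.+1)) = b k.*2 by rewrite ReD ReM /=; ring.
have e2 : complex.Im (rC (b k.*2) + iC * rC (b k.*2.+1)) = b k.*2.+1 by rewrite ImD ImM /=; ring.
move: h1 h2; rewrite /x /= odd_double /= doubleK uphalf_double => h1 h2.
by rewrite ReD ReN ImD ImN e1 e2; lra.
Qed.

End Subsequences.

Section Normality.
Context {R : realType}.
Implicit Types (f g : C R -> C R) (F : nat -> C R -> C R) (z w c d v : C R)
  (r rho m M e : R) (U V : set (C R)).

Definition ucvg F g U := forall e, 0 < e -> exists N, forall n, (N <= n)%N ->
  forall w, U w -> modulus (F n w - g w) < e.

Lemma dq_bound f z r M w : holomorphic (Ball z r) f ->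
  (forall v, Ball z r v -> modulus (f v) <= M) -> Ball z r w ->
  modulus (dq f z w) <= M * (4 / r).
Proof.
move=> h fM wr; have r0 : 0 < r by apply: le_lt_trans wr; exact: mod_ge0.
have zr := Ball_center z r0.
have M0 : 0 <= M by apply: le_trans (fM z zr); exact: mod_ge0.
have key v : Ball z r v -> r / 2 <= modulus (v - z) -> modulus (dq f z v) <= M * (4 / r).
  move=> vr vz; have vz0 : 0 < modulus (v - z) by apply: lt_le_trans vz; rewrite divr_gt0.
  rewrite /dq ifN; last by rewrite -subr_eq0 -mod_gt0.
  rewrite mod_div ler_pdivrMr //.
  have := modB (f v) (f z); have := fM v vr; have := fM z zr.
  have : M * (4 / r) * (r / 2) <= M * (4 / r) * modulus (v - z).
    by rewrite ler_wpM2l // mulr_ge0 // divr_ge0 // ltW.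
  have -> : M * (4 / r) * (r / 2) = 2 * M by field; rewrite gt_eqF.
  lra.
have [h1|h1] := leP (r / 2) (modulus (w - z)); first exact: key.
have rr : r / 2 < r by lra.
apply: (max_modulus rr h1 (hol_dq (@open_Ball _ z r) zr h)) => s _.
by apply: key; rewrite /Ball /= mod_circ; lra.
Qed.

Lemma ucvg_sub F g U V : V `<=` U -> ucvg F g U -> ucvg F g V.
Proof. by move=> VU H e /H[N NH]; exists N => n /NH nH w /VU; exact: nH. Qed.

(** The second order Taylor estimates are uniform along the sequence, so they pass
    to the limit; the linear coefficients converge along a subsequence. *)
Lemma hol_limit F g z r M : (forall n, holomorphic (Ball z r) (F n)) ->
  (forall n v, Ball z r v -> modulus (F n v) <= M) ->
  (forall v, Ball z r v -> forall e, 0 < e -> exists N, forall n, (N <= n)%N ->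
    modulus (F n v - g v) < e) -> holomorphic (Ball z r) g.
Proof.
move=> Fh FM Fg v vr; pose t := r - modulus (v - z).
have t0 : 0 < t by rewrite subr_gt0.
have tr : Ball v t `<=` Ball z r by apply: Ball_sub; rewrite /t addrC subrK.
have vt := Ball_center v t0.
have F1 n : holomorphic (Ball v t) (F n) by exact: sub_hol (Fh n).
have F2 n := hol_dq (@open_Ball _ v t) vt (F1 n).
have B1 n w : Ball v t w -> modulus (dq (F n) v w) <= M * (4 / t).
  by apply: dq_bound => // x /tr; exact: FM.
have B2 n w : Ball v t w -> modulus (dq (dq (F n) v) v w) <= M * (4 / t) * (4 / t).
  exact: (dq_bound (F2 n) (B1 n)).
have [s [sh [b bH]]] := @diag_complex _ (fun n _ => dq (F n) v v) (fun _ => M * (4 / t)) (fun n _ => B1 n v vt).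
pose Q := M * (4 / t) * (4 / t).
have Q0 : 0 <= Q by apply: le_trans (B2 0%N v vt); exact: mod_ge0.
apply: (@cder_derivable _ _ _ (b 0%N)); apply: cder_intro => e e0.
exists (Num.min t (e / (Q + 1))); first by rewrite lt_min t0 divr_gt0 //; lra.
move=> w; rewrite lt_min => /andP[wt we].
have Q1 : 0 < Q + 1 by lra.
have wr := tr _ wt.
have QE : Q * modulus (w - v) * modulus (w - v) <= e * modulus (w - v).
  rewrite ler_wpM2r ?mod_ge0 //; move: we; rewrite ltr_pdivlMr // => we.
  by have := mod_ge0 (w - v); lra.
apply: le_trans QE; rewrite leNgt; apply/negP => lt.
pose del := (modulus (g w - g v - b 0%N * (w - v)) - Q * modulus (w - v) * modulus (w - v)) / (4 * (1 + modulus (w - v))).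
have p4 : 0 < 4 * (1 + modulus (w - v)) by rewrite mulr_gt0 // ltr_pwDl ?mod_ge0.
have del0 : 0 < del by rewrite divr_gt0 // subr_gt0.
have [N1 H1] := Fg w wr del del0; have [N2 H2] := Fg v vr del del0.
have [N3 H3] := bH 0%N del del0.
pose n := maxn N1 (maxn N2 N3); pose k := s n.
have kn := subseq_ge sh n.
have h1 := H1 k (leq_trans (leq_maxl _ _) kn).
have h2 := H2 k (leq_trans (leq_trans (leq_maxl _ _) (leq_maxr _ _)) kn).
have h3 := H3 n (leq_trans (leq_maxr _ _) (leq_maxr _ _)).
have E : F k w = F k v + (w - v) * (dq (F k) v v + (w - v) * dq (dq (F k) v) v w).
  by rewrite -dqE -dqE.
have : modulus (g w - g v - b 0%N * (w - v)) <= del + del + del * modulus (w - v) + Q * modulus (w - v) * modulus (w - v).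
  have -> : g w - g v - b 0%N * (w - v) = - (F k w - g w) + (F k v - g v) +
     (dq (F k) v v - b 0%N) * (w - v) + (w - v) * (w - v) * dq (dq (F k) v) v w.
    by rewrite E; ring.
  apply: le_trans (modD _ _) _; apply: lerD.
    apply: le_trans (modD _ _) _; apply: lerD.
      by apply: le_trans (modD _ _) _; rewrite modN lerD // ltW.
    by rewrite modM ler_wpM2r ?mod_ge0 // ltW.
  rewrite !modM (_ : Q * _ * _ = modulus (w - v) * modulus (w - v) * Q); last by ring.
  by rewrite ler_wpM2l ?mulr_ge0 ?mod_ge0 //; exact: B2.
have : del * (4 * (1 + modulus (w - v))) = modulus (g w - g v - b 0%N * (w - v)) - Q * modulus (w - v) * modulus (w - v).
  by rewrite /del divfK // gt_eqF.
have : 0 <= del * modulus (w - v) by rewrite mulr_ge0 ?mod_ge0 // ltW.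
lra.
Qed.

(** Extract a subsequence for which all Taylor coefficients at the centre converge;
    the remainders decay geometrically, uniformly in the sequence. *)
Theorem montel_bounded F z r M : 0 < r -> (forall n, holomorphic (Ball z r) (F n)) ->
  (forall n v, Ball z r v -> modulus (F n v) <= M) ->
  exists s : nat -> nat, {homo s : i j / (i < j)%N} /\ exists g,
    holomorphic (Ball z (r / 8)) g /\ ucvg (fun n => F (s n)) g (Ball z (r / 8)).
Proof.
move=> r0 Fh FM; have zr := Ball_center z r0.
pose T n := fix T k := if k is k.+1 then dq (T k) z else F n.
have Th n k : holomorphic (Ball z r) (T n k).
  by elim: k => [|k IH]; [exact: Fh|exact: hol_dq (@open_Ball _ z r) zr IH].
have TM n k w : Ball z r w -> modulus (T n k w) <= M * (4 / r) ^+ k.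
  elim: k w => [|k IH] w wr; first by rewrite expr0 mulr1; exact: FM.
  by have := dq_bound (Th n k) IH wr; rewrite exprSr -[M * _ * _]mulrA.
have M0 : 0 <= M by apply: le_trans (FM 0%N z zr); exact: mod_ge0.
have TE n N w : F n w = \sum_(k < N) T n k z * (w - z) ^+ k + (w - z) ^+ N * T n N w.
  elim: N => [|N IH]; first by rewrite big_ord0 add0r expr0 mul1r.
  by rewrite IH big_ord_recr /= {1}[T n N w](dqE (T n N) z w) exprSr; ring.
have [s [sh [b bH]]] := @diag_complex _ (fun n k => T n k z) _ (fun n k => TM n k z zr).
have r8 : r / 8 < r by lra.
have sub w : Ball z (r / 8) w -> Ball z r w by apply: le_Ball; exact: ltW.
have tail n N w : Ball z (r / 8) w -> modulus ((w - z) ^+ N * T n N w) <= M * 2^-1 ^+ N.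
  move=> w8; rewrite modM modX.
  have h1 := TM n N w (sub w w8).
  have h2 : modulus (w - z) ^+ N <= (r / 8) ^+ N.
    by rewrite lerXn2r ?nnegrE ?mod_ge0 ?(ltW w8) // divr_ge0 // ltW.
  apply: le_trans (_ : (r / 8) ^+ N * (M * (4 / r) ^+ N) <= _).
    by apply: ler_pM => //; rewrite ?exprn_ge0 ?mod_ge0.
  rewrite mulrCA -exprMn; have -> : r / 8 * (4 / r) = 2^-1 by field; rewrite gt_eqF.
  by [].
have cau e : 0 < e -> exists N, forall n n', (N <= n)%N -> (N <= n')%N ->
    forall w, Ball z (r / 8) w -> modulus (F (s n) w - F (s n') w) < e.
  move=> e0; have [K KH] := @half_pow_small _ (4 * M) e e0.
  pose S := \sum_(k < K) (r / 8) ^+ k.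
  have S0 : 0 <= S by apply: sumr_ge0 => k _; rewrite exprn_ge0 // divr_ge0 // ltW.
  pose d := e / (4 * (S + 1)); have S1 : 0 < 4 * (S + 1) by lra.
  have d0 : 0 < d by rewrite divr_gt0.
  have [N NH] : exists N, forall n k, (N <= n)%N -> (k < K)%N -> modulus (T (s n) k z - b k) < d.
    elim: (K) => [|K' [N NH]]; first by exists 0%N.
    have [N' NH'] := bH K' d d0; exists (maxn N N') => n k.
    rewrite geq_max => /andP[n1 n2]; rewrite ltnS leq_eqVlt => /predU1P[->|]; first exact: NH'.
    exact: NH.
  exists N => n n' Nn Nn' w w8.
  rewrite (TE (s n) K) (TE (s n') K).
  have -> : forall A B A' B' : C R, A + B - (A' + B') = (A - A') + B - B' by move=> *; ring.
  rewrite -sumrB.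
  have h1 := tail (s n) K w w8; have h2 := tail (s n') K w w8.
  have h3 : modulus (\sum_(k < K) (T (s n) k z * (w - z) ^+ k - T (s n') k z * (w - z) ^+ k)) <= 2 * d * S.
    apply: le_trans (mod_sum _ _ _) _; rewrite /S mulr_sumr; apply: ler_sum => k _.
    rewrite -mulrBl modM modX; apply: ler_pM; rewrite ?exprn_ge0 ?mod_ge0 //.
      have := mod_dist_triangle (T (s n) k z) (T (s n') k z) (b k).
      by have := NH n k Nn (ltn_ord k); have := NH n' k Nn' (ltn_ord k); rewrite (mod_distC (b k)); lra.
    by rewrite lerXn2r ?nnegrE ?mod_ge0 ?(ltW w8) // divr_ge0 // ltW.
  have dE : d * (4 * (S + 1)) = e by rewrite /d divfK // gt_eqF.
  set X := \sum_(k < K) _ in h3 *.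
  set Y := (w - z) ^+ K * T (s n) K w in h1 *; set Z := (w - z) ^+ K * T (s n') K w in h2 *.
  have := modB (X + Y) Z; have := modD X Y; lra.
have lim w : exists l, Ball z (r / 8) w -> forall e, 0 < e -> exists N, forall n, (N <= n)%N ->
    modulus (F (s n) w - l) <= e.
  have [w8|nw8] := pselect (Ball z (r / 8) w); last by exists 0.
  have [|t [th [l lH]]] := @diag_complex _ (fun n _ => F (s n) w) (fun _ => M).
    by move=> n _; apply: FM; exact: sub.
  exists (l 0%N) => _ e e0.
  have [|N NH] := cau (e / 2); first exact: divr_gt0.
  have [|N' NH'] := lH 0%N (e / 2); first exact: divr_gt0.
  exists N => n Nn; pose n' := maxn N N'.
  have h1 := NH' n' (leq_maxr _ _).
  have h2 := NH n (t n') Nn (leq_trans (leq_maxl N N') (subseq_ge th n')) w w8.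
  by have := mod_dist_triangle (F (s n) w) (l 0%N) (F (s (t n')) w); lra.
have {lim}[g gH] := choice lim.
have gu : ucvg (fun n => F (s n)) g (Ball z (r / 8)).
  move=> e e0; have [|N NH] := cau (e / 4); first exact: divr_gt0.
  exists N => n Nn w w8; have [|N' NH'] := gH w w8 (e / 4); first exact: divr_gt0.
  have h1 := NH' (maxn N N') (leq_maxr _ _).
  have h2 := NH n (maxn N N') Nn (leq_maxl _ _) w w8.
  by have := mod_dist_triangle (F (s n) w) (g w) (F (s (maxn N N')) w); lra.
exists s; split => //; exists g; split => //.
apply: (@hol_limit (fun n => F (s n)) g z (r / 8) M).
- by move=> n; apply: sub_hol (Fh (s n)) => w /sub.
- by move=> n w /sub; exact: FM.
- by move=> w w8 e /gu[N NH]; exists N => n /NH; apply.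
Qed.

Lemma half_plane_dist (A B : C R) : 0 <= complex.Re A -> 0 <= complex.Re B ->
  modulus (A - B) <= modulus (A + B^*).
Proof.
move=> hA hB; rewrite -(@ler_pXn2r _ 2) ?nnegrE ?mod_ge0 // !mod_sqr.
have -> : complex.Re (A + B^*) = complex.Re A + complex.Re B by rewrite ReD; case: B {hB}.
have -> : complex.Im (A + B^*) = complex.Im A - complex.Im B by rewrite ImD; case: B {hB}.
rewrite ReD ImD ReN ImN lerD2r -subr_ge0.
have -> : (complex.Re A + complex.Re B) ^+ 2 - (complex.Re A - complex.Re B) ^+ 2 =
  4 * (complex.Re A * complex.Re B) by ring.
by rewrite !mulr_ge0.
Qed.

(** Schwarz' lemma for [(f - f z) / (f + conj (f z))], which maps into the disc. *)
Lemma schwarz_half_plane f z r w : holomorphic (Ball z r) f ->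
  (forall v, Ball z r v -> 0 <= complex.Re (f v)) -> 0 < complex.Re (f z) ->
  Ball z r w -> modulus (f w - f z) <= modulus (w - z) / r * modulus (f w + (f z)^*).
Proof.
move=> h fr fz wr.
have den v : Ball z r v -> f v + (f z)^* != 0.
  move=> vr; apply/eqP => /(congr1 (@complex.Re R)); rewrite ReD /=.
  have -> : complex.Re (f z)^* = complex.Re (f z) by case: (f z).
  by have := fr v vr; lra.
have gh : holomorphic (Ball z r) (fun v => (f v - f z) / (f v + (f z)^*)).
  by apply: hol_div den _ _; [exact: holB h (hol_cst (c := f z))|exact: holD h (hol_cst (c := (f z)^*))].
have gM v : Ball z r v -> modulus ((f v - f z) / (f v + (f z)^*)) <= 1.
  move=> vr; rewrite mod_div ler_pdivrMr ?mod_gt0 ?den // mul1r.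
  by apply: half_plane_dist; [exact: fr|exact: ltW].
have := schwarz gh gM _ wr; rewrite subrr mul0r mul1r => /(_ erefl).
by rewrite mod_div ler_pdivrMr ?mod_gt0 ?den.
Qed.

(** For [|w - z| <= r / 2] the half-plane form of Schwarz' lemma confines [f w] to a
    disc that is seen from the origin within these bounds. *)
Lemma harnack f z r w : holomorphic (Ball z r) f ->
  (forall v, Ball z r v -> 0 <= complex.Re (f v)) -> 0 < complex.Re (f z) ->
  modulus (w - z) <= r / 2 ->
  complex.Re (f w) <= 3 * complex.Re (f z) /\ complex.Re (f z) <= 3 * complex.Re (f w).
Proof.
move=> h fr fz wr2; have [r0|r0] := ltP 0 r; last first.
  have : modulus (w - z) <= 0 by apply: le_trans wr2 _; lra.
  by rewrite le_eqVlt ltNge mod_ge0 orbF mod_eq0 subr_eq0 => /eqP ->; lra.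
have wr : Ball z r w by rewrite /Ball /=; lra.
have H := schwarz_half_plane h fr fz wr.
set a := complex.Re (f w); set b := complex.Re (f z).
pose y := complex.Im (f w) - complex.Im (f z).
have a0 : 0 <= a := fr w wr; have b0 : 0 < b := fz.
have H2 : modulus (f w - f z) <= 2^-1 * modulus (f w + (f z)^*).
  apply: le_trans H _; rewrite ler_wpM2r ?mod_ge0 // ler_pdivrMr //; lra.
have : modulus (f w - f z) ^+ 2 <= (2^-1 * modulus (f w + (f z)^*)) ^+ 2.
  by rewrite ler_pXn2r // nnegrE ?mod_ge0 // mulr_ge0 ?mod_ge0.
rewrite exprMn !mod_sqr.
have -> : complex.Re (f w + (f z)^*) = a + b by rewrite ReD /a /b; case: (f z).
have -> : complex.Im (f w + (f z)^*) = y by rewrite ImD /y; case: (f z).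
have -> : complex.Re (f w - f z) = a - b by rewrite ReD ReN.
have -> : complex.Im (f w - f z) = y by rewrite ImD ImN.
move=> K; have y2 := sqr_ge0 y.
have : (a - b) ^+ 2 <= (2^-1 * (a + b)) ^+ 2 by rewrite [X in _ <= X]exprMn; nra.
have -> : (a - b) ^+ 2 = `|a - b| ^+ 2 by rewrite real_normK // num_real.
rewrite ler_pXn2r ?nnegrE ?normr_ge0 //; last by lra.
by rewrite ler_norml => /andP[h1 h2]; split; lra.
Qed.

(** Apply Harnack's inequality to [ln |f|] on both sides of the centre; each side
    costs a factor three in the logarithm. *)
Lemma modulus_harnack f z r w v : 0 < r -> holomorphic (Ball z r) f ->
  (forall u, Ball z r u -> 1 < modulus (f u)) ->
  modulus (w - z) <= r / 2 -> modulus (v - z) <= r / 2 ->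
  modulus (f w) <= modulus (f v) ^+ 9.
Proof.
move=> r0 h f1 wr vr; have zr := Ball_center z r0.
have f0 u : Ball z r u -> f u != 0.
  by move=> /f1 h1; rewrite -mod_gt0; apply: lt_trans h1.
have [c [cE _ _]] := cexp_surj (f0 z zr).
have [L [Lh Lz LE]] := hol_log r0 h f0 cE.
have Lp u : Ball z r u -> 0 < complex.Re (L u).
  by move=> ur; have := f1 u ur; rewrite -LE // mod_cexp -[1]expR0 ltr_expR.
have Lp' u : Ball z r u -> 0 <= complex.Re (L u) by move=> /Lp /ltW.
have [h1 _] := harnack Lh Lp' (Lp z zr) wr.
have [_ h2] := harnack Lh Lp' (Lp z zr) vr.
have sub u : modulus (u - z) <= r / 2 -> Ball z r u by rewrite /Ball /=; lra.
rewrite -(LE w (sub w wr)) -(LE v (sub v vr)) !mod_cexp -expRM_natl ler_expR.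
by rewrite -mulr_natl; lra.
Qed.

End Normality.

(** * The theorems of Bloch, Schottky, Picard and Montel *)

Section Schottky.
Context {R : realType}.
Implicit Types (f g : C R -> C R) (F : nat -> C R -> C R) (z w c d v : C R)
  (r rho m M e A : R) (U V : set (C R)).

(** Take [b] where [|f'|] times the distance to the boundary is nearly maximal: on a
    disc of comparable size [|f'|] exceeds [|f' b|] by a bounded factor only. *)
Lemma landau_point f z r : 0 < r -> holomorphic (Ball z r) f -> cD f z != 0 ->
  exists b t, [/\ 0 < t, Ball b (2 * t) `<=` Ball z (r / 2),
    modulus (cD f z) * (r / 2) <= 4 * (modulus (cD f b) * t), 0 < modulus (cD f b) &
    forall w, Ball b t w -> modulus (cD f w) <= 4 * modulus (cD f b)].
Proof.
move=> r0 h d0; pose rho := r / 2; have rho0 : 0 < rho by rewrite divr_gt0.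
have rr : rho < r by rewrite /rho; lra.
have h' := holo_cD (@open_Ball _ z r) h.
have [M [M0 MH]] := circle_max (contT_comp_circ (ltW rho0) rr h').
have bd w : Ball z rho w -> modulus (cD f w) <= M.
  by move=> wr; exact: max_modulus rr wr h' MH.
pose N w := modulus (cD f w) * (rho - modulus (w - z)).
pose S := [set N w | w in Ball z rho].
have zr := Ball_center z rho0.
have Nz : N z = modulus (cD f z) * rho by rewrite /N subrr mod0 subr0.
have Nz0 : 0 < N z by rewrite Nz mulr_gt0 // mod_gt0.
have sS : has_sup S.
  split; first by exists (N z), z.
  exists (M * rho) => _ [w wr <-]; apply: ler_pM; rewrite ?mod_ge0 ?bd //.
    by rewrite subr_ge0 ltW.
  by have := mod_ge0 (w - z); lra.
have S0 : N z <= sup S by apply: sup_upper_bound => //; exists z.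
have Sp : 0 < sup S / 2 by lra.
have [_ [b br <-] bS] := sup_adherent Sp sS.
pose t := (rho - modulus (b - z)) / 2.
have t0 : 0 < t by rewrite divr_gt0 // subr_gt0.
have Nb : N b = 2 * (modulus (cD f b) * t) by rewrite /N /t; field.
have mb : 0 < modulus (cD f b).
  have Nb0 : 0 < N b by lra.
  by move: Nb0; rewrite Nb pmulr_rgt0 // pmulr_lgt0.
exists b, t; split => //.
- by apply: Ball_sub; rewrite /t -/rho; lra.
- by rewrite -/rho -Nz; lra.
- move=> w wt; have wz : modulus (w - z) < rho - t.
    have := mod_dist_triangle w z b; move: wt; rewrite /Ball /= /t; lra.
  have : N w <= sup S by apply: sup_upper_bound => //; exists w => //; rewrite /Ball /=; lra.
  have : modulus (cD f w) * t <= N w.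
    by rewrite /N ler_wpM2l ?mod_ge0 //; lra.
  move=> h1 h2; have : modulus (cD f w) * t <= (4 * modulus (cD f b)) * t by lra.
  by rewrite ler_pM2r.
Qed.

(** At the point given by Landau's argument the function is nearly linear, so its
    image contains a disc of radius comparable to [|f' b| * t]. *)
Theorem bloch f z r A : 0 < r -> 0 < A -> holomorphic (Ball z r) f ->
  (forall c, exists2 v, Ball c A v & forall w, Ball z r w -> f w != v) ->
  modulus (cD f z) <= 640 * A / r.
Proof.
move=> r0 A0 h om; have [->|d0] := eqVneq (cD f z) 0.
  by rewrite mod0; apply: divr_ge0; [lra|exact: ltW].
have [b [t [t0 tB bt mb tM]]] := landau_point r0 h d0.
set mu := modulus (cD f b) in bt mb tM.
have rB : Ball z (r / 2) `<=` Ball z r by apply: le_Ball; lra.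
have h2 : holomorphic (Ball b (2 * t)) f by apply: sub_hol h => w /tB /rB.
have h1 : holomorphic (Ball b t) f by apply: sub_hol h2; apply: le_Ball; lra.
have h1' := holo_cD (@open_Ball _ b t) h1.
have bb := Ball_center b t0.
(* On the disc of radius [t / 10] the derivative varies by at most half of its
   value at [b]. *)
pose rho := t / 20; have rho0 : 0 < rho by rewrite divr_gt0.
pose rho' := t / 10.
have tB' : Ball b rho' `<=` Ball b t by apply: le_Ball; rewrite /rho'; lra.
have lin w : Ball b rho' w -> modulus (cD f w - cD f b) <= mu / 2.
  move=> wr; have wt := tB' w wr.
  have hd : holomorphic (Ball b t) (fun v => cD f v - cD f b).
    exact: holB h1' (hol_cst (c := cD f b)).
  have H5 v : Ball b t v -> modulus (cD f v - cD f b) <= 5 * mu.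
    by move=> vt; have := modB (cD f v) (cD f b); have := tM v vt; rewrite -/mu; lra.
  have H := schwarz hd H5 (subrr _) wt; apply: le_trans H _.
  have k : modulus (w - b) / t <= 10^-1.
    by rewrite ler_pdivrMr //; move: wr; rewrite /Ball /= /rho'; lra.
  have : mu * (modulus (w - b) / t) <= mu * 10^-1 by rewrite ler_wpM2l // mod_ge0.
  lra.
have rr' : rho < rho' by rewrite /rho /rho'; lra.
have r'0 : 0 < rho' by lra.
have app w : Ball b rho' w -> modulus (f w - f b - cD f b * (w - b)) <= mu / 2 * modulus (w - b).
  move=> wr.
  have := @cder_ball_bound _ (fun v => f v - cD f b * v) (fun v => cD f v - cD f b) b rho' (mu / 2) b w.
  have -> : f w - cD f b * w - (f b - cD f b * b) = f w - f b - cD f b * (w - b) by ring.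
  apply=> //; last exact: Ball_center.
  move=> v vr; apply: cderB; first exact: hol_cD h1 (tB' v vr).
  by have := cderZ (cD f b) (cder_id v); rewrite mulr1.
have low s : 0 <= s <= 2 * pi -> mu / 2 * rho <= modulus (f (circ b rho s) - f b).
  move=> _; have cm := @mod_circ _ b rho s (ltW rho0).
  have cB : Ball b rho' (circ b rho s) by rewrite /Ball /= cm.
  have := app _ cB; rewrite cm => h3.
  have := mod_dist_triangle (cD f b * (circ b rho s - b)) 0 (f (circ b rho s) - f b).
  rewrite !subr0 modM cm -/mu (mod_distC (cD f b * _)); lra.
have rt : rho < t by rewrite /rho; lra.
have [v vA vf] := om (f b).
have : A >= mu / 2 * rho / 2.
  rewrite leNgt; apply/negP => lt.
  have [|w wt wv] := cover_disc rho0 rt h1 low (c := v).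
    by apply: lt_trans lt; exact: vA.
  have t2 : t <= 2 * t by lra.
  by have := vf w (rB _ (tB _ (le_Ball t2 wt))); rewrite wv eqxx.
rewrite ler_pdivlMr // /rho; lra.
Qed.

(** On the positive half-line [cosh] grows by more than one over every interval of
    length two, so it takes an integer value there; and it has period [2 pi i]. *)
Lemma cosh_net c : exists2 v, Ball c 20 v &
  exists k : int, (cexp v + cexp (- v)) / 2 = k%:~R.
Proof.
pose ch (x : R) := (expR x + expR (- x)) / 2.
have chc : continuous ch.
  move=> x; apply: cvgM; last exact: cvg_cst.
  apply: cvgD; first exact: continuous_expR.
  by apply: (@continuous_comp _ _ _ (fun x : R => - x) expR); [exact: opp_continuous|exact: continuous_expR].
have pos (x : R) : 0 <= x -> exists s, `|s - x| <= 2 /\ exists k : int, ch s = k%:~R.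
  move=> x0; pose k := Num.ceil (ch x).
  have k1 : ch x <= k%:~R by exact: Num.Theory.ceil_ge.
  have k2 : k%:~R <= ch x + 1.
    by have := Num.Theory.ceilB1_lt (ch x); rewrite -/k intrB; lra.
  have step : ch x + 1 <= ch (x + 2).
    have e1 : 1 <= expR x by rewrite -expR0 ler_expR.
    have e2 : expR (- x) <= 1 by rewrite -expR0 ler_expR; lra.
    have e3 : 4 <= expR 2 :> R.
      have -> : 2 = 1 + 1 :> R by [].
      rewrite expRD; have := @expR_ge1Dx R 1; nra.
    have e4 : 0 <= expR (- (x + 2)) by exact: expR_ge0.
    rewrite /ch expRD; nra.
  have x2 : x <= x + 2 by lra.
  have bt : Num.min (ch x) (ch (x + 2)) <= k%:~R <= Num.max (ch x) (ch (x + 2)).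
    by rewrite ge_min k1 /= le_max (le_trans k2 step) orbT.
  have [s sI sE] := @IVT R ch x (x + 2) k%:~R x2 (continuous_subspaceT chc) bt.
  exists s; split; last by exists k.
  by move: sI; rewrite in_itv /= ler_norml => /andP[h1 h2]; apply/andP; split; lra.
have net (x : R) : exists s, `|s - x| <= 2 /\ exists k : int, ch s = k%:~R.
  have [/pos//|x0] := leP 0 x; have [|s [sx [k kE]]] := pos (- x); first by lra.
  exists (- s); split.
    by move: sx; rewrite opprK -[X in _ -> X <= _]normrN opprD !opprK.
  by exists k; rewrite -kE /ch opprK addrC.
have [s [sx [k kE]]] := net (complex.Re c).
have tp := @twopi_gt0 R.
pose j := Num.floor (complex.Im c / (2 * pi)).
have j1 := Num.Theory.floor_le (complex.Im c / (2 * pi)).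
have j2 := Num.Theory.floorD1_gt (complex.Im c / (2 * pi)).
rewrite -/j in j1 j2; rewrite ler_pdivlMr // in j1; rewrite intrD ltr_pdivrMr // in j2.
have p4 : 2 * pi <= 8 :> R by have [/andP[_]] := pihalf_02_cos_pihalf R; lra.
pose v := rC s + j%:~R * period.
have vE : cexp v = rC (expR s) by rewrite cexpD cexp_period mulr1 cexp_rC.
exists v; last first.
  exists k; rewrite cexpN vE -rCV -expRN.
  have -> : k%:~R = rC (ch s) :> C R by rewrite kE [RHS](rmorph_int (real_complex R)).
  by rewrite /ch rCM rCD rCV rCn.
rewrite /Ball /=; apply: le_lt_trans (mod_le_ReIm _) _.
have jE : j%:~R * period = iC * rC (2 * pi * j%:~R) :> C R.
  rewrite /period !rCM rCn; have -> : rC (j%:~R) = j%:~R :> C R by exact: (rmorph_int (real_complex R)).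
  ring.
have re : complex.Re v = s by rewrite /v jE ReD ReM /=; ring.
have im : complex.Im v = 2 * pi * j%:~R by rewrite /v jE ImD ImM /=; ring.
rewrite ReD ReN ImD ImN re im.
have : `|2 * pi * j%:~R - complex.Im c| <= 8.
  by rewrite ler_norml; apply/andP; split; lra.
lra.
Qed.

(** Take a logarithm of [g], divided by [2 pi i]; it omits the integers, in particular
    [1] and [-1], so that it is in turn the hyperbolic cosine of a function [v]. *)
Lemma omit_01_lift g z r : 0 < r -> holomorphic (Ball z r) g ->
  (forall w, Ball z r w -> g w != 0 /\ g w != 1) ->
  exists v : C R -> C R, [/\ holomorphic (Ball z r) v,
    forall w, Ball z r w -> g w = cexp (period * ((cexp (v w) + cexp (- v w)) / 2)) &
    modulus (v z) <= 2 * (`|ln (modulus (g z))| + 4) + 5].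
Proof.
move=> r0 h g01; have zr := Ball_center z r0.
have g0 w : Ball z r w -> g w != 0 by move=> /g01[].
have pi4 : pi <= 4 :> R by have [/andP[_]] := pihalf_02_cos_pihalf R; lra.
have p0 : (period : C R) != 0 := period_neq0.
have mp : modulus (period : C R) = 2 * pi.
  by rewrite !modM mod_iC mod_rC mod_nat mulr1 ger0_norm ?pi_ge0.
have mp1 : 1 <= modulus (period : C R) by rewrite mp; have := pi_ge2 R; lra.
have [c [cE cr ci]] := cexp_surj (g0 z zr).
have [L [Lh Lz LE]] := hol_log r0 h g0 cE.
pose l w := L w / period.
have lh : holomorphic (Ball z r) l by exact: holM Lh (hol_cst (c := period^-1)).
have gE w : Ball z r w -> g w = cexp (period * l w).
  by move=> wr; rewrite -LE // /l mulrC divfK.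
have lZ w (k : int) : Ball z r w -> l w != k%:~R.
  move=> wr; apply/eqP => lk; have [_ /eqP] := g01 w wr; apply.
  by rewrite gE // lk mulrC cexp_period.
have lz : modulus (l z) <= `|ln (modulus (g z))| + 4.
  rewrite /l Lz mod_div ler_pdivrMr; last by apply: lt_le_trans mp1.
  have := mod_le_ReIm c; rewrite cr => h1.
  have : (`|ln (modulus (g z))| + 4) * 1 <= (`|ln (modulus (g z))| + 4) * modulus (period : C R).
    by rewrite ler_wpM2l // addr_ge0.
  lra.
have q0 w : Ball z r w -> l w ^+ 2 - 1 != 0.
  move=> wr; have -> : l w ^+ 2 - 1 = (l w - 1%:~R) * (l w - (-1)%:~R).
    by rewrite rmorphN1 rmorph1; ring.
  by rewrite mulf_neq0 // subr_eq0; exact: lZ.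
have qh : holomorphic (Ball z r) (fun w => l w ^+ 2 - 1).
  exact: holB (holX (n := 2) lh) (hol_cst (c := 1)).
have [c2 [c2E _ _]] := cexp_surj (q0 z zr).
have [L2 [L2h _ L2E]] := hol_log r0 qh q0 c2E.
pose sq w := cexp (L2 w / 2).
have sqh : holomorphic (Ball z r) sq by exact: hol_cexpf (holM L2h (hol_cst (c := 2^-1))).
have sq2 w : Ball z r w -> sq w ^+ 2 = l w ^+ 2 - 1.
  move=> wr; rewrite -L2E // /sq -cexpMn; congr cexp.
  by rewrite mulrC divfK // pnatr_eq0.
pose u w := l w + sq w.
have uh : holomorphic (Ball z r) u by exact: holD lh sqh.
have uV w : Ball z r w -> u w * (l w - sq w) = 1.
  by move=> wr; rewrite /u; have := sq2 w wr => e; ring: e.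
have u0 w : Ball z r w -> u w != 0.
  by move=> /uV; apply: contra_eqN => /eqP ->; rewrite mul0r eq_sym oner_eq0.
have [d [dE dr di]] := cexp_surj (u0 z zr).
have [v [vh vz vE]] := hol_log r0 uh u0 dE.
have chv w : Ball z r w -> (cexp (v w) + cexp (- v w)) / 2 = l w.
  move=> wr; rewrite cexpN vE //.
  have -> : (u w)^-1 = l w - sq w by apply: (mulfI (u0 w wr)); rewrite divff ?u0 // uV.
  by rewrite /u; field.
exists v; split => //; first by move=> w wr; rewrite chv // gE.
rewrite vz; apply: le_trans (mod_le_ReIm _) _; rewrite dr.
suff : `|ln (modulus (u z))| <= 2 * modulus (l z) + 1 by lra.
have sqz : modulus (sq z) <= modulus (l z) + 1.
  rewrite -(@ler_pXn2r _ 2) ?nnegrE ?mod_ge0 // ?addr_ge0 ?mod_ge0 //.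
  rewrite -modX sq2 //; apply: le_trans (modB _ _) _; rewrite modX mod1 sqrrD1.
  by have := mod_ge0 (l z); lra.
have b1 : modulus (u z) <= 2 * modulus (l z) + 1 by have := modD (l z) (sq z); rewrite -/(u z); lra.
have b2 : (modulus (u z))^-1 <= 2 * modulus (l z) + 1.
  rewrite -modV (_ : (u z)^-1 = l z - sq z); last first.
    by apply: (mulfI (u0 z zr)); rewrite divff ?u0 // uV.
  by have := modB (l z) (sq z); lra.
have up : 0 < modulus (u z) by rewrite mod_gt0 u0.
have lnle (x y : R) : 0 < x -> x <= y -> ln x <= y.
  move=> x0 xy; rewrite -[y]expRK ler_ln ?posrE ?expR_gt0 //.
  by apply: le_trans xy _; have := expR_ge1Dx y; lra.
rewrite ler_norml; apply/andP; split; last exact: lnle.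
by have := lnle _ _ (_ : 0 < (modulus (u z))^-1) b2; rewrite lnV ?posrE // invr_gt0 => /(_ up); lra.
Qed.

(** The function [v] of the previous lemma omits a net, so Bloch's theorem bounds its
    derivative, and hence [v] itself on half the disc. *)
Lemma schottky_aux A : exists S, forall g z r, 0 < r -> holomorphic (Ball z r) g ->
  (forall w, Ball z r w -> g w != 0 /\ g w != 1) ->
  2^-1 <= modulus (g z) <= A -> forall w, Ball z (r / 2) w -> modulus (g w) <= S.
Proof.
(* The first summand bounds [v z]; the second is the derivative bound of Bloch's
   theorem for a net of mesh 20, times the radius. *)
pose K : R := 2 * (2 + `|A| + 4) + 5 + 640 * 20.
exists (expR (8 * expR K)) => g z r r0 h g01 /andP[gl gA] w w2.
have zr := Ball_center z r0.
have [v [vh vE vz]] := omit_01_lift r0 h g01.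
have om x : Ball z r x -> forall c, exists2 u, Ball c 20 u &
    forall y, Ball z r y -> v y != u.
  move=> _ c; have [u uB [k kE]] := cosh_net c; exists u => // y yr.
  apply/eqP => vy; have [_ /eqP] := g01 y yr; apply.
  by rewrite vE // vy kE mulrC cexp_period.
have r20 : 0 < r / 2 by rewrite divr_gt0.
have dB x : Ball z (r / 2) x -> modulus (cD v x) <= 640 * 20 / (r / 2).
  move=> x2; have xr : Ball x (r / 2) `<=` Ball z r.
    by apply: Ball_sub; move: x2; rewrite /Ball /=; lra.
  apply: bloch => //; first exact: sub_hol vh.
  move=> c; have [u uB uN] := om z zr c; exists u => // y /xr; exact: uN.
have v2 : holomorphic (Ball z (r / 2)) v by apply: sub_hol vh; apply: le_Ball; lra.
have := @cder_ball_bound _ v (cD v) z (r / 2) _ z w (fun x x2 => hol_cD v2 x2) dB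
  (Ball_center z r20) w2.
move=> dv; have vw : modulus (v w) <= K.
  have : 640 * 20 / (r / 2) * modulus (w - z) <= 640 * 20.
    rewrite mulrAC ler_pdivrMr //; apply: ler_wpM2l; [lra|exact: ltW].
  have := mod_dist_triangle (v w) 0 (v z); rewrite !subr0.
  have : `|ln (modulus (g z))| <= 2 + `|A|.
    have gz : 0 < modulus (g z) by apply: lt_le_trans gl.
    have lnle (x y : R) : 0 < x -> x <= y -> ln x <= y.
      move=> x0 xy; rewrite -[y]expRK ler_ln ?posrE ?expR_gt0 //.
      by apply: le_trans xy _; have := expR_ge1Dx y; lra.
    rewrite ler_norml; apply/andP; split.
      have : (modulus (g z))^-1 <= 2 by rewrite invf_ple ?posrE.
      move=> /(lnle _ _ (_ : 0 < (modulus (g z))^-1)); rewrite lnV ?posrE // invr_gt0.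
      by move=> /(_ gz); have := normr_ge0 A; lra.
    by have := lnle _ _ gz gA; have := ler_norm A; lra.
  by rewrite /K; lra.
rewrite vE; last by apply: le_Ball w2; lra.
rewrite mod_cexp ler_expR; apply: le_trans (le_trans (ler_norm _) (Re_le_mod _)) _.
rewrite modM mod_div mod_nat.
have -> : modulus (period : C R) = 2 * pi.
  by rewrite !modM mod_iC mod_rC mod_nat mulr1 ger0_norm ?pi_ge0.
have pi4 : pi <= 4 :> R by have [/andP[_]] := pihalf_02_cos_pihalf R; lra.
have eb x : modulus x <= K -> modulus (cexp x) <= expR K.
  move=> xK; rewrite mod_cexp ler_expR.
  exact: le_trans (le_trans (ler_norm _) (Re_le_mod _)) xK.
have : modulus (cexp (v w) + cexp (- v w)) / 2 <= expR K.
  have := modD (cexp (v w)) (cexp (- v w)); have := eb _ vw.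
  by have := eb (- v w); rewrite modN => /(_ vw); lra.
have := mod_ge0 (cexp (v w) + cexp (- v w)) => m0 mK.
by apply: ler_pM; rewrite ?twopi_ge0 ?divr_ge0 //; lra.
Qed.

(** When [g z] is close to [0], the previous bound applies to [1 - g]. *)
Theorem schottky A : exists S, forall g z r, 0 < r -> holomorphic (Ball z r) g ->
  (forall w, Ball z r w -> g w != 0 /\ g w != 1) -> modulus (g z) <= A ->
  forall w, Ball z (r / 2) w -> modulus (g w) <= S.
Proof.
have [S SH] := schottky_aux (Num.max A 2).
exists (S + 1) => g z r r0 h g01 gA w w2.
have [g2|g2] := leP 2^-1 (modulus (g z)).
  have := SH g z r r0 h g01 _ w w2; rewrite g2 le_max gA => /(_ isT); lra.
have h1 : holomorphic (Ball z r) (fun w => 1 - g w) by exact: holB (hol_cst (c := 1)) h.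
have g01' y : Ball z r y -> 1 - g y != 0 /\ 1 - g y != 1.
  move=> /g01[n0 n1]; split; first by rewrite subr_eq0 eq_sym.
  by rewrite -subr_eq0 addrAC subrr add0r oppr_eq0.
have b1 := modBB 1 (g z); have b2 := modB 1 (g z); rewrite mod1 in b1 b2.
have := SH _ z r r0 h1 g01' _ w w2.
have -> : 2^-1 <= modulus (1 - g z) <= Num.max A 2.
  by rewrite le_max; apply/andP; split; [lra|apply/orP; right; lra].
move=> /(_ isT) b3; have := modB 1 (1 - g w); rewrite mod1.
have -> : 1 - (1 - g w) = g w by ring.
lra.
Qed.

(** Schottky's theorem on discs of growing radius bounds the function, and
    Liouville's theorem concludes. *)
Theorem picard g : holomorphic setT g -> (forall w, g w != 0 /\ g w != 1) ->
  forall w, g w = g 0.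
Proof.
move=> h g01; have [S SH] := schottky (modulus (g 0)).
apply: (liouville h (M := S)) => z.
have r0 : 0 < 2 * (modulus z + 1) by rewrite mulr_gt0 // ltr_wpDl ?mod_ge0.
apply: (SH g 0 _ r0) => //; first exact: sub_hol h.
by rewrite /Ball /= subr0 mulrC mulKf // ltrDl.
Qed.

Lemma infinitely_or (P Q : nat -> Prop) : (forall n, P n \/ Q n) ->
  infinitely P \/ infinitely Q.
Proof.
move=> PQ; have [|/not_infinitely[m mP]] := pselect (infinitely P); first by left.
right=> k; exists (maxn m k).+1; split; first by rewrite ltnS leq_maxr.
have [Pn|//] := PQ (maxn m k).+1; exfalso; apply: mP Pn.
by rewrite ltnS leq_maxl.
Qed.

(** Up to passing to reciprocals, a subsequence is bounded at the centre, hence near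
    it by Schottky's theorem. The second omitted value may vary, since only the
    quotients [F n / c n] enter. *)
Theorem montel_omit F (c : nat -> C R) rho z r : 0 < r -> 0 < rho ->
  (forall n, modulus (c n) = rho) -> (forall n, holomorphic (Ball z r) (F n)) ->
  (forall n w, Ball z r w -> F n w != 0 /\ F n w != c n) ->
  exists s : nat -> nat, {homo s : i j / (i < j)%N} /\ exists g,
    holomorphic (Ball z (r / 16)) g /\
    (ucvg (fun n => F (s n)) g (Ball z (r / 16)) \/
     ucvg (fun n w => (F (s n) w)^-1) g (Ball z (r / 16))).
Proof.
move=> r0 rho0 cn Fh F0c; have r20 : 0 < r / 2 by rewrite divr_gt0.
have [S SH] := schottky 1.
have e8 : r / 2 / 8 = r / 16 by field.
have sub : Ball z (r / 2) `<=` Ball z r by apply: le_Ball; lra.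
have c0 n : c n != 0 by rewrite -mod_gt0 cn.
pose G n w := F n w / c n.
have Gh n : holomorphic (Ball z r) (G n) by exact: holM (Fh n) (hol_cst (c := (c n)^-1)).
have G01 n w : Ball z r w -> G n w != 0 /\ G n w != 1.
  move=> /(F0c n)[n0 n1]; rewrite /G mulf_neq0 ?invr_eq0 //; split => //.
  by apply: contra_neq n1 => /(congr1 ( *%R^~ (c n))); rewrite divfK // mul1r.
have [inf|inf] : infinitely (fun n => modulus (G n z) <= 1) \/
    infinitely (fun n => modulus (G n z)^-1 <= 1).
  apply: infinitely_or => n; have [|h1] := leP (modulus (G n z)) 1; first by left.
  by right; rewrite modV invf_le1 ?(ltW h1) // (lt_trans ltr01).
- have [s [sh sH]] := infinitely_subseq inf.
  have [] := @montel_bounded _ (fun n => F (s n)) z (r / 2) (S * rho) r20.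
  + by move=> n; apply: sub_hol (Fh (s n)).
  + move=> n v v2; have := SH _ z r r0 (Gh (s n)) (G01 (s n)) (sH n) v v2.
    by rewrite mod_div cn ler_pdivrMr.
  move=> t [th [g [gh gu]]]; rewrite e8 in gh gu.
  exists (fun n => s (t n)); split; first by move=> i j ij; exact/sh/th.
  by exists g; split => //; left.
- have [s [sh sH]] := infinitely_subseq inf.
  have Vh n : holomorphic (Ball z r) (fun w => (F n w)^-1).
    by apply: holV (Fh n) => w /(F0c n)[].
  have GVh n : holomorphic (Ball z r) (fun w => (G n w)^-1).
    by apply: holV (Gh n) => w /(G01 n)[].
  have V01 n w : Ball z r w -> (G n w)^-1 != 0 /\ (G n w)^-1 != 1.
    by move=> /(G01 n)[n0 n1]; rewrite invr_eq0 invr_eq1.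
  have [] := @montel_bounded _ (fun n w => (F (s n) w)^-1) z (r / 2) (S / rho) r20.
  + by move=> n; apply: sub_hol (Vh (s n)).
  + move=> n v v2; have := SH _ z r r0 (GVh (s n)) (V01 (s n)) (sH n) v v2.
    by rewrite ler_pdivlMr // /G invf_div mod_div cn modV mulrC.
  move=> t [th [g [gh gu]]]; rewrite e8 in gh gu.
  exists (fun n => s (t n)); split; first by move=> i j ij; exact/sh/th.
  by exists g; split => //; right.
Qed.

End Schottky.

(** * The Fatou set in the chordal metric *)

Section Chordal.
Context {R : realType}.
Implicit Types (z w x y : C R) (u v t : option (C R)) (e c : R).

Let sq z : R := Num.sqrt (1 + modulus z ^+ 2).

Let sq_sqr z : sq z ^+ 2 = 1 + modulus z ^+ 2.
Proof. by rewrite sqr_sqrtr // addr_ge0 // sqr_ge0. Qed.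

Let sq_gt0 z : 0 < sq z.
Proof. by rewrite sqrtr_gt0 ltr_pwDl // sqr_ge0. Qed.

Let sq_ge1 z : 1 <= sq z.
Proof.
rewrite -(@ler_pXn2r _ 2) ?nnegrE ?(ltW (sq_gt0 z)) // sq_sqr expr1n lerDl.
exact: sqr_ge0.
Qed.

Let sq_gem z : modulus z <= sq z.
Proof.
by rewrite -(@ler_pXn2r _ 2) ?nnegrE ?mod_ge0 ?(ltW (sq_gt0 z)) // sq_sqr lerDr.
Qed.

Let sq_le z : sq z <= 1 + modulus z.
Proof.
rewrite -(@ler_pXn2r _ 2) ?nnegrE ?addr_ge0 ?mod_ge0 ?(ltW (sq_gt0 z)) // sq_sqr.
by rewrite sqrrD expr1n mul1r; have := mod_ge0 z; lra.
Qed.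

Let sq_dist z w : sq z <= modulus (z - w) + sq w.
Proof.
rewrite -(@ler_pXn2r _ 2) ?nnegrE ?addr_ge0 ?mod_ge0 ?(ltW (sq_gt0 _)) // sq_sqr.
have := mod_dist_triangle z 0 w; rewrite !subr0 => h.
have := sq_gem w; have := mod_ge0 w; have := mod_ge0 z; have := mod_ge0 (z - w).
move=> h1 h2 h3 h4; rewrite sqrrD sq_sqr.
have : modulus z ^+ 2 <= (modulus (z - w) + modulus w) ^+ 2.
  by rewrite ler_pXn2r // nnegrE // addr_ge0.
rewrite sqrrD; have : modulus (z - w) * modulus w <= modulus (z - w) * sq w by rewrite ler_wpM2l.
rewrite !mulr2n; lra.
Qed.

Lemma chordal_sym u v : chordal u v = chordal v u.
Proof.
by case: u v => [z|] [w|] //=; rewrite mod_distC [X in _ / X]mulrC.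
Qed.

Let conj1 z w : modulus (1 + z^* * w) <= sq z * sq w.
Proof.
rewrite -(@ler_pXn2r _ 2) ?nnegrE ?mod_ge0 ?mulr_ge0 ?(ltW (sq_gt0 _)) //.
rewrite exprMn !sq_sqr; have h : modulus (1 + z^* * w) <= 1 + modulus z * modulus w.
  by apply: le_trans (modD _ _) _; rewrite mod1 modM mod_conj.
apply: le_trans (_ : (1 + modulus z * modulus w) ^+ 2 <= _).
  by rewrite ler_pXn2r // nnegrE ?mod_ge0 // addr_ge0 // mulr_ge0 ?mod_ge0.
have := sqr_ge0 (modulus z - modulus w); rewrite sqrrB !sqrrD exprMn !expr2; lra.
Qed.

(** The triangle inequality for three finite points comes from the identity
    [(z - w) (1 + |x|^2) = (z - x) (1 + conj x w) + (x - w) (1 + conj x z)]. *)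
Lemma chordal_triangle u v t : chordal u v <= chordal u t + chordal t v.
Proof.
have p2 z : 0 <= 2 / sq z by rewrite divr_ge0 // ltW // sq_gt0.
have n0 z : sq z != 0 by rewrite gt_eqF // sq_gt0.
have pp z w : 0 < sq z * sq w by rewrite mulr_gt0 // sq_gt0.
case: u v t => [z|] [w|] [x|]; rewrite /= -?/(sq _) ?addr0 ?add0r //.
- rewrite ler_pdivrMr ?pp //.
  have -> : (2 * modulus (z - x) / (sq z * sq x) + 2 * modulus (x - w) / (sq x * sq w)) *
     (sq z * sq w) = 2 * (modulus (z - x) * sq w + modulus (x - w) * sq z) / sq x.
    by field; rewrite !n0.
  rewrite ler_pdivlMr ?sq_gt0 // -mulrA ler_pM2l //.
  have sx := sq_gt0 x; rewrite -(ler_pM2r sx) -mulrA -expr2 sq_sqr.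
  have e1 : modulus (z - w) * (1 + modulus x ^+ 2) = modulus ((z - w) * (1 + x^* * x)).
    rewrite modM; congr (_ * _); rewrite mulrC conj_mod2 -rC1 -rCD mod_rC ger0_norm //.
    by rewrite addr_ge0 // sqr_ge0.
  rewrite e1.
  have -> : (z - w) * (1 + x^* * x) = (z - x) * (1 + x^* * w) + (x - w) * (1 + x^* * z) by ring.
  apply: le_trans (modD _ _) _; rewrite !modM mulrDl; apply: lerD.
    by rewrite -mulrA ler_wpM2l ?mod_ge0 // [_ * sq x]mulrC conj1.
  by rewrite -mulrA ler_wpM2l ?mod_ge0 // [_ * sq x]mulrC conj1.
- rewrite ler_pdivrMr ?pp //.
  have -> : (2 / sq z + 2 / sq w) * (sq z * sq w) = 2 * (sq w + sq z) by field; rewrite !n0.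
  rewrite ler_pM2l //; have := modB z w; have := sq_gem z; have := sq_gem w; lra.
- rewrite ler_pdivrMr ?sq_gt0 //.
  have -> : (2 * modulus (z - x) / (sq z * sq x) + 2 / sq x) * sq z =
    2 * (modulus (z - x) + sq z) / sq x by field; rewrite !n0.
  by rewrite ler_pdivlMr ?sq_gt0 // ler_pM2l //; have := sq_dist x z; rewrite mod_distC.
- rewrite ler_pdivrMr ?sq_gt0 //.
  have -> : (2 / sq x + 2 * modulus (x - w) / (sq x * sq w)) * sq w =
    2 * (modulus (x - w) + sq w) / sq x by field; rewrite !n0.
  by rewrite ler_pdivlMr ?sq_gt0 // ler_pM2l //; exact: sq_dist.
- by rewrite addr_ge0.
Qed.

Lemma chordal_le z w : chordal (Some z) (Some w) <= 2 * modulus (z - w).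
Proof.
rewrite /= -!/(sq _) ler_pdivrMr ?mulr_gt0 ?sq_gt0 //.
rewrite -[X in X <= _]mulr1 ler_wpM2l ?mulr_ge0 ?mod_ge0 //.
by rewrite -[1]mulr1 ler_pM // sq_ge1.
Qed.

Lemma chordal_ge z w (c : R) : 0 <= c -> chordal (Some z) (Some w) < c ->
  2 * modulus (z - w) <= c * ((1 + modulus z) * (1 + modulus w)).
Proof.
move=> c0; rewrite /= -!/(sq _) ltr_pdivrMr ?mulr_gt0 ?sq_gt0 // => /ltW h.
apply: le_trans h _; rewrite ler_wpM2l //.
by apply: ler_pM; rewrite ?(ltW (sq_gt0 _)) ?sq_le.
Qed.

(** With the next lemma: under equicontinuity, a function that is at least [1] at the
    centre is bounded below nearby, and one that is at most [1] is bounded above. *)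
Lemma chordal_large z w : chordal (Some z) (Some w) < 4^-1 -> 1 <= modulus w ->
  2^-1 <= modulus z.
Proof.
move=> h w1; rewrite leNgt; apply/negP => z2.
have q : (0 : R) <= 4^-1 by rewrite invr_ge0.
have := chordal_ge q h; have := modBB w z; rewrite (mod_distC w) => h1 h2.
have := mod_ge0 z; move: (modulus z) (modulus w) (modulus (z - w)) => a b d in w1 z2 h1 h2 *.
nra.
Qed.

Lemma chordal_small z w : chordal (Some z) (Some w) < 4^-1 -> modulus w <= 1 ->
  modulus z <= 2.
Proof.
move=> h w1; rewrite leNgt; apply/negP => z2.
have q : (0 : R) <= 4^-1 by rewrite invr_ge0.
have := chordal_ge q h; have := modBB z w => h1 h2.
have := mod_ge0 w; move: (modulus z) (modulus w) (modulus (z - w)) => a b d in w1 z2 h1 h2 *.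
nra.
Qed.

Definition sph_inv x := if x == 0 then None else Some x^-1.

Lemma chordal_inv z x : z != 0 -> chordal (Some z) (sph_inv x) <= 2 * modulus (z^-1 - x).
Proof.
move=> z0; rewrite /sph_inv; case: eqVneq => [->|x0] /=; rewrite -!/(sq _).
  rewrite subr0 modV ler_pM2l // lef_pV2 ?posrE ?mod_gt0 ?sq_gt0 //; exact: sq_gem.
rewrite ler_pdivrMr ?mulr_gt0 ?sq_gt0 // -mulrA ler_pM2l //.
have -> : z - x^-1 = - (z * x^-1) * (z^-1 - x) by field; rewrite z0 x0.
rewrite modM modN modM mulrC ler_wpM2l ?mod_ge0 //.
by apply: ler_pM; rewrite ?mod_ge0 ?sq_gem.
Qed.

Definition sph_add (c0 : C R) u : option (C R) := if u is Some z then Some (c0 + z) else None.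

Let sq_add (c0 : C R) z : sq z <= (1 + modulus c0) * sq (c0 + z).
Proof.
have := sq_dist z (c0 + z); rewrite opprD addrCA subrr addr0 modN => h.
have := sq_ge1 (c0 + z); have := mod_ge0 c0; nra.
Qed.

(** Lets a pair of omitted values be translated so that one of them is [0]. *)
Lemma chordal_add (c0 : C R) u v : chordal (sph_add c0 u) (sph_add c0 v) <=
  (1 + modulus c0) ^+ 2 * chordal u v.
Proof.
have n0 z : sq z != 0 by rewrite gt_eqF // sq_gt0.
have k1 : 1 <= 1 + modulus c0 by rewrite lerDl mod_ge0.
have one z : 2 / sq (c0 + z) <= (1 + modulus c0) ^+ 2 * (2 / sq z).
  rewrite ler_pdivrMr ?sq_gt0 // mulrA mulrAC ler_pdivlMr ?sq_gt0 //.
  have := sq_add c0 z; have := sq_gt0 (c0 + z); have := sq_gt0 z; rewrite expr2.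
  move: (sq z) (sq (c0 + z)) (1 + modulus c0) k1 => s t k k1 s0 t0 h.
  have : k * t <= k * (k * t) by rewrite ler_peMl // mulr_ge0 ?(ltW t0) // (le_trans ler01).
  lra.
case: u v => [z|] [w|] /=; rewrite -?/(sq _) ?mulr0 //.
have -> : c0 + z - (c0 + w) = z - w by ring.
rewrite mulrA ler_pdivlMr ?mulr_gt0 ?sq_gt0 // mulrAC ler_pdivrMr ?mulr_gt0 ?sq_gt0 //.
have := sq_add c0 z; have := sq_add c0 w => h1 h2.
have : sq z * sq w <= (1 + modulus c0) * sq (c0 + z) * ((1 + modulus c0) * sq (c0 + w)).
  by apply: ler_pM; rewrite ?(ltW (sq_gt0 _)).
have : 0 <= 2 * modulus (z - w) by rewrite mulr_ge0 // mod_ge0.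
move=> m0 h; have := ler_wpM2l m0 h; rewrite expr2; lra.
Qed.

End Chordal.

Section Normal.
Context {R : realType}.
Implicit Types (f g : C R -> C R) (F : nat -> C R -> C R) (z w c v : C R)
  (r rho e : R) (U V : set (C R)).

(** Convergence is asked uniformly on all of [U] rather than on compact subsets;
    every point of the Fatou set has a ball on which this stronger form holds. *)
Definition unormal F U := forall k : nat -> nat, exists s : nat -> nat,
  {homo s : i j / (i < j)%N} /\ exists g : C R -> option (C R),
    forall e, 0 < e -> exists N, forall n, (N <= n)%N -> forall w, U w ->
      chordal (Some (F (k (s n)) w)) (g w) < e.

Lemma unormal_fatou f z r : 0 < r -> unormal (fun n => iter n f) (Ball z r) -> Defs.fatou f z.
Proof.
move=> r0 H; exists (Ball z r); split; [exact: open_Ball|exact: Ball_center|].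
move=> k; have [s [sh [g gH]]] := H k; exists s; split => //; exists g.
move=> K _ KB e e0; have [N NH] := gH e e0; exists N => // n Nn w /KB.
exact: NH.
Qed.

(** A closed square serves as the compact neighbourhood demanded by normality. *)
Lemma compact_square z r : 0 < r -> exists K : set (C R),
  [/\ compact K, Ball z (r / 3) `<=` K & K `<=` Ball z r].
Proof.
move=> r0; pose x := complex.Re z; pose y := complex.Im z; pose d := r / 3.
pose S := `[x - d, x + d]%classic `*` `[y - d, y + d]%classic.
pose P (p : R * R) : C R := rC p.1 + iC * rC p.2.
have Pc p : cont P p.
  apply: contD.
    exact: (@cont_comp _ _ _ (fun p : R * R => p.1) (@rC R) p (cont_fst p) (cont_rC _)).
  apply: contM; first exact: cont_cst.
  exact: (@cont_comp _ _ _ (fun p : R * R => p.2) (@rC R) p (cont_snd p) (cont_rC _)).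
exists (P @` S); split.
- apply: continuous_compact; last by apply: compact_setX; exact: segment_compact.
  by apply: continuous_subspaceT => p; case: (Pc p).
- move=> w wd; exists (complex.Re w, complex.Im w); last by rewrite /P /= -CE.
  have h1 := Re_le_mod (w - z); have h2 := Im_le_mod (w - z).
  rewrite ReD ReN in h1; rewrite ImD ImN in h2; rewrite /Ball /= -/d in wd.
  have := le_lt_trans h1 wd; have := le_lt_trans h2 wd.
  rewrite /S /= !in_itv /= /x /y !ltr_norml => /andP[a1 a2] /andP[b1 b2].
  by split; apply/andP; split; lra.
- move=> _ [[u v] [/= hu hv] <-]; rewrite /Ball /=.
  apply: le_lt_trans (mod_le_ReIm _) _.
  have e1 : complex.Re (P (u, v)) = u by rewrite /P ReD ReM /=; ring.
  have e2 : complex.Im (P (u, v)) = v by rewrite /P ImD ImM /=; ring.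
  rewrite ReD ReN ImD ImN e1 e2 -/x -/y.
  move: hu hv; rewrite !in_itv /= => /andP[a1 a2] /andP[b1 b2].
  have : `|u - x| <= d by rewrite ler_norml; apply/andP; split; lra.
  have : `|v - y| <= d by rewrite ler_norml; apply/andP; split; lra.
  rewrite /d; lra.
Qed.

Lemma fatou_unormal f z : Defs.fatou f z -> exists2 r, 0 < r &
  unormal (fun n => iter n f) (Ball z r).
Proof.
move=> [V [/openP Vo Vz H]]; have [r r0 rV] := Vo z Vz.
have [K [Kc BK KB]] := compact_square z r0.
exists (r / 3); first by rewrite divr_gt0.
move=> k; have [s [sh [g gH]]] := H k; exists s; split => //; exists g => e e0.
have [N _ NH] := gH K Kc (fun w Kw => rV w (KB w Kw)) e e0.
by exists N => n Nn w /BK; exact: NH.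
Qed.

Lemma ucvg_chordal F g U : ucvg F g U ->
  forall e, 0 < e -> exists N, forall n, (N <= n)%N -> forall w, U w ->
    chordal (Some (F n w)) (Some (g w)) < e.
Proof.
move=> H e e0; have [|N NH] := H (e / 2); first exact: divr_gt0.
exists N => n Nn w Uw; apply: le_lt_trans (chordal_le _ _) _.
by have := NH n Nn w Uw; lra.
Qed.

Lemma ucvgV_chordal F g U : (forall n w, U w -> F n w != 0) ->
  ucvg (fun n w => (F n w)^-1) g U ->
  forall e, 0 < e -> exists N, forall n, (N <= n)%N -> forall w, U w ->
    chordal (Some (F n w)) (sph_inv (g w)) < e.
Proof.
move=> F0 H e e0; have [|N NH] := H (e / 2); first exact: divr_gt0.
exists N => n Nn w Uw; apply: le_lt_trans (chordal_inv _ (F0 n w Uw)) _.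
by have := NH n Nn w Uw; lra.
Qed.

Lemma hol_iter f n : entire f -> entire (iter n f).
Proof.
move=> h; elim: n => [|n IH]; first exact: hol_id.
exact: (@hol_comp _ setT setT (iter n f) f (fun _ _ => I) IH h).
Qed.

(** After translating [c] to the origin this is Montel's theorem with a constant
    second value. *)
Lemma omit_fatou f z r c d : 0 < r -> entire f -> c != d ->
  (forall n w, Ball z r w -> iter n f w != c /\ iter n f w != d) -> Defs.fatou f z.
Proof.
move=> r0 h cd om; apply: (@unormal_fatou f z (r / 16)); first by rewrite divr_gt0.
move=> k; pose F n w := iter (k n) f w - c.
have B16 : Ball z (r / 16) `<=` Ball z r by apply: le_Ball; lra.
have [] := @montel_omit _ F (fun=> d - c) (modulus (d - c)) z r r0.
- by rewrite mod_gt0 subr_eq0 eq_sym.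
- by [].
- move=> n; have hn : holomorphic (Ball z r) (iter (k n) f) by apply: sub_hol (hol_iter (n := k n) h).
  exact: holB hn (hol_cst (c := c)).
- move=> n w /(om (k n))[n0 n1]; rewrite !subr_eq0 n0; split => //.
  by rewrite /F; apply: contra_neq n1 => /addIr.
move=> s [sh [g [gh gu]]]; exists s; split => //.
have [G GH] : exists G : C R -> option (C R), forall e, 0 < e -> exists N, forall n, (N <= n)%N ->
    forall w, Ball z (r / 16) w -> chordal (Some (F (s n) w)) (G w) < e.
  case: gu => gu; first by exists (fun w => Some (g w)); exact: ucvg_chordal.
  exists (fun w => sph_inv (g w)); apply: ucvgV_chordal gu => n w /B16 /(om (k (s n)))[n0 _].
  by rewrite subr_eq0.
exists (fun w => sph_add c (G w)) => e e0.
have p2 : 0 < (1 + modulus c) ^+ 2 by rewrite exprn_gt0 // ltr_wpDr ?mod_ge0.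
have [|N NH] := GH (e / (1 + modulus c) ^+ 2); first exact: divr_gt0.
exists N => n Nn w wB; have := NH n Nn w wB; rewrite ltr_pdivlMr // mulrC => lt.
apply: le_lt_trans lt; apply: le_trans (chordal_add _ _ _).
by rewrite /F /sph_add addrC subrK.
Qed.

(** Without equicontinuity there are bad points tending to the centre; along a convergent
    subsequence of the corresponding functions a single one of them, which is
    continuous, controls all later ones. *)
Lemma unormal_equi F z r e : 0 < r -> (forall n, cont (F n) z) ->
  unormal F (Ball z r) -> 0 < e -> exists2 d, 0 < d & forall n w, Ball z d w ->
    chordal (Some (F n w)) (Some (F n z)) < e.
Proof.
move=> r0 Fc H e0; apply: contrapT => N.
have /choice[p pH] : forall j : nat, exists p : nat * C R, Ball z j.+1%:R^-1 p.2 /\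
    e <= chordal (Some (F p.1 p.2)) (Some (F p.1 z)).
  move=> j; apply: contrapT => H'; apply: N; exists j.+1%:R^-1; first by rewrite invr_gt0.
  by move=> n w wB; rewrite ltNge; apply/negP => h; apply: H'; exists (n, w).
have [s [sh [g gH]]] := H (fun j => (p j).1).
have [|J JH] := gH (e / 8); first exact: divr_gt0.
pose m := (p (s J)).1.
have /contCP/(_ (e / 16))[|t t0 tH] := Fc m; first exact: divr_gt0.
pose q := Num.min t r; have q0 : 0 < q by rewrite lt_min t0.
pose N' := Num.Def.archi_bound q^-1.
have N'H : q^-1 < N'%:R by apply: archi_boundP; rewrite invr_ge0 ltW.
pose j := maxn J N'; pose w := (p (s j)).2.
have [wB eB] := pH (s j).
have wq : Ball z q w.
  apply: le_Ball wB; rewrite invf_ple ?posrE // ltW //; apply: lt_le_trans N'H _.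
  by rewrite ler_nat; apply: leq_trans (leq_maxr J N') (leq_trans (subseq_ge sh j) (leqnSn _)).
have wr : Ball z r w by apply: le_Ball wq; rewrite ge_min lexx orbT.
have wt : Ball z t w by apply: le_Ball wq; rewrite ge_min lexx.
have zr := Ball_center z r0.
have h1 := JH j (leq_maxl _ _) w wr; have h2 := JH J (leqnn _) w wr.
have h3 := JH J (leqnn _) z zr; have h4 := JH j (leq_maxl _ _) z zr.
have h5 : chordal (Some (F m w)) (Some (F m z)) < e / 8.
  by apply: le_lt_trans (chordal_le _ _) _; have := tH w wt; lra.
have := chordal_triangle (Some (F (p (s j)).1 w)) (Some (F (p (s j)).1 z)) (g w).
have := chordal_triangle (g w) (Some (F (p (s j)).1 z)) (Some (F m w)).
have := chordal_triangle (Some (F m w)) (Some (F (p (s j)).1 z)) (Some (F m z)).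
have := chordal_triangle (Some (F m z)) (Some (F (p (s j)).1 z)) (g z).
rewrite (chordal_sym (g w) (Some (F m w))) (chordal_sym (g z) (Some (F (p (s j)).1 z))).
move: h1 h2 h3 h4 eB.
by cbv beta; rewrite -/m -/w; lra.
Qed.

End Normal.

(** * Growth of entire functions and orbits of lifts *)

Section Growth.
Context {R : realType}.
Implicit Types (f g : C R -> C R) (z w c : C R) (r rho M e : R).

Lemma circle_argmax (u : R -> C R) : contT u -> exists2 t, 0 <= t <= 2 * pi &
  forall s, 0 <= s <= 2 * pi -> modulus (u s) <= modulus (u t).
Proof.
move=> uc; have [|c cI H] := @EVT_max R (fun s => modulus (u s)) 0 (2 * pi) (twopi_ge0).
  apply: continuous_subspaceT => s.
  exact: (contE _ _).1 (cont_comp (uc s) (cont_mod _)).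
exists c; first by move: cI; rewrite in_itv.
by move=> s s01; apply: H; rewrite in_itv.
Qed.

Lemma max_on_circle f z rho w : entire f -> modulus (w - z) <= rho ->
  exists w', modulus (w' - z) = rho /\ modulus (f w) <= modulus (f w').
Proof.
move=> h; rewrite le_eqVlt => /predU1P[wr|wr]; first by exists w.
have rho0 : 0 <= rho by apply: le_trans (ltW wr); exact: mod_ge0.
have hB : holomorphic (Ball z (rho + 1)) f by apply: sub_hol h.
have rr : rho < rho + 1 by rewrite ltrDl.
have [t _ tH] := circle_argmax (contT_comp_circ rho0 rr hB).
exists (circ z rho t); rewrite mod_circ //; split => //.
exact: max_modulus rr wr hB tH.
Qed.

Lemma ln_le_sqrt r : 0 < r -> ln r <= 2 * Num.sqrt r.
Proof.
move=> r0; have s0 : 0 < Num.sqrt r by rewrite sqrtr_gt0.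
rewrite -{1}(sqr_sqrtr (ltW r0)) expr2 lnM ?posrE //.
suff : ln (Num.sqrt r) <= Num.sqrt r by lra.
rewrite -[X in _ <= X]expRK ler_ln ?posrE ?expR_gt0 //.
by have := expR_ge1Dx (Num.sqrt r); lra.
Qed.

Lemma archi_nat (x : R) : exists n : nat, x < n%:R.
Proof.
exists (Num.Def.archi_bound `|x|); apply: le_lt_trans (ler_norm x) _.
exact: archi_boundP (normr_ge0 _).
Qed.

(** If [h] grew only polynomially on arbitrarily large circles, the real part of [H]
    would be at most logarithmic there, and Schwarz' lemma for half-planes would
    make [H] constant. *)
Lemma super_polynomial (m D : nat) (K : R) (H h : C R -> C R) : entire H ->
  ~ (exists c, forall w, H w = c) -> (forall w, h w = w ^+ m * cexp (H w)) ->
  exists2 r0 : R, 1 <= r0 & forall r, r0 <= r ->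
    exists2 w, modulus w < r & K * r ^+ D < modulus (h w).
Proof.
move=> Hh Hnc hE; apply: contrapT => N; apply: Hnc; exists (H 0) => w.
pose L := Num.max K 1; have L1 : 1 <= L by rewrite /L le_max lexx orbT.
have L0 : 0 < L by apply: lt_le_trans L1.
have inf r0 : exists2 r, 1 <= r /\ r0 <= r & forall w, modulus w < r -> modulus (h w) <= L * r ^+ D.
  apply: contrapT => N'; apply: N; exists (Num.max 1 r0); first by rewrite le_max lexx.
  move=> r rr; apply: contrapT => N''; apply: N'; exists r.
    by move: rr; rewrite ge_max => /andP[].
  have r1 : 1 <= r by move: rr; rewrite ge_max => /andP[].
  move=> v vr; rewrite leNgt; apply/negP => lt; apply: N''; exists v => //.
  apply: le_lt_trans lt; rewrite ler_wpM2r ?exprn_ge0 ?(le_trans _ r1) //.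
  by rewrite /L le_max lexx.
have HB r : 2 <= r -> (forall w, modulus w < r -> modulus (h w) <= L * r ^+ D) ->
    forall v, Ball 0 (r / 2) v -> complex.Re (H v) <= ln (L * r ^+ D).
  move=> r2 hr v vB; have Lr : 0 < L * r ^+ D by rewrite mulr_gt0 // exprn_gt0 //; lra.
  have [|v' [v'r vE]] := @max_on_circle (fun x => cexp (H x)) 0 (r / 2) v (hol_cexpf Hh).
    exact: ltW.
  rewrite subr0 in v'r; rewrite -ler_expR lnK ?posrE // -mod_cexp; apply: le_trans vE _.
  have v'1 : 1 <= modulus v' by rewrite v'r; lra.
  have := hr v' _; rewrite hE modM modX v'r => /(_ _) h1.
  have {h1} : (r / 2) ^+ m * modulus (cexp (H v')) <= L * r ^+ D by apply: h1; lra.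
  apply: le_trans; rewrite -[X in X <= _]mul1r ler_wpM2r ?mod_ge0 //.
  by apply: exprn_ege1; lra.
apply/eqP; rewrite -subr_eq0 -mod_eq0 eq_le mod_ge0 andbT leNgt; apply/negP => p0.
pose a := modulus (H w) + modulus (H 0) + 2 * (ln L + 1) ; pose q := modulus w.
have q0 : 0 <= q := mod_ge0 w.
have lnL : 0 <= ln L by rewrite ln_ge0.
have a0 : 0 < a by rewrite /a; have := mod_ge0 (H w); have := mod_ge0 (H 0); lra.
pose p := modulus (H w - H 0); rewrite -/p in p0.
pose B := 2 * q * (a + 4 * D%:R).
have B0 : 0 <= B by rewrite /B !mulr_ge0 // addr_ge0 ?(ltW a0) // mulr_ge0.
have [r [r1 rr] hr] := inf (Num.max (2 * q + 2) ((B / p + 1) ^+ 2)).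
move: rr; rewrite ge_max => /andP[rq rB].
have r2 : 2 <= r by lra.
have rp : 0 < r by lra.
have s0 : 0 < Num.sqrt r by rewrite sqrtr_gt0.
have s2 : Num.sqrt r ^+ 2 = r by rewrite sqr_sqrtr // ltW.
have s1 : 1 <= Num.sqrt r by rewrite -(@ler_pXn2r _ 2) ?nnegrE ?(ltW s0) // s2 expr1n.
have sB : B / p + 1 <= Num.sqrt r.
  by rewrite -(@ler_pXn2r _ 2) ?nnegrE ?(ltW s0) // ?s2 // addr_ge0 // divr_ge0 // ltW.
have Lr : 0 < L * r ^+ D by rewrite mulr_gt0 // exprn_gt0.
pose A := ln (L * r ^+ D).
have AE : A <= ln L + 2 * D%:R * Num.sqrt r.
  rewrite /A lnM ?posrE ?exprn_gt0 // lnXn // lerD2l -[_ *+ D]mulr_natl.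
  have := ln_le_sqrt rp; have : 0 <= D%:R :> R by [].
  by move=> D0 hs; rewrite -mulrA mulrCA ler_wpM2l.
have Fh : holomorphic (Ball 0 (r / 2)) (fun v => rC (A + 1) - H v).
  by apply: holB (hol_cst (c := rC (A + 1))) _; apply: sub_hol Hh.
have Fr v : Ball 0 (r / 2) v -> 0 < complex.Re (rC (A + 1) - H v).
  by move=> vB; rewrite ReD ReN /=; have := HB r r2 hr v vB; rewrite -/A; lra.
have r20 : 0 < r / 2 by rewrite divr_gt0.
have wB : Ball 0 (r / 2) w by rewrite /Ball /= subr0 -/q; lra.
have := schwarz_half_plane Fh (fun v vB => ltW (Fr v vB)) (Fr 0 (Ball_center 0 r20)) wB.
have -> : rC (A + 1) - H w - (rC (A + 1) - H 0) = - (H w - H 0) by ring.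
rewrite modN subr0 -/p -/q.
set X := rC (A + 1) - H w + _.
have A0 : 0 <= A by rewrite /A ln_ge0 // -[1]mulr1; apply: ler_pM => //; apply: exprn_ege1.
have XB : modulus X <= 2 * (A + 1) + modulus (H w) + modulus (H 0).
  rewrite /X; apply: le_trans (modD _ _) _; rewrite mod_conj.
  have := modB (rC (A + 1)) (H w); have := modB (rC (A + 1)) (H 0).
  by rewrite mod_rC ger0_norm //; lra.
move=> h1.
have h2 : modulus X <= (a + 4 * D%:R) * Num.sqrt r.
  apply: le_trans XB _; rewrite mulrDl.
  have : a * 1 <= a * Num.sqrt r by rewrite ler_wpM2l // ltW.
  rewrite /a; lra.
have h3 : p * r <= B * Num.sqrt r.
  have : p * r <= (q / (r / 2) * modulus X) * r by rewrite ler_pM2r.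
  have -> : q / (r / 2) * modulus X * r = 2 * q * modulus X by field; rewrite gt_eqF.
  move=> hs; apply: le_trans hs _; rewrite /B -[X in _ <= X]mulrA.
  by apply: ler_wpM2l h2; rewrite mulr_ge0.
have : p * Num.sqrt r <= B.
  by move: h3; rewrite -{1}s2 expr2 mulrA ler_pM2r.
have : B < p * Num.sqrt r; last by lra.
have hs : B / p < Num.sqrt r by lra.
by move: hs; rewrite ltr_pdivrMr // mulrC.
Qed.

(** If no large circle were covered, then on some large disc [h] would omit a value of modulus [r ^ D] and one of
    modulus [2 r ^ D], and Schottky's theorem, applied after an affine change of the
    target, would limit the growth of [h]. *)
Lemma bohr (h : C R -> C R) (D : nat) : entire h -> (0 < D)%N ->
  (forall K : R, exists2 r0 : R, 1 <= r0 & forall r, r0 <= r ->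
    exists2 w, modulus w < r & K * r ^+ D < modulus (h w)) ->
  exists2 r0 : R, 1 <= r0 & forall r, r0 <= r -> exists2 rho, r ^+ D <= rho &
    forall c, modulus c = rho -> exists2 w, modulus w < r & h w = c.
Proof.
move=> hh D0 big; have [S SH] := @schottky R 2.
have [r1 r11 r1H] := big (2 ^+ D * (1 + 3 * `|S|)).
pose r0 := Num.max (2 * r1) (modulus (h 0)).
have r01 : 2 * r1 <= r0 by rewrite le_max lexx.
exists r0; first by lra.
move=> r rr; have rp : 0 < r by lra.
have r1' : 1 <= r by lra.
have hr : modulus (h 0) <= r ^+ D.
  apply: le_trans (_ : r <= _); first by apply: le_trans rr; rewrite le_max lexx orbT.
  by rewrite -[X in X <= _]expr1; apply: ler_weXn2l.
pose Q := r ^+ D; have Q0 : 0 < Q by rewrite exprn_gt0.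
rewrite -/Q in hr.
apply: contrapT => N.
have omit rho : Q <= rho -> exists2 c, modulus c = rho & forall w, Ball 0 r w -> h w != c.
  move=> Qrho; apply: contrapT => N'; apply: N; exists rho => // c cr.
  apply: contrapT => N''; apply: N'; exists c => // w wr.
  by apply/eqP => hw; apply: N''; exists w => //; rewrite -[w]subr0.
have [a am aH] := omit Q (lexx _).
have [b bm bH] := omit (2 * Q) (ltac:(lra)).
have ba : Q <= modulus (b - a) by have := modBB b a; lra.
have ba0 : b - a != 0 by rewrite -mod_gt0; lra.
have hB : holomorphic (Ball 0 r) h by apply: sub_hol hh.
have gh : holomorphic (Ball 0 r) (fun w => (h w - a) / (b - a)).
  exact: holM (holB hB (hol_cst (c := a))) (hol_cst (c := (b - a)^-1)).
have g01 w : Ball 0 r w -> (h w - a) / (b - a) != 0 /\ (h w - a) / (b - a) != 1.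
  move=> wr; split; first by rewrite mulf_neq0 ?invr_eq0 // subr_eq0 aH.
  apply/eqP => /(congr1 ( *%R^~ (b - a))); rewrite divfK // mul1r => /addIr/eqP.
  by rewrite (negPf (bH w wr)).
have g0 : modulus ((h 0 - a) / (b - a)) <= 2.
  rewrite mod_div ler_pdivrMr ?mod_gt0 //; have := modB (h 0) a; lra.
have [|w wr wh] := r1H (r / 2); first by lra.
have := SH _ 0 r rp gh g01 g0 w; rewrite /Ball /= subr0 => /(_ wr).
rewrite mod_div ler_pdivrMr ?mod_gt0 // => h1.
have h2 : modulus (b - a) <= 3 * Q by have := modB b a; lra.
have h3 : modulus (h w) <= Q + 3 * `|S| * Q.
  have := modBB (h w) a; have : S * modulus (b - a) <= `|S| * (3 * Q).
    apply: le_trans (_ : `|S| * modulus (b - a) <= _).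
      by rewrite ler_wpM2r ?mod_ge0 // ler_norm.
    by rewrite ler_wpM2l.
  lra.
move: wh; rewrite mulrAC -exprMn mulrCA divff ?pnatr_eq0 // mulr1 -/Q; lra.
Qed.

Lemma entire_of_exp (m : nat) (H h : C R -> C R) : entire H ->
  (forall w, h w = w ^+ m * cexp (H w)) -> entire h.
Proof.
move=> Hh hE; rewrite (_ : h = fun w => w ^+ m * cexp (H w)); last exact/funext.
exact: holM (holX (n := m) (@hol_id _ _)) (hol_cexpf Hh).
Qed.

(** By Bohr's theorem the image of each disc contains a circle of radius at least
    [r ^ D]; iterate this, using the maximum principle to move from circles to
    discs. *)
Lemma fast_iterates (m D : nat) (H h : C R -> C R) : entire H -> (0 < D)%N ->
  ~ (exists c, forall w, H w = c) -> (forall w, h w = w ^+ m * cexp (H w)) ->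
  exists2 r0 : R, 1 <= r0 & forall (t : nat) r, r0 <= r -> exists w, modulus w = r /\
    r ^+ (D ^ t) <= modulus (iter t h w).
Proof.
move=> Hh D0 Hnc hE; have hh := entire_of_exp Hh hE.
have [r0 r01 r0H] := bohr hh D0 (fun K => super_polynomial D K Hh Hnc hE).
exists r0 => //; have main t : forall r, r0 <= r -> exists w, modulus w <= r /\
    r ^+ (D ^ t) <= modulus (iter t h w).
  elim: t => [|t IH] r rr; have rp : 0 <= r by lra.
    exists (rC r); rewrite mod_rC ger0_norm // expn0 expr1 /= mod_rC ger0_norm //.
  have r1 : 1 <= r by lra.
  have [|w' [w'r w'H]] := IH (r ^+ D).
    by apply: le_trans rr _; rewrite -[X in X <= _]expr1; apply: ler_weXn2l.
  have [rho rrho rhoH] := r0H r rr.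
  have [|v [vr vH]] := @max_on_circle (iter t h) 0 rho w' (hol_iter hh).
    by rewrite subr0; exact: le_trans rrho.
  rewrite subr0 in vr; have [w wr wv] := rhoH v vr.
  exists w; split; first exact: ltW.
  by rewrite iterSr wv expnS exprM; apply: le_trans vH.
move=> t r rr; have [w [wr wH]] := main t r rr.
have [|v [vr vH]] := @max_on_circle (iter t h) 0 r w (hol_iter hh).
  by rewrite subr0.
by rewrite subr0 in vr; exists v; split => //; exact: le_trans vH.
Qed.

End Growth.

Section Semiconjugacy.
Context {R : realType}.
Implicit Types (z w c : C R) (r rho M e : R).

(** By continuity it is locally constant. *)
Lemma lattice_const (u : C R -> C R) (b : C R) z r : b != 0 ->
  (forall w, Ball z r w -> cont u w) ->
  (forall w, Ball z r w -> exists k : int, u w = k%:~R * b) ->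
  forall w, Ball z r w -> u w = u z.
Proof.
move=> b0 uc uZ w wr; have r0 : 0 < r by apply: le_lt_trans wr; exact: mod_ge0.
have zr := Ball_center z r0.
apply: (@cder_ball_eq _ u (fun=> u z) (fun=> 0) z r) => // [v vr|v _]; last exact: cder_cst.
have /contCP/(_ (modulus b))[|d d0 dH] := uc v vr; first by rewrite mod_gt0.
pose q := Num.min d (r - modulus (v - z)).
have q0 : 0 < q by rewrite lt_min d0 subr_gt0.
apply: (@cder_near _ (fun=> u v) u v 0 q q0) (cder_cst _ _) => x xq.
have xd : modulus (x - v) < d by apply: lt_le_trans xq _; rewrite ge_min lexx.
have xr : Ball z r x.
  apply: (@Ball_sub _ z v (r - modulus (v - z))); first by rewrite addrC subrK.
  by apply: le_Ball xq; rewrite ge_min lexx orbT.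
have [k kE] := uZ v vr; have [l lE] := uZ x xr.
have := dH x xd; rewrite kE lE -mulrBl -intrB modM.
rewrite -[X in _ < X]mul1r ltr_pM2r ?mod_gt0 //.
have -> : ((l - k)%:~R : C R) = rC ((l - k)%:~R) by rewrite [RHS](rmorph_int (real_complex R)).
rewrite mod_rC -intr_norm -[1]/(1%:~R) ltr_int => lk.
have : `|l - k| = 0 by apply/eqP; rewrite eq_le normr_ge0 andbT -ltzD1 add0r.
by move=> /eqP; rewrite normr_eq0 subr_eq0 => /eqP ->.
Qed.

Variables (m : nat) (H h : C R -> C R) (a : C R) (f : C R -> C R).
Hypothesis H_entire : entire H.
Hypothesis H_nonconstant : ~ exists c : C R, forall w, H w = c.
Hypothesis hE : forall w, h w = w ^+ m * cexp (H w).
Hypothesis a_neq0 : a != 0.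
Hypothesis f_lift : lifts a h f.

Let f_entire : entire f. Proof. by case: f_lift => -[]. Qed.
Let h_entire : entire h. Proof. exact: entire_of_exp H_entire hE. Qed.
Let T : C R := period / a.

Lemma exp_map_iter n z : iter n h (exp_map a z) = exp_map a (iter n f z).
Proof. by case: f_lift => _ E; elim: n => [//|n IH]; rewrite !iterS IH E. Qed.

Lemma exp_map_neq0 z : exp_map a z != 0.
Proof. exact: cexp_neq0. Qed.

Lemma exp_map_shift z (k : int) : exp_map a (z + k%:~R * T) = exp_map a z.
Proof.
rewrite /exp_map; have -> : a * (z + k%:~R * T) = a * z + k%:~R * period.
  by rewrite /T; field.
by rewrite cexpD cexp_period mulr1.
Qed.

Lemma exp_map_eq z w : exp_map a z = exp_map a w -> exists k : int, z = w + k%:~R * T.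
Proof.
move=> /cexp_eq[k kE]; exists k; apply: (mulfI a_neq0); rewrite kE /T.
by field.
Qed.

Lemma exp_map_surj w : w != 0 -> exists z, exp_map a z = w.
Proof.
move=> /cexp_surj[c [cE _ _]]; exists (c / a); rewrite /exp_map mulrC divfK //.
Qed.

(** Both sides of the semiconjugacy have the same exponential; their difference is
    continuous with values in the periods. *)
Lemma lift_form : exists c, forall z, f z = m%:R * z + H (exp_map a z) / a + c.
Proof.
pose u z := a * f z - (m%:R * (a * z) + H (exp_map a z)).
have Ec (U : set (C R)) : holomorphic U (exp_map a).
  by apply: hol_cexpf; exact: holM (hol_cst (c := a)) (@hol_id _ U).
have uh : entire u.
  apply: holB; first exact: holM (hol_cst (c := a)) f_entire.
  apply: holD; last exact: (@hol_comp _ setT setT (exp_map a) H (fun _ _ => I) (Ec setT) H_entire).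
  apply: holM (hol_cst (c := m%:R)) _.
  exact: holM (hol_cst (c := a)) (@hol_id _ setT).
have uZ z : exists k : int, u z = k%:~R * period.
  have [k kE] : exists k : int, a * f z = m%:R * (a * z) + H (exp_map a z) + k%:~R * period.
    apply: cexp_eq; rewrite cexpD cexpMn -[cexp (a * z)]/(exp_map a z) -hE.
    by case: f_lift => _ ->.
  by exists k; rewrite /u kE addrAC subrr add0r.
have uE z : u z = u 0.
  apply: (@lattice_const u period 0 (modulus z + 1)) => [|w _|w _|].
  - exact: period_neq0.
  - exact: hol_cont uh I.
  - exact: uZ.
  - by rewrite /Ball /= subr0 ltrDl.
exists (u 0 / a) => z; rewrite -(uE z) /u; field; exact: a_neq0.
Qed.

Lemma lift_shift z (k : int) : f (z + k%:~R * T) = f z + m%:R * k%:~R * T.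
Proof. by have [c cE] := lift_form; rewrite !cE exp_map_shift; ring. Qed.

(** The function [exp (a (f z - z))] omits [0]. If it also omitted [1] it would be
    constant by Picard's theorem, and [f] would be an affine polynomial. *)
Lemma fixed_mod_period : exists z (k : int), f z = z + k%:~R * T.
Proof.
pose g z := cexp (a * (f z - z)).
have uh : entire (fun z => a * (f z - z)).
  exact: holM (hol_cst (c := a)) (holB f_entire (@hol_id _ setT)).
have gh : entire g by exact: hol_cexpf uh.
have [[z gz]|N] := pselect (exists z, g z = 1).
  have [k kE] := cexp_eq1 gz; exists z, k.
  by apply: (mulfI a_neq0); rewrite -[a * f z](subrK (a * z)) -mulrBr kE /T; field.
have g01 z : g z != 0 /\ g z != 1.
  by split; [exact: cexp_neq0|apply/eqP => gz; apply: N; exists z].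
have gc := picard gh g01.
exfalso; case: f_lift => -[_ np] _; apply: np.
have uE z : a * (f z - z) = a * (f 0 - 0).
  apply/eqP; rewrite -subr_eq0; apply/eqP.
  rewrite (@lattice_const (fun z => a * (f z - z) - a * (f 0 - 0)) period 0 (modulus z + 1)).
  - by rewrite subrr.
  - exact: period_neq0.
  - by move=> w _; apply: contB; [exact: hol_cont uh I|exact: cont_cst].
  - move=> w _; apply: cexp_eq1; rewrite cexpB -[cexp (a * (f w - w))]/(g w) gc.
    by rewrite divff // cexp_neq0.
  - by rewrite /Ball /= subr0 ltrDl.
exists ('X + (f 0)%:P)%R => z; rewrite !hornerE.
by have := mulfI a_neq0 (uE z); rewrite subr0 => <-; ring.
Qed.

(** A point fixed modulo the period [T] moves by integer multiples of [T], and
    these multiples satisfy an affine recursion. *)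
Lemma slow_orbit z (k l : int) : f z = z + k%:~R * T ->
  exists2 c : R, 0 < c & forall t : nat,
    modulus (iter t f (z + l%:~R * T)) <= c * (m%:R + `|k%:~R : R| + 1) ^+ t.
Proof.
move=> fz; pose D : R := m%:R + `|k%:~R : R| + 1.
have D1 : 1 <= D by rewrite /D lerDr addr_ge0.
have jH t : exists j : int, iter t f (z + l%:~R * T) = z + j%:~R * T /\
    `|j%:~R : R| + 1 <= D ^+ t * (`|l%:~R : R| + 1).
  elim: t => [|t [j [jE jB]]]; first by exists l; rewrite expr0 mul1r.
  exists (k + m%:Z * j); split.
    by rewrite iterS jE lift_shift fz intrD intrM -pmulrn; ring.
  rewrite exprS -mulrA; apply: le_trans (_ : D * (`|j%:~R : R| + 1) <= _); last first.
    by rewrite ler_wpM2l // (le_trans ler01).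
  rewrite intrD intrM -pmulrn; have := ler_normD (k%:~R : R) (m%:R * j%:~R).
  rewrite normrM [`|m%:R|]ger0_norm // /D; have := normr_ge0 (k%:~R : R).
  have := normr_ge0 (j%:~R : R); have : 0 <= m%:R :> R by [].
  move: (`|k%:~R|) (`|j%:~R|) (m%:R : R) => x y v v0 y0 x0 hh.
  have : 0 <= x * y by rewrite mulr_ge0.
  lra.
pose c := modulus z + modulus T * (`|l%:~R : R| + 1) + 1.
have l0 : 0 <= `|l%:~R : R| + 1 by rewrite addr_ge0.
have c0 : 0 <= modulus T * (`|l%:~R : R| + 1) by rewrite mulr_ge0 // mod_ge0.
exists c; first by rewrite /c; have := mod_ge0 z; lra.
move=> t; have [j [-> jB]] := jH t; apply: le_trans (modD _ _) _.
have Dt : 1 <= D ^+ t by apply: exprn_ege1.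
have jm : modulus (j%:~R : C R) = `|j%:~R : R|.
  by rewrite -mod_rC; congr modulus; rewrite [RHS](rmorph_int (real_complex R)).
rewrite modM jm -/D.
have h1 : modulus z * 1 <= modulus z * D ^+ t by rewrite ler_wpM2l ?mod_ge0.
have h2 : `|j%:~R : R| * modulus T <= D ^+ t * (`|l%:~R : R| + 1) * modulus T.
  by rewrite ler_wpM2r ?mod_ge0 //; lra.
rewrite /c; lra.
Qed.

End Semiconjugacy.

(** * Fatou points of the lift project to Fatou points *)

Section Projection.
Context {R : realType}.
Implicit Types (z w c : C R) (r rho M e : R).
Variables (m : nat) (H h : C R -> C R) (a : C R) (f : C R -> C R).
Hypothesis H_entire : entire H.
Hypothesis H_nonconstant : ~ exists c : C R, forall w, H w = c.
Hypothesis hE : forall w, h w = w ^+ m * cexp (H w).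
Hypothesis a_neq0 : a != 0.
Hypothesis f_lift : lifts a h f.

Let f_entire : entire f. Proof. by case: f_lift => -[]. Qed.
Let h_entire : entire h. Proof. exact: entire_of_exp H_entire hE. Qed.

(** Locally uniform convergence of the branches gives that of the iterates of [h]. *)
Lemma ucvg_cexp (F : nat -> C R -> C R) g (U : set (C R)) M :
  (forall n w, U w -> modulus (F n w) <= M) ->
  ucvg F g U -> ucvg (fun n w => cexp (a * F n w)) (fun w => cexp (a * g w)) U.
Proof.
move=> FM Fg e e0; pose Q := expR (modulus a * (M + 1)).
have Q0 : 0 < Q by exact: expR_gt0.
have /contCP/(_ (e / Q)) := cont_cexp (0 : C R).
case; first by rewrite divr_gt0.
move=> d d0 dH; have am : 0 < modulus a by rewrite mod_gt0.
have [N1 N1H] := Fg (d / modulus a) (divr_gt0 d0 am).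
have [N2 N2H] := Fg 1 ltr01.
exists (maxn N1 N2) => n; rewrite geq_max => /andP[n1 n2] w wU.
have h1 := N1H n n1 w wU; have h2 := N2H n n2 w wU.
have gM : modulus (g w) <= M + 1.
  by have := FM n w wU; have := modBB (g w) (F n w); rewrite [modulus (g w - _)]mod_distC; lra.
have -> : cexp (a * F n w) - cexp (a * g w) =
    cexp (a * g w) * (cexp (a * (F n w - g w)) - cexp 0).
  rewrite mulrBr -cexpD cexp0 mulr1; congr (cexp _ - _); ring.
rewrite modM mod_cexp.
have h3 : expR (complex.Re (a * g w)) <= Q.
  rewrite ler_expR; apply: le_trans (ler_norm _) _; apply: le_trans (Re_le_mod _) _; rewrite modM.
  by rewrite ler_wpM2l // ltW.
have h4 : modulus (cexp (a * (F n w - g w)) - cexp 0) < e / Q.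
  by apply: dH; rewrite subr0 modM mulrC -ltr_pdivlMr.
apply: le_lt_trans (_ : Q * modulus (cexp (a * (F n w - g w)) - cexp 0) < _).
  by rewrite ler_wpM2r ?mod_ge0.
by rewrite mulrC -ltr_pdivlMr.
Qed.

(** The iterates [f^n], read near [w0] through a branch [F n] of the logarithm,
    cannot be normal there while the iterates of [h] are not.  Along a bad
    sequence of [h]-iterates the [F (k n)] tend to infinity, so by Harnack's
    inequality their moduli at two points are within a fixed power of each other;
    but by Montel's theorem the bad iterates cover both a point whose forward
    orbit under [f] is slow and the whole of a circle on which [h]-orbits are
    fast. *)
Lemma fatou_of_branches (F : nat -> C R -> C R) w0 d : 0 < d ->
  (forall n, holomorphic (Ball w0 d) (F n)) ->
  (forall s t w, F (s + t)%N w = iter s f (F t w)) ->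
  (forall n w, Ball w0 d w -> exp_map a (F n w) = iter n h w) ->
  (forall n, (forall w, Ball w0 d w -> 2^-1 <= modulus (F n w)) \/
             (forall w, Ball w0 d w -> modulus (F n w) <= 2)) ->
  Defs.fatou h w0.
Proof.
move=> d0 Fh FD Fe dich; have d64 : 0 < d / 64 by rewrite divr_gt0.
apply: (unormal_fatou d64); apply: contrapT => /existsNP[k bad].
have w0d : Ball w0 d w0 := Ball_center w0 d0.
have sub64 x : 1 <= x <= 64 -> Ball w0 (d / 64) `<=` Ball w0 (d / x).
  move=> /andP[x1 x2]; apply: le_Ball; rewrite ler_wpM2l ?(ltW d0) // lef_pV2 ?posrE //; lra.
have sub1 x : 1 <= x -> Ball w0 (d / x) `<=` Ball w0 d.
  by move=> x1; apply: le_Ball; rewrite ler_pdivrMr ?ler_peMr ?(ltW d0) //; lra.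
have hF0 n w : Ball w0 d w -> iter n h w != 0 by move=> wd; rewrite -Fe // exp_map_neq0.
have bad1 (s : nat -> nat) g : {homo s : i j / (i < j)%N} ->
    ~ ucvg (fun n => iter (k (s n)) h) g (Ball w0 (d / 64)).
  move=> sh /ucvg_chordal hs; apply: bad; exists s; split=> //.
  by exists (fun w => Some (g w)).
have bad2 (s : nat -> nat) g : {homo s : i j / (i < j)%N} ->
    ~ ucvg (fun n w => (iter (k (s n)) h w)^-1) g (Ball w0 (d / 64)).
  move=> sh /ucvgV_chordal hs; apply: bad; exists s; split=> //.
  exists (fun w => sph_inv (g w)); apply: hs => n w wd; apply: hF0.
  by apply: (sub1 64) wd; lra.
have F3h n : holomorphic (Ball w0 d) (fun w => 3 * F n w).
  exact: holM (hol_cst (c := 3)) (Fh n).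
have m3 n w : modulus (3 * F n w) = 3 * modulus (F n w).
  by rewrite modM -[3]/(3%:R) mod_nat.
have w0r r : 0 <= r -> modulus (w0 - w0) <= r by rewrite subrr -(rC0) mod_rC normr0.
have d20 : 0 <= d / 2 by rewrite divr_ge0 // ltW.
(* A bounded subsequence of branches would converge, and so would the
   corresponding iterates of [h]. *)
have infty A : exists N, forall n, (N <= n)%N -> A < modulus (F (k n) w0).
  apply: contrapT => NA.
  have inf : infinitely (fun n => modulus (F (k n) w0) <= A).
    move=> M; apply: contrapT => NM; apply: NA; exists M.+1 => n nM.
    by rewrite ltNge; apply/negP => hs; apply: NM; exists n.
  have [s [sh sA]] := infinitely_subseq inf.
  have A0 : 0 <= A by apply: le_trans (mod_ge0 _) (sA 0%N).
  pose M := 2 + (3 * A) ^+ 9.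
  have A9 : 0 <= (3 * A) ^+ 9 by rewrite exprn_ge0 // mulr_ge0.
  have FM n w : Ball w0 (d / 2) w -> modulus (F (k (s n)) w) <= M.
    move=> wd; case: (dich (k (s n))) => hb; last first.
      by have := hb w (sub1 2 ltac:(lra) _ wd); rewrite /M; lra.
    have := @modulus_harnack _ _ w0 d w w0 d0 (F3h (k (s n))) _ (ltW wd) (w0r _ d20).
    rewrite !m3 => /(_ _) hs.
    have {hs} : 3 * modulus (F (k (s n)) w) <= (3 * modulus (F (k (s n)) w0)) ^+ 9.
      by apply: hs => u ud; rewrite m3; have := hb u ud; lra.
    have : (3 * modulus (F (k (s n)) w0)) ^+ 9 <= (3 * A) ^+ 9.
      rewrite ler_pXn2r ?nnegrE ?mulr_ge0 ?mod_ge0 //.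
      by rewrite ler_pM2l.
    have := mod_ge0 (F (k (s n)) w); rewrite /M; lra.
  have d2 : 0 < d / 2 by rewrite divr_gt0.
  have Fh2 n : holomorphic (Ball w0 (d / 2)) (F (k (s n))).
    by apply: sub_hol (Fh _); apply: sub1; lra.
  have [s' [sh' [g [_ gc]]]] := montel_bounded d2 Fh2 FM.
  have sub16 : Ball w0 (d / 64) `<=` Ball w0 (d / 2 / 8) by apply: le_Ball; lra.
  have gc' := @ucvg_cexp _ g _ M (fun n w wd => FM (s' n) w (sub64 2 ltac:(lra) w wd))
    (ucvg_sub sub16 gc).
  apply: (bad1 (s \o s') (fun w => cexp (a * g w))).
    by move=> i j ij; apply: sh; apply: sh'.
  move=> e e0; have [N NH] := gc' e e0; exists N => n nN w wd.
  have := NH n nN w wd; rewrite /= -Fe //; apply: (sub1 64 _ _ wd); lra.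
have k_infty B : exists N, forall n, (N <= n)%N -> (B < k n)%N.
  have [N NH] := infty (\sum_(j < B.+1) modulus (F j w0)).
  exists N => n nN; rewrite ltnNge; apply/negP => kB.
  have := NH n nN; rewrite ltNge => /negP; apply.
  rewrite (bigD1 (Ordinal (kB : (k n < B.+1)%N))) //= lerDl.
  by apply: sumr_ge0 => i _; exact: mod_ge0.
have [N0 N0H] : exists N, forall n, (N <= n)%N -> forall w, Ball w0 (d / 2) w ->
    1 < modulus (F (k n) w).
  have [N NH] := infty (2 + 3 ^+ 9); exists N => n nN w wd.
  have h1 := NH n nN; have p9 : 0 <= 3 ^+ 9 :> R by rewrite exprn_ge0.
  case: (dich (k n)) => hb; last by have := hb w0 w0d; lra.
  have := @modulus_harnack _ _ w0 d w0 w d0 (F3h (k n)) _ (w0r _ d20) (ltW wd).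
  rewrite !m3 => /(_ _) hs.
  have {hs} : 3 * modulus (F (k n) w0) <= (3 * modulus (F (k n) w)) ^+ 9.
    by apply: hs => u ud; rewrite m3; have := hb u ud; lra.
  move=> h2; have : 3 ^+ 9 < (3 * modulus (F (k n) w)) ^+ 9 by lra.
  by rewrite ltr_pXn2r ?nnegrE ?mulr_ge0 ?mod_ge0 //; lra.
have d4 : 0 < d / 4 by rewrite divr_gt0.
have sub4 : Ball w0 (d / 4) `<=` Ball w0 d by apply: sub1; lra.
have cover (rho : R) : 0 < rho -> exists M : nat, forall n : nat, (M < n)%N -> forall c : C R, modulus c = rho ->
    exists2 x, Ball w0 (d / 4) x & iter (k n) h x = c.
  move=> rho0; pose P n := exists2 c, modulus c = rho &
    forall x, Ball w0 (d / 4) x -> iter (k n) h x != c.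
  have [inf|/not_infinitely[M MH]] := pselect (infinitely P); last first.
    exists M => n nM c cr; apply: contrapT => N; apply: (MH n nM); exists c => // x xd.
    by apply/eqP => xc; apply: N; exists x.
  exfalso; have [s [sh sP]] := infinitely_subseq inf.
  have /choice[c cH] : forall n, exists c, modulus c = rho /\
      forall x, Ball w0 (d / 4) x -> iter (k (s n)) h x != c.
    by move=> n; have [c c1 c2] := sP n; exists c.
  have [|||s' [sh' [g [_ gc]]]] :=
    @montel_omit _ (fun n => iter (k (s n)) h) c rho w0 (d / 4) d4 rho0.
  - by move=> n; case: (cH n).
  - by move=> n; apply: sub_hol (hol_iter h_entire).
  - by move=> n w wd; split; [exact: hF0 (sub4 _ wd)|case: (cH n) => _; apply].
  have E : d / 4 / 16 = d / 64 by field.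
  have sh2 : {homo s \o s' : i j / (i < j)%N} by move=> i j ij; apply: sh; apply: sh'.
  rewrite E in gc; case: gc => gc; first exact: bad1 sh2 gc.
  exact: bad2 sh2 gc.
have [zs [l fz]] := fixed_mod_period a_neq0 f_lift.
pose D1 : R := m%:R + `|l%:~R : R| + 1.
have D11 : 1 <= D1 by rewrite /D1 lerDr addr_ge0.
(* Harnack's inequality raises the slow orbit to the ninth power; the factor 2
   leaves room for the fast orbit to win. *)
have [D DH] := archi_nat (2 * D1 ^+ 9).
have D19 : 1 <= D1 ^+ 9 by apply: exprn_ege1.
have D0 : (0 < D)%N by rewrite -(ltr_nat R); lra.
have [r0 r01 fast] := fast_iterates H_entire D0 H_nonconstant hE.
(* Radius at least [e], so that [r ^+ (D ^ t)] dominates [exp (D ^ t)]. *)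
pose r := Num.max r0 (expR 1).
have r0r : r0 <= r by rewrite le_max lexx.
have er : expR 1 <= r by rewrite le_max lexx orbT.
have rp : 0 < r by lra.
have zs0 : 0 < modulus (exp_map a zs) by rewrite mod_gt0 exp_map_neq0.
have [M1 M1H] := cover r rp; have [M2 M2H] := cover _ zs0.
pose N1 := (maxn M1 M2).+1.
have [x_s xsd xsE] := M2H N1 (leq_maxr _ _ : (M2 < N1)%N) _ erefl.
have coverr := M1H N1 (leq_maxl _ _ : (M1 < N1)%N).
have [j jE] : exists j : int, F (k N1) x_s = zs + j%:~R * (period / a).
  by apply: (exp_map_eq a_neq0); rewrite Fe ?xsE //; apply: sub4.
have [c c0 cH] := slow_orbit H_entire hE a_neq0 f_lift j fz.
have [B BH] := archi_nat (modulus a * c ^+ 9).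
have [N2 N2H] := k_infty (B + k N1)%N.
pose n := maxn N0 N2; pose t := (k n - k N1)%N.
have kn : (B + k N1 < k n)%N by apply: N2H; exact: leq_maxr.
have nE : k n = (t + k N1)%N by rewrite /t subnK // ltnW // (leq_ltn_trans _ kn) // leq_addl.
have Bt : (B < t)%N by rewrite -(ltn_add2r (k N1)) -nE.
have [w_t [wtr wtH]] := fast t r r0r; have [x_t xtd xtE] := coverr w_t wtr.
have Fs : modulus (F (k n) x_s) <= c * D1 ^+ t by rewrite nE FD jE; exact: cH.
have Ft : D%:R ^+ t <= modulus a * modulus (F (k n) x_t).
  rewrite -ler_expR -modM; apply: le_trans (_ : expR (complex.Re (a * F (k n) x_t)) <= _); last first.
    by rewrite ler_expR (le_trans (ler_norm _)) // Re_le_mod.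
  rewrite -mod_cexp -[cexp _]/(exp_map a _) Fe; last exact: sub4.
  rewrite nE iterD xtE; apply: le_trans wtH.
  apply: le_trans (_ : expR 1 ^+ (D ^ t) <= _).
    by rewrite -expRM_natl mulr1 natrX.
  by apply: lerXn2r; rewrite ?nnegrE ?expR_ge0 ?(ltW rp).
have hs : modulus (F (k n) x_t) <= modulus (F (k n) x_s) ^+ 9.
  apply: (@modulus_harnack _ _ w0 (d / 2)).
  - by rewrite divr_gt0.
  - by apply: sub_hol (Fh _); apply: sub1; lra.
  - by apply: N0H; exact: leq_maxl.
  - by have := xtd; rewrite /Ball /=; lra.
  - by have := xsd; rewrite /Ball /=; lra.
have h1 : (2 * D1 ^+ 9) ^+ t <= modulus a * c ^+ 9 * (D1 ^+ 9) ^+ t.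
  apply: le_trans (_ : D%:R ^+ t <= _).
    by apply: lerXn2r; rewrite ?nnegrE ?ler0n ?(ltW DH) // mulr_ge0 // (le_trans ler01).
  apply: le_trans Ft _; rewrite -mulrA ler_wpM2l ?mod_ge0 //.
  apply: le_trans hs _; rewrite exprAC -exprMn ler_pXn2r ?nnegrE ?mod_ge0 ?mulr_ge0 //.
    exact: ltW.
  by rewrite exprn_ge0 //; lra.
have Dp : 0 < (D1 ^+ 9) ^+ t by rewrite exprn_gt0 //; lra.
move: h1; rewrite exprMn ler_pM2r // => h1.
have : (B%:R : R) < t%:R by rewrite ltr_nat.
have : t%:R <= 2 ^+ t :> R by rewrite -natrX ler_nat ltnW // ltn_expl.
lra.
Qed.

(** A branch of the logarithm near [exp (a z0)] pulls the iterates of [f] back; by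
    equicontinuity near [z0] each of them is there either bounded below or bounded
    above. *)
Theorem fatou_exp_map z0 : Defs.fatou f z0 -> Defs.fatou h (exp_map a z0).
Proof.
move=> /fatou_unormal[r r0 nf]; set w0 := exp_map a z0.
have w00 : 0 < modulus w0 by rewrite mod_gt0 exp_map_neq0.
have nz w : Ball w0 (modulus w0) w -> w != 0.
  by move=> wB; apply/eqP => w_0; move: wB; rewrite /Ball /= w_0 sub0r modN ltxx.
have [L [Lh L0 LE]] := hol_log w00 (@hol_id _ _) nz (erefl : cexp (a * z0) = w0).
pose lam w := L w / a.
have lh : holomorphic (Ball w0 (modulus w0)) lam := holM Lh (hol_cst (c := a^-1)).
have l0 : lam w0 = z0 by rewrite /lam L0; field.
have w0B := Ball_center w0 w00.
have /contCP/(_ r r0)[e e0 eH] := hol_cont lh w0B.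
pose e1 := Num.min e (modulus w0).
have e10 : 0 < e1 by rewrite lt_min e0.
have e1w : Ball w0 e1 `<=` Ball w0 (modulus w0) by apply: le_Ball; rewrite ge_min lexx orbT.
have e1e : Ball w0 e1 `<=` Ball w0 e by apply: le_Ball; rewrite ge_min lexx.
have lr w : Ball w0 e1 w -> Ball z0 r (lam w).
  by move=> /e1e we; rewrite /Ball /= -l0; apply: eH.
pose F n w := iter n f (lam w).
have Fh n : holomorphic (Ball w0 e1) (F n).
  exact: (@hol_comp _ _ setT lam _ (fun _ _ => I) (sub_hol e1w lh) (hol_iter f_entire)).
have Fn : unormal F (Ball w0 e1).
  move=> k; have [s [sh [g gH]]] := nf k; exists s; split=> //.
  exists (fun w => g (lam w)) => x x0; have [N NH] := gH x x0; exists N => n nN w wB.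
  exact: NH n nN (lam w) (lr w wB).
have w0e := Ball_center w0 e10.
have [|d d0 dH] := @unormal_equi _ F w0 e1 4^-1 e10 (fun n => hol_cont (Fh n) w0e) Fn.
  by [].
pose d1 := Num.min d e1.
have d10 : 0 < d1 by rewrite lt_min d0.
have d1d : Ball w0 d1 `<=` Ball w0 d by apply: le_Ball; rewrite ge_min lexx.
have d1e : Ball w0 d1 `<=` Ball w0 e1 by apply: le_Ball; rewrite ge_min lexx orbT.
apply: (@fatou_of_branches F w0 d1 d10) => [n|s t w|n w wd|n].
- exact: sub_hol d1e (Fh n).
- by rewrite /F iterD.
- rewrite /F -(exp_map_iter f_lift) /exp_map /lam.
  have -> : a * (L w / a) = L w by field.
  by rewrite LE //; apply: e1w; apply: d1e.
have [ge|lt] := leP 1 (modulus (F n w0)); [left|right] => w /d1d wd.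
  exact: chordal_large (dH n w wd) ge.
exact: chordal_small (dH n w wd) (ltW lt).
Qed.

End Projection.

(** * Components of the preimage *)

Section Topology.
Context {R : realType}.
Implicit Types (z w c : C R) (r e : R) (U V : set (C R)) (phi : C R -> C R).

Lemma connected_image U (f : C R -> C R) : open U -> connected U ->
  (forall z, U z -> cont f z) -> connected (f @` U).
Proof.
move=> Uo Uc fc; apply: connected_continuous_connected => //.
rewrite continuous_open_subspace // => z zU; apply/contE; apply: fc.
by move: zU; rewrite inE.
Qed.

Lemma star_connected U z : U z ->
  (forall w t, U w -> 0 <= t <= 1 -> U (z + rC t * (w - z))) -> connected U.
Proof.
move=> Uz star; pose I : set R := `[0, 1]%classic; pose p w t := z + rC t * (w - z).
have I01 t : I t = (0 <= t <= 1) :> Prop by rewrite /I /= in_itv.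
have -> : U = \bigcup_(w in U) (p w @` I).
  apply/seteqP; split => [w Uw|x [w Uw [t tI <-]]].
    by exists w => //; exists 1; rewrite ?I01 ?lexx ?ler01 // /p rC1 mul1r addrC subrK.
  by apply: star => //; rewrite -I01.
apply: bigcup_connected => [|w Uw].
  by exists z => w _; exists 0; rewrite ?I01 ?lexx ?ler01 // /p rC0 mul0r addr0.
apply: connected_continuous_connected; first by apply/connected_intervalP; exact: interval_is_interval.
apply: continuous_subspaceT => t; apply/contE.
apply: contD; first exact: cont_cst.
by apply: contM; [exact: cont_rC|exact: cont_cst].
Qed.

Lemma connected_disc : connected (@disc R).
Proof.
have B0 := @Ball_center _ (0 : C R) 1 ltr01.
rewrite disc_Ball; apply: (star_connected B0) => w t wB t01; exact: Ball_line.
Qed.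

Lemma connected_half_plane : connected (@upper_half_plane R).
Proof.
apply: (@star_connected _ (iC : C R)) => [|w t]; first exact: ltr01.
rewrite /upper_half_plane /= => w0 /andP[t0 t1].
rewrite ImD ImMr ImD ImN (_ : complex.Im iC = 1) //.
have : t * complex.Im w >= 0 by rewrite mulr_ge0 // ltW.
case: (ltP t 1) => [lt1|ge1]; first by lra.
have -> : t = 1 by lra.
by lra.
Qed.

Lemma sub_component (A B V : set (C R)) x : component A V -> connected B -> B `<=` A ->
  B x -> V x -> B `<=` V.
Proof.
move=> [y Ay ->] Bc BA Bx /same_connected_component ->.
exact: connected_component_max.
Qed.

Lemma open_disc : open (@disc R).
Proof. by rewrite disc_Ball; exact: open_Ball. Qed.

Lemma open_half_plane : open (@upper_half_plane R).
Proof.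
apply/openP => z z0; exists (complex.Im z) => // w; rewrite /Ball /= => wz.
have := Im_le_mod (w - z); rewrite ImD ImN => /ler_normlP[h1 h2].
rewrite /upper_half_plane /=; lra.
Qed.

Lemma riemann_mapP U V phi : riemann_map U V phi <->
  [/\ holomorphic U phi, forall u, U u -> V (phi u),
      forall v w, U v -> U w -> phi v = phi w -> v = w &
      forall v, V v -> exists2 u, U u & phi u = v].
Proof.
split=> [[h [h1 h2 h3]]|[h h1 h2 h3]]; split=> //.
  by move=> v w Uv Uw; apply: h2; rewrite inE.
split=> //; by move=> v w; rewrite !inE; exact: h2.
Qed.

Lemma riemann_inverse U V phi : open U -> riemann_map U V phi -> exists psi,
  [/\ open V, holomorphic V psi, forall u, U u -> psi (phi u) = u &
      forall v, V v -> U (psi v) /\ phi (psi v) = v].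
Proof.
move=> Uo /riemann_mapP[h hV hi hs].
pose psi v := xget 0 [set u | U u /\ phi u = v].
have psiP v : V v -> U (psi v) /\ phi (psi v) = v.
  by move=> /hs[u Uu uE]; rewrite /psi; case: xgetP => [x _ []|/(_ u) []].
exists psi; split => //; first exact: inj_image_open Uo h hi psiP hV.
  exact: inv_hol Uo h hi psiP hV.
move=> u Uu; have [h1 h2] := psiP _ (hV _ Uu); exact: hi.
Qed.

End Topology.

Section Preimage.
Context {R : realType}.
Implicit Types (z w c : C R) (r rho M e : R).
Variables (m : nat) (H h : C R -> C R) (a : C R) (f : C R -> C R).
Variables (G : set (C R)) (phi : C R -> C R).
Hypothesis H_entire : entire H.
Hypothesis H_nonconstant : ~ exists c : C R, forall w, H w = c.
Hypothesis hE : forall w, h w = w ^+ m * cexp (H w).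
Hypothesis a_neq0 : a != 0.
Hypothesis f_lift : lifts a h f.
Hypothesis G_component : fatou_component h G.
Hypothesis G_invariant : h @` G `<=` G.
Hypothesis phi_map : riemann_map disc G phi.

Let f_entire : entire f. Proof. by case: f_lift => -[]. Qed.

Lemma hol_exp_map (U : set (C R)) : holomorphic U (exp_map a).
Proof. by apply: hol_cexpf; exact: holM (hol_cst (c := a)) (@hol_id _ U). Qed.

Lemma cont_exp_map z : cont (exp_map a) z.
Proof. exact: hol_cont (@hol_exp_map setT) I. Qed.

(** If [G] contained all nonzero values, the exponential followed by an inverse
    Riemann map would be entire and bounded, hence constant. *)
Lemma omitted_value : exists2 w, w != 0 & ~ G w.
Proof.
apply: contrapT => N.
have all w : w != 0 -> G w by move=> w0; apply: contrapT => nG; apply: N; exists w.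
have [psi [_ psih _ psiP]] := riemann_inverse open_disc phi_map.
have uh : entire (fun z => psi (exp_map a z)).
  by apply: (@hol_comp _ setT G) psih => [z _|]; [apply: all; exact: exp_map_neq0|exact: hol_exp_map].
have um z : modulus (psi (exp_map a z)) <= 1.
  by have [] := psiP _ (all _ (exp_map_neq0 a z)); rewrite disc_mod => /ltW.
have c z : exp_map a z = exp_map a 0.
  have [_ <-] := psiP _ (all _ (exp_map_neq0 a z)).
  by rewrite (liouville uh um) (psiP _ (all _ (exp_map_neq0 a 0))).2.
have two0 : (2 : C R) != 0 by rewrite pnatr_eq0.
have [z zE] := exp_map_surj a_neq0 two0.
have [z1 z1E] := exp_map_surj a_neq0 (oner_neq0 (C R)).
have /eqP := c z; rewrite -(c z1) zE z1E -subr_eq0 (_ : 2 - 1 = 1 :> C R) ?oner_eq0 //.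
by ring.
Qed.

(** Iterates that start in the preimage of [G] stay in it, so that they omit all the
    logarithms of a nonzero value outside [G]. *)
Lemma preimage_fatou : exp_map a @^-1` G `<=` Defs.fatou f.
Proof.
move=> z Gz; have [w w0 nGw] := omitted_value.
have [psi [Go _ _ _]] := riemann_inverse open_disc phi_map.
have [e e0 eG] := (openP G).1 Go _ Gz.
have /contCP/(_ e e0)[d d0 dH] := cont_exp_map z.
have [x xE] := exp_map_surj a_neq0 w0.
have x2E : exp_map a (x + 1%:~R * (period / a)) = w by rewrite exp_map_shift.
have iG n v : G v -> G (iter n h v).
  by move=> Gv; elim: n => [//|n IH]; rewrite iterS; apply: G_invariant; exists (iter n h v).
apply: (@omit_fatou _ f z d x (x + 1%:~R * (period / a)) d0 f_entire).
  rewrite mul1r -subr_eq0 opprD addNKr oppr_eq0 mulf_neq0 ?invr_eq0 //; exact: period_neq0.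
move=> n v vB; have : G (exp_map a (iter n f v)).
  by rewrite -(exp_map_iter f_lift); apply: iG; apply: eG; apply: dH.
by move=> Gn; split; apply/eqP => E; apply: nGw; [rewrite -xE -E|rewrite -x2E -E].
Qed.

(** The exponential maps Fatou points of [f] to Fatou points of [h]; hence a component
    of the Fatou set of [f] that meets the preimage of [G] cannot leave it. *)
Lemma preimage_component V : component (exp_map a @^-1` G) V -> fatou_component f V.
Proof.
move=> [x Px ->]; exists x; first exact: preimage_fatou.
have F1 : connected (connected_component (Defs.fatou f) x) by exact: component_connected.
have F2 : connected_component (Defs.fatou f) x x.
  by apply: connected_component_refl; exact: preimage_fatou.
apply/seteqP; split.
  apply: connected_component_max; first exact: connected_component_refl.
    by move=> y /connected_component_sub; exact: preimage_fatou.
  exact: component_connected.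
apply: connected_component_max => //.
move=> y Fy.
have FG : exp_map a @` connected_component (Defs.fatou f) x `<=` G.
  apply: (@sub_component _ (Defs.fatou h) _ G (exp_map a x)) => //.
  - apply: connected_continuous_connected F1 _.
    by apply: continuous_subspaceT => v; apply/contE; exact: cont_exp_map.
  - move=> _ [v /connected_component_sub vF <-].
    exact: (fatou_exp_map H_entire H_nonconstant hE a_neq0 f_lift).
by apply: FG; exists y.
Qed.

Lemma preimage_invariant z : G (exp_map a z) -> G (exp_map a (f z)).
Proof. by case: f_lift => _ E Gz; rewrite -E; apply: G_invariant; exists (exp_map a z). Qed.

End Preimage.

(** * Positive harmonic functions with finitely many boundary atoms *)

Section Herglotz.
Context {R : realType}.
Implicit Types (f F : C R -> C R) (z w c : C R) (r e s : R).

Lemma add_conj z : z + z^* = 2 * rC (complex.Re z).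
Proof.
case: z => x y; apply: C_eq; rewrite ?ReD ?ImD ?ReM ?ImM /=; ring.
Qed.

Lemma sub_conj z : z - z^* = 2 * (iC * rC (complex.Im z)).
Proof.
case: z => x y; apply: C_eq; rewrite ?ReD ?ImD ?ReN ?ImN ?ReM ?ImM /=; ring.
Qed.

Lemma conjM z w : (z * w)^* = z^* * w^*.
Proof. exact: rmorphM. Qed.

Lemma conjB z w : (z - w)^* = z^* - w^*.
Proof. exact: rmorphB. Qed.

Lemma conjV z : (z^-1)^* = (z^*)^-1.
Proof. exact: fmorphV. Qed.

Lemma conj1 : (1 : C R)^* = 1.
Proof. exact: rmorph1. Qed.

Lemma conj0 : (0 : C R)^* = 0.
Proof. exact: rmorph0. Qed.

Lemma conjK z : z^*^* = z.
Proof. exact: conjCK. Qed.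

Lemma conj_rC (t : R) : (rC t)^* = rC t :> C R.
Proof. by apply: C_eq; rewrite //= oppr0. Qed.

Lemma contT_hol_circle F r : 0 <= r < 1 -> holomorphic disc F ->
  contT (fun s => F (rC r * expi s)).
Proof.
move=> /andP[r0 r1] Fh; rewrite disc_Ball in Fh.
have := contT_comp_circ r0 r1 Fh.
by rewrite /circ (_ : (fun s => _) = (fun s => F (rC r * expi s))) //; apply/funext => s; rewrite add0r.
Qed.

Lemma expi_sub_neq0 s z : modulus z < 1 -> expi s - z != 0.
Proof.
move=> z1; rewrite subr_eq0; apply/eqP => E; move: z1.
by rewrite -E mod_expi ltxx.
Qed.

(** The real part is half the sum of [F] and its conjugate. Cauchy's formula treats
    the first at [z]; conjugating the integral moves the pole of the kernel outside
    the disc, so the second contributes its value at the centre. *)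
Lemma half_poisson F r z : 0 < r < 1 -> holomorphic disc F -> disc z ->
  cint (fun s => rC (complex.Re (F (rC r * expi s))) * (expi s / (expi s - z))) (2 * pi) =
  rC pi * (F (rC r * z) + (F 0)^*).
Proof.
move=> /andP[r0 r1] Fh; rewrite disc_mod => z1; have pi2 : 0 <= 2 * pi :> R := twopi_ge0.
pose f w := F (rC r * w); pose K s := expi s / (expi s - z).
have uc : contT (fun s => f (expi s)) by apply: contT_hol_circle; rewrite ?r1 ?ltW.
have ec : contT (@expi R) by exact: contT_expi.
have Kc : contT K.
  apply: contT_M contT_expi _; apply: contT_V => [s|]; first exact: expi_sub_neq0.
  by apply: contT_B contT_expi _; exact: contT_cst.
have ucc : contT (fun s => (f (expi s))^*).
  move=> s; have cc : cont (fun w : C R => w^*) (f (expi s)).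
    apply/contCP => e e0; exists e => // w; by rewrite -rmorphB mod_conj.
  exact: cont_comp (uc s) cc.
pose rho := Num.min r^-1 (2 / (1 + modulus z)).
have z0 := mod_ge0 z.
have rho1 : 1 < rho by rewrite lt_min invf_gt1 // r1 ltr_pdivlMr; lra.
have rin w : Ball 0 rho w -> disc (rC r * w).
  rewrite /Ball /= subr0 lt_min => /andP[wr _].
  by rewrite disc_mod modM mod_rC gtr0_norm // mulrC -ltr_pdivlMr // mul1r.
have lin : holomorphic (Ball 0 rho) (fun w => rC r * w).
  exact: holM (hol_cst (c := rC r)) (@hol_id _ _).
have fh : holomorphic (Ball 0 rho) f := hol_comp rin lin Fh.
have nz w : Ball 0 rho w -> 1 - z^* * w != 0.
  rewrite /Ball /= subr0 lt_min => /andP[_ wr]; apply/eqP => E.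
  have : modulus (z^* * w) = 1 by rewrite -[z^* * w](subKr 1) E subr0 mod1.
  rewrite modM mod_conj; have w0 := mod_ge0 w; move: wr; rewrite ltr_pdivlMr; last by lra.
  nra.
have qh : holomorphic (Ball 0 rho) (fun w => 1 - z^* * w).
  exact: holB (hol_cst (c := 1)) (holM (hol_cst (c := z^*)) (@hol_id _ _)).
have Bh : holomorphic (Ball 0 rho) (fun w => f w / (1 - z^* * w)) := hol_div nz fh qh.
have A : cint (fun s => f (expi s) * K s) (2 * pi) = rC (2 * pi) * f z.
  rewrite [RHS]mulrC; apply/esym; apply: (etrans (cauchy_formula rho1 _ fh)).
    by rewrite subr0.
  rewrite /kern; congr (cint _ _); apply/funext => s.
  by rewrite /circ /K rC1 mul1r add0r expr1 mulrA.
have B : cint (fun s => (f (expi s))^* * K s) (2 * pi) = rC (2 * pi) * (f 0)^*.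
  have /= E := @cauchy_formula _ _ 0 1 rho 0 rho1 _ Bh.
  have {E} : f 0 * rC (2 * pi) = cint (fun s => f (expi s) / (1 - z^* * expi s)) (2 * pi).
    have := E; rewrite subrr mod0 mulr0 subr0 divr1 => ->; last exact: ltr01.
    rewrite /kern; congr (cint _ _); apply/funext => s.
    by rewrite /circ rC1 mul1r add0r subr0 expr1 mulfK // expi_neq0.
  move=> /(congr1 (fun w : C R => w^*)); rewrite conjM -cint_conj //; last first.
    move=> s; apply: contM (uc s) _; apply: contV.
      apply/eqP => E; have : modulus (z^* * expi s) = 1 by rewrite -[z^* * _](subKr 1) E subr0 mod1.
      by rewrite modM mod_conj mod_expi; lra.
    apply: contB; first exact: cont_cst.
    by apply: contM (ec s); exact: cont_cst.
  rewrite conj_rC => E0; rewrite [RHS]mulrC E0; congr (cint _ _); apply/funext => s.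
  have E : (1 - z^* * expi s)^* = 1 - z * (expi s)^-1.
    by rewrite conjB conj1 conjM conjK expi_conj.
  rewrite conjM conjV E /K; congr (_ * _).
  have e0 := expi_neq0 s; have := @expi_sub_neq0 s z z1 => h1.
  rewrite -invf_div; congr (_^-1); field; exact: e0.
rewrite (_ : (fun s => _) = fun s => 2^-1 * (f (expi s) * K s + (f (expi s))^* * K s)); last first.
  apply/funext => s; rewrite -mulrDl add_conj /f /K; field.
  exact: expi_sub_neq0.
have c1 := contT_M uc Kc; have c2 := contT_M ucc Kc.
rewrite (cintZ _ (contT_D c1 c2) pi2) (cintD c1 c2 pi2) A B.
by rewrite rCM /f mulr0 (_ : rC 2 = 2) //; field.
Qed.

Lemma contT_Re_circle F r : 0 <= r < 1 -> holomorphic disc F ->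
  contT (fun s => rC (complex.Re (F (rC r * expi s)))).
Proof.
move=> r01 Fh s; have h := contT_hol_circle r01 Fh s.
exact: cont_comp (cont_comp h (cont_Re _)) (cont_rC _).
Qed.

Lemma contT_kernel z : modulus z < 1 -> contT (fun s => expi s / (expi s - z)).
Proof.
move=> z1; apply: contT_M contT_expi _; apply: contT_V => [s|]; first exact: expi_sub_neq0.
by apply: contT_B contT_expi _; exact: contT_cst.
Qed.

(** Schwarz' kernel is twice Cauchy's kernel minus one. *)
Theorem schwarz_formula F r z : 0 < r < 1 -> holomorphic disc F -> disc z ->
  cint (fun s => rC (complex.Re (F (rC r * expi s))) * ((expi s + z) / (expi s - z))) (2 * pi) =
  rC (2 * pi) * (F (rC r * z) - iC * rC (complex.Im (F 0))).
Proof.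
move=> r01 Fh zd; have z1 := zd; rewrite disc_mod in z1.
have /andP[r0 r1] := r01; have r01' : 0 <= r < 1 by rewrite r1 ltW.
have uc := contT_Re_circle r01' Fh.
have d0 : disc (0 : C R) by rewrite disc_mod mod0.
have kc x : disc x -> contT (fun s => rC (complex.Re (F (rC r * expi s))) * (expi s / (expi s - x))).
  by rewrite disc_mod => x1; apply: contT_M uc _; exact: contT_kernel.
pose u x s := rC (complex.Re (F (rC r * expi s))) * (expi s / (expi s - x)).
rewrite (_ : (fun s => _) = fun s => 2 * u z s - u 0 s); last first.
  apply/funext => s; rewrite /u subr0 divff ?expi_neq0 // mulr1; field.
  exact: expi_sub_neq0.
have kz : contT (fun s => 2 * u z s) by apply: contT_M (kc z zd); exact: contT_cst.
rewrite (cintB kz (kc 0 d0) twopi_ge0) (cintZ _ (kc z zd) twopi_ge0).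
rewrite !half_poisson // mulr0 rCM (_ : rC 2 = 2); last exact: (@rCn _ 2).
have -> : iC * rC (complex.Im (F 0)) = (F 0 - (F 0)^*) / 2 by rewrite sub_conj; field.
by field.
Qed.

Lemma rC_prod (I : Type) (l : seq I) (P : pred I) (u : I -> R) :
  rC (\prod_(i <- l | P i) u i) = \prod_(i <- l | P i) rC (u i).
Proof. exact: (rmorph_prod (real_complex R)). Qed.

Lemma cint_ge0 (u : R -> R) b : contT (fun s => rC (u s)) -> 0 <= b ->
  (forall s, 0 <= s <= b -> 0 <= u s) ->
  exists2 k : R, 0 <= k & cint (fun s => rC (u s)) b = rC k.
Proof.
move=> uc b0 u0; exists (complex.Re (cint (fun s => rC (u s)) b)).
  have := @cint_le _ (fun=> 0) _ b (@contT_cst _ 0) uc b0.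
  by move=> /(_ _)/(le_trans (mod_ge0 _)); apply => s sb; rewrite mod0; exact: u0.
have := cint_conj uc b0; rewrite (_ : (fun t => _) = fun s => rC (u s)); last first.
  by apply/funext => s; rewrite conj_rC.
move=> E; apply: C_eq => //=; move: E; case: (cint _ _) => x y.
by move=> /(congr1 (@complex.Im R)) /= yE; lra.
Qed.

Section Finite.
Variables (q : nat) (zeta : 'I_q -> C R) (F : C R -> C R).
Hypothesis zeta_inj : injective zeta.
Hypothesis Fh : holomorphic disc F.
Hypothesis F0 : forall z, disc z -> 0 <= complex.Re (F z).
Hypothesis F_bd : forall w, modulus w = 1 -> (forall j, w != zeta j) ->
  forall e, 0 < e -> exists2 d : R, 0 < d &
    forall z, disc z -> modulus (z - w) < d -> complex.Re (F z) < e.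

Let rr (n : nat) : R := 1 - (n.+2%:R)^-1.

Let rr01 n : 0 < rr n < 1.
Proof.
rewrite /rr; have n0 : 0 < (n.+2%:R : R)^-1 by rewrite invr_gt0.
have n1 : (n.+2%:R : R)^-1 < 1 by rewrite invf_lt1 // ltr1n.
by move: (n.+2%:R^-1) n0 n1 => x x0 x1; apply/andP; split; lra.
Qed.

Let rr01' n : 0 <= rr n < 1. Proof. by case/andP: (rr01 n) => /ltW -> ->. Qed.

Let rr_cvg e : 0 < e -> exists N, forall n, (N <= n)%N -> 1 - rr n < e.
Proof.
move=> e0; have [N NH] := archi_nat e^-1; exists N => n nN.
rewrite /rr opprB addrC subrK invf_plt ?posrE //; apply: lt_le_trans NH _.
by rewrite ler_nat (leq_trans nN) // ltnW // ltnW.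
Qed.

Let disc_rr n s : disc (rC (rr n) * expi s).
Proof.
by rewrite disc_mod modM mod_expi mulr1 mod_rC ger0_norm; case/andP: (rr01' n).
Qed.

Let u n s : C R := rC (complex.Re (F (rC (rr n) * expi s))).

Let uc n : contT (u n). Proof. exact: contT_Re_circle (rr01' n) Fh. Qed.

(** Interpolation weights: [1] at [zeta j], [0] at the other points. *)
Let wt j w : R := \prod_(k < q | k != j)
  (modulus (w - zeta k) ^+ 2 / modulus (zeta j - zeta k) ^+ 2).

Let wt_ge0 j w : 0 <= wt j w.
Proof. by apply: prodr_ge0 => k _; rewrite divr_ge0 // exprn_ge0 // mod_ge0. Qed.

Let wt_cont j : contT (fun s => rC (wt j (expi s))).
Proof.
rewrite (_ : (fun s => _) = fun s => \prod_(k < q | k != j)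
    ((expi s - zeta k) * (expi s - zeta k)^* / rC (modulus (zeta j - zeta k) ^+ 2))); last first.
  apply/funext => s; rewrite /wt rC_prod; apply: eq_bigr => k _.
  by rewrite conj_mod2 rCM rCV.
move=> s; apply: cont_prod => k _; apply: contM; last exact: cont_cst.
have c1 : cont (fun s => expi s - zeta k) s by apply: contB; [exact: cont_expi|exact: cont_cst].
have c2 := @cont_comp _ _ _ _ (fun w : C R => w^*) _ c1.
apply: contM c1 _; apply: c2.
by apply/contCP => e e0; exists e => // w; rewrite -conjB mod_conj.
Qed.

Let wt_eq j : wt j (zeta j) = 1.
Proof.
rewrite /wt big1 // => k kj; rewrite divff // expf_neq0 // mod_eq0 subr_eq0.
by apply: contra kj => /eqP/zeta_inj ->.
Qed.

Let wt_neq i j : i != j -> wt i (zeta j) = 0.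
Proof.
by move=> ij; rewrite /wt (bigD1 j) 1?eq_sym //= subrr mod0 expr0n mul0r mul0r.
Qed.

Let Q z w : C R := (w + z) / (w - z).
Let Qt z w : C R := Q z w - \sum_(j < q) Q z (zeta j) * rC (wt j w).

Let Qt_eq z j : Qt z (zeta j) = 0.
Proof.
rewrite /Qt (bigD1 j) //= wt_eq rC1 mulr1 big1 ?addr0 ?subrr // => i ij.
by rewrite wt_neq // rC0 mulr0.
Qed.

Let Q_cont z : disc z -> contT (fun s => Q z (expi s)).
Proof.
rewrite disc_mod => z1; apply: contT_M.
  by apply: contT_D contT_expi _; exact: contT_cst.
apply: contT_V => [s|]; first exact: expi_sub_neq0.
by apply: contT_B contT_expi _; exact: contT_cst.
Qed.

Let Qt_cont z : disc z -> contT (fun s => Qt z (expi s)).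
Proof.
move=> zd s; apply: contB; first exact: Q_cont.
apply: cont_sum => j _; apply: contM; first exact: cont_cst.
exact: wt_cont.
Qed.

(** If both were large along a sequence tending to the circle, a limit point could
    neither be one of the [zeta j], where [Qt] vanishes, nor any other point, where
    [Re F] tends to [0]. *)
Let small z e : disc z -> 0 < e -> exists N, forall n, (N <= n)%N ->
  forall s, 0 <= s <= 2 * pi ->
    modulus (Qt z (expi s)) < e \/ complex.Re (F (rC (rr n) * expi s)) < e.
Proof.
move=> zd e0; apply: contrapT => N.
pose P n := exists s, [/\ 0 <= s <= 2 * pi, e <= modulus (Qt z (expi s)) &
  e <= complex.Re (F (rC (rr n) * expi s))].
have inf : infinitely P.
  move=> M; apply: contrapT => NM; apply: N; exists M.+1 => n nM s s01.
  have [lt1|ge1] := ltP (modulus (Qt z (expi s))) e; first by left.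
  have [lt2|ge2] := ltP (complex.Re (F (rC (rr n) * expi s))) e; first by right.
  by exfalso; apply: NM; exists n; split => //; exists s.
have [k [kh kP]] := infinitely_subseq inf.
have /choice[t tH] := kP.
have tB n (i : nat) : `|t n| <= 2 * pi.
  by have [/andP[t0 t1] _ _] := tH n; rewrite ger0_norm.
have [k' [kh' [b bH]]] := diag_real tB.
have cvg d : 0 < d -> exists M, forall n, (M <= n)%N -> `|t (k' n) - b 0%N| < d.
  by move=> d0; apply: bH.
have [[j jE]|Nj] := pselect (exists j, expi (b 0%N) = zeta j).
  have /contRP/(_ e e0)[d d0 dH] := Qt_cont zd (b 0%N).
  have [M MH] := cvg d d0; have [_ h _] := tH (k' M).
  have := dH (t (k' M)) (MH M (leqnn M)); rewrite jE Qt_eq subr0; lra.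
have [|d d0 dH] := F_bd (mod_expi (b 0%N)) _ e0.
  by move=> j; apply/eqP => jE; apply: Nj; exists j.
have d20 : 0 < d / 2 by rewrite divr_gt0.
have /contRP/(_ _ d20)[d' d'0 d'H] := @cont_expi _ (b 0%N).
have [M MH] := cvg d' d'0; have [M' M'H] := rr_cvg d20.
pose n := maxn M M'; have [_ _] := tH (k' n).
suff : complex.Re (F (rC (rr (k (k' n))) * expi (t (k' n)))) < e by lra.
apply: dH; first exact: disc_rr.
have h1 := d'H (t (k' n)) (MH n (leq_maxl _ _)).
have nk : (M' <= k (k' n))%N.
  have a1 := subseq_ge kh' n; have a2 := subseq_ge kh (k' n).
  exact: leq_trans (leq_maxr M M') (leq_trans a1 a2).
have h2 := M'H _ nk.
have -> : rC (rr (k (k' n))) * expi (t (k' n)) - expi (b 0%N) =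
    (expi (t (k' n)) - expi (b 0%N)) - rC (1 - rr (k (k' n))) * expi (t (k' n)).
  by move: (rr _) => y; rewrite rCB rC1; ring.
apply: le_lt_trans (modB _ _) _; rewrite modM mod_expi mulr1 mod_rC ger0_norm; first by lra.
by have /andP[_ /ltW] := rr01 (k (k' n)); rewrite subr_ge0.
Qed.

Let disc0 : disc (0 : C R). Proof. by rewrite disc_mod mod0. Qed.

Let mass n : cint (u n) (2 * pi) = rC (2 * pi * complex.Re (F 0)).
Proof.
have := schwarz_formula (rr01 n) Fh disc0.
rewrite (_ : (fun s => _) = u n); last first.
  by apply/funext => s; rewrite addr0 subr0 divff ?mulr1 // expi_neq0.
move=> ->; rewrite mulr0 [RHS]rCM; congr (_ * _).
by rewrite {1}(CE (F 0)) addrK.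
Qed.

Let remainder z e : disc z -> 0 < e -> exists N, forall n, (N <= n)%N ->
  modulus (cint (fun s => u n s * Qt z (expi s)) (2 * pi)) < e.
Proof.
move=> zd e0; have [M [M0 MH]] := circle_max (Qt_cont zd).
pose K := 2 * pi * complex.Re (F 0) + M * (2 * pi) + 1.
have pi0 := @twopi_gt0 R; have F00 := F0 disc0.
have K0 : 0 < K.
  by rewrite /K ltr_wpDl // addr_ge0 // mulr_ge0 // ltW.
have d0 : 0 < e / K by rewrite divr_gt0.
have [N NH] := small zd d0; exists N => n nN.
have c1 : contT (fun s => u n s * Qt z (expi s)) := contT_M (uc n) (Qt_cont zd).
have c2 : contT (fun s => rC (e / K) * (u n s + rC M)).
  by apply: contT_M (@contT_cst _ _) _; apply: contT_D (uc n) _; exact: contT_cst.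
have le1 : modulus (cint (fun s => u n s * Qt z (expi s)) (2 * pi)) <=
    complex.Re (cint (fun s => rC (e / K) * (u n s + rC M)) (2 * pi)).
  apply: cint_le c1 c2 (twopi_ge0) _ => s s01.
  have F1 := F0 (disc_rr n s); have M1 := MH s s01.
  rewrite modM mod_rC ger0_norm // ReMr ReD /=.
  have := mod_ge0 (Qt z (expi s)); case: (NH n nN s s01) => hs Q0.
    have : modulus (Qt z (expi s)) * complex.Re (F (rC (rr n) * expi s)) <= e / K * complex.Re (F (rC (rr n) * expi s)).
      by rewrite ler_wpM2r // ltW.
    have : 0 <= e / K * M by rewrite mulr_ge0 // ltW.
    lra.
  have : complex.Re (F (rC (rr n) * expi s)) * modulus (Qt z (expi s)) <= e / K * M.
    by apply: ler_pM => //; exact: ltW.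
  have : 0 <= e / K * complex.Re (F (rC (rr n) * expi s)) by rewrite mulr_ge0 // ltW.
  lra.
apply: le_lt_trans le1 _; rewrite cintZ ?cintD ?mass ?cint_cst ?twopi_ge0 //; last 2 first.
- exact: contT_cst.
- by apply: contT_D (uc n) _; exact: contT_cst.
rewrite -rCM -rCD ReMr /= mulrAC ltr_pdivrMr // ltr_pM2l // /K; lra.
Qed.

(** Subtracting from Schwarz' kernel the combination of the weights that agrees with
    it at the exceptional points leaves a kernel whose integral against [Re F] tends
    to [0]. The coefficients of that combination are masses of the weights, which
    stay bounded and so converge along a sequence of radii. *)
Theorem herglotz_finite : exists (tau : R) (c : 'I_q -> R), (forall j, 0 <= c j) /\
  forall z, disc z -> F z = iC * rC tau + \sum_(j < q) rC (c j) * ((zeta j + z) / (zeta j - z)).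
Proof.
have pi0 := @twopi_gt0 R; have pi20 := @twopi_ge0 R.
have /choice[M MH] : forall j, exists M, 0 <= M /\
    forall s, 0 <= s <= 2 * pi -> modulus (rC (wt j (expi s)) : C R) <= M.
  by move=> j; exact: circle_max (@wt_cont j).
pose k n j := cint (fun s => u n s * rC (wt j (expi s))) (2 * pi).
have kc n j : contT (fun s => u n s * rC (wt j (expi s))) := contT_M (uc n) (@wt_cont j).
have kE n j : exists x : R, [/\ 0 <= x, k n j = rC x & `|x| <= M j * (2 * pi * complex.Re (F 0))].
  have [||x x0 xE] := @cint_ge0 (fun s => complex.Re (F (rC (rr n) * expi s)) * wt j (expi s)) (2 * pi) _ pi20.
  - rewrite (_ : (fun s => _) = fun s => u n s * rC (wt j (expi s))) //.
    by apply/funext => s; rewrite rCM.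
  - by move=> s _; rewrite mulr_ge0 ?wt_ge0 // F0 //; exact: disc_rr.
  have kx : k n j = rC x by rewrite -xE /k; congr cint; apply/funext => s; rewrite rCM.
  exists x; split => //; rewrite -mod_rC -kx.
  have c2 : contT (fun s => rC (M j) * u n s) := contT_M (@contT_cst _ (rC (M j))) (uc n).
  apply: le_trans (_ : complex.Re (cint (fun s => rC (M j) * u n s) (2 * pi)) <= _).
    apply: cint_le (kc n j) c2 pi20 _ => s s01; have F1 := F0 (disc_rr n s).
    rewrite modM ReMr [leLHS]mulrC (_ : modulus (u n s) = complex.Re (F (rC (rr n) * expi s))); last first.
      by rewrite /u mod_rC ger0_norm.
    apply: le_trans (_ : M j * complex.Re (F (rC (rr n) * expi s)) <= _) => //.
    apply: ler_wpM2r => //.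
    exact: (MH j).2.
  by rewrite (cintZ _ (uc n) pi20) mass ReMr.
have /choice[x xH] : forall n, exists x : 'I_q -> R, forall j,
    [/\ 0 <= x j, k n j = rC (x j) & `|x j| <= M j * (2 * pi * complex.Re (F 0))].
  by move=> n; have /choice[x xH] := kE n; exists x.
pose ext (v : 'I_q -> R) (i : nat) := if insub i is Some j then v j else 0.
have extE v (j : 'I_q) : ext v j = v j by rewrite /ext valK.
have xB n i : `|ext (x n) i| <= ext (fun j => M j * (2 * pi * complex.Re (F 0))) i.
  rewrite /ext; case: insubP => [j _ _|_]; last by rewrite normr0.
  by case: (xH n j).
have [sg [sgh [b bH]]] := diag_real xB.
exists (complex.Im (F 0)), (fun j => b j / (2 * pi)); split=> [j|z zd].
  apply: divr_ge0 => //; rewrite leNgt; apply/negP => b0.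
  have [|N NH] := bH j (- b j); first by rewrite oppr_gt0.
  have := NH N (leqnn N); rewrite extE; have [x0 _ _] := xH (sg N) j.
  by move=> /ltr_normlP[]; lra.
pose X := rC (2 * pi) * (F z - iC * rC (complex.Im (F 0))) - \sum_(j < q) Q z (zeta j) * rC (b j).
have XE : X = 0; last first.
  have p0 : rC (2 * pi) != 0 :> C R by rewrite rC_eq0 gt_eqF.
  move: XE => /eqP; rewrite subr_eq0 => /eqP XE.
  rewrite -[F z](subrK (iC * rC (complex.Im (F 0)))) addrC; congr (_ + _).
  apply: (mulfI p0); rewrite XE mulr_sumr; apply: eq_bigr => j _.
  have -> : rC (b j) = rC (2 * pi) * rC (b j / (2 * pi)) by rewrite -rCM mulrC divfK ?gt_eqF.
  by rewrite -/(Q z (zeta j)); move: (Q _ _) (rC _) (rC _) => X1 X2 X3; ring.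
pose K := 2 * pi + 1 + \sum_(j < q) modulus (Q z (zeta j)).
have K0 : 0 < K.
  have : 0 <= \sum_(j < q) modulus (Q z (zeta j)) by apply: sumr_ge0 => j _; exact: mod_ge0.
  by rewrite /K; lra.
have XK e : 0 < e -> modulus X <= K * e.
  move=> e0; have [N1 N1H] := remainder zd e0.
  have /contCP/(_ e e0)[d d0 dH] := hol_cont Fh zd.
  have [N2 N2H] := rr_cvg d0.
  have /choice[N3 N3H] : forall j : 'I_q, exists N, forall n, (N <= n)%N ->
      `|ext (x (sg n)) j - b j| < e by move=> j; exact: bH.
  pose n := maxn (maxn N1 N2) (\max_(j < q) N3 j).
  have nsg : (n <= sg n)%N := subseq_ge sgh n.
  have n1 : (N1 <= sg n)%N.
    by apply: leq_trans nsg; rewrite /n -maxnA leq_maxl.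
  have n2 : (N2 <= sg n)%N.
    by apply: leq_trans nsg; apply: leq_trans (leq_maxl _ _); exact: leq_maxr.
  have n3 j : (N3 j <= n)%N by apply: leq_trans (leq_maxr _ _); exact: leq_bigmax.
  have R1 := N1H _ n1.
  have zd' : disc (rC (rr (sg n)) * z).
    have /andP[r0 r1] := rr01' (sg n).
    move: zd; rewrite !disc_mod modM mod_rC ger0_norm //; have := mod_ge0 z; nra.
  have R2 : modulus (F (rC (rr (sg n)) * z) - F z) < e.
    apply: dH; have -> : rC (rr (sg n)) * z - z = - (rC (1 - rr (sg n)) * z).
      by move: (rr _) => y; rewrite rCB rC1; ring.
    have /andP[r0 r1] := rr01' (sg n); have := N2H _ n2.
    rewrite modN modM mod_rC ger0_norm; last by lra.
    by move: zd; rewrite disc_mod; have := mod_ge0 z; nra.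
  have E : cint (fun s => u (sg n) s * Qt z (expi s)) (2 * pi) =
      rC (2 * pi) * (F (rC (rr (sg n)) * z) - iC * rC (complex.Im (F 0))) -
      \sum_(j < q) Q z (zeta j) * rC (x (sg n) j).
    rewrite (_ : (fun s => _) = fun s => u (sg n) s * Q z (expi s) -
        \sum_(j < q) Q z (zeta j) * (u (sg n) s * rC (wt j (expi s)))); last first.
      apply/funext => s; rewrite /Qt mulrBr mulr_sumr; congr (_ - _).
      by apply: eq_bigr => j _; rewrite mulrCA.
    have jc j : contT (fun s => Q z (zeta j) * (u (sg n) s * rC (wt j (expi s)))).
      by apply: contT_M (kc _ _); exact: contT_cst.
    rewrite cintB ?pi20 //; last 2 first.
    - exact: contT_M (uc _) (Q_cont zd).
    - by move=> s; apply: cont_sum => j _; exact: jc.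
    rewrite (schwarz_formula (rr01 _) Fh zd) (cint_sum _ jc pi20); congr (_ - _).
    apply: eq_bigr => j _; rewrite (cintZ _ (kc _ _) pi20); congr (_ * _).
    by case: (xH (sg n) j).
  have -> : X = cint (fun s => u (sg n) s * Qt z (expi s)) (2 * pi) -
      rC (2 * pi) * (F (rC (rr (sg n)) * z) - F z) +
      \sum_(j < q) Q z (zeta j) * rC (x (sg n) j - b j).
    rewrite E /X (_ : \sum_(j < q) Q z (zeta j) * rC (x (sg n) j - b j) =
      \sum_(j < q) Q z (zeta j) * rC (x (sg n) j) - \sum_(j < q) Q z (zeta j) * rC (b j)).
      by ring.
    by rewrite -sumrB; apply: eq_bigr => j _; rewrite rCB mulrBr.
  have R3 : modulus (\sum_(j < q) Q z (zeta j) * rC (x (sg n) j - b j)) <=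
      (\sum_(j < q) modulus (Q z (zeta j))) * e.
    apply: le_trans (mod_sum _ _ _) _; rewrite mulr_suml; apply: ler_sum => j _.
    rewrite modM mod_rC ler_wpM2l ?mod_ge0 // ltW //.
    by have := N3H j n (n3 j); rewrite extE.
  have R4 : modulus (rC (2 * pi) * (F (rC (rr (sg n)) * z) - F z)) <= 2 * pi * e.
    by rewrite modM mod_rC ger0_norm // ler_wpM2l // ltW.
  apply: le_trans (modD _ _) _; have := modB (cint (fun s => u (sg n) s * Qt z (expi s)) (2 * pi))
     (rC (2 * pi) * (F (rC (rr (sg n)) * z) - F z)).
  have -> : K * e = 2 * pi * e + e + (\sum_(j < q) modulus (Q z (zeta j))) * e by rewrite /K; ring.
  lra.
apply/eqP; rewrite -mod_eq0 eq_le mod_ge0 andbT leNgt; apply/negP => X0.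
have := XK (modulus X / (2 * K)); rewrite divr_gt0 ?mulr_gt0 // => /(_ isT).
have -> : K * (modulus X / (2 * K)) = modulus X / 2 by field; rewrite gt_eqF.
lra.
Qed.

End Finite.

End Herglotz.

(** * Blaschke products and zeros *)

Section Involution.
Context {R : realType}.
Implicit Types (a z w u : C R) (r e : R).

(** The automorphism of the disc that exchanges [0] and [a]; being an involution, it
    is its own inverse. *)
Definition swap a z : C R := (a - z) / (1 - a^* * z).

Lemma swap_den a z : disc a -> modulus z <= 1 -> 1 - a^* * z != 0.
Proof.
rewrite disc_mod => a1 z1; apply/eqP => E.
have : modulus (a^* * z) = 1 by rewrite -[a^* * z](subKr 1) E subr0 mod1.
by rewrite modM mod_conj; have := mod_ge0 z; have := mod_ge0 a; nra.
Qed.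

Lemma swap_swap a z : disc a -> 1 - a^* * z != 0 -> swap a (swap a z) = z.
Proof.
move=> a1 d0; have a2 : 1 - a^* * a != 0 by apply: swap_den => //; move: a1; rewrite disc_mod => /ltW.
have e1 : a - swap a z = (1 - a^* * a) * z / (1 - a^* * z) by rewrite /swap; field.
have e2 : 1 - a^* * swap a z = (1 - a^* * a) / (1 - a^* * z) by rewrite /swap; field.
by rewrite {1}/swap e1 e2; field; rewrite a2 d0.
Qed.

Lemma swap0 a : swap a 0 = a.
Proof. by rewrite /swap subr0 mulr0 subr0 divr1. Qed.

Lemma swap_mod a z : disc a -> modulus z <= 1 ->
  1 - modulus (swap a z) ^+ 2 =
  (1 - modulus a ^+ 2) * (1 - modulus z ^+ 2) / modulus (1 - a^* * z) ^+ 2.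
Proof.
move=> a1 z1; have d0 := swap_den a1 z1; have m0 : 0 < modulus (1 - a^* * z) by rewrite mod_gt0.
have E : modulus (1 - a^* * z) ^+ 2 - modulus (a - z) ^+ 2 =
    (1 - modulus a ^+ 2) * (1 - modulus z ^+ 2).
  apply: rC_inj; rewrite rCB [RHS]rCM !rCB rC1 -!conj_mod2 !conjB conj1 conjM conjK.
  by ring.
rewrite -E /swap mod_div expr_div_n; field; exact: lt0r_neq0.
Qed.

Lemma swap_disc a z : disc a -> disc z -> disc (swap a z).
Proof.
move=> a1 zd; have z1 := zd; rewrite disc_mod in z1.
have E := swap_mod a1 (ltW z1); have d0 := swap_den a1 (ltW z1); move: a1 zd; rewrite !disc_mod => a1 zd.
have p : 0 < 1 - modulus (swap a z) ^+ 2.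
  have ma := mod_ge0 a; have mz := mod_ge0 z.
  rewrite E divr_gt0 ?exprn_gt0 ?mod_gt0 // mulr_gt0 // subr_gt0.
    by rewrite expr_lt1.
  by rewrite expr_lt1.
by rewrite -(@expr_lt1 _ 2) ?mod_ge0 // -subr_gt0.
Qed.

Lemma swap_circle a z : disc a -> modulus z = 1 -> modulus (swap a z) = 1.
Proof.
move=> a1 z1; have := swap_mod a1; move=> /(_ z); rewrite z1 lexx => /(_ isT).
rewrite expr1n subrr mulr0 mul0r => /eqP; rewrite subr_eq0 eq_sym => /eqP E.
by apply/eqP; rewrite -(@eqrXn2 _ 2) ?mod_ge0 // expr1n E.
Qed.

Lemma hol_swap a (U : set (C R)) : (forall z, U z -> 1 - a^* * z != 0) -> holomorphic U (swap a).
Proof.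
move=> nz; apply: (hol_div nz).
  exact: holB (hol_cst (c := a)) (@hol_id _ U).
exact: holB (hol_cst (c := 1)) (holM (hol_cst (c := a^*)) (@hol_id _ U)).
Qed.

Lemma hol_swap_disc a : disc a -> holomorphic disc (swap a).
Proof. by move=> a1; apply: hol_swap => z; rewrite disc_mod => /ltW; exact: swap_den. Qed.

(** If [|z|] tends to [1] then so does [|swap a z|]; this carries boundary behaviour
    through changes of coordinates. *)
Lemma swap_boundary a z : disc a -> disc z ->
  1 - modulus (swap a z) <= 2 / (1 - modulus a) ^+ 2 * (1 - modulus z).
Proof.
move=> a1 zd; have := swap_disc a1 zd; have z1 := zd; rewrite disc_mod in z1.
rewrite disc_mod => s1; have E := swap_mod a1 (ltW z1).
have d0 := swap_den a1 (ltW z1); move: a1; rewrite disc_mod => a1.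
have ma := mod_ge0 a; have mz := mod_ge0 z; have ms := mod_ge0 (swap a z).
apply: le_trans (_ : 1 - modulus (swap a z) ^+ 2 <= _); first by rewrite lerD2l lerN2 expr2; nra.
rewrite E; have h : 1 - modulus a <= modulus (1 - a^* * z).
  have := modBB 1 (a^* * z); rewrite mod1 modM mod_conj; nra.
have p0 : 0 < (1 - modulus a) ^+ 2 by rewrite exprn_gt0 // subr_gt0.
have h2 : (modulus (1 - a^* * z) ^+ 2)^-1 <= ((1 - modulus a) ^+ 2)^-1.
  rewrite lef_pV2 ?posrE ?exprn_gt0 ?mod_gt0 //; last by rewrite subr_gt0.
  by apply: lerXn2r => //; rewrite nnegrE ?mod_ge0 // subr_ge0 ltW.
have h3 : (1 - modulus a ^+ 2) * (1 - modulus z ^+ 2) <= 2 * (1 - modulus z).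
  rewrite !expr2; have : 0 <= modulus a * modulus a by rewrite mulr_ge0.
  have : 0 <= 1 - modulus z * modulus z by nra.
  have : (1 - modulus z * modulus z) <= 2 * (1 - modulus z) by nra.
  nra.
rewrite [leRHS]mulrAC; apply: ler_pM => //; last by rewrite invr_ge0 exprn_ge0 // mod_ge0.
by apply: mulr_ge0; rewrite subr_ge0 expr_le1 // ltW.
Qed.

Lemma blaschke_swap a : exists2 u, modulus u = 1 & forall z, blaschke_factor a z = u * swap a z.
Proof.
have [-> |a0] := eqVneq a 0.
  exists (-1); first by rewrite modN mod1.
  by move=> z; rewrite /blaschke_factor eqxx /swap conj0 mul0r subr0 divr1 sub0r mulrN mulN1r opprK.
exists (`|a| / a); last by move=> z; rewrite /blaschke_factor (negPf a0).
have m0 : 0 < modulus a by rewrite mod_gt0.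
by rewrite normE mod_div mod_rC ger0_norm ?(ltW m0) // divff // gt_eqF.
Qed.

Lemma swap_riemann a : disc a -> riemann_map disc disc (swap a).
Proof.
move=> a1; have K z : disc z -> swap a (swap a z) = z.
  by rewrite disc_mod => /ltW z1; apply: swap_swap => //; exact: swap_den.
apply/riemann_mapP; split => [|z|z w zd wd E|z zd].
- exact: hol_swap_disc.
- exact: swap_disc.
- by rewrite -(K z zd) E K.
- by exists (swap a z); [exact: swap_disc|exact: K].
Qed.

End Involution.

Section ZeroOrder.
Context {R : realType}.
Implicit Types (f F P Q : C R -> C R) (z w : C R) (r e : R) (U V : set (C R)).

Lemma cont_eq_punctured (u v : C R -> C R) z r : 0 < r -> cont u z -> cont v z ->
  (forall w, Ball z r w -> w != z -> u w = v w) -> u z = v z.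
Proof.
move=> r0 uc vc E; apply/eqP; rewrite -subr_eq0 -mod_eq0 eq_le mod_ge0 andbT leNgt.
apply/negP => p; have /contCP/(_ (modulus (u z - v z)) p)[d d0 dH] := contB uc vc.
pose t := Num.min r d / 2.
have t0 : 0 < t by rewrite divr_gt0 // lt_min r0.
have [tr td] : t < r /\ t < d.
  have : Num.min r d <= r /\ Num.min r d <= d by rewrite !ge_min !lexx orbT.
  by rewrite /t; move: t0; rewrite /t; lra.
have wE : z + rC t - z = rC t by rewrite addrAC subrr add0r.
have := dH (z + rC t); rewrite wE mod_rC gtr0_norm // => /(_ td).
rewrite E ?subrr ?sub0r ?modN ?ltxx //; first by rewrite /Ball /= wE mod_rC gtr0_norm.
by rewrite -subr_eq0 wE rC_eq0 gt_eqF.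
Qed.

Lemma zero_order_ball F z k : zero_order F z k -> exists r g,
  [/\ 0 < r, holomorphic (Ball z r) g, forall w, Ball z r w -> g w != 0 &
      forall w, Ball z r w -> F w = (w - z) ^+ k * g w].
Proof.
move=> [V [g [Vo Vz gh g0 gE]]]; have [r r0 rV] := (openP V).1 Vo z Vz.
have gc := hol_cont gh Vz; have [d d0 dH] := cont_neq0 gc g0.
have s1 : Ball z (Num.min r d) `<=` Ball z r by apply: le_Ball; rewrite ge_min lexx.
have s2 : Ball z (Num.min r d) `<=` Ball z d by apply: le_Ball; rewrite ge_min lexx orbT.
exists (Num.min r d), g; split; first by rewrite lt_min r0.
- by apply: sub_hol gh => w /s1/rV.
- by move=> w /s2; exact: dH.
- by move=> w /s1/rV; exact: gE.
Qed.

Lemma zero_order0 F z U : open U -> U z -> holomorphic U F -> F z != 0 -> zero_order F z 0.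
Proof. by move=> Uo Uz Fh F0; exists U, F; split => // w _; rewrite expr0 mul1r. Qed.

Lemma zero_orderS F z k : zero_order F z k.+1 -> F z = 0.
Proof. by case=> V [g [_ Vz _ _ ->]] //; rewrite subrr exprS !mul0r. Qed.

(** Away from [z] the quotient of the two factorisations is forced, and at [z] it
    follows by continuity. *)
Lemma zero_order_div F P Q U z k j : open U -> U z -> holomorphic U Q ->
  (forall w, U w -> F w = P w * Q w) -> zero_order F z (j + k) -> zero_order P z j ->
  zero_order Q z k.
Proof.
move=> Uo Uz Qh E /zero_order_ball[r1 [g1 [r10 g1h g10 g1E]]].
move=> /zero_order_ball[r2 [g2 [r20 g2h g20 g2E]]].
have [r3 r30 r3U] := (openP U).1 Uo z Uz.
pose r := Num.min r1 (Num.min r2 r3).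
have r0 : 0 < r by rewrite !lt_min r10 r20.
have s1 : Ball z r `<=` Ball z r1 by apply: le_Ball; rewrite ge_min lexx.
have s2 : Ball z r `<=` Ball z r2 by apply: le_Ball; rewrite !ge_min lexx orbT.
have s3 : Ball z r `<=` U by move=> w wr; apply: r3U; apply: le_Ball wr; rewrite !ge_min lexx !orbT.
have zr := Ball_center z r0.
have qh : holomorphic (Ball z r) (fun w => g1 w / g2 w).
  by apply: hol_div (sub_hol s1 g1h) (sub_hol s2 g2h) => w /s2; exact: g20.
have xh : holomorphic (Ball z r) (fun w => (w - z) ^+ k * (g1 w / g2 w)).
  exact: holM (holX (n := k) (holB (@hol_id _ _) (hol_cst (c := z)))) qh.
have off w : Ball z r w -> w != z -> Q w = (w - z) ^+ k * (g1 w / g2 w).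
  move=> wr wz; have := E w (s3 w wr); rewrite (g1E w (s1 w wr)) (g2E w (s2 w wr)).
  have d0 : (w - z) ^+ j != 0 by rewrite expf_neq0 // subr_eq0.
  rewrite exprD -!mulrA => /(mulfI d0) hs.
  by rewrite mulrA hs mulrC mulKf // g20 //; exact: s2.
have at_z : Q z = (z - z) ^+ k * (g1 z / g2 z).
  apply: (cont_eq_punctured r0 _ _ off).
    exact: hol_cont Qh Uz.
  exact: hol_cont xh zr.
exists (Ball z r), (fun w => g1 w / g2 w); split => //.
- exact: open_Ball.
- by rewrite mulf_neq0 ?invr_eq0 ?g10 ?g20 //; [exact: s1|exact: s2].
- by move=> w wr; have [-> //|wz] := eqVneq w z; exact: off.
Qed.

Lemma zero_order_uniq F z k j : zero_order F z k -> zero_order F z j -> k = j.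
Proof.
wlog kj : k j / (k <= j)%N.
  move=> hs h1 h2; have [kj|/ltnW jk] := leqP k j; first exact: hs.
  by apply/esym; apply: hs.
move=> hk hj; have U1 := @zero_order_div F F (fun=> 1) setT z (j - k) k openT I.
have {U1} : zero_order (fun=> 1 : C R) z (j - k).
  by apply: (U1 (@hol_cst _ _ 1)) => //; [move=> w _; rewrite mulr1|rewrite subnKC].
case E : (j - k)%N => [|n]; first by move=> _; apply/eqP; rewrite eqn_leq kj -subn_eq0 E.
by move=> /zero_orderS /eqP; rewrite oner_eq0.
Qed.

(** The divided difference of [phi] at [z] has the nonzero value [phi' z] there. *)
Lemma zero_order_comp F U (phi : C R -> C R) z k : open U -> U z -> holomorphic U phi ->
  (forall v w, U v -> U w -> phi v = phi w -> v = w) ->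
  zero_order F (phi z) k -> zero_order (fun w => F (phi w)) z k.
Proof.
move=> Uo Uz ph pinj /zero_order_ball[r [g [r0 gh g0 gE]]].
have pc := hol_cont ph Uz; have /contCP/(_ r r0)[d d0 dH] := pc.
have [r1 r10 r1U] := (openP U).1 Uo z Uz.
pose t := Num.min d r1; have t0 : 0 < t by rewrite lt_min d0.
have s1 : Ball z t `<=` Ball z d by apply: le_Ball; rewrite ge_min lexx.
have s2 : Ball z t `<=` U by move=> w wr; apply: r1U; apply: le_Ball wr; rewrite !ge_min lexx orbT.
have inB w : Ball z t w -> Ball (phi z) r (phi w) by move=> /s1; exact: dH.
have zt := Ball_center z t0.
have dh := hol_dq Uo Uz ph.
exists (Ball z t), (fun w => dq phi z w ^+ k * g (phi w)); split.
- exact: open_Ball.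
- exact: zt.
- apply: holM; first exact: holX (sub_hol s2 dh).
  exact: hol_comp inB (sub_hol s2 ph) gh.
- rewrite mulf_neq0 // ?g0 //; last exact: inB.
  rewrite expf_neq0 // /dq eqxx; apply: (inj_cD_neq0 r10 (sub_hol r1U ph)) => v w /r1U Uv /r1U Uw.
  exact: pinj.
- move=> w wt; rewrite (gE _ (inB w wt)) (dqE phi z w) addrAC subrr add0r exprMn mulrA.
  by rewrite -dqE.
Qed.

End ZeroOrder.

Section Structure.
Context {R : realType}.
Implicit Types (f g u B : C R -> C R) (z w a : C R) (r e t : R) (s : seq (C R)).

Lemma zero_order_swap a z : disc a -> disc z -> zero_order (swap a) z (a == z).
Proof.
move=> ad zd; have [<-|az] := eqVneq a z; last first.
  apply: (zero_order0 open_disc zd (hol_swap_disc ad)).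
  rewrite /swap mulf_neq0 ?subr_eq0 // invr_eq0 swap_den //.
  by move: zd; rewrite disc_mod => /ltW.
exists disc, (fun w => - (1 - a^* * w)^-1).
have nz w : disc w -> 1 - a^* * w != 0 by rewrite disc_mod => /ltW; exact: swap_den.
split => //; first exact: open_disc.
- apply: holN; apply: holV nz _.
  exact: holB (hol_cst (c := 1)) (holM (hol_cst (c := a^*)) (@hol_id _ _)).
- by rewrite oppr_eq0 invr_eq0 nz.
- by move=> w _; rewrite expr1 /swap mulrN -mulNr opprB.
Qed.

(** Schwarz' lemma after moving [a] to the centre. *)
Lemma schwarz_pick g a z : holomorphic disc g -> (forall w, disc w -> modulus (g w) <= 1) ->
  disc a -> g a = 0 -> disc z -> modulus (g z) <= modulus (swap a z).
Proof.
move=> gh g1 ad ga zd.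
have vh : holomorphic disc (fun w => g (swap a w)).
  by apply: hol_comp (hol_swap_disc ad) gh => w; exact: swap_disc.
rewrite disc_Ball in vh.
have := @schwarz _ (fun w => g (swap a w)) 0 1 (swap a z) 1 vh.
rewrite subr0 divr1 mul1r swap0 ga swap_swap //; last first.
  by apply: swap_den => //; move: zd; rewrite disc_mod => /ltW.
apply => //; last by rewrite -disc_Ball; exact: swap_disc.
by move=> v; rewrite -disc_Ball => vd; apply: g1; exact: swap_disc.
Qed.

(** Each quotient by a factor [swap a] is again bounded by one, by Schwarz' lemma. *)
Lemma blaschke_split s : forall g, holomorphic disc g ->
  (forall z, disc z -> modulus (g z) <= 1) -> (forall a, a \in s -> disc a) ->
  (forall z, disc z -> zero_order g z (count_mem z s)) ->
  exists u, [/\ holomorphic disc u,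
    forall z, disc z -> modulus (u z) <= 1, forall z, disc z -> u z != 0 &
    forall z, disc z -> g z = (\prod_(a <- s) swap a z) * u z].
Proof.
elim: s => [|a s IH] g gh g1 sd g0.
  exists g; split => // z zd; last by rewrite big_nil mul1r.
  by have [V [v [_ Vz _ v0 ->]]] := g0 z zd; rewrite //= expr0 mul1r.
have ad : disc a by apply: sd; rewrite mem_head.
have ga : g a = 0 by have := g0 a ad; rewrite /= eqxx; exact: zero_orderS.
pose u1 z := - dq g a z * (1 - a^* * z).
have u1h : holomorphic disc u1.
  apply: holM; first by apply: holN; exact: hol_dq open_disc ad gh.
  exact: holB (hol_cst (c := 1)) (holM (hol_cst (c := a^*)) (@hol_id _ _)).
have E z : disc z -> g z = swap a z * u1 z.
  move=> zd; have d0 : 1 - a^* * z != 0 by apply: swap_den => //; move: zd; rewrite disc_mod => /ltW.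
  by rewrite /swap /u1 (dqE g a z) ga; field.
have off z : disc z -> z != a -> modulus (u1 z) <= 1.
  move=> zd za; have := schwarz_pick gh g1 ad ga zd; rewrite E // modM.
  have d0 : 1 - a^* * z != 0 by apply: swap_den => //; move: zd; rewrite disc_mod => /ltW.
  have p : 0 < modulus (swap a z).
    by rewrite mod_gt0 /swap mulf_neq0 ?invr_eq0 // subr_eq0 eq_sym.
  by rewrite -[X in _ <= X]mulr1 ler_pM2l.
have u11 z : disc z -> modulus (u1 z) <= 1.
  move=> zd; have [za|] := eqVneq z a; last exact: off.
  rewrite leNgt; apply/negP; rewrite -subr_gt0 => p.
  have /contCP/(_ _ p)[d d0 dH] := hol_cont u1h zd.
  have [r r0 rd] := (openP _).1 open_disc z zd.
  pose t := Num.min r d / 2.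
  have t0 : 0 < t by rewrite divr_gt0 // lt_min r0.
  have [tr td] : t < r /\ t < d.
    have : Num.min r d <= r /\ Num.min r d <= d by rewrite !ge_min !lexx orbT.
    by rewrite /t; move: t0; rewrite /t; lra.
  have wE : z + rC t - z = rC t by rewrite addrAC subrr add0r.
  have wd : disc (z + rC t) by apply: rd; rewrite /Ball /= wE mod_rC gtr0_norm.
  have := dH (z + rC t); rewrite wE mod_rC gtr0_norm // => /(_ td) h1.
  have : modulus (u1 (z + rC t)) <= 1.
    by apply: off wd _; rewrite -za -subr_eq0 wE rC_eq0 gt_eqF.
  by have := modBB (u1 z) (u1 (z + rC t)); rewrite mod_distC; lra.
have [|z zd|u [uh ule u0 uE]] := IH u1 u1h u11.
- by move=> x xs; apply: sd; rewrite inE xs orbT.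
- exact: zero_order_div open_disc zd u1h E (g0 z zd) (zero_order_swap ad zd).
exists u; split => // z zd; by rewrite big_cons E // uE // mulrA.
Qed.

Lemma blaschke_prod s : exists t, forall z,
  \prod_(a <- s) swap a z = expi t * \prod_(n < size s) blaschke_factor s`_n z.
Proof.
have [u u1 uE] : exists2 u : C R, modulus u = 1 & forall z,
    \prod_(a <- s) swap a z = u * \prod_(n < size s) blaschke_factor s`_n z.
  elim: s => [|a s [u u1 uE]]; first by exists 1; [exact: mod1|move=> z; rewrite big_nil big_ord0 mul1r].
  have [v v1 vE] := blaschke_swap a.
  have v0 : v != 0 by rewrite -mod_gt0 v1.
  exists (u / v); first by rewrite mod_div u1 v1 divr1.
  by move=> z; rewrite big_cons big_ord_recl /= uE vE; field.
have [t [_ tE]] := unit_expi u1; exists t => z; by rewrite uE tE.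
Qed.

(** What remains after splitting off the zeros is [exp (- F)] with [Re F >= 0], and
    [Re F] tends to [0] wherever [|g|] tends to [1], since [|g| <= exp (- Re F)]. *)
Theorem inner_structure s g (q : nat) (zeta : 'I_q -> C R) : holomorphic disc g ->
  (forall z, disc z -> modulus (g z) <= 1) -> (forall a, a \in s -> disc a) ->
  (forall z, disc z -> zero_order g z (count_mem z s)) ->
  injective zeta ->
  (forall w, modulus w = 1 -> (forall j, w != zeta j) -> forall e, 0 < e ->
    exists2 d : R, 0 < d & forall z, disc z -> modulus (z - w) < d -> 1 - e < modulus (g z)) ->
  exists (t : R) (c : 'I_q -> R), (forall j, 0 <= c j) /\ forall z, disc z ->
    g z = expi t * \prod_(n < size s) blaschke_factor s`_n z *
      cexp (- \sum_(j < q) rC (c j) * ((zeta j + z) / (zeta j - z))).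
Proof.
move=> gh g1 sd g0 zeta_inj bd.
have [u [uh ule u0 uE]] := blaschke_split gh g1 sd g0.
have d0 : disc (0 : C R) by rewrite disc_mod mod0.
have uB : holomorphic (Ball 0 1) u by rewrite -disc_Ball.
have [|c [cE _ _]] := @cexp_surj _ (u 0); first exact: u0.
have [|L [Lh _ LE]] := hol_log ltr01 uB _ cE.
  by move=> w; rewrite -disc_Ball; exact: u0.
rewrite -disc_Ball in Lh LE.
have mE z : disc z -> modulus (u z) = expR (complex.Re (L z)) by move=> zd; rewrite -LE // mod_cexp.
have ML z : disc z -> complex.Re (L z) <= 0.
  by move=> zd; rewrite -ler_expR expR0 -mE // ule.
have [||tau [x [x0 xE]]] := herglotz_finite zeta_inj (holN Lh).
- by move=> z zd; rewrite ReN oppr_ge0 ML.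
- move=> w w1 wz e e0; have [|d dp dH] := bd w w1 wz (1 - expR (- e)).
    by rewrite subr_gt0 -expR0 ltr_expR oppr_lt0.
  exists d => // z zd zw; have := dH z zd zw; rewrite subKr => h1.
  have h2 : modulus (g z) <= modulus (u z).
    rewrite uE // modM -[X in _ <= X]mul1r ler_wpM2r ?mod_ge0 // mod_prod.
    rewrite big_seq_cond; have /andP[] // : 0 <= \prod_(a <- s | (a \in s) && true) modulus (swap a z) <= 1.
    elim/big_ind : _ => [|x y /andP[x0' x1] /andP[y0 y1]|a /andP[/sd ad _]].
    - by rewrite ler01 lexx.
    - by rewrite mulr_ge0 //= mulr_ile1.
    - by rewrite mod_ge0 /=; have := swap_disc ad zd; rewrite disc_mod => /ltW.
  have : expR (- e) < expR (complex.Re (L z)) by rewrite -mE // (lt_le_trans h1).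
  by rewrite ltr_expR ReN; lra.
have [t tE] := blaschke_prod s.
exists (t - tau), x; split => // z zd.
rewrite uE // tE -LE // -[L z]opprK xE // expiD opprD cexpD /expi.
rewrite (_ : iC * rC (- tau) = - (iC * rC tau)); last by rewrite rCN mulrN.
by ring.
Qed.

End Structure.

(** * Boundary values *)

Section BoundaryForm.
Context {R : realType}.
Implicit Types (g B : C R -> C R) (z w a : C R) (r e t : R) (s : seq (C R)).

(** Numerator of the Poisson kernel; it vanishes when both points are on the circle. *)
Lemma kernel_ReE (zeta z : C R) : zeta != z ->
  modulus (zeta - z) ^+ 2 * complex.Re ((zeta + z) / (zeta - z)) =
  modulus zeta ^+ 2 - modulus z ^+ 2.
Proof.
move=> zz; have d0 : zeta - z != 0 by rewrite subr_eq0.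
have E : rC (modulus (zeta - z) ^+ 2) * ((zeta + z) / (zeta - z)) = (zeta + z) * (zeta - z)^*.
  by rewrite -conj_mod2; field.
rewrite -ReMr E !mod_sqr; case: zeta z {zz d0 E} => x y [x' y'].
rewrite ReM /=; ring.
Qed.

Lemma kernel_Re (zeta w : C R) : modulus zeta = 1 -> modulus w = 1 ->
  complex.Re ((zeta + w) / (zeta - w)) = 0.
Proof.
move=> z1 w1; have [->|zw] := eqVneq zeta w; first by rewrite subrr invr0 mulr0.
have := kernel_ReE zw; rewrite z1 w1 subrr => /eqP; rewrite mulf_eq0 expf_eq0 /= mod_eq0 subr_eq0.
by rewrite (negPf zw) => /eqP.
Qed.

Lemma kernel_Re_ge0 (zeta z : C R) : modulus zeta = 1 -> modulus z < 1 ->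
  0 <= complex.Re ((zeta + z) / (zeta - z)).
Proof.
move=> z1 zd; have zz : zeta != z by apply: contraTneq zd => <-; rewrite z1 ltxx.
have p : 0 < modulus (zeta - z) ^+ 2 by rewrite exprn_gt0 // mod_gt0 subr_eq0.
rewrite -(pmulr_rge0 _ p) kernel_ReE // z1 expr1n subr_ge0 expr_le1 ?mod_ge0 //.
exact: ltW.
Qed.

Lemma mod_cexp_kernel (q : nat) (c : 'I_q -> R) (zeta : 'I_q -> C R) w :
  (forall j, modulus (zeta j) = 1) -> modulus w = 1 ->
  complex.Re (- \sum_(j < q) rC (c j) * ((zeta j + w) / (zeta j - w))) = 0.
Proof.
move=> z1 w1; rewrite ReN Re_sum big1 ?oppr0 // => j _.
by rewrite ReMr kernel_Re // mulr0.
Qed.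

Lemma hol_blaschke a (U : set (C R)) : (forall z, U z -> 1 - a^* * z != 0) ->
  holomorphic U (blaschke_factor a).
Proof.
move=> nz; have [u _ uE] := blaschke_swap a.
rewrite (_ : blaschke_factor a = fun z => u * swap a z); last exact/funext.
exact: holM (hol_cst (c := u)) (hol_swap nz).
Qed.

Lemma mod_blaschke a w : disc a -> modulus w = 1 -> modulus (blaschke_factor a w) = 1.
Proof. by move=> ad w1; have [u u1 ->] := blaschke_swap a; rewrite modM u1 swap_circle // mulr1. Qed.

(** Near [w] the sum only involves kernels whose poles are elsewhere, and the kernels
    are purely imaginary on the circle. *)
Lemma form_extension s (q : nat) (c : 'I_q -> R) (zeta : 'I_q -> C R) t w :
  (forall a, a \in s -> disc a) -> (forall j, modulus (zeta j) = 1) -> modulus w = 1 ->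
  (forall j, zeta j = w -> c j = 0) ->
  exists V E, [/\ open V, V w, holomorphic V E, modulus (E w) = 1 &
    forall z, V z -> E z = expi t * \prod_(n < size s) blaschke_factor s`_n z *
      cexp (- \sum_(j < q) rC (c j) * ((zeta j + z) / (zeta j - z)))].
Proof.
move=> sd zeta1 w1 c0.
have snd (n : 'I_(size s)) : disc s`_n by apply: sd; exact: mem_nth.
pose den (j : 'I_q) z := if zeta j == w then 1 else zeta j - z.
pose D z := (\prod_(n < size s) (1 - (s`_n)^* * z)) * \prod_(j < q) den j z.
have Dc : cont D w.
  apply: contM; apply: cont_prod => i _.
    apply: contB; first exact: cont_cst.
    by apply: contM; [exact: cont_cst|exact: cont_id].
  rewrite /den; case: (zeta i == w); first exact: cont_cst.
  by apply: contB; [exact: cont_cst|exact: cont_id].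
have D0 : D w != 0.
  rewrite mulf_neq0 //; apply/prodf_neq0 => i _.
    by apply: swap_den; rewrite ?w1.
  rewrite /den; have [iw|iw] := eqVneq (zeta i) w; first exact: oner_neq0.
  by rewrite subr_eq0.
have [d d0 dH] := cont_neq0 Dc D0.
have den1 z : Ball w d z -> forall n : 'I_(size s), 1 - (s`_n)^* * z != 0.
  by move=> /dH; rewrite mulf_eq0 => /norP[/prodf_neq0 hs _] n; exact: hs.
have den2 z : Ball w d z -> forall j, den j z != 0.
  by move=> /dH; rewrite mulf_eq0 => /norP[_ /prodf_neq0 hs] n; exact: hs.
pose K j z := if zeta j == w then 0 else rC (c j) * ((zeta j + z) / (zeta j - z)).
have Kh j : holomorphic (Ball w d) (K j).
  rewrite /K; have [jw|jw] := eqVneq (zeta j) w; first exact: (@hol_cst _ _ 0).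
  apply: holM; first exact: (@hol_cst _ _ (rC (c j))).
  apply: hol_div => [z /den2/(_ j)||].
  - by rewrite /den (negPf jw).
  - exact: holD (hol_cst (c := zeta j)) (@hol_id _ _).
  - exact: holB (hol_cst (c := zeta j)) (@hol_id _ _).
have KE z : \sum_(j < q) K j z = \sum_(j < q) rC (c j) * ((zeta j + z) / (zeta j - z)).
  apply: eq_bigr => j _; rewrite /K; have [jw|//] := eqVneq (zeta j) w.
  by rewrite c0 // rC0 mul0r.
exists (Ball w d), (fun z => expi t * \prod_(n < size s) blaschke_factor s`_n z *
   cexp (- \sum_(j < q) K j z)); split.
- exact: open_Ball.
- exact: Ball_center.
- apply: holM; last by apply: hol_cexpf; apply: holN; exact: hol_sum.
  apply: holM; first exact: (@hol_cst _ _ (expi t)).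
  by apply: hol_prod => n; apply: hol_blaschke => z /den1; apply.
- rewrite modM mod_cexp KE mod_cexp_kernel // expR0 mulr1 modM mod_expi mul1r mod_prod.
  by rewrite big1 // => n _; exact: mod_blaschke.
- by move=> z _; rewrite KE.
Qed.

(** On the radius through [zeta j] the kernel of that atom is [(1 + r) / (1 - r)], and
    the other kernels have nonnegative real part. *)
Lemma form_radial s (q : nat) (c : 'I_q -> R) (zeta : 'I_q -> C R) t j e :
  (forall a, a \in s -> disc a) -> (forall j, modulus (zeta j) = 1) ->
  (forall j, 0 < c j) -> 0 < e -> exists2 d : R, 0 < d & forall r, 0 < r < 1 -> 1 - r < d ->
    modulus (expi t * \prod_(n < size s) blaschke_factor s`_n (rC r * zeta j) *
      cexp (- \sum_(i < q) rC (c i) * ((zeta i + rC r * zeta j) / (zeta i - rC r * zeta j)))) < e.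
Proof.
move=> sd z1 c0 e0; exists (c j * e); first by rewrite mulr_gt0.
move=> r /andP[r0 r1] rd; set z := rC r * zeta j.
have zm : modulus z = r by rewrite modM z1 mulr1 mod_rC gtr0_norm.
have zd : disc z by rewrite disc_mod zm.
rewrite modM mod_cexp modM mod_expi mul1r.
have h1 : modulus (\prod_(n < size s) blaschke_factor s`_n z) <= 1.
  rewrite mod_prod; have /andP[] // : 0 <= \prod_(n < size s) modulus (blaschke_factor s`_n z) <= 1.
  elim/big_ind : _ => [|x y /andP[x0' x1] /andP[y0 y1]|n _].
  - by rewrite ler01 lexx.
  - by rewrite mulr_ge0 //= mulr_ile1.
  - have ad : disc s`_n by apply: sd; exact: mem_nth.
    have [u u1 ->] := blaschke_swap s`_n; rewrite modM u1 mul1r mod_ge0 /=.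
    by have := swap_disc ad zd; rewrite disc_mod => /ltW.
have r10 : 0 < 1 - r by rewrite subr_gt0.
have kj : complex.Re ((zeta j + z) / (zeta j - z)) = (1 + r) / (1 - r).
  have zj0 : zeta j != 0 by rewrite -mod_gt0 z1.
  have d1 : 1 - rC r != 0 :> C R by rewrite -rC1 -rCB rC_eq0 gt_eqF.
  rewrite (_ : (zeta j + z) / (zeta j - z) = rC ((1 + r) / (1 - r))) //.
  rewrite rCM rCV rCD rCB rC1 /z; field; rewrite d1 /=.
  by rewrite (_ : zeta j - rC r * zeta j = (1 - rC r) * zeta j) ?mulf_neq0 //; ring.
have h2 : c j / (1 - r) <= complex.Re (\sum_(i < q) rC (c i) * ((zeta i + z) / (zeta i - z))).
  rewrite Re_sum (bigD1 j) //= ReMr kj; apply: ler_wpDr.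
    apply: sumr_ge0 => i _; rewrite ReMr mulr_ge0 ?(ltW (c0 i)) //.
    by apply: kernel_Re_ge0; rewrite ?zm.
  rewrite ler_pM2l // -[X in X <= _]mul1r ler_wpM2r // ?invr_ge0 ?(ltW r10) //; lra.
have h3 : expR (complex.Re (- \sum_(i < q) rC (c i) * ((zeta i + z) / (zeta i - z)))) < e.
  rewrite ReN; have x0 : 0 < c j / (1 - r) by rewrite divr_gt0.
  apply: le_lt_trans (_ : (c j / (1 - r))^-1 < _).
    rewrite expRN lef_pV2 ?posrE ?expR_gt0 //; apply: le_trans h2 _.
    by apply: le_trans (expR_ge1Dx _); lra.
  by rewrite invf_div ltr_pdivrMr // mulrC.
apply: le_lt_trans h3; rewrite -[X in _ <= X]mul1r ler_wpM2r // expR_ge0.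
Qed.

End BoundaryForm.

Section Radial.
Context {R : realType}.
Implicit Types (g E : C R -> C R) (V : set (C R)) (z w : C R) (t e d : R).

Lemma radial_limit g V E t : open V -> V (expi t) -> cont E (expi t) ->
  (forall z, V z -> disc z -> E z = g z) ->
  g (rC r * expi t) @[r --> (1 : R)^'-] --> E (expi t).
Proof.
move=> Vo Vt Ec EE; have [d d0 dV] := (openP V).1 Vo _ Vt.
have c1 : cont (fun r : R => rC r * expi t) 1.
  by apply: contM; [exact: cont_rC|exact: cont_cst].
have c2 : cont (fun r : R => E (rC r * expi t)) 1.
  by apply: cont_comp c1 _; rewrite rC1 mul1r.
have /contE := c2; rewrite rC1 mul1r => /cvg_at_left_filter; apply: cvg_trans.
apply: near_eq_cvg; near=> r.
have r1 : r < 1 by near: r; exact: nbhs_left_lt.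
have r0 : 0 < r by near: r; exact: nbhs_left_gt.
have rd : 1 - r < d by near: r; exact: nbhs_left_ltBl.
apply: EE; last by rewrite disc_mod modM mod_expi mulr1 mod_rC gtr0_norm.
apply: dV; rewrite /Ball /= (_ : _ - _ = rC (r - 1) * expi t); last by rewrite rCB rC1; ring.
by rewrite modM mod_expi mulr1 mod_rC distrC gtr0_norm // subr_gt0.
Unshelve. all: by end_near.
Qed.

(** If [|E w|] were not [1], the radial limits would fail to be unimodular on an
    interval of angles, which has positive measure. *)
Lemma inner_unimodular g V E w : inner g -> modulus w = 1 -> open V -> V w ->
  holomorphic V E -> (forall z, V z -> disc z -> E z = g z) -> modulus (E w) = 1.
Proof.
move=> [_ _ ae] w1 Vo Vw Eh EE; have [t [_ tE]] := unit_expi w1.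
apply: contrapT => N; have p : 0 < `|modulus (E w) - 1|.
  by rewrite normr_gt0 subr_eq0; apply/eqP.
have [d1 d10 d1V] := (openP V).1 Vo _ Vw.
have Ec := hol_cont Eh Vw; have /contCP/(_ _ p)[d2 d20 d2H] := Ec.
pose d := Num.min d1 d2; have d0 : 0 < d by rewrite lt_min d10.
have /contRP/(_ d d0)[x x0 xH] := @cont_expi _ t.
case: ae => A [Am A0 AH].
have sub : `](t - x), (t + x)[%classic `<=` A.
  move=> y /=; rewrite in_itv /= => /andP[y1 y2]; apply: AH => /= -[l [l1 lim]].
  have yx : `|y - t| < x by rewrite ltr_norml; apply/andP; split; lra.
  have := xH y yx; rewrite tE lt_min => /andP[yd1 yd2].
  have yV : V (expi y) by exact: d1V.
  have lim2 := radial_limit Vo yV (hol_cont Eh yV) EE.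
  have lE := cvg_unique (@norm_hausdorff _ _) lim lim2.
  have m1 : modulus (E (expi y)) = 1 by apply/norm1_mod; rewrite -lE.
  have := d2H _ yd2; rewrite ltNge => /negP; apply.
  rewrite -m1; have := modBB (E w) (E (expi y)); have := modBB (E (expi y)) (E w).
  by rewrite [modulus (E w - _)]mod_distC ler_norml => h1 h2; apply/andP; split; lra.
pose S : set R := `](t - x), (t + x)[%classic.
have : (lebesgue_measure S <= lebesgue_measure A)%E.
  by apply: le_measure => //; rewrite inE //; exact: measurable_itv.
rewrite [X in (_ <= X)%E -> _]A0 /S lebesgue_measure_itv /= lte_fin.
have -> : t - x < t + x by lra.
rewrite -EFinD lee_fin; lra.
Qed.

(** Only countably many angles are exceptional. *)
Lemma inner_of_extension g (A : set (C R)) : countable A -> holomorphic disc g ->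
  (forall z, disc z -> disc (g z)) ->
  (forall w, modulus w = 1 -> ~ A w -> exists V E, [/\ open V, V w, holomorphic V E,
     modulus (E w) = 1 & forall z, V z -> disc z -> E z = g z]) -> inner g.
Proof.
move=> Ac gh gd ext; split => //.
have /choice[arg argE] : forall w : C R, exists t, modulus w = 1 -> expi t = w.
  move=> w; have [/unit_expi[t [_ tE]]|N] := pselect (modulus w = 1); first by exists t.
  by exists 0.
pose S : set R := \bigcup_(w in A) \bigcup_(k in [set: int]) [set arg w + 2 * pi * k%:~R].
have Sc : countable S.
  apply: bigcup_countable => // w _; apply: bigcup_countable => [|k _]; first exact: countableP.
  exact: countable1.
exists S; split.
- by apply: countable_measurable => // t; exact: measurable_set1.
- exact: countable_lebesgue_measure0.
move=> t /= N; apply: contrapT => tS; apply: N.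
have [|V [E [Vo Vt Eh E1 EE]]] := ext (expi t) (mod_expi t).
  move=> tA; apply: tS; exists (expi t) => //.
  have E : cexp (iC * rC t) = cexp (iC * rC (arg (expi t))).
    by rewrite -/(expi t) -/(expi (arg (expi t))) argE // mod_expi.
  have [k kE] := cexp_eq E; exists k => //.
  apply: rC_inj; apply: (mulfI (@iC_neq0 R)); rewrite /= kE rCD !rCM /period.
  rewrite (_ : rC 2 = 2); last exact: (@rCn _ 2).
  by have -> : rC (k%:~R) = k%:~R :> C R; [exact: rmorph_int|ring].
exists (E (expi t)); split; first exact/norm1_mod.
exact: radial_limit Vo Vt (hol_cont Eh Vt) EE.
Qed.

End Radial.

(** * The normal form of the inner function *)

Section NormalForm.
Context {R : realType}.
Implicit Types (z w v u : C R) (r e t : R) (s : seq (C R)) (U V W : set (C R)).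

Lemma enum_card (T : choiceType) (S : set T) (q : nat) : (S #= `I_q)%card ->
  exists x : 'I_q -> T, injective x /\ forall y, S y <-> exists j, x j = y.
Proof.
move=> /card_set_bijP[f [f1 f2 f3]].
have /choice[x xH] : forall j : 'I_q, exists y, S y /\ f y = j.
  by move=> j; have [y Sy yE] := f3 j (ltn_ord j); exists y.
exists x; split=> [i j E|y].
  by apply: val_inj => /=; rewrite -(xH i).2 E (xH j).2.
split=> [Sy|[j <-]]; last by case: (xH j).
exists (Ordinal (f1 y Sy)); apply: f2; rewrite ?inE //; first by case: (xH (Ordinal (f1 y Sy))).
by rewrite (xH _).2.
Qed.

Lemma riemann_comp U V W (p1 p2 : C R -> C R) : riemann_map U V p1 -> riemann_map V W p2 ->
  riemann_map U W (fun z => p2 (p1 z)).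
Proof.
move=> /riemann_mapP[h1 m1 i1 s1] /riemann_mapP[h2 m2 i2 s2].
apply/riemann_mapP; split => [|u Uu|v w Uv Uw E|w Ww].
- exact: hol_comp m1 h1 h2.
- by apply: m2; exact: m1.
- by apply: i1 => //; apply: i2 => //; exact: m1.
- by have [v Vv <-] := s2 w Ww; have [u Uu <-] := s1 v Vv; exists u.
Qed.

Variables (h : C R -> C R) (G : set (C R)) (b : C R) (p q : nat).
Variables (phi0 gh : C R -> C R).
Hypothesis phi0_map : riemann_map disc G phi0.
Hypothesis gh_inner : inner gh.
Hypothesis gh_conj : forall z, disc z -> phi0 (gh z) = h (phi0 z).
Hypothesis G_b : G b.
Hypothesis b_preimages : npreimages h G b p.
Variables (xi : 'I_q -> C R) (beta beta2 : C R).
Hypothesis xi_inj : injective xi.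
Hypothesis xiP : forall y, singularity gh y <-> exists j, xi j = y.
Hypothesis beta_disc : disc beta.
Hypothesis beta2_disc : disc beta2.
Hypothesis phi0_beta2 : phi0 beta2 = b.

Let gh_hol : holomorphic disc gh. Proof. by case: gh_inner. Qed.
Let gh_disc z : disc z -> disc (gh z). Proof. by case: gh_inner => _ H _; exact: H. Qed.
Let d0 : disc (0 : C R). Proof. by rewrite disc_mod mod0. Qed.
Let discW z : disc z -> modulus z <= 1. Proof. by rewrite disc_mod => /ltW. Qed.

(** Precomposing and postcomposing [gh] with automorphisms of the disc moves the
    point over [b] to the origin, so that the zeros correspond to the preimages of
    [b]. The modulus still tends to [1] away from the images of the singularities. An
    atom of weight zero would let [gh] extend across the corresponding singularity. *)
Theorem normal_form : exists s (c : 'I_q -> R) t,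
  [/\ inner (fun z => swap beta2 (gh (swap beta z))),
      size s = p /\ (forall a, a \in s -> disc a /\ h (phi0 (swap beta a)) = b),
      forall j, 0 < c j &
      forall z, disc z -> swap beta2 (gh (swap beta z)) =
        expi t * \prod_(n < size s) blaschke_factor s`_n z *
        cexp (- \sum_(j < q) rC (c j) * ((swap beta (xi j) + z) / (swap beta (xi j) - z)))].
Proof.
have nz x z : disc x -> modulus z <= 1 -> 1 - x^* * z != 0 by exact: swap_den.
have KK x z : disc x -> modulus z <= 1 -> swap x (swap x z) = z.
  by move=> xd z1; apply: swap_swap (nz x z xd z1).
pose phi z := phi0 (swap beta z); pose phi2 z := phi0 (swap beta2 z).
have pmap : riemann_map disc G phi := riemann_comp (swap_riemann beta_disc) phi0_map.
have pmap2 : riemann_map disc G phi2 := riemann_comp (swap_riemann beta2_disc) phi0_map.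
have p0 : phi2 0 = b by rewrite /phi2 swap0.
have [ph pG pinj psur] := (riemann_mapP _ _ _).1 pmap.
have [ph2 _ pinj2 _] := (riemann_mapP _ _ _).1 pmap2.
pose g z := swap beta2 (gh (swap beta z)).
have gh1 : holomorphic disc (fun z => gh (swap beta z)).
  by apply: hol_comp (hol_swap_disc beta_disc) gh_hol => z; exact: swap_disc.
have gd z : disc z -> disc (g z).
  by move=> zd; apply: swap_disc => //; apply: gh_disc; exact: swap_disc.
have gh' : holomorphic disc g.
  apply: hol_comp gh1 (hol_swap_disc beta2_disc) => z zd; apply: gh_disc; exact: swap_disc.
have gconj z : disc z -> phi2 (g z) = h (phi z).
  move=> zd; rewrite /phi /phi2 /g KK //; first by rewrite gh_conj //; exact: swap_disc.
  by apply: discW; apply: gh_disc; exact: swap_disc.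
have [psi [_ _ psiK psiP]] := riemann_inverse open_disc pmap.
have [s0 [s0p s0G s0o]] := b_preimages.
pose s := [seq psi x | x <- s0].
have sH a : a \in s -> disc a /\ h (phi a) = b.
  move=> /mapP[x /[dup] xs /s0G Gx ->]; have [h1 h2] := psiP x Gx; split => //.
  rewrite h2; apply/eqP; rewrite -subr_eq0.
  have := s0o x Gx; rewrite -(prednK (_ : 0 < count_mem x s0)%N); last by rewrite -has_count has_pred1.
  by move=> /zero_orderS ->.
have sc z : disc z -> count_mem z s = count_mem (phi z) s0.
  move=> zd; rewrite count_map; apply: eq_in_count => x xs /=.
  have [h1 h2] := psiP x (s0G x xs); apply/eqP/eqP => [<- //|->].
  exact: psiK.
have go z : disc z -> zero_order g z (count_mem z s).
  move=> zd; have o1 := s0o (phi z) (pG z zd); rewrite -sc // in o1.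
  have o2 := zero_order_comp open_disc zd ph pinj o1.
  pose P w := dq phi2 0 (g w).
  have dh := hol_dq open_disc d0 ph2.
  have Ph : holomorphic disc P := hol_comp gd gh' dh.
  have P0 : P z != 0.
    rewrite /P; apply/eqP => E; have [v0|v0] := eqVneq (g z) 0.
      have : cD phi2 0 != 0.
        have phB : holomorphic (Ball 0 1) phi2 by rewrite -disc_Ball.
        by apply: (inj_cD_neq0 ltr01 phB) => v w; rewrite -disc_Ball; exact: pinj2.
      by move: E; rewrite v0 /dq eqxx => ->; rewrite eqxx.
    have := dqE phi2 0 (g z); rewrite E mulr0 addr0 => /(pinj2 _ _ (gd z zd) d0) /eqP.
    by rewrite (negPf v0).
  have PE w : disc w -> h (phi w) - b = P w * g w.
    by move=> wd; rewrite -gconj // (dqE phi2 0 (g w)) p0 subr0 addrAC subrr add0r mulrC.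
  exact: (@zero_order_div _ _ P g disc z (count_mem z s) 0) open_disc zd gh' PE o2 (zero_order0 open_disc zd Ph P0).
have xi1 j : modulus (xi j) = 1.
  by have [/norm1_mod] := (xiP (xi j)).2 (ex_intro _ j erefl).
pose zeta j := swap beta (xi j).
have zeta1 j : modulus (zeta j) = 1 by exact: swap_circle.
have KX j : swap beta (zeta j) = xi j by apply: KK; rewrite ?xi1.
have zinj : injective zeta by move=> i j E; apply: xi_inj; rewrite -(KX i) E KX.
have swc w : modulus w <= 1 -> cont (swap beta) w.
  move=> w1; have := @hol_swap _ beta [set v | 1 - beta^* * v != 0] (fun v hv => hv).
  by move=> hs; exact: hol_cont hs (nz _ w beta_disc w1).
have bdry w : modulus w = 1 -> (forall j, w != zeta j) -> forall e, 0 < e ->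
    exists2 d : R, 0 < d & forall z, disc z -> modulus (z - w) < d -> 1 - e < modulus (g z).
  move=> w1 wz e e0; pose w' := swap beta w.
  have w'1 : modulus w' = 1 by exact: swap_circle.
  have [V [E [Vo Vw Eh EE]]] : exists V E, [/\ open V, V w', holomorphic V E &
      forall z, V z -> disc z -> E z = gh z].
    apply: contrapT => N; have sg : singularity gh w' by split; [exact/norm1_mod|].
    have [j jE] := (xiP w').1 sg; have /eqP := wz j; apply.
    by rewrite /zeta jE KK ?w1.
  have E1 := inner_unimodular gh_inner w'1 Vo Vw Eh EE.
  pose K := 2 / (1 - modulus beta2) ^+ 2.
  have K0 : 0 < K by rewrite divr_gt0 // exprn_gt0 // subr_gt0 -disc_mod.
  have eK : 0 < e / K by rewrite divr_gt0.
  have /contCP/(_ _ eK)[d1 d10 d1H] := hol_cont Eh Vw.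
  have [d2 d20 d2V] := (openP V).1 Vo _ Vw.
  have m0 : 0 < Num.min d1 d2 by rewrite lt_min d10.
  have w1' : modulus w <= 1 by rewrite w1.
  have /contCP/(_ _ m0)[d dp dH] := swc w w1'.
  exists d => // z zd zw; have := dH z zw; rewrite lt_min => /andP[h1 h2].
  have zs := swap_disc beta_disc zd; have ghs := gh_disc zs.
  have := swap_boundary beta2_disc ghs; rewrite -/(g z) -/K -(EE _ (d2V _ h2) zs).
  have := d1H _ h1; have := modBB (E w') (E (swap beta z)).
  rewrite [modulus (E w' - _)]mod_distC E1 => h3 h4 h5.
  have : K * (1 - modulus (E (swap beta z))) < e.
    by rewrite mulrC -ltr_pdivlMr //; lra.
  lra.
have [t [c [c0 gE]]] := inner_structure gh' (fun z zd => discW (gd z zd))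
  (fun a as_ => (sH a as_).1) go zinj bdry.
have ext w := @form_extension _ s q c zeta t w (fun a as_ => (sH a as_).1) zeta1.
have cp j : 0 < c j.
  rewrite lt_neqAle c0 andbT eq_sym; apply/eqP => cj.
  have [|V [E [Vo Vz Eh E1 EE]]] := ext (zeta j) (zeta1 j).
    by move=> i /zinj ->.
  have [_ ns] := (xiP (xi j)).2 (ex_intro _ j erefl); apply: ns.
  have [d dp dV] := (openP V).1 Vo _ Vz.
  have xij1 : modulus (xi j) <= 1 by rewrite xi1.
  have Es : cont (fun z => E (swap beta z)) (xi j).
    by apply: cont_comp (swc _ xij1) _; exact: hol_cont Eh Vz.
  have c1 : cont (fun z => 1 - beta^* * z) (xi j).
    by apply: contB; [exact: cont_cst|apply: contM; [exact: cont_cst|exact: cont_id]].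
  have c2 : cont (fun z => 1 - beta2^* * E (swap beta z)) (xi j).
    by apply: contB; [exact: cont_cst|apply: contM Es; exact: cont_cst].
  have [r1 r10 r1H] := cont_neq0 c1 (nz _ _ beta_disc xij1).
  have [|r2 r20 r2H] := cont_neq0 c2; first by rewrite nz // -/(zeta j) E1.
  have /contCP/(_ d dp)[r3 r30 r3H] := swc _ xij1.
  pose r := Num.min r1 (Num.min r2 r3).
  have s1 : Ball (xi j) r `<=` Ball (xi j) r1 by apply: le_Ball; rewrite ge_min lexx.
  have s2 : Ball (xi j) r `<=` Ball (xi j) r2 by apply: le_Ball; rewrite !ge_min lexx orbT.
  have s3 : Ball (xi j) r `<=` Ball (xi j) r3 by apply: le_Ball; rewrite !ge_min lexx !orbT.
  have inV z : Ball (xi j) r z -> V (swap beta z) by move=> /s3 zr; apply: dV; exact: r3H.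
  have sh : holomorphic (Ball (xi j) r) (swap beta) by apply: hol_swap => z /s1; exact: r1H.
  have EV : holomorphic (Ball (xi j) r) (fun z => E (swap beta z)) := hol_comp inV sh Eh.
  have in2 z : Ball (xi j) r z -> [set v | 1 - beta2^* * v != 0] (E (swap beta z)).
    by move=> /s2; exact: r2H.
  exists (Ball (xi j) r), (fun z => swap beta2 (E (swap beta z))); split.
  - exact: open_Ball.
  - by apply: Ball_center; rewrite !lt_min r10 r20.
  - exact: hol_comp in2 EV (@hol_swap _ beta2 [set v | 1 - beta2^* * v != 0] (fun v hv => hv)).
  - move=> z zr zd; have zs := swap_disc beta_disc zd.
    have -> : E (swap beta z) = g (swap beta z) by rewrite (EE _ (inV z zr)) gE.
    by rewrite /g (KK beta z beta_disc (discW zd)) KK //; apply: discW; exact: gh_disc.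
exists s, c, t; split => //.
- apply: (@inner_of_extension _ g (range zeta)) => //.
    by apply: finite_set_countable; exact: finite_image.
  move=> w w1 wA; have [|V [E [Vo Vw Eh E1 EE]]] := ext w w1.
    by move=> j jw; exfalso; apply: wA; exists j.
  by exists V, E; split => // z Vz zd; rewrite (EE z Vz) gE.
- by split=> //; rewrite size_map.
Qed.

End NormalForm.

(** * The origin outside the domain *)

Section OutsideOrigin.
Context {R : realType}.
Implicit Types (z w c u v x : C R) (r e t : R).
Variables (m : nat) (H h : C R -> C R) (a : C R) (f : C R -> C R).
Variables (G : set (C R)).
Hypothesis H_entire : entire H.
Hypothesis H_nonconstant : ~ exists c : C R, forall w, H w = c.
Hypothesis hE : forall w, h w = w ^+ m * cexp (H w).
Hypothesis a_neq0 : a != 0.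
Hypothesis f_lift : lifts a h f.
Hypothesis G_component : fatou_component h G.
Hypothesis G_invariant : h @` G `<=` G.
Hypothesis G_0 : ~ G 0.

Let f_entire : entire f. Proof. by case: f_lift => -[]. Qed.
Let P : set (C R) := exp_map a @^-1` G.
Let T : C R := period / a.
Let T_neq0 : T != 0.
Proof. by rewrite mulf_neq0 ?invr_eq0 //; exact: period_neq0. Qed.
Let d0 : disc (0 : C R). Proof. by rewrite disc_mod mod0. Qed.

Definition lifted (lam : C R -> C R) (k : int) : set (C R) :=
  [set lam z + k%:~R * T | z in disc].

Section Lift.
Variables (phi lam : C R -> C R).
Hypothesis phi_map : riemann_map disc G phi.
Hypothesis lam_hol : holomorphic disc lam.
Hypothesis lamE : forall z, disc z -> exp_map a (lam z) = phi z.

Let lam_inj z w k l : disc z -> disc w -> lam z + k%:~R * T = lam w + l%:~R * T ->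
  z = w /\ k = l.
Proof.
move=> zd wd E; have /riemann_mapP[_ _ inj _] := phi_map.
have zw : z = w.
  by apply: inj => //; rewrite -!lamE // -(exp_map_shift a_neq0 _ k) E exp_map_shift.
split => //; apply: (@intr_inj (C R)); apply: (mulIf T_neq0).
by move: E; rewrite zw => /addrI.
Qed.

Lemma lifted_map k : riemann_map disc (lifted lam k) (fun z => lam z + k%:~R * T).
Proof.
apply/riemann_mapP; split => [|u ud|z w zd wd E|_ [z zd <-]].
- exact: holD lam_hol (@hol_cst _ disc (k%:~R * T)).
- by exists u.
- by have [] := lam_inj zd wd E.
- by exists z.
Qed.

Lemma lifted_open k : open (lifted lam k).
Proof. by have [psi []] := riemann_inverse open_disc (lifted_map k). Qed.

Lemma lifted_disjoint k l x : lifted lam k x -> lifted lam l x -> k = l.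
Proof. by move=> [z zd <-] [w wd E]; have [] := lam_inj wd zd E. Qed.

Lemma lifted_sub k : lifted lam k `<=` P.
Proof.
move=> _ [z zd <-]; rewrite /P /preimage /= exp_map_shift // lamE //.
by have /riemann_mapP[_ hG _ _] := phi_map; exact: hG.
Qed.

Lemma lifted_cover x : P x -> exists k, lifted lam k x.
Proof.
move=> Px; have /riemann_mapP[_ _ _ sur] := phi_map; have [z zd zE] := sur _ Px.
have [k kE] := exp_map_eq a_neq0 (etrans (esym zE) (esym (lamE zd))).
by exists k, z.
Qed.

(** The translates are disjoint, open and connected, and they cover [P]. *)
Lemma lifted_component k x : lifted lam k x -> connected_component P x = lifted lam k.
Proof.
move=> kx; apply/seteqP; split; last first.
  apply: connected_component_max => //; first exact: lifted_sub.
  apply: connected_image open_disc connected_disc _ => z zd.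
  by have [ph _] := lifted_map k; exact: hol_cont ph zd.
pose D := connected_component P x; pose B := D `&` lifted lam k.
have Px : P x := lifted_sub kx.
have Dx : D x by exact: connected_component_refl.
suff BD : B = D by rewrite -/D -BD => y [].
apply: (@component_connected _ P x B).
- by exists x.
- by exists (lifted lam k) => //; exact: lifted_open.
exists (~` \bigcup_(l in [set l | l != k]) lifted lam l).
  by apply: open_closedC; apply: bigcup_open => l _; exact: lifted_open.
apply/seteqP; split => y [Dy ky]; split => //.
  by move=> [l /= lk ly]; move/eqP: lk; apply; exact: lifted_disjoint ly ky.
have [l ly] := lifted_cover (connected_component_sub Dy).
have [<- //|lk] := eqVneq l k; exfalso; apply: ky; by exists l.
Qed.

Lemma lifted_range : range (lifted lam) = [set V | component P V].
Proof.
apply/seteqP; split => [_ [k _ <-]|V [x Px ->]] /=.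
  have k0 : lifted lam k (lam 0 + k%:~R * T) by exists 0.
  by exists (lam 0 + k%:~R * T); [exact: lifted_sub k0|rewrite (lifted_component k0)].
by have [k kx] := lifted_cover Px; exists k => //; rewrite (lifted_component kx).
Qed.

Lemma lifted_injective : injective (lifted lam).
Proof.
move=> k l E; have k0 : lifted lam k (lam 0 + k%:~R * T) by exists 0.
by apply: (lifted_disjoint k0); rewrite -E.
Qed.

Lemma lifted_succ k : lifted lam (k + 1) = [set z + T | z in lifted lam k].
Proof.
apply/seteqP; split => [_ [z zd <-]|_ [_ [z zd <-] <-]].
  by exists (lam z + k%:~R * T); [exists z|rewrite intrD; ring].
by exists z => //; rewrite intrD; ring.
Qed.

Lemma lifted_fatou k : fatou_component f (lifted lam k).
Proof.
apply: (preimage_component H_entire H_nonconstant hE a_neq0 f_lift G_component G_invariant phi_map).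
have : range (lifted lam) (lifted lam k) by exists k.
by rewrite lifted_range.
Qed.

(** The lifts of both sides of the conjugacy differ by a period, which is constant on
    the disc. *)
Lemma lifted_associated g k : inner g -> (forall z, disc z -> phi (g z) = h (phi z)) ->
  associated_inner f (lifted lam k) g.
Proof.
move=> gi gE; have [gh gd _] := gi; split => //.
pose u z := f (lam z + k%:~R * T) - lam (g z).
have [ph _] := lifted_map k.
have fh : holomorphic disc (fun z => f (lam z + k%:~R * T)).
  exact: (@hol_comp _ disc setT _ f (fun _ _ => I) ph f_entire).
have uh : holomorphic disc u := holB fh (hol_comp gd gh lam_hol).
have uZ z : disc z -> exists l : int, u z = l%:~R * T.
  move=> zd; have [|l lE] := @exp_map_eq _ a a_neq0 (f (lam z + k%:~R * T)) (lam (g z)).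
    case: f_lift => _ E; rewrite -E exp_map_shift // (lamE zd) -gE // lamE //; exact: gd.
  by exists l; rewrite /u lE addrAC subrr add0r.
have uE z : disc z -> u z = u 0.
  rewrite disc_Ball => zd; apply: (@lattice_const _ u T 0 1 T_neq0) => // w; rewrite -disc_Ball.
    by move=> wd; exact: hol_cont uh wd.
  exact: uZ.
have [l lE] := uZ 0 d0.
have conj z : disc z -> lam (g z) + l%:~R * T = f (lam z + k%:~R * T).
  by move=> zd; rewrite -lE -(uE z zd) /u addrC subrK.
exists (lifted lam l), (fun z => lam z + k%:~R * T), (fun z => lam z + l%:~R * T); split; split.
- exact: lifted_fatou.
- exact: lifted_fatou.
- by move=> _ [_ [z zd <-] <-]; exists (g z); [exact: gd|exact: conj].
- exact: lifted_map.
- exact: lifted_map.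
- exact: conj.
Qed.

End Lift.

Lemma lift_exists phi : riemann_map disc G phi -> exists lam,
  holomorphic disc lam /\ forall z, disc z -> exp_map a (lam z) = phi z.
Proof.
move=> /riemann_mapP[ph pG _ _].
have nz z : disc z -> phi z != 0.
  by move=> zd; apply/eqP => E; apply: G_0; rewrite -E; exact: pG.
have phB : holomorphic (Ball 0 1) phi by rewrite -disc_Ball.
have [c [cE _ _]] := cexp_surj (nz 0 d0).
have [|L [Lh _ LE]] := hol_log ltr01 phB _ cE.
  by move=> w; rewrite -disc_Ball; exact: nz.
rewrite -disc_Ball in Lh LE; exists (fun z => L z / a); split.
  exact: holM Lh (@hol_cst _ disc a^-1).
by move=> z zd; rewrite /exp_map mulrC divfK // LE.
Qed.

(** Two branches for two Riemann maps give the same family of components, indexed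
    differently. *)
Lemma lifted_associated_any phi lam phi' g k : riemann_map disc G phi ->
  holomorphic disc lam -> (forall z, disc z -> exp_map a (lam z) = phi z) ->
  riemann_map disc G phi' -> inner g -> (forall z, disc z -> phi' (g z) = h (phi' z)) ->
  associated_inner f (lifted lam k) g.
Proof.
move=> pm lh lE pm' gi gE; have [lam' [lh' lE']] := lift_exists pm'.
have : range (lifted lam') (lifted lam k).
  by rewrite (lifted_range pm' lh' lE') -(lifted_range pm lh lE); exists k.
by move=> [k' _ <-]; exact: (lifted_associated pm' lh' lE').
Qed.

End OutsideOrigin.

(** * The half-plane model *)

Section Cayley.
Context {R : realType}.
Implicit Types (z w u v x : C R) (r e t : R).

Definition cayley v : C R := iC * (1 + v) / (1 - v).
Definition cayley_inv w : C R := (w - iC) / (w + iC).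

Lemma cayleyK v : v != 1 -> cayley_inv (cayley v) = v.
Proof.
move=> v1; have d0 : 1 - v != 0 by rewrite subr_eq0 eq_sym.
have i0 := @iC_neq0 R; have two0 : (2 : C R) != 0 by rewrite pnatr_eq0.
have e1 : cayley v - iC = 2 * iC * v / (1 - v) by rewrite /cayley; field.
have e2 : cayley v + iC = 2 * iC / (1 - v) by rewrite /cayley; field.
by rewrite /cayley_inv e1 e2; field; rewrite i0 d0.
Qed.

Lemma cayley_invK w : w != - iC -> cayley (cayley_inv w) = w.
Proof.
move=> w1; have d0 : w + iC != 0 by rewrite addr_eq0.
have i0 := @iC_neq0 R; have two0 : (2 : C R) != 0 by rewrite pnatr_eq0.
have e1 : 1 + cayley_inv w = 2 * w / (w + iC) by rewrite /cayley_inv; field.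
have e2 : 1 - cayley_inv w = 2 * iC / (w + iC) by rewrite /cayley_inv; field.
by rewrite /cayley e1 e2; field; rewrite i0 d0.
Qed.

Lemma Im_cayley v : v != 1 ->
  modulus (1 - v) ^+ 2 * complex.Im (cayley v) = 1 - modulus v ^+ 2.
Proof.
rewrite eq_sym => v1; have := kernel_ReE v1; rewrite mod1 expr1n => <-; congr (_ * _).
by rewrite /cayley -mulrA ImM /=; ring.
Qed.

Lemma half_plane_neq z : 0 <= complex.Im z -> z != - iC.
Proof. by apply: contraTneq => ->; rewrite ImN /=; lra. Qed.

(** Shows both that the half-plane goes to the disc and that the real line goes to
    the circle. *)
Lemma mod_cayley_inv w : w != - iC ->
  modulus (w + iC) ^+ 2 * (1 - modulus (cayley_inv w) ^+ 2) = 4 * complex.Im w.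
Proof.
move=> w1; have d0 : modulus (w + iC) != 0 by rewrite mod_eq0 addr_eq0.
have E : modulus (w + iC) ^+ 2 * modulus (cayley_inv w) ^+ 2 = modulus (w - iC) ^+ 2.
  by rewrite -exprMn -modM /cayley_inv mulrC divfK // addr_eq0.
rewrite mulrBr mulr1 E !mod_sqr; case: w {w1 d0 E} => x y; rewrite !ReD !ImD ReN ImN /=; ring.
Qed.

Lemma cayley_disc v : disc v -> upper_half_plane (cayley v).
Proof.
rewrite disc_mod => vd; have v1 : v != 1 by apply: contraTneq vd => ->; rewrite mod1 ltxx.
have p : 0 < modulus (1 - v) ^+ 2 by rewrite exprn_gt0 // mod_gt0 subr_eq0 eq_sym.
by rewrite /upper_half_plane /= -(pmulr_rgt0 _ p) Im_cayley // subr_gt0 expr_lt1 // mod_ge0.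
Qed.

Lemma cayley_inv_disc w : upper_half_plane w -> disc (cayley_inv w).
Proof.
rewrite /upper_half_plane /= => w0; have w1 := half_plane_neq (ltW w0).
have p : 0 < modulus (w + iC) ^+ 2 by rewrite exprn_gt0 // mod_gt0 addr_eq0.
rewrite disc_mod -(@expr_lt1 _ 2) ?mod_ge0 // -subr_gt0 -(pmulr_rgt0 _ p) mod_cayley_inv //.
by rewrite mulr_gt0.
Qed.

Lemma hol_cayley (U : set (C R)) : (forall v, U v -> v != 1) -> holomorphic U cayley.
Proof.
move=> U1; apply: hol_div => [v /U1||].
- by rewrite subr_eq0 eq_sym.
- exact: holM (@hol_cst _ U iC) (holD (@hol_cst _ U 1) (@hol_id _ U)).
- exact: holB (@hol_cst _ U 1) (@hol_id _ U).
Qed.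

Lemma hol_cayley_inv (U : set (C R)) : (forall w, U w -> w != - iC) -> holomorphic U cayley_inv.
Proof.
move=> U1; apply: hol_div => [v /U1||].
- by rewrite addr_eq0.
- exact: holB (@hol_id _ U) (@hol_cst _ U iC).
- exact: holD (@hol_id _ U) (@hol_cst _ U iC).
Qed.

Lemma disc_neq1 v : disc v -> v != 1.
Proof. by rewrite disc_mod; apply: contraTneq => ->; rewrite mod1 ltxx. Qed.

Lemma cayley_map : riemann_map disc upper_half_plane cayley.
Proof.
apply/riemann_mapP; split => [|v|v w vd wd E|w wH].
- apply: hol_cayley => v; exact: disc_neq1.
- exact: cayley_disc.
- by rewrite -(cayleyK (disc_neq1 vd)) E cayleyK // disc_neq1.
- by exists (cayley_inv w); [exact: cayley_inv_disc|rewrite cayley_invK // half_plane_neq // ltW].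
Qed.

End Cayley.

Section HalfPlaneForm.
Context {R : realType}.
Implicit Types (z w u v x : C R) (r e t : R).
Variables (m q : nat) (sigma : R) (theta c : 'I_q -> R).

Let E2 z : C R := cexp (2 * iC * z).

Let S z : C R := \sum_(j < q) rC (c j) * ((expi (theta j) + E2 z) / (expi (theta j) - E2 z)).

Let gf z : C R := rC sigma + m%:R * z + iC / 2 * S z.

Let mod_E2 z : modulus (E2 z) = expR (- 2 * complex.Im z).
Proof.
rewrite /E2 mod_cexp; congr expR; rewrite -mulrA (_ : 2 = rC 2); last exact/esym/(@rCn _ 2).
by rewrite ReMr ReM /=; ring.
Qed.

Let Im_gf z : complex.Im (gf z) = m%:R * complex.Im z + complex.Re (S z) / 2.
Proof.
rewrite /gf (_ : iC / 2 * S z = rC (2^-1) * (iC * S z)); last first.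
  by rewrite rCV (_ : rC 2 = 2); [ring|exact: (@rCn _ 2)].
rewrite !ImD (_ : (m%:R : C R) = rC m%:R); last exact/esym/rCn.
by rewrite !ImMr ImM /=; ring.
Qed.

(** On the real line the kernels are purely imaginary. *)
Let Im_real x : complex.Im x = 0 -> complex.Im (gf x) = 0.
Proof.
move=> x0; rewrite Im_gf x0 mulr0 add0r Re_sum big1 ?mul0r // => j _.
have E1 : modulus (E2 x) = 1 by rewrite mod_E2 x0 mulr0 expR0.
by rewrite ReMr (kernel_Re (mod_expi (theta j)) E1) mulr0.
Qed.

Let den z := \prod_(j < q) (expi (theta j) - E2 z).

Let gf_hol (U : set (C R)) : (forall z, U z -> den z != 0) -> holomorphic U gf.
Proof.
move=> nz; have Eh : holomorphic U E2.
  by apply: hol_cexpf; exact: holM (@hol_cst _ U (2 * iC)) (@hol_id _ U).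
apply: holD; first exact: holD (@hol_cst _ U (rC sigma)) (holM (@hol_cst _ U m%:R) (@hol_id _ U)).
apply: holM; first exact: (@hol_cst _ U (iC / 2)).
apply: hol_sum => j; apply: holM; first exact: (@hol_cst _ U (rC (c j))).
apply: hol_div => [z /nz /prodf_neq0/(_ j isT) //||].
- exact: holD (@hol_cst _ U (expi (theta j))) Eh.
- exact: holB (@hol_cst _ U (expi (theta j))) Eh.
Qed.

Let den_half z : upper_half_plane z -> den z != 0.
Proof.
rewrite /upper_half_plane /= => z0; apply/prodf_neq0 => j _; rewrite subr_eq0.
apply/eqP => E; have E1 : modulus (E2 z) = 1 by rewrite -E mod_expi.
have lt1 : modulus (E2 z) < 1 by rewrite mod_E2 -[X in _ < X]expR0 ltr_expR; lra.
by rewrite E1 ltxx in lt1.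
Qed.

Hypothesis gf_half : forall z, upper_half_plane z -> upper_half_plane (gf z).

(** On the disc, the map extends across every boundary point except the preimage of
    infinity and the countably many preimages of atoms. *)
Theorem half_plane_inner : inner_half_plane gf.
Proof.
pose g' v := cayley_inv (gf (cayley v)).
exists cayley, g'; split; first exact: cayley_map.
- pose at_ (o : option ('I_q * int)) : C R :=
    if o is Some (j, k) then cayley_inv (rC (theta j / 2 + pi * k%:~R)) else 1.
  pose A : set (C R) := \bigcup_(o in setT) [set at_ o].
  apply: (@inner_of_extension _ g' A).
  + apply: bigcup_countable => [|o _]; [exact: countableP|exact: countable1].
  + have mh : holomorphic disc (fun v => gf (cayley v)).
      by apply: hol_comp (gf_hol den_half); [exact: cayley_disc|apply: hol_cayley => v; exact: disc_neq1].
    apply: (@hol_comp _ _ upper_half_plane) mh (@hol_cayley_inv _ upper_half_plane _).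
      by move=> v vd; apply: gf_half; exact: cayley_disc.
    by move=> w; rewrite /upper_half_plane /= => /ltW; exact: half_plane_neq.
  + by move=> v vd; apply: cayley_inv_disc; apply: gf_half; exact: cayley_disc.
  + move=> w w1 wA; have wn1 : w != 1 by apply/eqP => E; apply: wA; exists None.
    pose x := cayley w.
    have x0 : complex.Im x = 0.
      have := Im_cayley wn1; rewrite w1 expr1n subrr => /eqP; rewrite mulf_eq0 expf_eq0 /= mod_eq0.
      by rewrite subr_eq0 eq_sym (negPf wn1) => /eqP.
    have dx : den x != 0.
      apply/prodf_neq0 => j _; rewrite subr_eq0; apply/eqP => E; apply: wA.
      have E3 : cexp (2 * iC * x) = cexp (iC * rC (theta j)) by rewrite -[RHS]/(expi (theta j)) E.
      have [k kE] := cexp_eq E3; exists (Some (j, k)) => //=.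
      have two0 : (2 : C R) != 0 by rewrite pnatr_eq0.
      have two : rC 2 = 2 :> C R by exact: (@rCn _ 2).
      have xE : x = rC (theta j / 2 + pi * k%:~R).
        apply: (mulfI (mulf_neq0 two0 (@iC_neq0 R))); rewrite kE rCD !rCM rCV two /period.
        by have -> : rC (k%:~R) = k%:~R :> C R; [exact: rmorph_int|field].
      by rewrite -xE /x cayleyK.
    have gx : gf x != - iC by apply: half_plane_neq; rewrite Im_real.
    have dc : cont den x.
      apply: cont_prod => j _; apply: contB; first exact: cont_cst.
      apply: (@cont_comp _ _ _ (fun z => 2 * iC * z) (@cexp R)) (cont_cexp _).
      by apply: contM; [exact: cont_cst|exact: cont_id].
    have [d1 d10 d1H] := cont_neq0 dc dx.
    have gfh := gf_hol d1H.
    have gc := hol_cont gfh (Ball_center x d10).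
    have gc' : cont (fun z => gf z + iC) x by apply: contD gc _; exact: cont_cst.
    have [|d2 d20 d2H] := cont_neq0 gc'; first by rewrite addr_eq0.
    pose d := Num.min d1 d2; have dp : 0 < d by rewrite lt_min d10.
    have s1 : Ball x d `<=` Ball x d1 by apply: le_Ball; rewrite ge_min lexx.
    have s2 : Ball x d `<=` Ball x d2 by apply: le_Ball; rewrite ge_min lexx orbT.
    have cw : cont cayley w by exact: hol_cont (@hol_cayley _ [set v | v != 1] (fun v hv => hv)) wn1.
    have /contCP/(_ d dp)[d3 d30 d3H] := cw.
    have c1 : cont (fun v : C R => v - 1) w by apply: contB; [exact: cont_id|exact: cont_cst].
    have [|d4 d40 d4H] := cont_neq0 c1; first by rewrite subr_eq0.
    pose d' := Num.min d3 d4; have dp' : 0 < d' by rewrite lt_min d30.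
    have s3 : Ball w d' `<=` Ball w d3 by apply: le_Ball; rewrite ge_min lexx.
    have s4 : Ball w d' `<=` Ball w d4 by apply: le_Ball; rewrite ge_min lexx orbT.
    have in1 v : Ball w d' v -> Ball x d (cayley v) by move=> /s3; exact: d3H.
    have n1 v : Ball w d' v -> v != 1 by move=> /s4/d4H; rewrite subr_eq0.
    have h1 : holomorphic (Ball w d') (fun v => gf (cayley v)).
      exact: hol_comp in1 (hol_cayley n1) (sub_hol s1 gfh).
    have in2 v : Ball w d' v -> [set u | u != - iC] (gf (cayley v)).
      by move=> /in1/s2/d2H; rewrite addr_eq0.
    have gw : modulus (g' w) = 1.
      have := mod_cayley_inv gx; rewrite Im_real // mulr0 => /eqP.
      rewrite mulf_eq0 expf_eq0 /= mod_eq0 addr_eq0 (negPf gx) /= subr_eq0 eq_sym => /eqP E.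
      by apply/eqP; rewrite -(@eqrXn2 _ 2) ?mod_ge0 // expr1n; apply/eqP; exact: E.
    have g'h : holomorphic (Ball w d') g'.
      exact: hol_comp in2 h1 (@hol_cayley_inv _ [set u | u != - iC] (fun v hv => hv)).
    exists (Ball w d'), g'.
    exact: (And5 (@open_Ball _ _ _) (Ball_center w dp') g'h gw (fun _ _ _ => erefl)).
- move=> v vd; rewrite /g' cayley_invK // half_plane_neq // ltW //.
  by apply: gf_half; exact: cayley_disc.
Qed.

End HalfPlaneForm.

(** * The origin inside the domain *)

Section InsideOrigin.
Context {R : realType}.
Implicit Types (z w u v x : C R) (r e t : R) (s : seq (C R)).
Variables (m p q : nat) (H h : C R -> C R) (a b : C R) (f : C R -> C R).
Variables (G : set (C R)) (phi0 gh : C R -> C R) (xi : 'I_q -> C R).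
Hypothesis H_entire : entire H.
Hypothesis H_nonconstant : ~ exists c : C R, forall w, H w = c.
Hypothesis hE : forall w, h w = w ^+ m * cexp (H w).
Hypothesis a_neq0 : a != 0.
Hypothesis f_lift : lifts a h f.
Hypothesis G_component : fatou_component h G.
Hypothesis G_invariant : h @` G `<=` G.
Hypothesis phi0_map : riemann_map disc G phi0.
Hypothesis gh_inner : inner gh.
Hypothesis gh_conj : forall z, disc z -> phi0 (gh z) = h (phi0 z).
Hypothesis G_b : G b.
Hypothesis b_preimages : npreimages h G b p.
Hypothesis xi_inj : injective xi.
Hypothesis xiP : forall y, singularity gh y <-> exists j, xi j = y.
Hypothesis q_gt0 : (0 < q)%N.
Hypothesis G_0 : G 0.

Let f_entire : entire f. Proof. by case: f_lift => -[]. Qed.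
Let h_entire : entire h. Proof. exact: entire_of_exp H_entire hE. Qed.
Let P : set (C R) := exp_map a @^-1` G.
Let T : C R := period / a.
Let T_neq0 : T != 0.
Proof. by rewrite mulf_neq0 ?invr_eq0 //; exact: period_neq0. Qed.
Let d0 : disc (0 : C R). Proof. by rewrite disc_mod mod0. Qed.

Let h0 z : h z = 0 -> z = 0.
Proof. by rewrite hE => /eqP; rewrite mulf_eq0 expf_eq0 (negPf (cexp_neq0 _)) orbF => /andP[_ /eqP]. Qed.

Let h_order : zero_order h 0 m.
Proof.
exists setT, (fun w => cexp (H w)).
apply: (And5 openT I (hol_cexpf H_entire) (cexp_neq0 _)) => w _.
by rewrite subr0 hE.
Qed.

Let sub0E : (fun u => h u - 0) = h. Proof. by apply/funext => u; rewrite subr0. Qed.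

(** The only zero of [h] is the origin. *)
Lemma zero_preimages : npreimages h G 0 m.
Proof.
exists (nseq m 0); split; first by rewrite size_nseq.
  by move=> z /nseqP[-> _].
move=> z Gz; rewrite sub0E count_nseq /= eq_sym; have [->|z0] := eqVneq z 0; first by rewrite mul1n.
apply: (@zero_order0 _ _ _ setT) => //; first exact: openT.
by apply/eqP => /h0 E; move: z0; rewrite E eqxx.
Qed.

Let xi1 j : modulus (xi j) = 1.
Proof. by have [/norm1_mod] := (xiP (xi j)).2 (ex_intro _ j erefl). Qed.

(** Along one curve into a singularity, the image of the radius under [swap beta], the
    inner function tends to the point over [0] and to the point over [b], because
    both [0] and [b] have finitely many preimages. *)
Lemma base_point_eq0 : b = 0.
Proof.
have /riemann_mapP[_ _ _ sur] := phi0_map.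
have [beta bd bE] := sur 0 G_0; have [beta2 bd2 bE2] := sur b G_b.
have [s1 [c1 [t1 [_ [_ sd1] cp1 E1]]]] :=
  normal_form phi0_map gh_inner gh_conj zero_preimages xi_inj xiP bd bd bE.
have [s2 [c2 [t2 [_ [_ sd2] cp2 E2]]]] :=
  normal_form phi0_map gh_inner gh_conj b_preimages xi_inj xiP bd bd2 bE2.
pose j0 := Ordinal q_gt0; pose zeta j := swap beta (xi j).
have zeta1 j : modulus (zeta j) = 1 by exact: swap_circle.
suff E : beta = beta2 by rewrite -bE2 -E bE.
have sc x : disc x -> cont (swap x) 0 by move=> xd; exact: hol_cont (hol_swap_disc xd) d0.
apply/eqP; rewrite -subr_eq0 -mod_eq0 eq_le mod_ge0 andbT leNgt; apply/negP => pos.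
have hp : 0 < modulus (beta - beta2) / 2 by rewrite divr_gt0.
have /contCP/(_ _ hp)[e1 e10 e1H] := sc beta bd.
have /contCP/(_ _ hp)[e2 e20 e2H] := sc beta2 bd2.
have [r1 r10 r1H] := @form_radial _ s1 q c1 zeta t1 j0 e1 (fun x xs => (sd1 x xs).1) zeta1 cp1 e10.
have [r2 r20 r2H] := @form_radial _ s2 q c2 zeta t2 j0 e2 (fun x xs => (sd2 x xs).1) zeta1 cp2 e20.
pose d := Num.min 1 (Num.min r1 r2) / 2.
have dp : 0 < d by rewrite divr_gt0 // !lt_min ltr01 r10.
have [dl1 [dl2 dl3]] : d < 1 /\ (d < r1 /\ d < r2).
  have : Num.min 1 (Num.min r1 r2) <= 1 /\ (Num.min 1 (Num.min r1 r2) <= r1 /\ Num.min 1 (Num.min r1 r2) <= r2).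
    by rewrite !ge_min !lexx !orbT.
  by move: dp; rewrite /d; lra.
have r01 : 0 < 1 - d < 1 by apply/andP; split; lra.
have zd : disc (rC (1 - d) * zeta j0).
  by rewrite disc_mod modM zeta1 mulr1 mod_rC; case/andP: r01 => r0 r1'; rewrite gtr0_norm.
pose y := gh (swap beta (rC (1 - d) * zeta j0)).
have yd : disc y by case: gh_inner => _ ghd _; apply: ghd; exact: swap_disc.
have h1 : modulus (swap beta y) < e1.
  by rewrite /y E1 //; apply: r1H => //; rewrite subKr.
have h2 : modulus (swap beta2 y) < e2.
  by rewrite /y E2 //; apply: r2H => //; rewrite subKr.
have yK x : disc x -> swap x (swap x y) = y.
  by move=> xd; apply: swap_swap (swap_den xd _) => //; move: yd; rewrite disc_mod => /ltW.
have := e1H (swap beta y); rewrite subr0 yK // swap0 => /(_ h1) k1.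
have := e2H (swap beta2 y); rewrite subr0 yK // swap0 => /(_ h2) k2.
have := mod_dist_triangle beta beta2 y; rewrite [modulus (beta - y)]mod_distC; lra.
Qed.

(** Counting the zeros of [h] in two ways. *)
Lemma preimage_count : p = m.
Proof.
have [s [<- sG so]] := b_preimages; rewrite base_point_eq0 sub0E in so.
have s0 : s = nseq (size s) 0.
  apply/all_pred1P/allP => z zs /=; have := so z (sG z zs).
  rewrite -(prednK (_ : 0 < count_mem z s)%N); last by rewrite -has_count has_pred1.
  by move=> /zero_orderS/h0 ->.
have cnt : count_mem 0 s = size s by rewrite s0 count_nseq /= eqxx mul1n size_nseq.
have := so 0 G_0; rewrite cnt => o.
exact: zero_order_uniq o h_order.
Qed.

Let E2 z : C R := cexp (2 * iC * z).

Let mod_E2 z : modulus (E2 z) = expR (- 2 * complex.Im z).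
Proof.
rewrite /E2 mod_cexp; congr expR; rewrite -mulrA (_ : 2 = rC 2); last exact/esym/(@rCn _ 2).
by rewrite ReMr ReM /=; ring.
Qed.

Let E2_disc z : upper_half_plane z <-> disc (E2 z).
Proof.
rewrite disc_mod mod_E2 /upper_half_plane /=.
have -> : (expR (- 2 * complex.Im z) < 1) = (- 2 * complex.Im z < 0) by rewrite -expR_lt1.
by split; lra.
Qed.

Let two0 : (2 : C R) != 0. Proof. by rewrite pnatr_eq0. Qed.

Let E2_hol U : holomorphic U E2.
Proof. by apply: hol_cexpf; exact: holM (@hol_cst _ U (2 * iC)) (@hol_id _ U). Qed.

Let two : rC 2 = 2 :> C R. Proof. exact: (@rCn _ 2). Qed.
Let rCZ (k : int) : rC (k%:~R) = k%:~R :> C R. Proof. exact: rmorph_int. Qed.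

(** A Riemann map fixing the origin is [z exp (k z)]; substituting [exp (2 i z)] for [z]
    and taking logarithms gives [2 i z + k (exp (2 i z))]. Translation by [pi]
    corresponds to translation by one period, which makes the map onto. *)
Lemma half_plane_lift phi : riemann_map disc G phi -> phi 0 = 0 -> exists Phi,
  [/\ riemann_map upper_half_plane P Phi,
      forall z, upper_half_plane z -> exp_map a (Phi z) = phi (E2 z) &
      forall z (k : int), Phi (z + k%:~R * rC pi) = Phi z + k%:~R * T].
Proof.
move=> pm p0; have [ph pG pinj psur] := (riemann_mapP _ _ _).1 pm.
have dh := hol_dq open_disc d0 ph.
have nz z : disc z -> dq phi 0 z != 0.
  move=> zd; have [->|z0] := eqVneq z 0.
    rewrite /dq eqxx; have phB : holomorphic (Ball 0 1) phi by rewrite -disc_Ball.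
    by apply: (inj_cD_neq0 ltr01 phB) => v w; rewrite -disc_Ball; exact: pinj.
  apply/eqP => E; have := dqE phi 0 z; rewrite E mulr0 addr0 => /(pinj _ _ zd d0) /eqP.
  by rewrite (negPf z0).
have dhB : holomorphic (Ball 0 1) (dq phi 0) by rewrite -disc_Ball.
have [c [cE _ _]] := cexp_surj (nz 0 d0).
have [|k [kh _ kE]] := hol_log ltr01 dhB _ cE.
  by move=> w; rewrite -disc_Ball; exact: nz.
rewrite -disc_Ball in kh kE.
pose Phi z := (2 * iC * z + k (E2 z)) / a.
have PE z : upper_half_plane z -> exp_map a (Phi z) = phi (E2 z).
  move=> /E2_disc zd; rewrite /exp_map /Phi mulrC divfK // cexpD kE //.
  by rewrite (dqE phi 0 (E2 z)) p0 add0r subr0.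
have E2s z (l : int) : E2 (z + l%:~R * rC pi) = E2 z.
  rewrite /E2 mulrDr cexpD (_ : 2 * iC * (l%:~R * rC pi) = l%:~R * period); last by rewrite /period; ring.
  by rewrite cexp_period mulr1.
have PS z (l : int) : Phi (z + l%:~R * rC pi) = Phi z + l%:~R * T.
  by rewrite /Phi E2s /T /period; field.
exists Phi; split => //; apply/riemann_mapP; split => [|z zH|z w zH wH E|x Px].
- apply: holM (@hol_cst _ _ a^-1).
  apply: holD; first exact: holM (@hol_cst _ _ (2 * iC)) (@hol_id _ _).
  exact: (@hol_comp _ _ disc E2 k (fun z zH => (E2_disc z).1 zH) (@E2_hol _) kh).
- by rewrite /P /preimage /= PE //; apply: pG; exact/E2_disc.
- have E2E : E2 z = E2 w.
    by apply: pinj; [exact/E2_disc|exact/E2_disc|rewrite -!PE // E].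
  move: E; rewrite /Phi E2E => /(mulIf (_ : a^-1 != 0)); rewrite invr_eq0 => /(_ a_neq0).
  by move=> /addIr/(mulfI (mulf_neq0 two0 (@iC_neq0 R))).
- have [u ud uE] := psur _ Px.
  have u0 : u != 0 by apply/eqP => E; have := exp_map_neq0 a x; rewrite -uE E p0 eqxx.
  have [v [vE _ _]] := cexp_surj u0; pose z := v / (2 * iC).
  have zE : E2 z = u by rewrite /E2 /z mulrC divfK // mulf_neq0 // iC_neq0.
  have zH : upper_half_plane z by apply/E2_disc; rewrite zE.
  have [l lE] := @exp_map_eq _ a a_neq0 x (Phi z) (etrans (esym uE) (etrans (congr1 phi (esym zE)) (esym (PE z zH)))).
  exists (z + l%:~R * rC pi); last by rewrite PS lE.
  by apply/E2_disc; rewrite E2s zE.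
Qed.

(** In the coordinate [exp (2 i z)] of the half-plane the inner function at [0] lifts
    to [gf0], because all its zeros lie at the origin. Both [Phi \o gf0] and
    [f \o Phi] have exponential [phi \o g \o E2], so they differ by a constant multiple
    of the period, which a shift of [sigma] by a multiple of [pi] absorbs. *)
Theorem inside_origin : [/\ connected P, b = 0, p = m &
  exists (sigma : R) (theta c : 'I_q -> R), (forall j, 0 < c j) /\
    dyn_associated_inner_half_plane f P (fun z => rC sigma + m%:R * z + iC / 2 *
      \sum_(j < q) rC (c j) * ((expi (theta j) + cexp (2 * iC * z)) /
        (expi (theta j) - cexp (2 * iC * z))))].
Proof.
have /riemann_mapP[_ _ _ sur] := phi0_map; have [beta bd bE] := sur 0 G_0.
have [s [c [t [gi [sm sd] cp gE]]]] :=
  normal_form phi0_map gh_inner gh_conj zero_preimages xi_inj xiP bd bd bE.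
pose phi z := phi0 (swap beta z); pose g z := swap beta (gh (swap beta z)).
have pm : riemann_map disc G phi := riemann_comp (swap_riemann bd) phi0_map.
have p0 : phi 0 = 0 by rewrite /phi swap0.
have [ph pG pinj _] := (riemann_mapP _ _ _).1 pm.
have [_ gd _] := gi.
have gconj z : disc z -> phi (g z) = h (phi z).
  move=> zd; have zs := swap_disc bd zd; have ghd : disc (gh (swap beta z)) by case: gh_inner => _ H1 _; exact: H1.
  rewrite /phi /g swap_swap ?gh_conj //; apply: swap_den => //.
  by move: ghd; rewrite disc_mod => /ltW.
have s0 : s = nseq m 0.
  rewrite -sm; apply/all_pred1P/allP => z zs /=; have [zd /h0 z0] := sd z zs.
  by apply/eqP; apply: pinj; rewrite ?p0.
have s_nth (i : nat) : s`_i = 0 by rewrite s0 nth_nseq if_same.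
have zeta1 j : modulus (swap beta (xi j)) = 1 by exact: swap_circle.
have /choice[theta thE] : forall j, exists th, expi th = swap beta (xi j).
  by move=> j; have [th [_ thE]] := unit_expi (zeta1 j); exists th.
have g1E z : disc z -> g z = expi t * z ^+ m *
    cexp (- \sum_(j < q) rC (c j) * ((expi (theta j) + z) / (expi (theta j) - z))).
  move=> zd; rewrite /g gE //; congr (expi t * _ * cexp (- _)).
    rewrite (eq_bigr (fun=> z)); first by rewrite prodr_const card_ord sm.
    by move=> n _; rewrite s_nth /blaschke_factor eqxx.
  by apply: eq_bigr => j _; rewrite thE.
have [Phi [Pm PE PS]] := half_plane_lift pm p0.
have [Ph PG Pinj Psur] := (riemann_mapP _ _ _).1 Pm.
pose S z := \sum_(j < q) rC (c j) * ((expi (theta j) + E2 z) / (expi (theta j) - E2 z)).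
pose gf0 (sg : R) z := rC sg + m%:R * z + iC / 2 * S z.
have E2g z : upper_half_plane z -> forall l : int,
    E2 (gf0 (t / 2 + pi * l%:~R) z) = g (E2 z).
  move=> zH l; have zd := (E2_disc z).1 zH; rewrite g1E // -/(S z) /expi /E2.
  have -> : 2 * iC * gf0 (t / 2 + pi * l%:~R) z =
      (iC * rC t + m%:R * (2 * iC * z)) + (- S z) + l%:~R * period.
    rewrite /gf0 rCD !rCM rCV two rCZ /period.
    have -> : 2 * iC * (rC t / 2 + rC pi * l%:~R + m%:R * z + iC / 2 * S z) =
       iC * rC t + m%:R * (2 * iC * z) + (iC * iC) * S z + l%:~R * (2 * rC pi * iC) by field.
    by rewrite iC2 mulN1r.
  by rewrite !cexpD cexp_period mulr1 cexpMn.
have gfH z : upper_half_plane z -> forall l : int, upper_half_plane (gf0 (t / 2 + pi * l%:~R) z).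
  by move=> zH l; apply/E2_disc; rewrite E2g //; apply: gd; exact/E2_disc.
have conn : connected P.
  have <- : Phi @` upper_half_plane = P.
    apply/seteqP; split => [_ [z zH <-]|x /Psur[z zH <-]]; first exact: PG.
    by exists z.
  by apply: connected_image open_half_plane connected_half_plane _ => z; exact: hol_cont Ph.
have iH : upper_half_plane (iC : C R) by exact: ltr01.
have Pc : component P P.
  by exists (Phi iC); [exact: PG|rewrite connected_component_id //; exact: PG].
have Pf : fatou_component f P.
  exact: (preimage_component H_entire H_nonconstant hE a_neq0 f_lift G_component G_invariant phi0_map).
have Pinv : f @` P `<=` P by move=> _ [z Pz <-]; exact: (preimage_invariant f_lift G_invariant).
have den0 z : upper_half_plane z -> forall j, expi (theta j) - E2 z != 0.
  by move=> /E2_disc; rewrite disc_mod => z1 j; exact: expi_sub_neq0.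
have Sh : holomorphic upper_half_plane S.
  apply: hol_sum => j; apply: holM (@hol_cst _ _ (rC (c j))) _.
  apply: hol_div => [z zH||]; first exact: den0.
  - exact: holD (@hol_cst _ _ (expi (theta j))) (@E2_hol _).
  - exact: holB (@hol_cst _ _ (expi (theta j))) (@E2_hol _).
have gfh sg : holomorphic upper_half_plane (gf0 sg).
  apply: holD; first exact: holD (@hol_cst _ _ (rC sg)) (holM (@hol_cst _ _ m%:R) (@hol_id _ _)).
  exact: holM (@hol_cst _ _ (iC / 2)) Sh.
pose sg0 := t / 2 + pi * (0 : int)%:~R.
pose W z := f (Phi z) - Phi (gf0 sg0 z).
have fPh : holomorphic upper_half_plane (fun z => f (Phi z)).
  exact: (@hol_comp _ _ setT Phi f (fun _ _ => I) Ph f_entire).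
have PgH : holomorphic upper_half_plane (fun z => Phi (gf0 sg0 z)).
  exact: (@hol_comp _ _ upper_half_plane (gf0 sg0) Phi (fun z zH => gfH z zH 0) (gfh sg0) Ph).
have Wh : holomorphic upper_half_plane W := holB fPh PgH.
have WZ z : upper_half_plane z -> exists l : int, W z = l%:~R * T.
  move=> zH; have [|l lE] := @exp_map_eq _ a a_neq0 (f (Phi z)) (Phi (gf0 sg0 z)).
    case: f_lift => _ E; rewrite -E (PE z zH) PE; last exact: gfH.
    by rewrite E2g // gconj //; exact/E2_disc.
  by exists l; rewrite /W lE addrAC subrr add0r.
have WC : holomorphic (Ball 0 1) (fun v => W (cayley v)).
  rewrite -disc_Ball; apply: hol_comp Wh; first exact: cayley_disc.
  by apply: hol_cayley => v; exact: disc_neq1.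
have WE v : disc v -> W (cayley v) = W (cayley 0).
  rewrite disc_Ball => vd.
  apply: (@lattice_const _ (fun v => W (cayley v)) T 0 1 T_neq0) => // w wB.
    exact: hol_cont WC wB.
  by apply: WZ; apply: cayley_disc; rewrite disc_Ball.
have [l lE] := WZ _ (cayley_disc d0).
have fE z : upper_half_plane z -> Phi (gf0 (t / 2 + pi * l%:~R) z) = f (Phi z).
  move=> zH; have zn : z != - iC by apply: half_plane_neq; exact: ltW.
  have := WE _ (cayley_inv_disc zH); rewrite cayley_invK // lE /W => /eqP; rewrite subr_eq => /eqP ->.
  rewrite [RHS]addrC -PS; congr Phi; rewrite /gf0 /sg0 !rCD !rCM !rCZ mulr0z; ring.
split => //; [exact: base_point_eq0|exact: preimage_count|].
exists (t / 2 + pi * l%:~R), theta, c; split => //.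
split; last by exists Phi; split.
apply: (@half_plane_inner _ m q (t / 2 + pi * l%:~R) theta c) => z zH; exact: gfH.
Qed.

End InsideOrigin.

(** * The dichotomy *)

Section OutsideForm.
Context {R : realType}.
Variables (m p q : nat) (H h : C R -> C R) (a b : C R) (f : C R -> C R).
Variables (G : set (C R)) (phi0 gh : C R -> C R) (xi : 'I_q -> C R).
Hypothesis H_entire : entire H.
Hypothesis H_nonconstant : ~ exists c : C R, forall w, H w = c.
Hypothesis hE : forall w, h w = w ^+ m * cexp (H w).
Hypothesis a_neq0 : a != 0.
Hypothesis f_lift : lifts a h f.
Hypothesis G_component : fatou_component h G.
Hypothesis G_invariant : h @` G `<=` G.
Hypothesis phi0_map : riemann_map disc G phi0.
Hypothesis gh_inner : inner gh.
Hypothesis gh_conj : forall z, disc z -> phi0 (gh z) = h (phi0 z).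
Hypothesis G_b : G b.
Hypothesis b_preimages : npreimages h G b p.
Hypothesis xi_inj : injective xi.
Hypothesis xiP : forall y, singularity gh y <-> exists j, xi j = y.
Hypothesis G_0 : ~ G 0.

(** The semiconjugacy identifies [f] on each component with [h] on [G], so every inner
    function of [h] on [G] is associated to [f]; the one based at [b] has the stated
    form. *)
Theorem outside_origin : exists U : int -> set (C R),
  [/\ range U = [set V | component (exp_map a @^-1` G) V], injective U,
      forall k, U (k + 1) = [set z + 2 * rC pi * iC / a | z in U k],
      forall k, associated_inner f (U k) gh &
      exists (g B : C R -> C R) (theta c : 'I_q -> R),
        [/\ dyn_associated_inner h G g, forall k, associated_inner f (U k) g,
            finite_blaschke p B, forall j, 0 < c j &
            forall z, disc z -> g z = B z * cexp (- \sum_(j < q) rC (c j) *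
              ((expi (theta j) + z) / (expi (theta j) - z)))]].
Proof.
have /riemann_mapP[_ _ _ sur] := phi0_map; have [beta bd bE] := sur b G_b.
have [s [c [t [gi [sp sd] cp gE]]]] :=
  normal_form phi0_map gh_inner gh_conj b_preimages xi_inj xiP bd bd bE.
pose phi z := phi0 (swap beta z); pose g z := swap beta (gh (swap beta z)).
have pm : riemann_map disc G phi := riemann_comp (swap_riemann bd) phi0_map.
have gconj z : disc z -> phi (g z) = h (phi z).
  move=> zd; have zs := swap_disc bd zd; have ghd : disc (gh (swap beta z)) by case: gh_inner => _ H1 _; exact: H1.
  rewrite /phi /g swap_swap ?gh_conj //; apply: swap_den => //.
  by move: ghd; rewrite disc_mod => /ltW.
have [lam [lh lE]] := lift_exists a_neq0 G_0 phi0_map.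
pose U := lifted a lam.
have assoc k phi' g' : riemann_map disc G phi' -> inner g' ->
    (forall z, disc z -> phi' (g' z) = h (phi' z)) -> associated_inner f (U k) g'.
  move=> pm' gi' gE'.
  exact: (lifted_associated_any H_entire H_nonconstant hE a_neq0 f_lift G_component
    G_invariant G_0 k phi0_map lh lE pm' gi' gE').
have xi1 j : modulus (xi j) = 1.
  by have [/norm1_mod] := (xiP (xi j)).2 (ex_intro _ j erefl).
have zeta1 j : modulus (swap beta (xi j)) = 1 by exact: swap_circle.
have /choice[theta thE] : forall j, exists th, expi th = swap beta (xi j).
  by move=> j; have [th [_ thE]] := unit_expi (zeta1 j); exists th.
exists U; split.
- exact: (lifted_range a_neq0 phi0_map lh lE).
- exact: (lifted_injective a_neq0 phi0_map lE).
- by move=> k; exact: lifted_succ.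
- by move=> k; exact: assoc phi0_map gh_inner gh_conj.
exists g, (fun z => expi t * \prod_(n < size s) blaschke_factor s`_n z), theta, c; split.
- by split => //; exists phi.
- by move=> k; exact: assoc pm gi gconj.
- rewrite -sp; exists t, (fun n : 'I_(size s) => s`_n); split => // n.
  by have [] := sd s`_n (mem_nth _ (ltn_ord n)).
- exact: cp.
move=> z zd; rewrite /g gE //; congr (_ * cexp (- _)).
by apply: eq_bigr => j _; rewrite thE.
Qed.

End OutsideForm.

Theorem theorem1p1 (R : realType) (m p q : nat) (H h : C R -> C R)
    (G : set (C R)) (b : C R) (gh : C R -> C R) (a : C R) (f : C R -> C R)
    (H_entire : entire H)
    (H_nonconstant : ~ exists c : C R, forall w, H w = c)
    (hE : forall w, h w = w ^+ m * cexp (H w))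
    (G_component : fatou_component h G)
    (G_unbounded : ~ bounded_set G)
    (G_invariant : h @` G `<=` G)
    (G_degree : infinite_degree h G G)
    (G_b : G b)
    (b_preimages : npreimages h G b p)
    (gh_inner : dyn_associated_inner h G gh)
    (q_ge1 : (1 <= q)%N)
    (gh_singularities : ([set zeta | singularity gh zeta] #= `I_q)%card)
    (a_neq0 : a != 0)
    (f_lift : lifts a h f) :
  let case_i :=
    [/\ G 0, connected (exp_map a @^-1` G), b = 0, p = m &
      exists (sigma : R) (theta c : 'I_q -> R),
        (forall j, 0 < c j) /\
        dyn_associated_inner_half_plane f (exp_map a @^-1` G)
          (fun z => rC sigma + m%:R * z + iC / 2 *
             \sum_(j < q) rC (c j) *
               ((expi (theta j) + cexp (2 * iC * z)) /
                (expi (theta j) - cexp (2 * iC * z))))] in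
  let case_ii :=
    ~ G 0 /\
    exists U : int -> set (C R),
      [/\ range U = [set V | component (exp_map a @^-1` G) V],
          injective U,
          forall k, U (k + 1) =
            [set z + 2 * rC pi * iC / a | z in U k],
          forall k, associated_inner f (U k) gh &
          exists (g B : C R -> C R) (theta c : 'I_q -> R),
            [/\ dyn_associated_inner h G g,
                forall k, associated_inner f (U k) g,
                finite_blaschke p B,
                forall j, 0 < c j &
                forall z, disc z ->
                  g z = B z * cexp (- \sum_(j < q) rC (c j) *
                    ((expi (theta j) + z) / (expi (theta j) - z)))]] in
  (case_i \/ case_ii) /\ ~ (case_i /\ case_ii).
Proof.
move=> case_i case_ii; split; last by move=> [[G0 _ _ _ _] [nG0 _]].
have [ghi [phi0 [_ _ phi0_map gh_conj]]] := gh_inner.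
have [xi [xi_inj xiP]] := enum_card gh_singularities.
have [G0|nG0] := pselect (G 0); [left|right].
  have [h1 h2 h3 h4] := inside_origin H_entire H_nonconstant hE a_neq0 f_lift G_component
    G_invariant phi0_map ghi gh_conj G_b b_preimages xi_inj xiP q_ge1 G0.
  exact: And5 G0 h1 h2 h3 h4.
split; first exact: nG0.
exact: (outside_origin H_entire H_nonconstant hE a_neq0 f_lift G_component
  G_invariant phi0_map ghi gh_conj G_b b_preimages xi_inj xiP nG0).
Qed.
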